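(* Let $n \ge 1$ and let $A \subset \mathbb{R}^n$ be a subanalytic set such that $0 \in \overline{A}$. If $n \ge 2$, then $$\mathcal{GD}^{n-1}(A) = \mathcal{GD}^{n}(A) = \mathcal{GD}^{n+1}(A) = \cdots,$$ and if $n = 1$, then $\mathcal{GD}^1(A) = \mathcal{GD}^2(A) = \mathcal{GD}^3(A) = \cdots$ (that is, $\mathcal{GD}$ is stabilised at degree $1$).
   Context: Subanalytic is in the sense of Hironaka; $\overline{\,\cdot\,}$ denotes closure. For $A \subset \mathbb{R}^n$ and $p \in \overline{A}$, the direction set of $A$ at $p$ is $$D_p(A) := \{a \in S^{n-1} \mid \exists \{x_i\} \subset A \setminus \{p\},\ x_i \to p,\ \tfrac{x_i-p}{\|x_i-p\|} \to a\}.$$ Put $D_A(A) := \bigcup_{p \in A} \{p\} \times D_p(A) \subset \mathbb{R}^n \times S^{n-1}$. The geometric directional bundle of $A$ at $0$ is $$\mathcal{GD}(A) := \{a \in S^{n-1} \mid (0,a) \in \overline{D_A(A)}\},$$ closure in $\mathbb{R}^n \times S^{n-1}$, and $L\mathcal{GD}(A) := \{tv \in \mathbb{R}^n \mid v \in \mathcal{GD}(A),\ t \ge 0\}$ (so $L\mathcal{GD}(A) = \emptyset$ if $\mathcal{GD}(A)=\emptyset$, and $\mathcal{GD}(\emptyset)=\emptyset$). Set $\mathcal{GD}^1 := \mathcal{GD}$ and, for $m \ge 2$, $\mathcal{GD}^m(A) := \mathcal{GD}(L\mathcal{GD}^{m-1}(A))$, where $L\mathcal{GD}^{m}(A) :=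 \{tv \mid v \in \mathcal{GD}^{m}(A),\ t \ge 0\}$. *)

(* Defs.v *)
From mathcomp Require Import all_boot all_order all_algebra.
From mathcomp Require Import all_classical all_reals all_analysis.
Import Order.TTheory GRing.Theory Num.Theory.
Import numFieldNormedType.Exports.

Set Implicit Arguments.
Unset Strict Implicit.
Unset Printing Implicit Defensive.

Local Open Scope classical_set_scope.
Local Open Scope ring_scope.

(* The library norm `|x| on 'rV[R]_n is the sup norm (it gives the usual
   topology); the unit sphere and the directions below use the Euclidean one. *)
Definition enorm (R : realType) (n : nat) (x : 'rV[R]_n) : R :=
  Num.sqrt (\sum_(i < n) x 0 i ^+ 2).

Definition sphere (R : realType) (n : nat) : set 'rV[R]_n :=
  [set a | enorm a = 1].
Arguments sphere : clear implicits.

Definition monomial_at (R : realType) (m : nat) (x y : 'rV[R]_m)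
    (k : {ffun 'I_m -> nat}) : R :=
  \prod_(i < m) (y 0 i - x 0 i) ^+ k i.

(* Near x, f is the sum of an absolutely convergent power series in y - x.
   Because of absolute convergence, the sum can be computed along the boxes
   of multi-indices with all entries < N. *)
Definition analytic_at (R : realType) (m : nat) (f : 'rV[R]_m -> R)
    (x : 'rV[R]_m) : Prop :=
  exists c : {ffun 'I_m -> nat} -> R, \forall y \near x,
    summable setT (fun k => (c k * monomial_at x y k)%:E) /\
    (fun N : nat => \sum_(k : {ffun 'I_m -> 'I_N})
       let k' := [ffun i => nat_of_ord (k i)] in c k' * monomial_at x y k')
      @ \oo --> f y.

Definition analytic_on (R : realType) (m : nat) (W : set 'rV[R]_m)
    (f : 'rV[R]_m -> R) : Prop :=
  forall x, W x -> analytic_at f x.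

Definition analytic_map_on (R : realType) (m n : nat) (W : set 'rV[R]_m)
    (f : 'rV[R]_m -> 'rV[R]_n) : Prop :=
  forall j : 'I_n, analytic_on W (fun x => f x 0 j).

(* Y is closed in W: the local equations are required at every point of W. *)
Definition analytic_subset (R : realType) (m : nat) (W Y : set 'rV[R]_m)
  : Prop :=
  Y `<=` W /\
  forall x, W x -> exists (V : set 'rV[R]_m) (k : nat)
      (g : 'I_k -> 'rV[R]_m -> R),
    [/\ open V, V x, V `<=` W, forall i, analytic_on V (g i) &
        Y `&` V = [set z | V z /\ forall i, g i z = 0]].

(* X is the image of a proper real analytic map f : Y -> U, where the real
   analytic space Y is realized as an analytic subset of an open W in R^m. *)
Definition proper_analytic_image (R : realType) (n : nat)
    (U X : set 'rV[R]_n) : Prop :=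
  exists (m : nat) (W Y : set 'rV[R]_m) (f : 'rV[R]_m -> 'rV[R]_n),
    [/\ open W /\ analytic_subset W Y, analytic_map_on W f,
        f @` Y `<=` U,
        forall K, compact K -> K `<=` U -> compact (Y `&` f @^-1` K) &
        X = f @` Y].

(* Hironaka's definition. The point x ranges over all of R^n, not only A. *)
Definition subanalytic (R : realType) (n : nat) (A : set 'rV[R]_n) : Prop :=
  forall x : 'rV[R]_n, exists (U : set 'rV[R]_n) (k : nat)
      (X1 X2 : 'I_k -> set 'rV[R]_n),
    [/\ open U, U x,
        forall i, proper_analytic_image U (X1 i),
        forall i, proper_analytic_image U (X2 i) &
        A `&` U = \bigcup_(i in [set: 'I_k]) (X1 i `\` X2 i)].

(* D_p(A) *)
Definition dirset (R : realType) (n : nat) (A : set 'rV[R]_n) (p : 'rV[R]_n)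
  : set 'rV[R]_n :=
  [set a | sphere R n a /\ exists x : nat -> 'rV[R]_n,
     [/\ forall i, (A `\ p) (x i), x @ \oo --> p &
         (fun i => (enorm (x i - p))^-1 *: (x i - p)) @ \oo --> a]].

(* D_A(A) *)
Definition dirbundle (R : realType) (n : nat) (A : set 'rV[R]_n)
  : set ('rV[R]_n * 'rV[R]_n) :=
  [set pa | A pa.1 /\ dirset A pa.1 pa.2].

(* GD(A); the closure in R^n x S^(n-1) is the trace of the closure in
   R^n x R^n. *)
Definition GD (R : realType) (n : nat) (A : set 'rV[R]_n) : set 'rV[R]_n :=
  [set a | sphere R n a /\ closure (dirbundle A) (0, a)].

(* L D *)
Definition cone (R : realType) (n : nat) (D : set 'rV[R]_n) : set 'rV[R]_n :=
  [set x | exists v t, [/\ D v, 0 <= t & x = t *: v]].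

(* GD^m(A), meant for m >= 1; the value at m = 0 is irrelevant. *)
Fixpoint GDpow (R : realType) (n m : nat) (A : set 'rV[R]_n) {struct m}
  : set 'rV[R]_n :=
  match m with
  | 0 | 1 => GD A
  | m'.+1 => GD (cone (GDpow m' A))
  end.

(* Main.v *)
(* Near 0 the set A is a finite union of differences of proper analytic images
   f(Y). Local monomialization along ultrafilters (Tschirnhausen, root and
   blow-up charts, by induction on the number of variables) yields charts of Y
   in which f = z^alpha * H with H(0) <> 0, and secant directions of A are
   approximated by velocities of arcs in Y. Finitely many charts cover the fibre
   over 0, and by Baire an arc runs for a while inside one of them. There either
   df has rank at least 2 throughout, and the direction lies in a plane of
   directions, or f keeps to a line and the direction is +-H(0). Hence the cone
   over GD(A) is symmetric, and each of its points outside finitely many lines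
   lies in a 2-plane contained in it. A further application of GD raises the
   dimension of such subspaces by one outside the previous cone C: if q_j -> p
   lie in k-planes of C with secants tending to u outside C, the limit k-plane
   and u span a (k+1)-plane of the next cone. In dimension n nothing is left to
   add, which happens from degree n - 1 on. *)

Require Import Defs.
From mathcomp Require Import all_boot all_order all_algebra.
From mathcomp Require Import all_classical all_reals all_analysis.
From mathcomp Require Import ring lra.
From mathcomp Require zify.
Import Order.TTheory GRing.Theory Num.Theory.
Import numFieldNormedType.Exports.
Local Open Scope classical_set_scope.
Local Open Scope ring_scope.

Set Implicit Arguments.
Unset Strict Implicit.
Unset Printing Implicit Defensive.

(** * Absolutely convergent series *)

(** Monomialization is carried out along one germ of points at a time, and an ultrafilter makes
    every choice for such a germ: it fixes the sign of each coordinate or its vanishing, and gives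
    each ratio a finite or an infinite limit, hence one chart of each blow-up. Charts are never
    patched. Compactness returns at the end: a filter avoiding every finite family of charts would
    extend to an ultrafilter that has a chart of its own. The charts are not immersions, so
    velocities could be lost. They are therefore built to lift differentiable arcs back to the open
    positive orthant, which is why roots are taken of, and divisions made by, positive coordinates
    only. The induction on dimensions carries an exceptional subset [B] of the cone [C]: each
    nonzero point of [C] is in [B] or on a $k$-plane of [C], and tangent vectors of [B] stay in [C].
    At first [B] lies on finitely many lines, and the symmetry of the cone puts the tangents of
    these lines back into it. Afterwards [B] is the previous cone. *)

Section Sums.
Variable R : realType.
Implicit Types (a b M : nat -> R) (l B : R).

Lemma cvg_eqfun (u v : nat -> R) l : u =1 v -> u @ \oo --> l -> v @ \oo --> l.
Proof. by move=> /funext ->. Qed.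

Definition hsum a l := (fun N => \sum_(k < N) a k) @ \oo --> l.

Lemma hsum_uniq a l l' : hsum a l -> hsum a l' -> l = l'.
Proof. by move=> h h'; apply: cvg_unique h h'; apply: norm_hausdorff. Qed.

Lemma hsum_ext a b l : a =1 b -> hsum a l -> hsum b l.
Proof. by move=> /funext ->. Qed.

Lemma hsumD a b l l' : hsum a l -> hsum b l' ->
  hsum (fun k => a k + b k) (l + l').
Proof.
by move=> h h'; apply: cvg_eqfun (cvgD h h') => N; rewrite big_split.
Qed.

Lemma hsumZ c a l : hsum a l -> hsum (fun k => c * a k) (c * l).
Proof.
by move=> h; apply: cvg_eqfun (cvgM (cvg_cst c) h) => N; rewrite /= mulr_sumr.
Qed.

Arguments hsumZ c {a l} _.

Lemma hsum0 : hsum (fun=> 0) 0.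
Proof.
by apply: (cvg_eqfun _ (cvg_cst (0 : R))) => N; rewrite big1.
Qed.

Lemma cvg_sumn (u : nat -> nat -> R) (v : nat -> R) K :
  (forall k, u k @ \oo --> v k) ->
  (fun N => \sum_(k < K) u k N) @ \oo --> \sum_(k < K) v k.
Proof.
move=> uv; elim: K => [|K IH].
  by rewrite big_ord0; apply: (cvg_eqfun _ (cvg_cst (0 : R))) => N; rewrite big_ord0.
rewrite big_ord_recr /=.
have h : (fun N => \sum_(k < K) u k N + u K N) @ \oo --> \sum_(k < K) v k + v K.
  exact: cvgD.
by apply: (cvg_eqfun _ h) => N; rewrite big_ord_recr.
Qed.

Lemma hsum_fin a n : (forall k, (n <= k)%N -> a k = 0) ->
  hsum a (\sum_(k < n) a k).
Proof.
move=> a0; apply: cvg_near_cst; exists n => // N /= nN.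
rewrite -!(big_mkord xpredT a) (big_cat_nat (leq0n _) nN) //= [X in _ + X]big1_seq ?addr0//.
by move=> i; rewrite mem_index_iota => /andP[_ /andP[/a0]].
Qed.

Lemma hsumS a l : hsum a l <-> hsum (fun k => a k.+1) (l - a 0%N).
Proof.
split=> h.
  have h1 : (fun N => \sum_(k < N.+1) a k) @ \oo --> l.
    by move: h; rewrite /hsum -cvg_shiftS.
  apply: cvg_eqfun (cvgB h1 (cvg_cst (a 0%N))) => N.
  by rewrite fctE big_ord_recl addrC addKr.
rewrite /hsum -cvg_shiftS.
have h1 : (fun N => \sum_(k < N) a k.+1 + a 0%N) @ \oo --> l - a 0%N + a 0%N.
  by apply: cvgD h (cvg_cst _).
rewrite subrK in h1; apply: (cvg_eqfun _ h1) => N.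
by rewrite /= big_ord_recl addrC.
Qed.

Lemma hsum_le a l B : hsum a l -> (forall N, \sum_(k < N) a k <= B) -> l <= B.
Proof.
move=> h ab; rewrite -(cvg_lim _ h)//.
by apply: limr_le; [apply/cvg_ex; exists l|near=> N].
Unshelve. all: by end_near. Qed.

Lemma hsum_norm a M l B : hsum a l -> (forall k, `|a k| <= M k) ->
  (forall N, \sum_(k < N) M k <= B) -> `|l| <= B.
Proof.
move=> h aM MB; have h' : (fun N => `|\sum_(k < N) a k|) @ \oo --> `|l| by apply: cvg_norm.
rewrite -(cvg_lim _ h')//; apply: limr_le; first by apply/cvg_ex; exists `|l|.
near=> N; apply: le_trans (MB N); apply: le_trans (ler_norm_sum _ _ _) _.
exact: ler_sum.
Unshelve. all: by end_near. Qed.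

Lemma hsum_ge0_ex M B : (forall k, 0 <= M k) ->
  (forall N, \sum_(k < N) M k <= B) -> exists l, hsum M l.
Proof.
move=> M0 MB; have : cvgn (fun N => \sum_(k < N) M k).
  apply: nondecreasing_is_cvgn.
    apply/nondecreasing_seqP => n; rewrite big_ord_recr /=.
    by rewrite lerDl.
  by exists B => _ [n _ <-].
by move=> /cvg_ex[l hl]; exists l.
Qed.

Lemma hsum_partial_le M l N : (forall k, 0 <= M k) -> hsum M l ->
  \sum_(k < N) M k <= l.
Proof.
move=> M0 h; rewrite -(cvg_lim _ h)//.
apply: limr_ge; first by apply/cvg_ex; exists l.
exists N => // n /= Nn; rewrite -!(big_mkord xpredT M) (big_cat_nat (leq0n _) Nn) //= lerDl.
by apply: sumr_ge0.
Qed.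

(** The series [a] is the difference of the nonnegative series [M] and [M - a], both with bounded
    partial sums. *)
Lemma hsum_ex a M B : (forall k, `|a k| <= M k) ->
  (forall N, \sum_(k < N) M k <= B) -> exists l, hsum a l.
Proof.
move=> aM MB.
have M0 k : 0 <= M k by apply: le_trans (aM k).
pose p k := M k - a k.
have aM' k : a k <= M k by apply: le_trans (aM k); apply: ler_norm.
have aM2 k : - a k <= M k by apply: le_trans (aM k); rewrite -normrN ler_norm.
have [l hl] : exists l, hsum p l.
  apply: (@hsum_ge0_ex _ (B *+ 2)) => [k|N]; first by rewrite subr_ge0.
  have -> : B *+ 2 = B + B by rewrite mulr2n.
  apply: le_trans (lerD (MB N) (MB N)); rewrite -big_split /=.
  by apply: ler_sum => i _; rewrite lerD2l.
have [l' hl'] := hsum_ge0_ex M0 MB.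
exists (l' + (-1) * l); refine (hsum_ext _ (hsumD hl' (hsumZ (-1) hl))) => k.
by rewrite mulN1r opprB addrC subrK.
Qed.

(** Fubini for double series. Beyond a rectangle [N0] by [K0] whose majorant sum is within e/2 of
    the supremum of all rectangular sums, every rectangular sum of [a] stays within e/2 of its value
    there, hence so do both iterated sums. *)
Lemma hsum_double (a M : nat -> nat -> R) b c l B :
  (forall n k, `|a n k| <= M n k) ->
  (forall N K, \sum_(n < N) \sum_(k < K) M n k <= B) ->
  (forall n, hsum (a n) (b n)) -> hsum b l ->
  (forall k, hsum (a^~ k) (c k)) -> hsum c l.
Proof.
move=> aM MB ab bl ac.
have M0 n k : 0 <= M n k by apply: le_trans (aM n k).
pose S N K := \sum_(n < N) \sum_(k < K) M n k.
pose s N K := \sum_(n < N) \sum_(k < K) a n k.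
have split2 (g : nat -> nat -> R) N0 K0 N K : (N0 <= N)%N -> (K0 <= K)%N ->
    \sum_(n < N) \sum_(k < K) g n k - \sum_(n < N0) \sum_(k < K0) g n k =
    \sum_(0 <= n < N0) \sum_(K0 <= k < K) g n k +
    \sum_(N0 <= n < N) \sum_(0 <= k < K) g n k.
  move=> NN KK.
  rewrite -(big_mkord xpredT (fun n => \sum_(k < K) g n k)).
  rewrite -(big_mkord xpredT (fun n => \sum_(k < K0) g n k)).
  rewrite (big_cat_nat (leq0n _) NN)//= addrAC; congr (_ + _); last first.
    by apply: eq_bigr => i _; rewrite big_mkord.
  rewrite -sumrB; apply: eq_bigr => i _.
  rewrite -!(big_mkord xpredT (g i)) (big_cat_nat (leq0n _) KK)//=.
  by rewrite addrAC subrr add0r.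
have key N0 K0 N K : (N0 <= N)%N -> (K0 <= K)%N ->
    `|s N K - s N0 K0| <= S N K - S N0 K0.
  move=> NN KK; rewrite /s /S !split2//.
  apply: le_trans (ler_normD _ _) _; apply: lerD;
    apply: le_trans (ler_norm_sum _ _ _) _; apply: ler_sum => i _;
    apply: le_trans (ler_norm_sum _ _ _) _; exact: ler_sum.
pose E := [set x | exists N K, x = S N K].
have supE : has_sup E.
  by split; [exists (S 0 0)%N, 0%N, 0%N|exists B => _ [N [K ->]]; exact: MB].
have SE N K : S N K <= sup E.
  by apply: (ub_le_sup (proj2 supE)); exists N, K.
apply/cvgrPdist_le => e e0.
have e4 : 0 < e / 2 by apply: divr_gt0.
have [_ [N0 [K0 ->]] h0] := sup_adherent e4 supE.
have close N K : (N0 <= N)%N -> (K0 <= K)%N -> `|s N K - s N0 K0| <= e / 2.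
  move=> NN KK; apply: le_trans (key _ _ _ _ NN KK) _.
  by have := SE N K; lra.
have lim1 K : (fun N => s N K) @ \oo --> \sum_(k < K) c k.
  have -> : (fun N => s N K) = (fun N => \sum_(k < K) \sum_(n < N) a n k).
    by apply/funext => N; rewrite /s exchange_big.
  exact: (@cvg_sumn (fun k N => \sum_(n < N) a n k)).
have lim2 N : (fun K => s N K) @ \oo --> \sum_(n < N) b n.
  exact: (@cvg_sumn (fun n K => \sum_(k < K) a n k)).
have limle (u : nat -> R) v n0 : u @ \oo --> v ->
    (forall n, (n0 <= n)%N -> `|u n - s N0 K0| <= e / 2) ->
    `|v - s N0 K0| <= e / 2.
  move=> uv h; have h1 : (fun n => `|u n - s N0 K0|) @ \oo --> `|v - s N0 K0|.
    by apply: cvg_norm; apply: cvgB uv (cvg_cst _).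
  rewrite -(cvg_lim _ h1)//; apply: limr_le; first by apply/cvg_ex; eexists; exact: h1.
  by exists n0 => // n /=; exact: h.
have hl : `|l - s N0 K0| <= e / 2.
  apply: (limle _ _ N0 bl) => N NN.
  by apply: (limle _ _ K0 (lim2 N)) => K KK; exact: close.
exists K0 => // K /= KK.
have hK : `|\sum_(k < K) c k - s N0 K0| <= e / 2.
  by apply: (limle _ _ N0 (lim1 K)) => N NN; exact: close.
have -> : l - \sum_(k < K) c k = (l - s N0 K0) - (\sum_(k < K) c k - s N0 K0).
  by ring.
apply: le_trans (ler_normB _ _) _; lra.
Qed.

End Sums.
Arguments hsumZ {R} c {a l} _.

(** * Germs of analytic functions *)

Section AN.
Variable R : realType.
Notation pt := (nat -> R).
Implicit Types (f g : pt -> R) (x : pt) (r M c e B : R).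

Definition cube m r x := forall i, (i < m)%N -> `|x i| <= r.

(* Points are infinite sequences so that the number m of relevant variables can
   vary. AN m r M f: on the polydisc of radius r, f is the sum of a power series
   in the first m variables whose normal convergence is witnessed by a majorant
   series with sum at most M. *)
Fixpoint AN m r M f : Prop :=
  match m with
  | 0 => exists c, `|c| <= M /\ forall x, f x = c
  | m'.+1 => exists (F : nat -> pt -> R) (N : nat -> R),
     [/\ forall k, AN m' r (N k) (F k),
         forall K, \sum_(k < K) N k * r ^+ k <= M &
         forall x, cube m'.+1 r x -> hsum (fun k => F k x * x m' ^+ k) (f x)]
  end.

Lemma AN_SP m r M f : AN m.+1 r M f <->
  exists (F : nat -> pt -> R) (N : nat -> R),
     [/\ forall k, AN m r (N k) (F k),
         forall K, \sum_(k < K) N k * r ^+ k <= M &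
         forall x, cube m.+1 r x -> hsum (fun k => F k x * x m ^+ k) (f x)].
Proof. by []. Qed.

Definition pt0 : pt := fun=> 0.

Lemma cube0 m r : 0 <= r -> cube m r pt0.
Proof. by move=> r0 i _; rewrite normr0. Qed.

Lemma cubeW m m' r r' x : (m' <= m)%N -> r <= r' -> cube m r x -> cube m' r' x.
Proof.
by move=> mm rr cx i im; apply: le_trans (cx i (leq_trans im mm)) rr.
Qed.

Lemma AN_bound m r M f x : 0 <= r -> AN m r M f -> cube m r x -> `|f x| <= M.
Proof.
move=> r0; elim: m M f => [|m IH] M f /=; first by move=> [c [cM ->]].
move=> /AN_SP[F [N [FN NM fx]]] cx.
have cx' : cube m r x by apply: cubeW cx.
apply: (@hsum_norm _ _ (fun k => N k * r ^+ k) _ _ (fx x cx)) => // k.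
rewrite normrM normrX.
apply: ler_pM => //; first by apply: IH cx'; exact: FN.
by apply: lerXn2r; rewrite ?nnegrE//; exact: cx.
Qed.

Lemma AN_ge0 m r M f : 0 <= r -> AN m r M f -> 0 <= M.
Proof.
by move=> r0 /AN_bound - /(_ pt0 r0 (cube0 r0)); apply: le_trans.
Qed.

Lemma AN_sub m r M f r' M' : 0 <= r' -> r' <= r -> M <= M' -> AN m r M f ->
  AN m r' M' f.
Proof.
move=> r0 rr; elim: m M M' f => [|m IH] M M' f MM /=.
  by move=> [c [cM fc]]; exists c; split => //; apply: le_trans MM.
move=> /AN_SP[F [N [FN NM fx]]]; exists F, N; split=> [k|K|x cx].
- exact: IH (FN k).
- apply: le_trans MM; apply: le_trans (NM K); apply: ler_sum => k _.
  apply: ler_wpM2l; first exact: AN_ge0 (le_trans r0 rr) (FN k).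
  by apply: lerXn2r; rewrite ?nnegrE// (le_trans r0).
- by apply: fx; apply: cubeW cx.
Qed.

Lemma AN_ext m r M f g : AN m r M f -> (forall x, cube m r x -> f x = g x) ->
  AN m r M g.
Proof.
case: m => [|m] /=.
  by move=> [c [cM fc]] fg; exists c; split=> // x; rewrite -fg// => i.
by move=> /AN_SP[F [N [FN NM fx]]] fg; exists F, N; split=> // x cx; rewrite -fg//; exact: fx.
Qed.

Lemma AN_0 m r : AN m r 0 (fun=> 0).
Proof.
elim: m => [|m IH] /=; first by exists 0; rewrite normr0.
exists (fun _ => fun=> 0), (fun=> 0); split=> [k|K|x _] //.
- by rewrite big1// => k _; rewrite mul0r.
- by refine (hsum_ext _ (@hsum0 R)) => k; rewrite mul0r.
Qed.

Lemma AN_S m r M f : 0 <= r -> AN m r M f -> AN m.+1 r M f.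
Proof.
move=> r0 fM; have M0 := AN_ge0 r0 fM.
exists (fun k => if k is 0%N then f else (fun=> 0)).
exists (fun k => if k is 0%N then M else 0); split=> [k|K|x cx].
- by case: k => [|k]; [exact: fM|exact: AN_0].
- case: K => [|K]; first by rewrite big_ord0.
  rewrite big_ord_recl /= expr0 mulr1 big1 ?addr0// => i _.
  by rewrite mul0r.
- have := @hsum_fin R (fun k => (if k is 0%N then f else (fun=> 0)) x * x m ^+ k) 1.
  rewrite big_ord1 /= expr0 mulr1; apply => -[|k]// _; by rewrite mul0r.
Qed.

Lemma AN_leq m m' r M f : 0 <= r -> (m <= m')%N -> AN m r M f -> AN m' r M f.
Proof.
by move=> r0 /subnK <-; elim: (m' - m)%N => // k IH /IH; rewrite addSn; exact: AN_S.
Qed.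

Lemma AN_cst m r c M : 0 <= r -> `|c| <= M -> AN m r M (fun=> c).
Proof. by move=> r0 cM; apply: (@AN_leq 0) => //; exists c. Qed.

Lemma AN_mulX m r M f : 0 <= r -> AN m.+1 r M f ->
  AN m.+1 r (r * M) (fun x => x m * f x).
Proof.
move=> r0 [F [N [FN NM fx]]].
exists (fun k => if k is k'.+1 then F k' else (fun=> 0)).
exists (fun k => if k is k'.+1 then N k' else 0); split=> [k|K|x cx].
- by case: k => [|k]; [exact: AN_0|exact: FN].
- case: K => [|K].
    by rewrite big_ord0 mulr_ge0// (le_trans _ (NM 0%N))// big_ord0.
  rewrite big_ord_recl /= mul0r add0r.
  under eq_bigr do rewrite exprS mulrCA.
  by rewrite -mulr_sumr ler_wpM2l//; under eq_bigr do rewrite add0n; exact: NM.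
- apply/hsumS; rewrite /= mul0r subr0.
  refine (hsum_ext _ (hsumZ (x m) (fx x cx))) => k /=.
  by rewrite exprS mulrCA.
Qed.

Lemma AN_coord m r i : 0 <= r -> (i < m)%N -> AN m r r (fun x => x i).
Proof.
move=> r0 im; apply: (AN_leq r0 im).
have := @AN_mulX i r 1 (fun=> 1) r0 (AN_cst _ r0 _).
rewrite normr1 mulr1 => /(_ (lexx _)).
by move/AN_ext; apply => x _; rewrite mulr1.
Qed.

(** Weierstrass' theorem for normally convergent series, by induction on [m]: the coefficients of
    each power of the last variable are summed over [n] first, and [hsum_double] justifies the
    exchange. Products and substitutions are derived from it, without Cauchy products. *)
Lemma AN_hsum m r (N : nat -> R) B (F : nat -> pt -> R) f : 0 < r ->
  (forall n, AN m r (N n) (F n)) -> (forall K, \sum_(k < K) N k <= B) ->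
  (forall x, cube m r x -> hsum (fun n => F n x) (f x)) -> AN m r B f.
Proof.
move=> r0; have r0' := ltW r0.
elim: m N B F f => [|m IH] N B F f FN NB fx.
  have fc x : f x = f pt0.
    have h1 : hsum (fun n => F n x) (f x) by apply: fx.
    have h2 : hsum (fun n => F n pt0) (f pt0) by apply: fx.
    apply: (hsum_uniq h1); refine (hsum_ext _ h2) => n.
    by have [c [_ Fc]] := FN n; rewrite !Fc.
  exists (f pt0); split=> //; apply: (hsum_norm (fx pt0 _) _ NB) => // n.
  by apply: AN_bound (FN n) _.
have /choice[G /choice[P GP]] : forall n,
    exists G : nat -> pt -> R, exists P : nat -> R,
    [/\ forall k, AN m r (P k) (G k),
       forall K, \sum_(k < K) P k * r ^+ k <= N n &
       forall x, cube m.+1 r x -> hsum (fun k => G k x * x m ^+ k) (F n x)].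
  by move=> n; have /AN_SP[G [P h]] := FN n; exists G, P.
have P0 n k : 0 <= P n k by have [h _ _] := GP n; apply: AN_ge0 (h k).
have PN n k : P n k * r ^+ k <= N n.
  have [_ h _] := GP n; apply: le_trans (h k.+1).
  rewrite big_ord_recr /= lerDr sumr_ge0// => i _.
  by rewrite mulr_ge0// exprn_ge0.
(* A single coefficient is controlled by the whole majorant, [P n k * r ^+ k <= N n]; dividing by
   [r ^+ k] is where [0 < r] enters. *)
have sumP k K : \sum_(n < K) P n k <= B / r ^+ k.
  rewrite ler_pdivlMr ?exprn_gt0// mulr_suml; apply: le_trans (NB K).
  exact: ler_sum.
have /choice[Q hQ] : forall k, exists l, hsum (P^~ k) l.
  by move=> k; apply: hsum_ge0_ex (sumP k).
have exG k x : cube m r x -> exists l, hsum (fun n => G n k x) l.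
  move=> cx; apply: (hsum_ex _ (sumP k)) => n.
  by have [h _ _] := GP n; exact: AN_bound (h k) cx.
have /choice[H hH] : forall k, exists H : pt -> R, forall x, cube m r x ->
    hsum (fun n => G n k x) (H x).
  move=> k; have /choice[H hH] : forall x, exists l, cube m r x ->
      hsum (fun n => G n k x) l.
    move=> x; case: (pselect (cube m r x)) => [/exG - /(_ k)[l hl]|nc];
      [by exists l|by exists 0].
  by exists H.
exists H, Q; split=> [k|K|x cx].
- apply: (IH (P^~ k) _ (fun n => G n k)) => //.
  + by move=> n; have [h _ _] := GP n; exact: h.
  + by move=> K; apply: hsum_partial_le (hQ k).
  + exact: hH.
- have h : hsum (fun n => \sum_(k < K) P n k * r ^+ k) (\sum_(k < K) Q k * r ^+ k).
    elim: K => [|K IHK].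
      by rewrite big_ord0; refine (hsum_ext _ (@hsum0 R)) => n; rewrite big_ord0.
    rewrite big_ord_recr /= [X in _ + X]mulrC.
    refine (hsum_ext _ (hsumD IHK (hsumZ (r ^+ K) (hQ K)))) => n /=.
    by rewrite big_ord_recr /= [X in _ + X]mulrC.
  apply: (hsum_le h) => L; apply: le_trans (NB L); apply: ler_sum => n _.
  by have [_ h' _] := GP n.
- have cx' : cube m r x by apply: cubeW cx.
  have xr : `|x m| <= r by exact: cx.
  apply: (@hsum_double R (fun n k => G n k x * x m ^+ k) (fun n k => P n k * r ^+ k)
           (fun n => F n x) _ _ B).
  + move=> n k; rewrite normrM normrX; have [h _ _] := GP n.
    apply: ler_pM => //; first exact: AN_bound (h k) cx'.
    by apply: lerXn2r; rewrite ?nnegrE.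
  + move=> L K; apply: le_trans (NB L); apply: ler_sum => n _.
    by have [_ h' _] := GP n.
  + by move=> n; have [_ _ h] := GP n; exact: h.
  + exact: fx.
  + move=> k; rewrite [X in hsum _ X]mulrC.
    by refine (hsum_ext _ (hsumZ (x m ^+ k) (hH k x cx'))) => n; rewrite mulrC.
Qed.

Lemma AN_D m r M1 M2 f g : AN m r M1 f -> AN m r M2 g ->
  AN m r (M1 + M2) (fun x => f x + g x).
Proof.
elim: m M1 M2 f g => [|m IH] M1 M2 f g /=.
  move=> [c [cM fc]] [d [dM gd]]; exists (c + d); split=> [|x].
    by apply: le_trans (ler_normD _ _) (lerD cM dM).
  by rewrite fc gd.
move=> /AN_SP[F [N [FN NM fx]]] /AN_SP[G [P [GP PM gx]]].
exists (fun k x => F k x + G k x), (fun k => N k + P k); split=> [k|K|x cx].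
- exact: IH.
- under eq_bigr do rewrite mulrDl.
  by rewrite big_split /=; exact: (lerD (NM K) (PM K)).
- refine (hsum_ext _ (hsumD (fx x cx) (gx x cx))) => k /=.
  by rewrite mulrDl.
Qed.

(** Only [f] is expanded in the last variable: $fg=\sum_k x_m^k F_k g$. As [F k] has one variable
    less, [F k * g] is handled coefficientwise by induction, and [AN_hsum] adds the results. *)
Lemma AN_M m r M1 M2 f g : 0 < r -> AN m r M1 f -> AN m r M2 g ->
  AN m r (M1 * M2) (fun x => f x * g x).
Proof.
move=> r0; have r0' := ltW r0.
elim: m M1 M2 f g => [|m IH] M1 M2 f g.
  move=> [c [cM fc]] [d [dM gd]]; exists (c * d); split=> [|x].
    by rewrite normrM ler_pM.
  by rewrite fc gd.
move=> /AN_SP[F [N [FN NM fx]]] hg.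
have M20 := AN_ge0 r0' hg.
have Fg k : AN m.+1 r (N k * M2) (fun x => F k x * g x).
  have /AN_SP[G [P [GP PM gx]]] := hg.
  exists (fun j x => F k x * G j x), (fun j => N k * P j); split=> [j|K|x cx].
  - exact: IH (FN k) (GP j).
  - under eq_bigr do rewrite -mulrA.
    rewrite -mulr_sumr ler_wpM2l//; exact: AN_ge0 r0' (FN k).
  - refine (hsum_ext _ (hsumZ (F k x) (gx x cx))) => j /=.
    by rewrite mulrA.
apply: (@AN_hsum m.+1 r (fun k => r ^+ k * (N k * M2)) _
  (fun k x => x m ^+ k * (F k x * g x))) => // [k|K|x cx].
- have := Fg k; elim: k (F k) (N k * M2) => [|k IHk] h B hB.
    by rewrite expr0 mul1r; apply: AN_ext hB _ => x _; rewrite expr0 mul1r.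
  have := AN_mulX r0' (IHk _ _ hB); rewrite exprS -mulrA => /AN_ext; apply.
  by move=> x _; rewrite exprS -mulrA.
- under eq_bigr do rewrite mulrA [_ * N _]mulrC.
  by rewrite -mulr_suml ler_wpM2r.
- rewrite [X in hsum _ X]mulrC.
  refine (hsum_ext _ (hsumZ (g x) (fx x cx))) => k /=; ring.
Qed.

Lemma AN_Z m r M c f : 0 < r -> AN m r M f ->
  AN m r (`|c| * M) (fun x => c * f x).
Proof. by move=> r0; apply: AN_M => //; apply: AN_cst => //; exact: ltW. Qed.

Lemma AN_X m r M f k : 0 < r -> AN m r M f ->
  AN m r (M ^+ k) (fun x => f x ^+ k).
Proof.
move=> r0 fM; elim: k => [|k IH].
  by apply: AN_cst; [exact: ltW|rewrite normr1 expr0].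
have := AN_M r0 fM IH; rewrite -exprS => /AN_ext; apply.
by move=> x _; rewrite exprS.
Qed.

(** The bound [r] on [p i] plays two parts: it keeps the substituted point in the polydisc of [f],
    and it dominates $p_m^k$ by $r^k$, so that the same [M] bounds the composite. *)
Lemma AN_comp m r M f s rho (p : nat -> pt -> R) : 0 < rho -> 0 < r ->
  AN m r M f -> (forall i, (i < m)%N -> AN s rho r (p i)) ->
  AN s rho M (fun z => f (fun i => p i z)).
Proof.
move=> h0 r0; elim: m M f => [|m IH] M f.
  move=> [c [cM fc]] _; have := @AN_cst s rho c M (ltW h0) cM.
  by move/AN_ext; apply => x _; rewrite fc.
move=> /AN_SP[F [N [FN NM fx]]] hp.
apply: (@AN_hsum s rho (fun k => N k * r ^+ k) _
   (fun k z => F k (fun i => p i z) * p m z ^+ k)) => // [k|z cz].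
- apply: AN_M => //; last by apply: AN_X => //; exact: hp.
  by apply: (IH _ _ (FN k)) => i im; apply: hp; apply: ltnW.
- have := fx (fun i => p i z); apply=> i im.
  exact: AN_bound (ltW h0) (hp i im) cz.
Qed.

(** The majorant sum can be brought down to the absolute value at the origin by shrinking the
    radius. Vanishing at 0 thus becomes an arbitrarily small bound, as substitution and the implicit
    function theorem require. *)
Lemma AN_small m r M f e : 0 < r -> AN m r M f -> 0 < e ->
  exists2 r', 0 < r' <= r & AN m r' (`|f pt0| + e) f.
Proof.
move=> r0; elim: m M f e => [|m IH] M f e.
  move=> [c [cM fc]] e0; exists r; first by rewrite r0 lexx.
  by exists c; rewrite fc lerDl ltW.
move=> hf e0; have M0 := AN_ge0 (ltW r0) hf.
have /AN_SP[F [N [FN NM fx]]] := hf.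
have e2 : 0 < e / 2 by rewrite divr_gt0.
have [r1 /andP[r10 r1r] h1] := IH _ _ _ (FN 0%N) e2.
have f0 : F 0%N pt0 = f pt0.
  apply: (@hsum_uniq R (fun k => F k pt0 * pt0 m ^+ k)); last first.
    by apply: fx; apply: cube0; exact: ltW.
  have := @hsum_fin R (fun k => F k pt0 * pt0 m ^+ k) 1.
  rewrite big_ord1 /= expr0 mulr1; apply=> -[|k]// _.
  by rewrite /pt0 exprS mul0r mulr0.
(* Passing from [r] to [r2] multiplies the terms of positive degree in the last variable by at most
   [r2 / r], so their total is at most e/2; the other e/2 goes to the constant coefficient, by
   induction. *)
pose r2 := Num.min r1 (r * (e / (2 * (M + 1)))).
have M1 : 0 < M + 1 by rewrite ltr_pwDr.
have r20 : 0 < r2.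
  by rewrite lt_min r10 mulr_gt0// divr_gt0// mulr_gt0.
have r21 : r2 <= r1 by rewrite ge_min lexx.
have r2r : r2 <= r by apply: le_trans r21 r1r.
have r22 : r2 / r * M <= e / 2.
  rewrite mulrAC ler_pdivrMr//.
  have : r2 <= r * (e / (2 * (M + 1))) by rewrite ge_min lexx orbT.
  move=> /(ler_wpM2r M0) /le_trans; apply.
  rewrite -mulrA [leRHS]mulrC; apply: (ler_wpM2l (ltW r0)).
  have -> : e / (2 * (M + 1)) * M = e / 2 * (M / (M + 1)).
    by field; rewrite gt_eqF.
  by apply: (ler_piMr (ltW e2)); rewrite ler_pdivrMr// mul1r lerDl.
exists r2; first by rewrite r20 r2r.
exists F, (fun k => if k is 0%N then `|f pt0| + e / 2 else N k); split=> [k|K|x cx].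
- case: k => [|k]; last by apply: AN_sub (FN k.+1) => //; exact: ltW.
  by rewrite -f0; apply: AN_sub h1 => //; exact: ltW.
- case: K => [|K]; first by rewrite big_ord0 addr_ge0// ltW.
  rewrite big_ord_recl /= expr0 mulr1 [in leRHS](splitr e) addrA lerD2l.
  apply: le_trans r22.
  apply: (@le_trans _ _ (r2 / r * (\sum_(k < K) N k.+1 * r ^+ k.+1))).
    rewrite mulr_sumr; apply: ler_sum => i _.
    rewrite mulrCA; apply: ler_wpM2l; first exact: AN_ge0 (ltW r0) (FN _).
    rewrite !exprS mulrA divfK ?gt_eqF//; apply: (ler_wpM2l (ltW r20)).
    by apply: lerXn2r; rewrite ?nnegrE ?(ltW r20) ?(ltW r0).
  apply: ler_wpM2l; first by rewrite divr_ge0 ?ltW.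
  apply: le_trans (NM K.+1); rewrite big_ord_recl /= lerDr expr0 mulr1.
  exact: AN_ge0 (ltW r0) (FN _).
- by apply: fx; apply: cubeW cx.
Qed.

Lemma AN_dep m r M f x y : 0 <= r -> AN m r M f -> cube m r x ->
  (forall i, (i < m)%N -> x i = y i) -> f x = f y.
Proof.
move=> r0; elim: m M f => [|m IH] M f.
  by move=> [c [_ fc]] _ _; rewrite !fc.
move=> /AN_SP[F [N [FN _ fx]]] cx xy.
have cy : cube m.+1 r y by move=> i im; rewrite -xy//; exact: cx.
apply: (hsum_uniq (fx x cx)); refine (hsum_ext _ (fx y cy)) => k.
rewrite xy//; congr (_ * _); apply/esym; apply: IH (FN k) _ _.
  by apply: cubeW cx.
by move=> i im; apply: xy; exact: ltnW.
Qed.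

Definition upd x i (v : R) : pt := fun j => if j == i then v else x j.

Lemma upd_eq x i v : upd x i v i = v.
Proof. by rewrite /upd eqxx. Qed.

Lemma upd_neq x i v j : j != i -> upd x i v j = x j.
Proof. by rewrite /upd => /negbTE ->. Qed.

Lemma cube_upd m r x i v : cube m r x -> `|v| <= r -> cube m r (upd x i v).
Proof. by move=> cx vr j jm; rewrite /upd; case: eqP => // _; exact: cx. Qed.

(** In the last variable the quotient is the shifted series; in any other variable each coefficient
    is divided, by induction. The bound loses a factor [r] with the removed $x_i$. *)
Lemma AN_div m r M f i : 0 < r -> (i < m)%N -> AN m r M f -> exists2 g,
  AN m r (M / r) g & forall x, cube m r x -> f x = f (upd x i 0) + x i * g x.
Proof.
move=> r0; have r0' := ltW r0; elim: m M f => // m IH M f im fM.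
have M0 := AN_ge0 r0' fM; have /AN_SP[F [N [FN NM fx]]] := fM.
have N0 k : 0 <= N k by apply: AN_ge0 (FN k).
have exg x : cube m.+1 r x -> exists l, hsum (fun k => F k.+1 x * x m ^+ k) l.
  move=> cx; apply: (@hsum_ex _ _ (fun k => N k.+1 * r ^+ k) (M / r)) => [k|K].
    rewrite normrM normrX; apply: ler_pM => //.
      by apply: AN_bound (FN k.+1) _ => //; apply: cubeW cx.
    by apply: lerXn2r; rewrite ?nnegrE//; exact: cx.
  rewrite ler_pdivlMr// mulr_suml; apply: le_trans (NM K.+1).
  rewrite big_ord_recl /= expr0 mulr1; apply: ler_wpDl => //.
  by apply: ler_sum => k _; rewrite -mulrA -exprSr.
have [/eqP imE|imE] := boolP (i == m).
  subst i.
  have /choice[g hg] : forall x, exists l, cube m.+1 r x ->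
      hsum (fun k => F k.+1 x * x m ^+ k) l.
    move=> x; case: (pselect (cube m.+1 r x)) => [/exg[l hl]|nc];
      [by exists l|by exists 0].
  exists g.
    exists (fun k => F k.+1), (fun k => N k.+1); split=> // K.
    rewrite ler_pdivlMr// mulr_suml; apply: le_trans (NM K.+1).
    rewrite big_ord_recl /= expr0 mulr1; apply: ler_wpDl => //.
    by apply: ler_sum => k _; rewrite -mulrA -exprSr.
  move=> x cx; have := fx x cx; move/hsumS; rewrite expr0 mulr1 => h.
  have h2 := hsumZ (x m) (hg x cx).
  have E : f x - F 0%N x = x m * g x.
    apply: (hsum_uniq h); refine (hsum_ext _ h2) => k /=.
    by rewrite exprS mulrCA.
  have c0 : cube m.+1 r (upd x m 0) by apply: cube_upd; rewrite ?normr0.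
  have E0 : f (upd x m 0) = F 0%N x.
    have h3 := fx _ c0; apply: (hsum_uniq h3).
    have h4 : hsum (fun k => F k (upd x m 0) * upd x m 0 m ^+ k)
       (\sum_(k < 1) F k (upd x m 0) * upd x m 0 m ^+ k).
      apply: hsum_fin => -[|k]// _; by rewrite upd_eq exprS mul0r mulr0.
    rewrite big_ord1 expr0 mulr1 in h4.
    suff <- : F 0%N (upd x m 0) = F 0%N x by [].
    apply: AN_dep (FN 0%N) _ _ => //; first by apply: cubeW c0.
    by move=> j jm; rewrite upd_neq// neq_ltn jm.
  by rewrite E0 -E addrC subrK.
have im' : (i < m)%N by rewrite ltn_neqAle imE -ltnS.
have /choice[G hG] : forall k, exists g, AN m r (N k / r) g /\
    forall x, cube m r x -> F k x = F k (upd x i 0) + x i * g x.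
  by move=> k; have [g h1 h2] := IH _ _ im' (FN k); exists g.
have exh x : cube m.+1 r x -> exists l, hsum (fun k => G k x * x m ^+ k) l.
  move=> cx; apply: (@hsum_ex _ _ (fun k => N k / r * r ^+ k) (M / r)) => [k|K].
    rewrite normrM normrX; apply: ler_pM => //.
      by apply: AN_bound (proj1 (hG k)) _ => //; apply: cubeW cx.
    by apply: lerXn2r; rewrite ?nnegrE//; exact: cx.
  rewrite ler_pdivlMr// mulr_suml; apply: le_trans (NM K).
  by apply: ler_sum => k _; rewrite mulrAC divfK// gt_eqF.
have /choice[g hg] : forall x, exists l, cube m.+1 r x ->
      hsum (fun k => G k x * x m ^+ k) l.
  move=> x; case: (pselect (cube m.+1 r x)) => [/exh[l hl]|nc];
    [by exists l|by exists 0].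
exists g.
  exists G, (fun k => N k / r); split=> // [k|K]; first exact: (proj1 (hG k)).
  rewrite ler_pdivlMr// mulr_suml; apply: le_trans (NM K).
  by apply: ler_sum => k _; rewrite mulrAC divfK// gt_eqF.
move=> x cx.
have c0 : cube m.+1 r (upd x i 0) by apply: cube_upd; rewrite ?normr0.
apply: (hsum_uniq (fx x cx)).
refine (hsum_ext _ (hsumD (fx _ c0) (hsumZ (x i) (hg x cx)))) => k /=.
rewrite (proj2 (hG k) x); last by apply: cubeW cx.
rewrite upd_neq 1?eq_sym// mulrDl; congr (_ + _); ring.
Qed.

Definition trunc m x : pt := fun i => if (i < m)%N then x i else 0.

Lemma cube_trunc m n r x : 0 <= r -> cube m r x -> cube m r (trunc n x).
Proof. by move=> r0 cx i im; rewrite /trunc; case: ifP; rewrite ?normr0// cx. Qed.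

(** Hadamard's lemma: one division by [AN_div] for each of the last [n] coordinates. With increments
    as these coordinates it yields difference quotients that are analytic. *)
Lemma AN_hadamard m n r M f : 0 < r -> AN (m + n) r M f ->
  exists2 g : nat -> pt -> R,
  (forall i, AN (m + n) r (M / r) (g i)) &
  forall x, cube (m + n) r x ->
    f x = f (trunc m x) + \sum_(i < n) x (m + i)%N * g i x.
Proof.
move=> r0; have r0' := ltW r0; elim: n M f => [|n IH] M f.
  rewrite addn0 => fM; have M0 := AN_ge0 r0' fM.
  exists (fun _ _ => 0) => [_|x cx].
    by apply: AN_cst => //; rewrite normr0 divr_ge0.
  rewrite big_ord0 addr0; apply: AN_dep r0' fM cx _ => i im.
  by rewrite /trunc im.
rewrite addnS => fM; have [g gM fg] := AN_div r0 (ltnSn (m + n)) fM.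
have /AN_SP[F [N [FN NM fx]]] := fM.
have M0 := AN_ge0 r0' fM.
have NM0 : N 0%N <= M.
  by apply: le_trans (NM 1%N); rewrite big_ord1 expr0 mulr1.
have F0 x : cube (m + n).+1 r x -> x (m + n)%N = 0 -> f x = F 0%N x.
  move=> cx x0; apply: (hsum_uniq (fx _ cx)).
  have := @hsum_fin R (fun k => F k x * x (m + n)%N ^+ k) 1.
  rewrite big_ord1 expr0 mulr1; apply=> -[|k]// _.
  by rewrite x0 exprS mul0r mulr0.
have [h hM fh] := IH _ _ (FN 0%N).
exists (fun i => if i == n then g else h i) => [i|x cx].
  case: eqP => // _; apply: (@AN_sub _ r (N 0%N / r)) => //.
    by rewrite ler_pM2r ?invr_gt0.
  exact: AN_S.
have cx' : cube (m + n) r x by apply: cubeW cx.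
set x1 := upd x (m + n) 0.
have c1 : cube (m + n).+1 r x1 by apply: cube_upd; rewrite ?normr0.
have cd : F 0%N x1 = F 0%N x.
  apply: AN_dep r0' (FN 0%N) _ _; first by apply: cubeW c1.
  by move=> j jm; rewrite /x1 upd_neq// neq_ltn jm.
have ct : cube (m + n).+1 r (trunc m x) by apply: cube_trunc.
rewrite fg// F0 ?upd_eq// cd fh// big_ord_recr /= eqxx addrA; congr (_ + _ + _).
  by rewrite F0// /trunc ltnNge leq_addr.
by apply: eq_bigr => i _; rewrite ltn_eqF.
Qed.

Definition shift x0 x : pt := fun i => x0 i + x i.

Lemma AN_recenter m r M f x0 rho : 0 < rho -> 0 < r -> AN m r M f ->
  (forall i, (i < m)%N -> `|x0 i| + rho <= r) ->
  AN m rho M (fun h => f (shift x0 h)).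
Proof.
move=> h0 r0 fM hx; apply: (AN_comp (p := fun i z => x0 i + z i)) fM _ => //.
move=> i im; apply: AN_sub (hx i im) _ => //; first exact: ltW.
by apply: AN_D; [apply: AN_cst => //; exact: ltW|apply: AN_coord => //; exact: ltW].
Qed.

(* nz m P: P holds near zero. *)
Definition nz m (P : pt -> Prop) := exists2 d : R, 0 < d & forall x, cube m d x -> P x.

Lemma nzW m P P' : (forall x, P x -> P' x) -> nz m P -> nz m P'.
Proof. by move=> PP [d d0 h]; exists d => // x /h/PP. Qed.

Lemma nzI m P P' : nz m P -> nz m P' -> nz m (fun x => P x /\ P' x).
Proof.
move=> [d d0 h] [d' d'0 h']; exists (Num.min d d'); first by rewrite lt_min d0.
move=> x cx; split; [apply: h|apply: h']; apply: cubeW cx => //.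
  by rewrite ge_min lexx.
by rewrite ge_min lexx orbT.
Qed.

Lemma nzT m (P : pt -> Prop) : (forall x, P x) -> nz m P.
Proof. by move=> h; exists 1. Qed.

Lemma min_rad n (P : nat -> R -> Prop) :
  (forall i d d', 0 < d' -> d' <= d -> P i d -> P i d') ->
  (forall i, (i < n)%N -> exists2 d : R, 0 < d & P i d) ->
  exists2 d : R, 0 < d & forall i, (i < n)%N -> P i d.
Proof.
move=> Pm; elim: n => [|n IH] h; first by exists 1.
have [i im|d d0 hd] := IH; first by apply: h; exact: ltnW.
have [d' d'0 hd'] := h n (ltnSn n).
have dd0 : 0 < Num.min d d' by rewrite lt_min d0.
exists (Num.min d d') => // i; rewrite ltnS leq_eqVlt => /orP[/eqP ->|im].
  by apply: Pm hd' => //; rewrite ge_min lexx orbT.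
by apply: Pm (hd i im) => //; rewrite ge_min lexx.
Qed.

Lemma nz_all m n (P : nat -> pt -> Prop) : (forall i, (i < n)%N -> nz m (P i)) ->
  nz m (fun x => forall i, (i < n)%N -> P i x).
Proof.
move=> h; have [|d d0 hd] := @min_rad n (fun i d => forall x, cube m d x -> P i x) _ h.
  by move=> i d d' _ dd H x cx; apply: H; apply: cubeW cx.
by exists d => // x cx i im; exact: hd.
Qed.

Definition An m f := exists r M, 0 < r /\ AN m r M f.

Lemma An_ext m f g : An m f -> nz m (fun x => f x = g x) -> An m g.
Proof.
move=> [r [M [r0 fM]]] [d d0 fg].
have rd0 : 0 < Num.min r d by rewrite lt_min r0.
exists (Num.min r d), M; split=> //.
apply: (@AN_ext _ _ _ f).
  by apply: AN_sub fM => //; [exact: ltW|rewrite ge_min lexx].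
by move=> x cx; apply: fg; apply: cubeW cx => //; rewrite ge_min lexx orbT.
Qed.

Lemma An_eq m f g : An m f -> (forall x, f x = g x) -> An m g.
Proof. by move=> fM fg; apply: An_ext fM (nzT _ fg). Qed.

Lemma An_cst m c : An m (fun=> c).
Proof. by exists 1, `|c|; split=> //; apply: AN_cst. Qed.

Lemma An_coord m i : (i < m)%N -> An m (fun x => x i).
Proof. by move=> im; exists 1, 1; split=> //; apply: AN_coord. Qed.

Lemma An_common m f g : An m f -> An m g -> exists r M1 M2,
  [/\ 0 < r, AN m r M1 f & AN m r M2 g].
Proof.
move=> [r [M [r0 fM]]] [r' [M' [r'0 gM]]].
have rd0 : 0 < Num.min r r' by rewrite lt_min r0.
exists (Num.min r r'), M, M'; split => //.
  by apply: AN_sub fM => //; [exact: ltW|rewrite ge_min lexx].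
by apply: AN_sub gM => //; [exact: ltW|rewrite ge_min lexx orbT].
Qed.

Lemma An_D m f g : An m f -> An m g -> An m (fun x => f x + g x).
Proof.
move=> hf hg; have [r [M [M' [r0 fM gM]]]] := An_common hf hg.
by exists r, (M + M'); split=> //; apply: AN_D.
Qed.

Lemma An_M m f g : An m f -> An m g -> An m (fun x => f x * g x).
Proof.
move=> hf hg; have [r [M [M' [r0 fM gM]]]] := An_common hf hg.
by exists r, (M * M'); split=> //; apply: AN_M.
Qed.

Lemma An_Z m c f : An m f -> An m (fun x => c * f x).
Proof. by apply: An_M; exact: An_cst. Qed.

Lemma An_N m f : An m f -> An m (fun x => - f x).
Proof. by move=> /(An_Z (-1)) /An_eq; apply => x; rewrite mulN1r. Qed.

Lemma An_B m f g : An m f -> An m g -> An m (fun x => f x - g x).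
Proof. by move=> hf hg; apply: An_D hf (An_N hg). Qed.

Lemma An_X m f k : An m f -> An m (fun x => f x ^+ k).
Proof.
by move=> [r [M [r0 fM]]]; exists r, (M ^+ k); split=> //; apply: AN_X.
Qed.

Lemma An_sum m (I : Type) (s : seq I) (P : pred I) (f : I -> pt -> R) :
  (forall i, P i -> An m (f i)) -> An m (fun x => \sum_(i <- s | P i) f i x).
Proof.
move=> h; elim: s => [|a s IH].
  by apply: An_eq (An_cst m 0) _ => x; rewrite big_nil.
case Pa : (P a).
  by apply: An_eq (An_D (h a Pa) IH) _ => x; rewrite big_cons Pa.
by apply: An_eq IH _ => x; rewrite big_cons Pa.
Qed.

Lemma An_prod m (I : Type) (s : seq I) (P : pred I) (f : I -> pt -> R) :
  (forall i, P i -> An m (f i)) -> An m (fun x => \prod_(i <- s | P i) f i x).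
Proof.
move=> h; elim: s => [|a s IH].
  by apply: An_eq (An_cst m 1) _ => x; rewrite big_nil.
case Pa : (P a).
  by apply: An_eq (An_M (h a Pa) IH) _ => x; rewrite big_cons Pa.
by apply: An_eq IH _ => x; rewrite big_cons Pa.
Qed.

Lemma An_leq m m' f : (m <= m')%N -> An m f -> An m' f.
Proof.
by move=> mm [r [M [r0 fM]]]; exists r, M; split=> //; apply: AN_leq fM => //; exact: ltW.
Qed.

Lemma An_cts m f e : An m f -> 0 < e -> nz m (fun x => `|f x - f pt0| <= e).
Proof.
move=> fA e0; have [r [M [r0 fM]]] := An_D fA (An_cst m (- f pt0)).
have [r' /andP[r'0 r'r] h] := AN_small r0 fM e0.
exists r' => // x cx; have := AN_bound (ltW r'0) h cx.
by rewrite subrr normr0 add0r.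
Qed.

Lemma An_neq0 m f : An m f -> f pt0 != 0 ->
  nz m (fun x => `|f pt0| / 2 <= `|f x|).
Proof.
move=> fA f0; have e0 : 0 < `|f pt0| / 2 by rewrite divr_gt0// normr_gt0.
apply: nzW (An_cts fA e0) => x h.
have := ler_normD (f x) (f pt0 - f x); rewrite addrC subrK distrC; lra.
Qed.

Lemma An_comp m f s (p : nat -> pt -> R) : An m f ->
  (forall i, (i < m)%N -> An s (p i)) ->
  (forall i, (i < m)%N -> p i pt0 = 0) -> An s (fun z => f (fun i => p i z)).
Proof.
move=> [r [M [r0 fM]]] hp hp0.
have [|i im|rho rho0 h] := @min_rad m (fun i d => AN s d r (p i)).
- by move=> i d d' d0 dd; apply: AN_sub => //; exact: ltW.
- have [ri [Mi [ri0 pM]]] := hp i im.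
  have [d /andP[d0 _] h] := AN_small ri0 pM r0; exists d => //.
  by rewrite hp0// normr0 add0r in h.
by exists rho, M; split => //; apply: AN_comp fM _.
Qed.

Lemma An_dep m f : An m f -> nz m (fun x => forall y,
  (forall i, (i < m)%N -> x i = y i) -> f x = f y).
Proof.
move=> [r [M [r0 fM]]]; exists r => // x cx y; apply: AN_dep fM cx.
exact: ltW.
Qed.

Lemma ps_tail (a N : nat -> R) r M y s : 0 < r ->
  (forall j, `|a j| <= N j) -> (forall K, \sum_(j < K) N j * r ^+ j <= M) ->
  `|y| <= r -> hsum (fun j => a j * y ^+ j) s -> `|s - a 0%N| <= `|y| * (M / r).
Proof.
move=> r0 aN NM yr /hsumS; rewrite expr0 mulr1 => h.
have N0 j : 0 <= N j by apply: le_trans (aN j).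
apply: (@hsum_norm _ _ (fun j => `|y| * (N j.+1 * r ^+ j)) _ _ h) => [j|K].
  rewrite normrM normrX exprS mulrCA; apply: ler_wpM2l => //.
  by apply: ler_pM; rewrite ?exprn_ge0//; apply: lerXn2r;
    rewrite ?nnegrE ?(ltW r0).
rewrite -mulr_sumr; apply: ler_wpM2l => //.
rewrite ler_pdivlMr// mulr_suml; apply: le_trans (NM K.+1).
rewrite big_ord_recl /= expr0 mulr1; apply: ler_wpDl => //.
by apply: ler_sum => j _; rewrite -mulrA -exprSr.
Qed.

(** By induction on [k]: letting [y] tend to 0 gives the constant coefficient, then one factor [y]
    is divided out. With [v = 0] this is the identity theorem for power series in one variable, from
    small positive arguments alone. *)
Lemma ps_lead (a N : nat -> R) r M d k (v : R -> R) v0 : 0 < r -> 0 < d ->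
  (forall j, `|a j| <= N j) -> (forall K, \sum_(j < K) N j * r ^+ j <= M) ->
  (forall y, 0 < y -> y < d -> hsum (fun j => a j * y ^+ j) (y ^+ k * v y)) ->
  (forall e, 0 < e -> exists2 d', 0 < d' & forall y, 0 < y -> y < d' ->
     `|v y - v0| <= e) ->
  (forall j, (j < k)%N -> a j = 0) /\ a k = v0.
Proof.
move=> r0; elim: k a N M d => [|k IH] a N M d d0 aN NM av vv.
all: have N0 j : 0 <= N j by apply: le_trans (aN j).
all: have M0 : 0 <= M by apply: le_trans (NM 0%N); rewrite big_ord0.
all: have NM1 K : \sum_(j < K) N j.+1 * r ^+ j <= M / r.
1,3: rewrite ler_pdivlMr// mulr_suml; apply: le_trans (NM K.+1);
  rewrite big_ord_recl /= expr0 mulr1; apply: ler_wpDl => //;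
  by apply: ler_sum => j _; rewrite -mulrA -exprSr.
all: have tail y s (y0 : 0 < y) (yr : y <= r)
  (h : hsum (fun j => a j * y ^+ j) s) : `|s - a 0%N| <= y * (M / r).
1,3: by have := ps_tail r0 aN NM _ h; rewrite (gtr0_norm y0); apply.
- split=> //; apply/eqP; rewrite eq_sym -subr_eq0 -normr_le0.
  apply/ler_addgt0Pl => e e0; rewrite addr0.
  have e2 : 0 < e / 2 by rewrite divr_gt0.
  have [d' d'0 hd'] := vv _ e2.
  (* This [y] is below every threshold at once; the last entry makes the tail estimate [y * (M / r)]
     at most e/2. *)
  pose y := Num.min (Num.min (d / 2) (d' / 2)) (Num.min r (e / 2 / (M / r + 1))).
  have Mr : 0 < M / r + 1 by rewrite ltr_pwDr// divr_ge0// ltW.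
  have y0 : 0 < y.
    by rewrite !lt_min (divr_gt0 d0)// (divr_gt0 d'0)// r0 (divr_gt0 e2).
  have yd : y < d.
    have : y <= d / 2 by rewrite !ge_min lexx.
    lra.
  have yd' : y < d'.
    have : y <= d' / 2 by rewrite !ge_min lexx orbT.
    lra.
  have yr : y <= r by rewrite !ge_min lexx !orbT.
  have ye : y * (M / r) <= e / 2.
    have : y <= e / 2 / (M / r + 1) by rewrite !ge_min lexx !orbT.
    rewrite ler_pdivlMr// => /(le_trans _); apply.
    by rewrite ler_wpM2l ?ltW// ltrDl.
  have h1 := tail y _ y0 yr (av y y0 yd); rewrite expr0 mul1r in h1.
  have h2 := hd' y y0 yd'.
  have -> : v0 - a 0%N = (v y - a 0%N) - (v y - v0) by ring.
  by apply: le_trans (ler_normB _ _) _; lra.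
- have vb : exists B d', [/\ 0 < d', 0 <= B & forall y, 0 < y -> y < d' -> `|v y| <= B].
    have [d' d'0 hd'] := vv 1 ltr01; exists (`|v0| + 1), d'; split=> // y y0 yd.
    have := hd' y y0 yd; have := ler_normD (v y - v0) v0; rewrite subrK; lra.
  have [B [d' [d'0 B0 hB]]] := vb.
  have a0 : a 0%N = 0.
    apply/eqP; rewrite -normr_le0; apply/ler_addgt0Pl => e e0; rewrite addr0.
    pose y := Num.min (Num.min (d / 2) (d' / 2)) (Num.min (Num.min r 1) (e / (M / r + B + 1))).
    have Mr : 0 < M / r + B + 1 by rewrite ltr_pwDr// addr_ge0// divr_ge0// ltW.
    have y0 : 0 < y.
      by rewrite !lt_min (divr_gt0 d0)// (divr_gt0 d'0)// r0 ltr01 (divr_gt0 e0).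
    have yd : y < d.
      have : y <= d / 2 by rewrite !ge_min lexx.
      lra.
    have yd' : y < d'.
      have : y <= d' / 2 by rewrite !ge_min lexx orbT.
      lra.
    have yr : y <= r by rewrite !ge_min lexx !orbT.
    have y1 : y <= 1 by rewrite !ge_min lexx !orbT.
    have ye : y * (M / r + B) <= e.
      have : y <= e / (M / r + B + 1) by rewrite !ge_min lexx !orbT.
      rewrite ler_pdivlMr// => /(le_trans _); apply.
      by rewrite ler_wpM2l ?ltW// ltrDl.
    have h1 := tail y _ y0 yr (av y y0 yd).
    have h2 : `|y ^+ k.+1 * v y| <= y * B.
      rewrite exprS -mulrA normrM (gtr0_norm y0); apply: (ler_wpM2l (ltW y0)).
      rewrite normrM normrX (gtr0_norm y0) -[leRHS]mul1r.
      apply: ler_pM; rewrite ?exprn_ge0 ?(ltW y0)//; last exact: hB.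
      by rewrite exprn_ile1 ?(ltW y0).
    have -> : a 0%N = y ^+ k.+1 * v y - (y ^+ k.+1 * v y - a 0%N) by ring.
    apply: le_trans (ler_normB _ _) _; rewrite mulrDr in ye; lra.
  have [||y y0 yd|h1 h2] := IH (fun j => a j.+1) (fun j => N j.+1) (M / r) d d0 _ _ _ vv => //.
    have /hsumS := av y y0 yd.
    rewrite a0 mul0r subr0 => /(hsumZ y^-1); rewrite exprS -mulrA mulKf ?gt_eqF//.
    by apply: hsum_ext => j; rewrite exprS mulrCA mulKf ?gt_eqF.
  by split=> // -[|j]// jk; exact: h1.
Qed.

(** Over a point of the small open box in the first variables, [ps_lead] with [v = 0] makes every
    coefficient vanish; by induction the coefficients then vanish on the whole polydisc. *)
Lemma AN_zero m r M f d : 0 < d -> d <= r -> AN m r M f ->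
  (forall x, (forall i, (i < m)%N -> 0 < x i < d) -> f x = 0) ->
  forall x, cube m r x -> f x = 0.
Proof.
move=> d0 dr; have r0 := lt_le_trans d0 dr; elim: m M f => [|m IH] M f.
  by move=> _ fx x _; exact: fx.
move=> /AN_SP[F [N [FN NM fx]]] f0.
have F0 k : forall x, cube m r x -> F k x = 0.
  apply: IH (FN k) _ => x xd.
  have cx : cube m r x.
    by move=> i /xd/andP[x0 xd']; rewrite gtr0_norm// (le_trans (ltW xd')).
  have [|||h _] := @ps_lead (fun j => F j x) N r M d k.+1 (fun=> 0) 0 r0 d0 _ NM.
  - by move=> j; apply: AN_bound (FN j) cx; exact: ltW.
  - move=> y y0 yd; rewrite mulr0.
    have cu : cube m.+1 r (upd x m y).
      move=> i; rewrite ltnS leq_eqVlt => /orP[/eqP ->|im].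
        by rewrite upd_eq gtr0_norm// (le_trans (ltW yd)).
      by rewrite upd_neq ?cx// neq_ltn im.
    have <- : f (upd x m y) = 0.
      apply: f0 => i; rewrite ltnS leq_eqVlt => /orP[/eqP ->|im].
        by rewrite upd_eq y0.
      by rewrite upd_neq ?xd// neq_ltn im.
    refine (hsum_ext _ (fx _ cu)) => j; rewrite upd_eq; congr (_ * _).
    apply/esym; apply: AN_dep (FN j) cx _; first exact: ltW.
    by move=> i im; rewrite upd_neq// neq_ltn im.
  - by move=> e e0; exists 1 => // y _ _; rewrite subrr normr0 ltW.
  - by apply: h; exact: ltnSn.
move=> x cx; apply: (hsum_uniq (fx x cx)).
refine (hsum_ext _ (@hsum0 R)) => k.
by rewrite F0 ?mul0r//; apply: cubeW cx.
Qed.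

End AN.
Arguments pt0 {R}.

(** * Implicit functions and the Tschirnhausen transformation *)

Section Calc.
Variable R : realType.
Notation pt := (nat -> R).
Implicit Types (f g : pt -> R) (x : pt) (r M c e B : R).

Lemma cvgr_sum (T I : Type) (F : set_system T) {FF : Filter F} (s : seq I)
    (u : I -> T -> R) (v : I -> R) : (forall i, u i @ F --> v i) ->
  (fun t => \sum_(i <- s) u i t) @ F --> \sum_(i <- s) v i.
Proof.
move=> uv; elim: s => [|a s IH].
  rewrite big_nil; have -> : (fun t : T => \sum_(i <- [::]) u i t) = (fun=> 0).
    by apply/funext => t; rewrite big_nil.
  exact: cvg_cst.
rewrite big_cons.
have -> : (fun t : T => \sum_(i <- a :: s) u i t) =
          (fun t => u a t + \sum_(i <- s) u i t).
  by apply/funext => t; rewrite big_cons.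
exact: cvgD.
Qed.

Lemma An_cvg (T : Type) (F : set_system T) {FF : Filter F} m r M f x0 (z : T -> pt) :
  AN m r M f -> (forall i, (i < m)%N -> `|x0 i| < r) ->
  (forall i, (i < m)%N -> (fun t => z t i) @ F --> x0 i) -> 0 < r ->
  (fun t => f (z t)) @ F --> f x0.
Proof.
move=> fM xr zx r0.
have [i d d' _ dd|i im|rho rho0 hr] := @min_rad R m (fun i d => `|x0 i| + d <= r).
- by apply: le_trans; rewrite lerD2l.
- exists (r - `|x0 i|); first by rewrite subr_gt0 xr.
  by rewrite addrC subrK.
have fA : An m (fun h => f (shift x0 h)).
  by exists rho, M; split=> //; apply: AN_recenter fM _.
have dA := An_dep fA.
have f0 : f (shift x0 pt0) = f x0.
  by congr f; apply/funext => i; rewrite /shift /pt0 addr0.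
apply/cvgrPdist_le => e e0.
have [d d0 hd] := An_cts fA e0.
have [rd0 rdd] : 0 < Num.min d rho /\ Num.min d rho <= d.
  by rewrite lt_min d0 ge_min lexx.
have : \forall t \near F, forall i : 'I_m, `|x0 i - z t i| <= Num.min d rho.
  apply: filter_forall => i.
  by have /cvgrPdist_le/(_ _ rd0) := zx i (ltn_ord i).
apply: filterS => t ht.
have ch : cube m d (fun i => z t i - x0 i).
  by move=> i im; rewrite distrC; apply: le_trans (ht (Ordinal im)) rdd.
have := hd _ ch; rewrite f0 distrC; congr (`| _ - f _| <= _).
by apply/funext => i; rewrite /shift addrC subrK.
Qed.

Lemma An_cvg0 (T : Type) (F : set_system T) {FF : Filter F} m f (z : T -> pt) :
  An m f -> (forall i, (i < m)%N -> (fun t => z t i) @ F --> (0 : R)) ->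
  (fun t => f (z t)) @ F --> f pt0.
Proof.
move=> [r [M [r0 fM]]] z0; apply: An_cvg fM _ _ _ => // i im.
by rewrite /pt0 normr0.
Qed.

(** The increments are divided out of the two-point function ([AN_hadamard]): $f(x+h)-f(x)=\sum_i
    h_i g_i(x,h)$. The $g_i(x,0)$ are analytic partial derivatives, and Carathéodory's criterion
    gives the chain rule along any path differentiable at the single time [t0]. *)
Lemma An_diff m f : An m f -> exists D : nat -> pt -> R,
  (forall i, (i < m)%N -> An m (D i)) /\
  nz m (fun x => forall (c : R -> pt) (c' : pt) t0,
    (forall i, (i < m)%N -> c t0 i = x i) ->
    (forall i, (i < m)%N -> is_derive t0 1 (fun t => c t i) (c' i)) ->
    is_derive t0 1 (fun t => f (c t)) (\sum_(i < m) D i x * c' i)).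
Proof.
move=> [r [M [r0 fM]]]; pose rho := r / 2.
have rho0 : 0 < rho by rewrite divr_gt0.
have rhoE : rho + rho = r by rewrite -splitr.
pose K (w : pt) := f (fun i => w i + w (m + i)%N).
have KA : AN (m + m) rho M K.
  apply: (AN_comp (p := fun i w => w i + w (m + i)%N) rho0 r0 fM) => i im.
  by rewrite -rhoE; apply: AN_D; apply: AN_coord; rewrite ?(ltW rho0)// ?ltn_add2l// ltn_addr.
have [g gA Kg] := AN_hadamard rho0 KA.
exists (fun i x => g i (trunc m x)); split=> [i im|].
  exists rho, (M / rho); split=> //.
  apply: (AN_comp (p := fun j (w : pt) => if (j < m)%N then w j else 0) rho0 rho0 (gA i)).
  move=> j jm; case: (ltnP j m) => h; first by apply: AN_coord => //; exact: ltW.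
  by apply: AN_cst; rewrite ?normr0 ltW.
exists (rho / 2); first by rewrite divr_gt0.
move=> x cx c c' t0 cx0 dc.
(* The first [m] coordinates hold the base point, the next [m] the increment of the path at time
   [t]. *)
pose w t : pt := fun j => if (j < m)%N then x j else
  if (j < m + m)%N then c t (j - m)%N - x (j - m)%N else 0.
have cc i : (i < m)%N -> (fun t => c t i) @ t0 --> x i.
  move=> im; rewrite -cx0//.
  have /is_derive1_caratheodory [q [qe qc _]] := dc i im.
  have -> : (fun t => c t i) = (fun t => c t0 i + q t * (t - t0)).
    by apply/funext => t; rewrite -qe addrC subrK.
  have h : (fun t => c t0 i + q t * (t - t0)) @ t0 --> c t0 i + q t0 * (t0 - t0).
    apply: cvgD; first exact: cvg_cst.
    by apply: cvgM => //; apply: cvgB => //; exact: cvg_cst.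
  by rewrite subrr mulr0 addr0 in h.
have w0 : w t0 = trunc m x.
  apply/funext => j; rewrite /w /trunc; case: (ltnP j m) => // h.
  by case: ifP => // h2; rewrite cx0 ?subrr// ltn_subLR.
have gc i : (fun t => g i (w t)) @ t0 --> g i (trunc m x).
  apply: (An_cvg (gA i)) => // j jm.
    rewrite /trunc; case: ifP => h; last by rewrite normr0.
    by apply: le_lt_trans (cx j h) _; rewrite ltr_pdivrMr// ltr_pMr// ltr1n.
  rewrite /w /trunc jm; case: (ltnP j m) => h; first exact: cvg_cst.
  have jm' : (j - m < m)%N by rewrite ltn_subLR.
  have := cvgB (cc _ jm') (cvg_cst (x (j - m)%N)).
  by rewrite subrr; apply.
pose FF t := f x + \sum_(i < m) (c t i - c t0 i) * g i (w t).
have nearE : \near t0, FF t0 = f (c t0).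
  have : \forall t \near t0, forall i : 'I_m, `|x i - c t i| <= rho / 2.
    apply: (@filter_forall _ _ (fun (i : 'I_m) t => `|x i - c t i| <= rho / 2) (nbhs t0)) => i.
    by have /cvgrPdist_le := cc i (ltn_ord i); apply; rewrite divr_gt0.
  apply: filterS => t ht.
  have cw : cube (m + m) rho (w t).
    move=> j jm; rewrite /w jm; case: (ltnP j m) => h.
      by apply: le_trans (cx j h) _; rewrite ler_pdivrMr// ler_pMr// ler1n.
    have jm' : (j - m < m)%N by rewrite ltn_subLR.
    rewrite distrC; apply: le_trans (ht (Ordinal jm')) _.
    by rewrite ler_pdivrMr// ler_pMr// ler1n.
  have ctr : cube m r (c t).
    move=> i im; have := ht (Ordinal im); have := cx i im => /=.
    have := ler_normD (x i) (c t i - x i); rewrite addrC subrK distrC.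
    by rewrite -rhoE; lra.
  have e1 : K (w t) = f (c t).
    apply/esym; apply: (AN_dep (ltW r0) fM ctr) => i im.
    by rewrite /w im ltnNge leq_addr /= ltn_add2l im addKn addrC subrK.
  have e2 : K (trunc m (w t)) = f x.
    apply/esym; apply: (AN_dep (ltW r0) fM).
      by move=> i im; apply: le_trans (cx i im) _; rewrite -rhoE; lra.
    by move=> i im; rewrite /trunc /w im ltnNge leq_addr /= addr0.
  rewrite -e1 Kg// e2 /FF; congr (_ + _); apply: eq_bigr => i _.
  by rewrite [in RHS]/w ltnNge leq_addr /= ltn_add2l ltn_ord addKn cx0.
apply: (near_eq_is_derive nearE).
apply/is_derive1_caratheodory.
have /choice[q hq] : forall i : 'I_m, exists q : R -> R,
   [/\ forall z, c z i - c t0 i = q z * (z - t0), {for t0, continuous q} & q t0 = c' i].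
  by move=> i; apply/is_derive1_caratheodory/dc.
exists (fun t => \sum_(i < m) q i t * g i (w t)); split.
- move=> z; rewrite /FF; set s0 := \sum_(i < m) (c t0 i - _) * _.
  have -> : s0 = 0 by rewrite /s0 big1// => i _; rewrite subrr mul0r.
  rewrite addr0 addrC addKr mulr_suml; apply: eq_bigr => i _.
  by have [-> _ _] := hq i; ring.
- rewrite /prop_for /continuous_at.
  apply: cvgr_sum => i; apply: cvgM; first by have [_ h _] := hq i.
  by rewrite -w0 in gc; exact: gc.
- by apply: eq_bigr => i _; have [_ _ ->] := hq i; rewrite mulrC w0.
Qed.

Lemma hsum_drop (a : nat -> R) d l :
  hsum a l <-> hsum (fun k => a (k + d)%N) (l - \sum_(k < d) a k).
Proof.
elim: d a l => [|d IH] a l.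
  rewrite big_ord0 subr0; split; apply: hsum_ext => k; by rewrite addn0.
rewrite hsumS (IH (fun k => a k.+1)) big_ord_recl opprD addrA.
by split; apply: hsum_ext => k; rewrite addnS.
Qed.

Lemma hsum_sum (a : nat -> nat -> R) l J : (forall j, hsum (a j) (l j)) ->
  hsum (fun n => \sum_(j < J) a j n) (\sum_(j < J) l j).
Proof.
move=> al; elim: J => [|J IH].
  by rewrite big_ord0; refine (hsum_ext _ (@hsum0 R)) => n; rewrite big_ord0.
rewrite big_ord_recr /=; refine (hsum_ext _ (hsumD IH (al J))) => n.
by rewrite big_ord_recr.
Qed.

Lemma sum_shift (a : nat -> R) d K :
  \sum_(k < d + K) a k = \sum_(k < d) a k + \sum_(k < K) a (k + d)%N.
Proof.
rewrite -!(big_mkord xpredT a) (big_cat_nat (leq0n d) (leq_addr _ _)) /=.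
congr (_ + _); rewrite -[X in index_iota X _]add0n big_addn addKn.
by rewrite big_mkord.
Qed.

Lemma sum_bin_le n J : \sum_(j < J) 'C(n, j)%:R <= 2 ^+ n :> R.
Proof.
have -> : 2 ^+ n = \sum_(j < n.+1) 'C(n, j)%:R :> R.
  rewrite -[2]/(1 + 1) exprDn; apply: eq_bigr => j _.
  by rewrite !expr1n mul1r.
case: (leqP J n.+1) => [Jn|nJ].
  rewrite -!(big_mkord xpredT (fun j => 'C(n, j)%:R)).
  by rewrite [leRHS](big_cat_nat (leq0n _) Jn) //= lerDl sumr_ge0.
rewrite -!(big_mkord xpredT (fun j => 'C(n, j)%:R)).
rewrite (big_cat_nat (leq0n _) (ltnW nJ)) //= [X in _ + X]big1_seq ?addr0// => j.
by rewrite mem_index_iota => /andP[_ /andP[nj _]]; rewrite bin_small.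
Qed.

(** Re-expansion about [y], with $b_j=\sum_n\binom{n+j}{j}a_{n+j}y^n$. Half of the radius is given
    up so that $\sum_j\binom nj\le 2^n$ is absorbed by $(2\rho)^n$. *)
Lemma ps_taylor (a N : nat -> R) rho M (y : R) : 0 < rho ->
  (forall j, `|a j| <= N j) ->
  (forall K, \sum_(j < K) N j * (rho + rho) ^+ j <= M) -> `|y| <= rho ->
  exists b P : nat -> R, [/\
    forall j, hsum (fun n => 'C(n + j, j)%:R * a (n + j)%N * y ^+ n) (b j),
    forall j, `|b j| <= P j, forall K, \sum_(j < K) P j * rho ^+ j <= M &
    forall t s, `|t| <= rho -> hsum (fun n => a n * (y + t) ^+ n) s ->
      hsum (fun j => b j * t ^+ j) s].
Proof.
move=> rho0 aN NM yr; have rho0' := ltW rho0.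
have N0 j : 0 <= N j by apply: le_trans (aN j).
have rect I J : \sum_(n < I) \sum_(j < J) 'C(n, j)%:R * N n * rho ^+ n <= M.
  apply: le_trans (NM I); apply: ler_sum => n _.
  under eq_bigr do rewrite -mulrA.
  have -> : rho + rho = 2 * rho by ring.
  rewrite -mulr_suml exprMn.
  rewrite [leRHS]mulrCA; apply: ler_wpM2r; last exact: sum_bin_le.
  by rewrite mulr_ge0// exprn_ge0.
have drop (g : nat -> R) j l : hsum (fun n => 'C(n + j, j)%:R * g (n + j)%N) l ->
    hsum (fun n => 'C(n, j)%:R * g n) l.
  move=> h; apply/(hsum_drop _ j); rewrite big1 ?subr0// => k _.
  by rewrite bin_small ?mul0r.
have drop' (g : nat -> R) j l : hsum (fun n => 'C(n, j)%:R * g n) l ->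
    hsum (fun n => 'C(n + j, j)%:R * g (n + j)%N) l.
  move=> /(hsum_drop _ j); rewrite big1 ?subr0// => k _.
  by rewrite bin_small ?mul0r.
have col j K : \sum_(n < K) 'C(n, j)%:R * (N n * rho ^+ n) <= M.
  apply: le_trans (rect K j.+1); apply: ler_sum => n _.
  rewrite big_ord_recr /= mulrA lerDr sumr_ge0// => i _.
  by rewrite !mulr_ge0// exprn_ge0.
have /choice[Q hQ] : forall j, exists l, hsum (fun n => 'C(n, j)%:R * (N n * rho ^+ n)) l.
  move=> j; apply: hsum_ge0_ex (col j) => n.
  by rewrite !mulr_ge0// exprn_ge0.
have hQ' j : hsum (fun n => 'C(n + j, j)%:R * (N (n + j)%N * rho ^+ n)) (Q j / rho ^+ j).
  rewrite mulrC.
  refine (hsum_ext _ (hsumZ (rho ^+ j)^-1 (drop' _ _ _ (hQ j)))) => n.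
  rewrite exprD; field; by rewrite expf_neq0// gt_eqF.
have bnd j n : `|'C(n + j, j)%:R * a (n + j)%N * y ^+ n| <=
    'C(n + j, j)%:R * (N (n + j)%N * rho ^+ n).
  rewrite -mulrA normrM normr_nat; apply: ler_wpM2l => //.
  rewrite normrM normrX; apply: ler_pM; rewrite ?exprn_ge0//.
  by apply: lerXn2r; rewrite ?nnegrE.
have Qle j K : \sum_(n < K) 'C(n + j, j)%:R * (N (n + j)%N * rho ^+ n) <= Q j / rho ^+ j.
  apply: (hsum_partial_le _ _ (hQ' j)) => n.
  by rewrite !mulr_ge0// exprn_ge0.
have /choice[b hb] : forall j, exists l,
    hsum (fun n => 'C(n + j, j)%:R * a (n + j)%N * y ^+ n) l.
  by move=> j; apply: hsum_ex (bnd j) (Qle j).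
exists b, (fun j => Q j / rho ^+ j); split=> //.
- by move=> j; apply: hsum_norm (hb j) (bnd j) (Qle j).
- move=> K; under eq_bigr do rewrite divfK ?expf_neq0 ?gt_eqF//.
  apply: (hsum_le (@hsum_sum _ _ K hQ)) => L.
  apply: le_trans (rect L K); apply: ler_sum => n _.
  by apply: ler_sum => j _; rewrite mulrA.
- move=> t s tr hs.
  apply: (@hsum_double R (fun n j => 'C(n, j)%:R * a n * y ^+ (n - j) * t ^+ j)
     (fun n j => 'C(n, j)%:R * N n * rho ^+ n) _ _ _ M) hs _ => //.
  + move=> n j; case: (leqP j n) => jn; last first.
      by rewrite bin_small ?mul0r ?normr0// .
    rewrite -!mulrA normrM normr_nat; apply: ler_wpM2l => //.
    rewrite normrM; apply: ler_pM => //.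
    rewrite normrM !normrX -[in leRHS](subnK jn) exprD.
    by apply: ler_pM; rewrite ?exprn_ge0//; apply: lerXn2r; rewrite ?nnegrE.
  + move=> n.
    have := @hsum_fin R (fun j => 'C(n, j)%:R * a n * y ^+ (n - j) * t ^+ j) n.+1.
    have -> : \sum_(j < n.+1) 'C(n, j)%:R * a n * y ^+ (n - j) * t ^+ j = a n * (y + t) ^+ n.
      rewrite exprDn mulr_sumr; apply: eq_bigr => j _.
      by rewrite -mulr_natr; ring.
    by apply=> k nk; rewrite bin_small// !mul0r.
  + move=> j; apply/(hsum_drop _ j); rewrite big1 ?subr0; last first.
      by move=> k _; rewrite bin_small// !mul0r.
    rewrite mulrC; refine (hsum_ext _ (hsumZ (t ^+ j) (hb j))) => n.
    by rewrite addnK; ring.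
Qed.

Lemma AN_sumn m r n (M : nat -> R) (f : nat -> pt -> R) : 0 <= r ->
  (forall k, (k < n)%N -> AN m r (M k) (f k)) ->
  AN m r (\sum_(k < n) M k) (fun x => \sum_(k < n) f k x).
Proof.
move=> r0; elim: n => [|n IH] h.
  by rewrite big_ord0; apply: AN_ext (AN_0 m r) _ => x _; rewrite big_ord0.
rewrite big_ord_recr /=; apply: AN_ext (AN_D (IH _) (h n (ltnSn n))) _.
  by move=> k kn; apply: h; exact: ltnW.
by move=> x _; rewrite big_ord_recr.
Qed.

Lemma cube_upd_last m r x v : cube m r x -> `|v| <= r -> cube m.+1 r (upd x m v).
Proof.
move=> cx vr i im; rewrite /upd; case: eqP => // /eqP ne.
by apply: cx; rewrite ltn_neqAle ne -ltnS.
Qed.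

(** Fixed point iteration for $u=x_m-h/c$. As [h] has derivative [c] along the last axis at 0, [u]
    contracts by 1/2 in the last variable near the origin; the iterates starting from 0 form a
    series dominated by a geometric one, and its sum is analytic by [AN_hsum]. *)
Lemma An_ift m h c : An m.+1 h -> h pt0 = 0 -> c != 0 ->
  (forall e, 0 < e -> exists2 d : R, 0 < d & forall t, 0 < t -> t < d ->
      `|t^-1 * h (upd pt0 m t) - c| <= e) ->
  exists phi, [/\ An m phi, phi pt0 = 0 & nz m (fun x => h (upd x m (phi x)) = 0)].
Proof.
move=> hA h0 c0 hc.
pose u x := x m - c^-1 * h x.
have uA : An m.+1 u by apply: An_B; [exact: An_coord|exact: An_Z].
have u0 : u pt0 = 0 by rewrite /u h0 mulr0 subr0.
have [ru [M [ru0 uM]]] := uA.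
pose r := ru / 2; have r0 : 0 < r by rewrite divr_gt0.
have rE : r + r = ru by rewrite -splitr.
(* An extra variable for the increment makes the difference quotient of [u] in the last variable an
   analytic function [D], to which [AN_small] applies. *)
pose u2 (w : pt) := u (fun i => if i == m then w m + w m.+1 else w i).
have u2M : AN m.+2 r M u2.
  apply: (AN_comp (p := fun i w => if i == m then w m + w m.+1 else w i) r0 ru0 uM).
  move=> i im; case: (eqVneq i m) => [_|im'].
    by rewrite -rE; apply: AN_D; apply: AN_coord => //; exact: ltW.
  have := @AN_coord R m.+2 r i (ltW r0) (ltnW im).
  by apply: AN_sub; rewrite ?(ltW r0)// -rE lerDl ltW.
have [D DM uD] := AN_div r0 (ltnSn m.+1) u2M.
pose W (x : pt) (a b : R) : pt := fun j => if (j < m)%N then x j else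
   if j == m then a else if j == m.+1 then b else 0.
have cW rr x a b : 0 < rr -> cube m rr x -> `|a| <= rr -> `|b| <= rr ->
    cube m.+2 rr (W x a b).
  move=> rr0 cx ar br j _; rewrite /W; case: ifP => [/cx//|_].
  by case: ifP => // _; case: ifP => // _; rewrite normr0 ltW.
have uW x a b : cube m r x -> `|a| <= r -> `|b| <= r ->
    u (upd x m (a + b)) - u (upd x m a) = b * D (W x a b).
  move=> cx ar br; have := uD _ (cW _ _ _ _ r0 cx ar br).
  have Wm : W x a b m = a by rewrite /W ltnn eqxx.
  have Wm1 : W x a b m.+1 = b by rewrite /W ltnNge leqnSn /= gtn_eqF// eqxx.
  have cxu v : `|v| <= ru -> cube m.+1 ru (upd x m v).
    by apply: cube_upd_last; apply: cubeW cx => //; rewrite -rE lerDl ltW.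
  have e1 : u2 (W x a b) = u (upd x m (a + b)).
    apply/esym; apply: (AN_dep (ltW ru0) uM).
      by apply: cxu; rewrite -rE (le_trans (ler_normD _ _))// lerD.
    move=> i im; rewrite /upd Wm Wm1; case: eqP => // /eqP ne.
    by rewrite /W ltn_neqAle ne -ltnS im.
  have e2 : u2 (upd (W x a b) m.+1 0) = u (upd x m a).
    apply/esym; apply: (AN_dep (ltW ru0) uM).
      by apply: cxu; apply: le_trans ar _; rewrite -rE lerDl ltW.
    move=> i im; rewrite /upd eqxx (ltn_eqF (ltnSn m)) Wm addr0; case: eqP => // /eqP ne.
    by rewrite (ltn_eqF im) /W ltn_neqAle ne -ltnS im.
  by rewrite -e1 -e2 => ->; rewrite Wm1 addrC addKr.
(* On the last axis [D] equals [- c^-1 * (t^-1 * h - c)], which is small for small positive [t];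
   continuity of [D] does the rest. *)
have D0 : D pt0 = 0.
  apply/eqP; rewrite -normr_le0; apply/ler_addgt0Pl => e e0; rewrite addr0.
  have e2 : 0 < e / 2 by rewrite divr_gt0.
  have DA : An m.+2 D by exists r, (M / r).
  have [d d0 hd] := An_cts DA e2.
  have ce : 0 < `|c| * (e / 2) by rewrite mulr_gt0// normr_gt0.
  have [d' d'0 hd'] := hc _ ce.
  pose t := Num.min (Num.min d r) (d' / 2).
  have t0 : 0 < t by rewrite !lt_min d0 r0 divr_gt0.
  have td : t <= d by rewrite !ge_min lexx.
  have tr : t <= r by rewrite !ge_min lexx orbT.
  have td' : t < d'.
    have : t <= d' / 2 by rewrite !ge_min lexx orbT.
    lra.
  have h1 := hd (W pt0 0 t) _; have {}h1 := h1 (cW _ _ _ _ d0 _ _ _).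
  have {}h1 : `|D (W pt0 0 t) - D pt0| <= e / 2.
    by apply: h1; rewrite ?normr0 ?(ltW d0)// ?(gtr0_norm t0)//; apply: cube0; exact: ltW.
  have := uW pt0 0 t (cube0 (ltW r0)); rewrite normr0 (gtr0_norm t0) add0r.
  move=> /(_ (ltW r0) tr).
  have -> : upd pt0 m (0 : R) = pt0 by apply/funext => j; rewrite /upd; case: eqP.
  rewrite u0 subr0 /u upd_eq => h2.
  have h3 : D (W pt0 0 t) = - c^-1 * (t^-1 * h (upd pt0 m t) - c).
    apply: (mulfI (lt0r_neq0 t0)); rewrite -h2; field.
    by rewrite c0 gt_eqF.
  have h4 := hd' t t0 td'.
  have h5 : `|D (W pt0 0 t)| <= e / 2.
    rewrite h3 normrM normrN normfV ler_pdivrMl ?normr_gt0//.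
  have -> : D pt0 = D (W pt0 0 t) - (D (W pt0 0 t) - D pt0) by ring.
  by apply: le_trans (ler_normB _ _) _; lra.
have half : 0 < 1 / 2 :> R by rewrite divr_gt0.
have [r1 /andP[r10 r1r] D1] := AN_small r0 DM half.
rewrite D0 normr0 add0r in D1.
pose u_ (x : pt) := u (upd x m 0).
have u_A : An m u_.
  apply: (An_comp (p := fun i (x : pt) => if i == m then 0 else x i) uA) => i im.
    case: (eqVneq i m) => [_|ne]; first exact: An_cst.
    by apply: An_coord; rewrite ltn_neqAle ne -ltnS.
  by case: eqP.
have u_0 : u_ pt0 = 0.
  by rewrite /u_ -[RHS]u0; congr u; apply/funext => j; rewrite /upd; case: eqP.
(* With [r1 / 4] as bound for the first iterate the geometric series sums to at most [r1 / 2], so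
   that all iterates stay where [D] is at most 1/2. *)
have r14 : 0 < r1 / 4 by rewrite divr_gt0.
have [rA [MA [rA0 u_M]]] := u_A.
have [rB /andP[rB0 rBA] u_B] := AN_small rA0 u_M r14.
rewrite u_0 normr0 add0r in u_B.
pose rho := Num.min rB r1.
have rho0 : 0 < rho by rewrite lt_min rB0.
have rhoB : rho <= rB by rewrite ge_min lexx.
have rho1 : rho <= r1 by rewrite ge_min lexx orbT.
have u_rho : AN m rho (r1 / 4) u_ by apply: AN_sub u_B => //; exact: ltW.
pose phi := fix phi n : pt -> R :=
  if n is n'.+1 then fun x => u (upd x m (phi n' x)) else fun=> 0.
pose dl n x := phi n.+1 x - phi n x.
pose q : R := 1 / 2.
have geo N : \sum_(k < N) r1 / 4 * q ^+ k <= r1 / 2.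
  have -> : \sum_(k < N) r1 / 4 * q ^+ k = r1 / 2 - r1 / 2 * q ^+ N.
    elim: N => [|N IH]; first by rewrite big_ord0 expr0; lra.
    by rewrite big_ord_recr /= IH exprS /q; field.
  by rewrite gerBl// mulr_ge0 ?divr_ge0 ?exprn_ge0// ltW.
have phisum n x : \sum_(k < n) dl k x = phi n x.
  elim: n => [|n IH]; first by rewrite big_ord0.
  by rewrite big_ord_recr /= IH /dl addrC subrK.
have geo1 n : r1 / 4 * q ^+ n <= r1.
  apply: (@le_trans _ _ (r1 / 4)); last by lra.
  apply: (ler_piMr (ltW r14)); apply: exprn_ile1; rewrite /q; lra.
have phiA n : (forall k, (k < n)%N -> AN m rho (r1 / 4 * q ^+ k) (dl k)) ->
    AN m rho (r1 / 2) (phi n).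
  move=> hk; apply: (@AN_ext _ _ _ _ (fun x => \sum_(k < n) dl k x)) => [|x _].
    by apply: AN_sub (AN_sumn (ltW rho0) hk) => //; exact: ltW.
  exact: phisum.
have main n : AN m rho (r1 / 4 * q ^+ n) (dl n).
  elim/ltn_ind: n => -[|n] IH.
    by rewrite expr0 mulr1; apply: AN_ext u_rho _ => x _; rewrite /dl /= subr0.
  have IH2 : AN m rho (r1 / 2) (phi n).
    by apply: phiA => k kn; apply: IH; rewrite ltnS ltnW.
  have IH1 := IH n (ltnSn n).
  have : AN m rho (r1 / 4 * q ^+ n * (1 / 2)) (fun x => dl n x * D (W x (phi n x) (dl n x))).
    apply: AN_M => //.
    apply: (AN_comp (p := fun j x => W x (phi n x) (dl n x) j) rho0 r10 D1).
    move=> j jm; rewrite /W; case: (ltnP j m) => jm'.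
      by apply: AN_sub (AN_coord (ltW rho0) jm') => //; exact: ltW.
    case: eqP => _.
      by apply: AN_sub IH2 => //; [exact: ltW|lra].
    case: eqP => _; last by apply: AN_cst; rewrite ?normr0 ltW.
    by apply: AN_sub IH1 => //; exact: ltW.
  rewrite -mulrA -exprSr => /AN_ext; apply => x cx.
  have cx' : cube m r x by apply: cubeW cx => //; apply: le_trans rho1 r1r.
  rewrite -uW//.
  - have -> : phi n x + dl n x = phi n.+1 x by rewrite /dl addrC subrK.
    by [].
  - apply: le_trans (AN_bound (ltW rho0) IH2 cx) _; lra.
  - by apply: le_trans (AN_bound (ltW rho0) IH1 cx) _; apply: le_trans (geo1 n) r1r.
have /choice[ph hph] : forall x, exists l, cube m rho x -> hsum (fun n => dl n x) l.
  move=> x; case: (pselect (cube m rho x)) => [cx|nc]; last by exists 0.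
  have [l hl] : exists l, hsum (fun n => dl n x) l.
    apply: (@hsum_ex _ _ (fun n => r1 / 4 * q ^+ n) (r1 / 2)) => // n.
    exact: AN_bound (ltW rho0) (main n) cx.
  by exists l.
have phA : AN m rho (r1 / 2) ph by apply: AN_hsum main geo _.
exists ph; split; first by exists rho, (r1 / 2).
  apply: (hsum_uniq (hph pt0 (cube0 (ltW rho0)))).
  have phi0 n : phi n pt0 = 0.
    elim: n => //= n ->; rewrite -[RHS]u0; congr u.
    by apply/funext => j; rewrite /upd; case: eqP.
  by refine (hsum_ext _ (@hsum0 R)) => n; rewrite /dl !phi0 subrr.
exists rho => // x cx.
have cx' : cube m r x by apply: cubeW cx => //; apply: le_trans rho1 r1r.
have cx1 : cube m r1 x by apply: cubeW cx.
have phx : `|ph x| <= r1 / 2 by apply: AN_bound phA cx; exact: ltW.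
have phix n : `|phi n x| <= r1 / 2.
  by apply: AN_bound (phiA n _) cx; [exact: ltW|move=> k _; exact: main].
have lim1 : (fun n => phi n x) @ \oo --> ph x.
  by apply: cvg_eqfun (hph x cx) => n; exact: phisum.
have step n : `|u (upd x m (ph x)) - phi n.+1 x| <= 1 / 2 * `|ph x - phi n x|.
  have := uW x (phi n x) (ph x - phi n x) cx'.
  have b1 : `|ph x - phi n x| <= r1.
    by apply: le_trans (ler_normB _ _) _; have := phix n; lra.
  have b2 : `|phi n x| <= r1 by have := phix n; lra.
  have -> : phi n x + (ph x - phi n x) = ph x by rewrite addrC subrK.
  move=> /(_ (le_trans b2 r1r) (le_trans b1 r1r)) ->.
  rewrite normrM mulrC; apply: ler_wpM2r => //.
  by apply: AN_bound (ltW r10) D1 _; apply: cW.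
have lim2 : (fun n => phi n.+1 x) @ \oo --> u (upd x m (ph x)).
  apply/cvgrPdist_le => e e0; have /cvgrPdist_le/(_ _ e0) := lim1.
  apply: filterS => n hn; apply: le_trans (step n) _; lra.
have E : u (upd x m (ph x)) = ph x.
  have lim3 : (fun n => phi n.+1 x) @ \oo --> ph x.
    by rewrite (cvg_shiftS (fun n => phi n x)).
  by apply: cvg_unique lim2 lim3; exact: norm_hausdorff.
move: E; rewrite /u upd_eq => /eqP; rewrite -subr_eq0 addrAC subrr add0r oppr_eq0.
by rewrite mulf_eq0 invr_eq0 (negbTE c0) /= => /eqP.
Qed.

(* The order of f along the last axis, expressed on the positive half-axis only. *)
Definition ordlast m d f := exists v v0, exists2 d0 : R, 0 < d0 & [/\ v0 != 0,
   forall y, 0 < y -> y < d0 -> f (upd pt0 m y) = y ^+ d * v y &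
   forall e, 0 < e -> exists2 d' : R, 0 < d' & forall y, 0 < y -> y < d' ->
     `|v y - v0| <= e].

Lemma AN_splitX m r M f (F : nat -> pt -> R) N d : 0 < r ->
  (forall k, AN m r (N k) (F k)) ->
  (forall K, \sum_(k < K) N k * r ^+ k <= M) ->
  (forall x, cube m.+1 r x -> hsum (fun k => F k x * x m ^+ k) (f x)) ->
  exists u, [/\ An m.+1 u,
    forall x, cube m.+1 r x -> x m = 0 -> u x = F d x &
    forall x, cube m.+1 r x ->
       f x = \sum_(k < d) F k x * x m ^+ k + x m ^+ d * u x].
Proof.
move=> r0 FN NM fx; have r0' := ltW r0.
have N0 k : 0 <= N k by apply: AN_ge0 (FN k).
have NM' K : \sum_(k < K) N (k + d)%N * r ^+ k <= M / r ^+ d.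
  rewrite ler_pdivlMr ?exprn_gt0// mulr_suml.
  apply: le_trans (NM (d + K)%N).
  rewrite (sum_shift (fun k => N k * r ^+ k)).
  apply: ler_wpDl; first by apply: sumr_ge0 => i _; rewrite mulr_ge0// exprn_ge0.
  by apply: ler_sum => k _; rewrite -mulrA -exprD.
have /choice[u hu] : forall x, exists l, cube m.+1 r x ->
     hsum (fun k => F (k + d)%N x * x m ^+ k) l.
  move=> x; case: (pselect (cube m.+1 r x)) => [cx|nc]; last by exists 0.
  have [l hl] : exists l, hsum (fun k => F (k + d)%N x * x m ^+ k) l.
    apply: (@hsum_ex _ _ (fun k => N (k + d)%N * r ^+ k) (M / r ^+ d)) => // k.
    rewrite normrM normrX; apply: ler_pM => //.
      by apply: AN_bound (FN _) _ => //; apply: cubeW cx.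
    by apply: lerXn2r; rewrite ?nnegrE//; exact: cx.
  by exists l.
exists u; split.
- exists r, (M / r ^+ d); split=> //.
  by exists (fun k => F (k + d)%N), (fun k => N (k + d)%N); split.
- move=> x cx xm0; apply: (hsum_uniq (hu x cx)).
  have := @hsum_fin R (fun k => F (k + d)%N x * x m ^+ k) 1.
  rewrite big_ord1 /= expr0 mulr1 add0n; apply=> -[|k]// _.
  by rewrite xm0 exprS mul0r mulr0.
- move=> x cx; have /(hsum_drop _ d) h := fx x cx.
  have h2 := hsumZ (x m ^+ d) (hu x cx).
  apply/eqP; rewrite addrC -subr_eq; apply/eqP; apply: (hsum_uniq h).
  by refine (hsum_ext _ h2) => k; rewrite exprD; ring.
Qed.

(* phi solves (d/dx_m)^d f = 0, so that no term in (x_m)^d is left. *)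
Lemma An_tschirnhausen m d f : An m.+1 f -> ordlast m d.+1 f ->
  exists (phi : pt -> R) (F : nat -> pt -> R) (u : pt -> R),
  [/\ An m phi /\ phi pt0 = 0, forall k, An m (F k), An m.+1 u /\ u pt0 != 0,
     forall k, (k <= d)%N -> F k pt0 = 0 &
     nz m.+1 (fun x => f (upd x m (x m + phi x)) =
        \sum_(k < d) F k x * x m ^+ k + x m ^+ d.+1 * u x)].
Proof.
move=> [r [M [r0 fM]]] [v [v0 [d0 d00 [v00 fv vv]]]].
have r0' := ltW r0.
have /AN_SP[F [N [FN NM fx]]] := fM.
pose a k := F k pt0.
have aN k : `|a k| <= N k by apply: AN_bound (FN k) (cube0 r0').
have fa y : `|y| <= r -> hsum (fun k => a k * y ^+ k) (f (upd pt0 m y)).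
  move=> yr; have cu := cube_upd_last (cube0 r0' (m := m)) yr.
  refine (hsum_ext _ (fx _ cu)) => k; rewrite upd_eq; congr (_ * _).
  apply: AN_dep r0' (FN k) _ _; first by apply: cubeW cu.
  by move=> i im; rewrite upd_neq// neq_ltn im.
have [a0 ad] : (forall j, (j < d.+1)%N -> a j = 0) /\ a d.+1 = v0.
  have dr : 0 < Num.min d0 r by rewrite lt_min d00.
  apply: (ps_lead r0 dr aN NM _ vv) => y y0; rewrite lt_min => /andP[yd yr].
  by rewrite -fv//; apply: fa; rewrite gtr0_norm// ltW.
pose rho := r / 2; have rho0 : 0 < rho by rewrite divr_gt0.
have rho0' := ltW rho0.
have rE : rho + rho = r by rewrite -splitr.
have rhor : rho <= r by rewrite -rE lerDl.
(* Expanding [f] at $x_m+t$ in powers of [t] yields [psi j], the $j$-th derivative in $x_m$ divided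
   by $j!$, as an analytic function. *)
pose g (w : pt) := f (fun i => if i == m then w m + w m.+1 else w i).
have gM : AN m.+2 rho M g.
  apply: (AN_comp (p := fun i w => if i == m then w m + w m.+1 else w i) rho0 r0 fM).
  move=> i im; case: (eqVneq i m) => [_|im'].
    by rewrite -rE; apply: AN_D; apply: AN_coord.
  have := @AN_coord R m.+2 rho i rho0' (ltnW im).
  exact: AN_sub.
have /AN_SP[psi [P [psiP PM gx]]] := gM.
have gE x t : cube m.+1 rho x -> `|t| <= rho ->
    hsum (fun j => psi j x * t ^+ j) (f (upd x m (x m + t))).
  move=> cx tr; have cu := cube_upd_last cx tr.
  have -> : f (upd x m (x m + t)) = g (upd x m.+1 t).
    apply: (AN_dep r0' fM).
      apply: cube_upd; first by apply: cubeW cx.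
      by rewrite -rE (le_trans (ler_normD _ _))// lerD// cx.
    move=> i im; rewrite /upd eqxx (ltn_eqF (ltnSn m)).
    by case: eqP => // ne; rewrite ltn_eqF.
  refine (hsum_ext _ (gx _ cu)) => j; rewrite upd_eq; congr (_ * _).
  apply: AN_dep rho0' (psiP j) _ _; first by apply: cubeW cu.
  by move=> i im; rewrite upd_neq// neq_ltn im.
(* On the last axis, uniqueness of coefficients identifies [psi j] with the re-expansion of
   [ps_taylor]. *)
have psiE y : `|y| <= rho -> forall j,
    hsum (fun n => 'C(n + j, j)%:R * a (n + j)%N * y ^+ n) (psi j (upd pt0 m y)).
  move=> yr.
  have NM' K : \sum_(j < K) N j * (rho + rho) ^+ j <= M by rewrite rE.
  have [b [Q [hb bQ QM bt]]] := ps_taylor rho0 aN NM' yr.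
  have cy : cube m.+1 rho (upd pt0 m y) by apply: cube_upd_last yr; exact: cube0.
  move=> j; suff -> : psi j (upd pt0 m y) = b j by exact: hb.
  apply/eqP; rewrite -subr_eq0; apply/eqP.
  have [||||h _] := @ps_lead R (fun j => psi j (upd pt0 m y) - b j)
     (fun j => P j + Q j) rho (M + M) rho j.+1 (fun=> 0) 0 rho0 rho0.
  - move=> i; apply: le_trans (ler_normB _ _) _; apply: lerD => //.
    exact: AN_bound rho0' (psiP i) cy.
  - move=> K; under eq_bigr do rewrite mulrDl.
    by rewrite big_split /=; exact: (lerD (PM K) (QM K)).
  - move=> t t0 tr; rewrite mulr0.
    have tr' : `|t| <= rho by rewrite gtr0_norm// ltW.
    have h1 := gE _ _ cy tr'; rewrite upd_eq in h1.
    have eu : upd (upd pt0 m y) m (y + t) = upd pt0 m (y + t).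
      by apply/funext => i; rewrite /upd; case: eqP.
    rewrite eu in h1.
    have h2 := bt t _ tr' (fa (y + t) _).
    have {}h2 := h2 (le_trans (ler_normD _ _) (le_trans (lerD yr tr') _)).
    rewrite rE in h2; have {}h2 := h2 (lexx _).
    have := hsumD h1 (hsumZ (-1) h2); rewrite mulN1r subrr; apply: hsum_ext => i.
    by rewrite mulN1r mulrBl.
  - by move=> e e0; exists 1 => // y0 _ _; rewrite subrr normr0 ltW.
  - exact: h.
have psi0 j : psi j pt0 = a j.
  have := psiE 0 _ j; rewrite normr0 => /(_ rho0') h.
  have -> : pt0 = upd pt0 m (0 : R) by apply/funext => i; rewrite /upd; case: eqP.
  apply: (hsum_uniq h).
  have := @hsum_fin R (fun n => 'C(n + j, j)%:R * a (n + j)%N * 0 ^+ n) 1.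
  rewrite big_ord1 expr0 mulr1 add0n binn mul1r; apply=> -[|n]// _.
  by rewrite exprS mul0r mulr0.
(* Its expansion along the last axis starts with $\binom{d+1}{d}a_{d+1}y$, so it vanishes at 0 with
   derivative $(d+1)v_0\ne0$ there, and [An_ift] solves $h=0$ by $x_m=\phi$. *)
pose h := psi d.
have hA : An m.+1 h by exists rho, (P d); split=> //; exact: psiP.
have c0 : d.+1%:R * v0 != 0 by rewrite mulf_neq0// pnatr_eq0.
have [|||phi [phiA phi0 hphi]] := @An_ift m h (d.+1%:R * v0) hA.
- by rewrite /h psi0 a0.
- exact: c0.
- have [Q [Qa QM]] : exists Q : nat -> R, (forall n, `|'C(n.+1 + d, d)%:R * a (n.+1 + d)%N| <= Q n)
      /\ forall K, \sum_(n < K) Q n * rho ^+ n <= M / rho ^+ d.+1.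
    exists (fun n => 2 ^+ (n.+1 + d) * N (n.+1 + d)%N); split=> [n|K].
      rewrite normrM normr_nat; apply: ler_pM => //.
      apply: le_trans (sum_bin_le (n.+1 + d) d.+1).
      by rewrite big_ord_recr /= lerDr sumr_ge0.
    rewrite ler_pdivlMr ?exprn_gt0// mulr_suml.
    apply: le_trans (NM (d.+1 + K)%N).
    rewrite (sum_shift (fun k => N k * r ^+ k)).
    have N0 k : 0 <= N k by apply: le_trans (aN k).
    apply: ler_wpDl; first by apply: sumr_ge0 => i _; rewrite mulr_ge0// exprn_ge0.
    apply: ler_sum => k _; rewrite addSnnS -rE.
    have -> : rho + rho = 2 * rho by ring.
    by rewrite (exprMn _ 2 rho) [rho ^+ (_ + _)%N]exprD le_eqVlt; apply/orP; left; apply/eqP; ring.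
  move=> e e0.
  have M0 : 0 <= M by apply: AN_ge0 fM.
  have Mr : 0 < M / rho ^+ d.+1 / rho + 1.
    by rewrite ltr_pwDr// !divr_ge0// exprn_ge0.
  exists (Num.min rho (e / (M / rho ^+ d.+1 / rho + 1))).
    by rewrite lt_min rho0 divr_gt0.
  move=> t t0; rewrite lt_min => /andP[tr te].
  have tr' : `|t| <= rho by rewrite gtr0_norm// ltW.
  have /hsumS := psiE t tr' d; rewrite add0n a0// mulr0 mul0r subr0 => h1.
  have h2 : hsum (fun n => 'C(n.+1 + d, d)%:R * a (n.+1 + d)%N * t ^+ n) (t^-1 * h (upd pt0 m t)).
    refine (hsum_ext _ (hsumZ t^-1 h1)) => n.
    by rewrite exprS; field; rewrite gt_eqF.
  have := ps_tail rho0 Qa QM tr' h2; rewrite add1n binSn ad (gtr0_norm t0).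
  move=> /le_trans; apply; rewrite ltr_pdivlMr// in te.
  by apply: le_trans (ltW te); apply: (ler_wpM2l (ltW t0)); rewrite lerDl.
have [r1 [M1 [r10 phM]]] := phiA.
have [r2 /andP[r20 r21] phi2] := AN_small r10 phM rho0.
rewrite phi0 normr0 add0r in phi2.
have [r3 r30 hphi3] := hphi.
pose r4 := Num.min (Num.min r2 r3) rho.
have r40 : 0 < r4 by rewrite !lt_min r20 r30.
have r42 : r4 <= r2 by rewrite !ge_min lexx.
have r43 : r4 <= r3 by rewrite !ge_min lexx !orbT.
have r4r : r4 <= rho by rewrite !ge_min lexx orbT.
have phi4 : AN m r4 rho phi by apply: AN_sub phi2 => //; exact: ltW.
pose G k x := psi k (upd x m (phi x)).
have GP k : AN m r4 (P k) (G k).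
  apply: (AN_comp (p := fun i x => upd x m (phi x) i) r40 rho0 (psiP k)) => i im.
  rewrite /upd; case: (eqVneq i m) => [_|ne] //.
  have im' : (i < m)%N by rewrite ltn_neqAle ne -ltnS.
  by apply: AN_sub (AN_coord (ltW r40) im') => //; exact: ltW.
have G0 k : G k pt0 = a k.
  by rewrite /G phi0 -psi0; congr (psi k); apply/funext => i; rewrite /upd; case: eqP.
have fG x : cube m.+1 r4 x -> hsum (fun k => G k x * x m ^+ k) (f (upd x m (x m + phi x))).
  move=> cx; have cx' : cube m r4 x by apply: cubeW cx.
  have px : `|phi x| <= rho by apply: AN_bound phi4 cx'; exact: ltW.
  have cu : cube m.+1 rho (upd x m (phi x)).
    by apply: cube_upd_last px; apply: cubeW cx'.
  have := gE _ (x m) cu (le_trans (cx m (ltnSn m)) r4r); rewrite upd_eq addrC.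
  congr (hsum _ (f _)); apply/funext => i; rewrite /upd; by case: eqP.
have PM4 K : \sum_(k < K) P k * r4 ^+ k <= M.
  apply: le_trans (PM K); apply: ler_sum => k _; apply: ler_wpM2l.
    exact: AN_ge0 rho0' (psiP k).
  by apply: lerXn2r; rewrite ?nnegrE ?(ltW r40).
have [u [uA u0 fu]] := @AN_splitX m r4 M _ G P d.+1 r40 GP PM4 fG.
exists phi, G, u; split=> //.
- by move=> k; exists r4, (P k).
- by split=> //; rewrite u0 ?G0 ?ad//; apply: cube0; exact: ltW.
- by move=> k kd; rewrite G0 a0.
- exists r4 => // x cx; rewrite fu// big_ord_recr /=; congr (_ + _).
  have -> : G d x = 0; last by rewrite mul0r addr0.
  by apply: hphi3; apply: cubeW cx.
Qed.

End Calc.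

(** * Differentiable real functions and $n$-th roots of positive numbers *)

Section Deriv.
Variable R : realType.
Implicit Types (f g : R -> R) (t c : R).

Definition dv f t := derivable f t 1.

Lemma dvD f g t : dv f t -> dv g t -> dv (fun s => f s + g s) t.
Proof. exact: derivableD. Qed.

Lemma dvB f g t : dv f t -> dv g t -> dv (fun s => f s - g s) t.
Proof. exact: derivableB. Qed.

Lemma dvM f g t : dv f t -> dv g t -> dv (fun s => f s * g s) t.
Proof. exact: derivableM. Qed.

Lemma dv_cst c t : dv (fun=> c) t.
Proof. exact: derivable_cst. Qed.

Lemma dvZ c f t : dv f t -> dv (fun s => c * f s) t.
Proof. by move=> h; apply: dvM h; exact: dv_cst. Qed.

Lemma dvV f t : f t != 0 -> dv f t -> dv (fun s => (f s)^-1) t.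
Proof. exact: derivableV. Qed.

Lemma dvX f n t : dv f t -> dv (fun s => f s ^+ n) t.
Proof.
move=> h; elim: n => [|n IH]; first exact: dv_cst.
have -> : (fun s => f s ^+ n.+1) = (fun s => f s * f s ^+ n).
  by apply/funext => s; rewrite exprS.
exact: dvM.
Qed.

Lemma dv_prod n (f : nat -> R -> R) t : (forall i, (i < n)%N -> dv (f i) t) ->
  dv (fun s => \prod_(i < n) f i s) t.
Proof.
elim: n => [|n IH] h.
  have -> : (fun s => \prod_(i < 0) f i s) = (fun=> 1).
    by apply/funext => s; rewrite big_ord0.
  exact: dv_cst.
have -> : (fun s => \prod_(i < n.+1) f i s) =
    (fun s => \prod_(i < n) f i s * f n s).
  by apply/funext => s; rewrite big_ord_recr.
by apply: dvM; [apply: IH => i im; apply: h; exact: ltnW|exact: h].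
Qed.

Lemma dv_near f g t : (\forall s \near t, f s = g s) -> dv f t -> dv g t.
Proof. exact: near_eq_derivable. Qed.

Lemma dv_is f t : dv f t -> exists l, is_derive t 1 f l.
Proof. by move=> h; exists ('D_1 f t); apply: DeriveDef. Qed.

Lemma is_dv f t l : is_derive t 1 f l -> dv f t.
Proof. by case. Qed.

Lemma dv_cts f t : dv f t -> f @ t --> f t.
Proof. by move=> /derivable1_diffP /differentiable_continuous. Qed.

Definition rt n (x : R) : R := expR (ln x / n%:R).

Lemma rtK n x : (0 < n)%N -> 0 < x -> rt n x ^+ n = x.
Proof.
move=> n0 x0; rewrite /rt -expRM_natl mulrC divfK ?pnatr_eq0 ?gtn_eqF//.
by rewrite lnK.
Qed.

Lemma rt_gt0 n x : 0 < rt n x. Proof. exact: expR_gt0. Qed.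

Lemma Krt n x : (0 < n)%N -> 0 < x -> rt n (x ^+ n) = x.
Proof.
move=> n0 x0; apply/eqP; rewrite -(@eqrXn2 _ n)// ?ltW ?rt_gt0//.
by rewrite rtK// exprn_gt0.
Qed.

Lemma dv_rt n f t : 0 < f t -> dv f t -> dv (fun s => rt n (f s)) t.
Proof.
move=> f0 /dv_is[l fl].
have h1 := is_derive1_comp (is_derive1_ln f0) fl.
have h3 : dv (fun s => ln (f s) / n%:R) t by apply: dvM (is_dv h1) _; exact: dv_cst.
have [l' h2] := dv_is h3.
have h4 := @is_derive1_comp R expR (fun s => ln (f s) / n%:R) t _ _ (is_derive_expR _) h2.
by rewrite /rt; exact: (is_dv h4).
Qed.

Lemma dv_ext f g t : f =1 g -> dv f t -> dv g t.
Proof. by move=> /funext ->. Qed.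

End Deriv.
Arguments dvZ {R} c {f t} _.
Arguments dv_cst {R} c t.

(** * Monomials times units *)

Section Mono.
Variable R : realType.
Notation pt := (nat -> R).
Implicit Types (f g : pt -> R) (x z : pt) (al be : nat -> nat) (c e : R).

Definition mono s al z : R := \prod_(i < s) z i ^+ al i.

Lemma monoD s al be z :
  mono s (fun i => al i + be i)%N z = mono s al z * mono s be z.
Proof. by rewrite /mono -big_split; apply: eq_bigr => i _; rewrite exprD. Qed.

Lemma monoX s al n z : mono s (fun i => n * al i)%N z = mono s al z ^+ n.
Proof. by rewrite /mono -prodrXl; apply: eq_bigr => i _; rewrite mulnC exprM. Qed.

Lemma mono0 s al z : (forall i, (i < s)%N -> al i = 0%N) -> mono s al z = 1.
Proof. by move=> h; rewrite /mono big1// => i _; rewrite h. Qed.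

Lemma mono1 s i z : (i < s)%N -> mono s (fun j => (j == i) : nat) z = z i.
Proof.
move=> im; rewrite /mono (bigD1 (Ordinal im)) //= eqxx expr1 big1 ?mulr1// => j ji.
have /negbTE -> : nat_of_ord j != i by apply: contra ji => /eqP h; apply/eqP/val_inj.
by rewrite expr0.
Qed.

Lemma mono_ext s al be z x : (forall i, (i < s)%N -> al i = be i) ->
  (forall i, (i < s)%N -> (0 < al i)%N -> z i = x i) -> mono s al z = mono s be x.
Proof.
move=> ab zx; apply: eq_bigr => i _; rewrite -ab//.
by case: (posnP (al i)) => [->//|h]; rewrite zx.
Qed.

Lemma mono_gt0 s al z : (forall i, (i < s)%N -> (0 < al i)%N -> 0 < z i) ->
  0 < mono s al z.
Proof.
move=> h; apply: prodr_gt0 => i _.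
by case: (posnP (al i)) => [->|a0]; rewrite ?expr0// exprn_gt0// h.
Qed.

Lemma mono_eq0 s al z i : (i < s)%N -> (0 < al i)%N -> z i = 0 -> mono s al z = 0.
Proof.
move=> im a0 z0; rewrite /mono (bigD1 (Ordinal im)) //= z0 expr0n gtn_eqF//.
by rewrite mul0r.
Qed.

Lemma An_mono s al : An s (mono s al).
Proof.
by apply: An_prod => i _; apply: An_X; exact: An_coord.
Qed.

Definition Mono1 s f := exists al u, [/\ An s u, u pt0 != 0 &
  nz s (fun z => f z = mono s al z * u z)].

Definition MonoZ s f := nz s (fun z => f z = 0) \/ Mono1 s f.

Lemma Mono1_ext s f g : nz s (fun z => f z = g z) -> Mono1 s f -> Mono1 s g.
Proof.
move=> fg [al [u [uA u0 fu]]]; exists al, u; split=> //.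
by apply: nzW (nzI fg fu) => z [<-].
Qed.

Lemma Mono1_unit s f : An s f -> f pt0 != 0 -> Mono1 s f.
Proof.
move=> fA f0; exists (fun=> 0%N), f; split=> //; apply: nzT => z.
by rewrite mono0 ?mul1r.
Qed.

Lemma Mono1_mono s al : Mono1 s (mono s al).
Proof.
exists al, (fun=> 1); split; [exact: An_cst|exact: oner_neq0|].
by apply: nzT => z; rewrite mulr1.
Qed.

Lemma Mono1_coord s i : (i < s)%N -> Mono1 s (fun z => z i).
Proof.
move=> im; apply: Mono1_ext (Mono1_mono s (fun j => (j == i) : nat)).
by apply: nzT => z; exact: mono1.
Qed.

Lemma Mono1_M s f g : Mono1 s f -> Mono1 s g -> Mono1 s (fun z => f z * g z).
Proof.
move=> [al [u [uA u0 fu]]] [be [v [vA v0 gv]]].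
exists (fun i => al i + be i)%N, (fun z => u z * v z); split.
- exact: An_M.
- exact: mulf_neq0.
- by apply: nzW (nzI fu gv) => z [-> ->]; rewrite monoD; ring.
Qed.

Lemma Mono1_X s f n : Mono1 s f -> Mono1 s (fun z => f z ^+ n).
Proof.
move=> h; elim: n => [|n IH].
  by apply: Mono1_unit; [exact: An_cst|exact: oner_neq0].
apply: Mono1_ext (Mono1_M h IH); apply: nzT => z; by rewrite exprS.
Qed.

Lemma Mono1_Z s c f : c != 0 -> Mono1 s f -> Mono1 s (fun z => c * f z).
Proof.
by move=> c0; apply: Mono1_M; apply: Mono1_unit => //; exact: An_cst.
Qed.

Lemma Mono1_prod s n (f : nat -> pt -> R) : (forall i, (i < n)%N -> Mono1 s (f i)) ->
  Mono1 s (fun z => \prod_(i < n) f i z).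
Proof.
elim: n => [|n IH] h.
  apply: (@Mono1_ext _ (fun=> 1)); first by apply: nzT => z; rewrite big_ord0.
  by apply: Mono1_unit; [exact: An_cst|exact: oner_neq0].
apply: (@Mono1_ext _ (fun z => \prod_(i < n) f i z * f n z)).
  by apply: nzT => z; rewrite big_ord_recr.
by apply: Mono1_M; [apply: IH => i im; apply: h; exact: ltnW|exact: h].
Qed.

Lemma Mono1_An s f : Mono1 s f -> An s f.
Proof.
move=> [al [u [uA u0 fu]]]; apply: (An_ext (An_M (An_mono s al) uA)).
by apply: nzW fu => z ->.
Qed.

Lemma nz_comp m s (p : pt -> pt) (P : pt -> Prop) :
  (forall i, (i < m)%N -> An s (fun z => p z i)) ->
  (forall i, (i < m)%N -> p pt0 i = 0) -> nz m P -> nz s (fun z => P (p z)).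
Proof.
move=> pA p0 [d d0 hP].
have h i : (i < m)%N -> nz s (fun z => `|p z i| <= d).
  by move=> im; apply: nzW (An_cts (pA i im) d0) => z; rewrite p0// subr0.
by apply: nzW (nz_all h) => z hz; apply: hP.
Qed.

Lemma Mono1_comp m s f (p : pt -> pt) : Mono1 m f ->
  (forall i, (i < m)%N -> Mono1 s (fun z => p z i)) ->
  (forall i, (i < m)%N -> p pt0 i = 0) -> Mono1 s (fun z => f (p z)).
Proof.
move=> [al [u [uA u0 fu]]] pM p0.
have pA i : (i < m)%N -> An s (fun z => p z i) by move=> /pM /Mono1_An.
apply: (@Mono1_ext _ (fun z => mono m al (p z) * u (p z))).
  by apply: nzW (nz_comp pA p0 fu) => z ->.
apply: Mono1_M.
  apply: (@Mono1_prod s m (fun i z => p z i ^+ al i)) => i im.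
  exact: Mono1_X (pM i im).
apply: Mono1_unit; first exact: (An_comp (p := fun i z => p z i) uA pA p0).
suff -> : u (p pt0) = u pt0 by [].
have [d d0 h] := An_dep uA; apply/esym/h; first exact: cube0 (ltW d0).
by move=> i im; rewrite p0.
Qed.

(** A nonzero germ is $z_s^k u$ where [u] restricts on $z_s=0$ to the first nonzero coefficient in
    $z_s$. A zero product of two such germs would restrict to a zero product of nonzero germs in one
    variable less. *)
Lemma An_domain s f g : An s f -> An s g -> nz s (fun z => f z * g z = 0) ->
  nz s (fun z => f z = 0) \/ nz s (fun z => g z = 0).
Proof.
elim: s f g => [|s IH] f g fA gA [d d0 fg0].
  have c0 : forall z : pt, cube 0 d z by [].
  have [rf [Mf [_ [cf [_ fc]]]]] := fA; have [rg [Mg [_ [cg [_ gc]]]]] := gA.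
  have := fg0 pt0 (c0 _); rewrite fc gc => /eqP; rewrite mulf_eq0 => /orP[]/eqP h.
    by left; apply: nzT => z; rewrite fc.
  by right; apply: nzT => z; rewrite gc.
have [//|nf] := pselect (nz s.+1 (fun z => f z = 0)); first by left.
have [//|ng] := pselect (nz s.+1 (fun z => g z = 0)); first by right.
exfalso.
have split h : An s.+1 h -> ~ nz s.+1 (fun z => h z = 0) -> exists k H u,
    [/\ An s H, ~ nz s (fun z => H z = 0), An s.+1 u,
      nz s.+1 (fun z => z s = 0 -> u z = H z) &
      nz s.+1 (fun z => h z = z s ^+ k * u z)].
  move=> [r [M [r0 /AN_SP[F [N [FN NM fx]]]]]] nh.
  have FA k : An s (F k) by exists r, (N k).
  have ex : exists k, `[< ~ nz s (fun z => F k z = 0) >].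
    apply: contrapT => nex; apply: nh; exists r => // z cz.
    apply: (hsum_uniq (fx z cz)); refine (hsum_ext _ (@hsum0 R)) => k.
    have Fk : nz s (fun z => F k z = 0).
      by apply: contrapT => nk; apply: nex; exists k; apply/asboolP.
    have [d' d'0 hd'] := Fk.
    have dr : 0 < Num.min d' r by rewrite lt_min d'0.
    rewrite (@AN_zero _ _ _ _ _ _ dr _ (FN k)) ?mul0r//.
    - by rewrite ge_min lexx orbT.
    - move=> y hy; apply: hd' => i im; have /andP[y0 yd] := hy i im.
      by rewrite gtr0_norm// (le_trans (ltW yd))// ge_min lexx.
    - by apply: cubeW cz.
  have [k /asboolP nk kmin] := ex_minnP ex.
  have [u [uA uF hu]] := AN_splitX k r0 FN NM fx.
  exists k, (F k), u; split=> //; first by exists r.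
  have F0 j : (j < k)%N -> nz s (fun z => F j z = 0).
    move=> jk; apply: contrapT => nj.
    have /kmin : `[< ~ nz s (fun z => F j z = 0) >] by apply/asboolP.
    by rewrite leqNgt jk.
  have [d' d'0 hd'] := nz_all F0.
  exists (Num.min d' r); first by rewrite lt_min d'0.
  move=> z cz; rewrite hu; last by apply: cubeW cz => //; rewrite ge_min lexx orbT.
  rewrite big1 ?add0r// => j _; rewrite hd' ?mul0r//.
  by apply: cubeW cz => //; rewrite ge_min lexx.
have [k [F [u [FA nF uA uF hu]]]] := split f fA nf.
have [l [G [v [GA nG vA vG hv]]]] := split g gA ng.
(* Powers of $z_s$ cancel on a small box of the open positive orthant, which suffices by
   [AN_zero]. *)
have uv : nz s.+1 (fun z => u z * v z = 0).
  have [r [M [r0 hM]]] := An_M uA vA.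
  have [d1 d10 h1] := nzI hu hv.
  pose d2 := Num.min (Num.min d d1) r.
  have d20 : 0 < d2 by rewrite !lt_min d0 d10.
  exists r => // z cz; apply: (AN_zero d20 _ hM) cz.
    by rewrite /d2 ge_min lexx orbT.
  move=> y hy.
  have cy : cube s.+1 d2 y.
    by move=> i im; have /andP[y0 yd] := hy i im; rewrite gtr0_norm// ltW.
  have [e1 e2] : f y = y s ^+ k * u y /\ g y = y s ^+ l * v y.
    by apply: h1; apply: cubeW cy => //; rewrite /d2 !ge_min lexx orbT.
  have : f y * g y = 0.
    by apply: fg0; apply: cubeW cy => //; rewrite /d2 !ge_min lexx.
  rewrite e1 e2 => /eqP; rewrite !mulf_eq0 !expf_eq0.
  have /andP[ys _] := hy s (ltnSn s).
  by rewrite gt_eqF// !andbF /= => /orP[]/eqP ->; rewrite ?mul0r ?mulr0.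
have : nz s (fun z => F z * G z = 0).
  have [d1 d10 h1] := nzI uv (nzI uF vG).
  have [d3 d30 h3] := nzI (An_dep FA) (An_dep GA).
  exists (Num.min d1 d3) => [|z cz]; first by rewrite lt_min d10.
  have c1 : cube s d1 z by apply: cubeW cz => //; rewrite ge_min lexx.
  have c3 : cube s d3 z by apply: cubeW cz => //; rewrite ge_min lexx orbT.
  have cz' : cube s.+1 d1 (upd z s 0).
    by apply: cube_upd_last => //; rewrite normr0 ltW.
  have [e1 [e2 e3]] := h1 _ cz'; have [h4 h5] := h3 z c3.
  have zz i : (i < s)%N -> z i = upd z s 0 i by move=> im; rewrite upd_neq// neq_ltn im.
  by rewrite (h4 _ zz) (h5 _ zz) -e2 ?upd_eq// -e3 ?upd_eq.
by case/(IH _ _ FA GA).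
Qed.

(** Coordinates are prime: if [f * g] vanishes on $z_i=0$, one factor does by [An_domain], and
    [AN_div] takes $z_i$ out of it. Induction on the degree of the monomial. Thanks to this, a whole
    family is monomialized through its product. *)
Lemma Mono1_factor s f g : An s f -> An s g -> Mono1 s (fun z => f z * g z) ->
  Mono1 s f.
Proof.
move=> fA gA [al [u [uA u0 fu]]].
have [n] := ubnP (\sum_(i < s) al i); elim: n al f g fA gA fu => // n IH al f g fA gA fu.
have [al0|] := pselect (forall i, (i < s)%N -> al i = 0%N).
  move=> _; apply: Mono1_unit => //.
  have [d d0 h] := fu; have := h pt0 (cube0 (ltW d0)).
  rewrite mono0// mul1r => e; have : f pt0 * g pt0 != 0 by rewrite e.
  by rewrite mulf_eq0 negb_or => /andP[].
move=> /existsNP[i] /not_implyP[im /eqP]; rewrite -lt0n => ai sn.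
pose be j := if j == i then (al i).-1 else al j.
have alE z : mono s al z = z i * mono s be z.
  rewrite -[in RHS](mono1 z im) -monoD; apply: mono_ext => // j jm.
  by rewrite /be; case: eqP => // ->; rewrite add1n prednK.
have sbe : (\sum_(j < s) be j < n)%N.
  rewrite ltnS in sn; apply: leq_trans sn; rewrite (bigD1 (Ordinal im)) //= [in leqRHS](bigD1 (Ordinal im)) //=.
  rewrite /be eqxx -addSn prednK// leq_add2l leq_eqVlt; apply/orP; left; apply/eqP.
  apply: eq_bigr => j ji; case: eqP => // jj.
  by case/eqP: ji; apply: val_inj.
have updA h : An s h -> An s (fun z => h (upd z i 0)).
  move=> hA; apply: (An_comp (p := fun j z => upd z i 0 j) hA) => j jm.
    rewrite /upd; case: (eqVneq j i) => _; [exact: An_cst|exact: An_coord].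
  by rewrite /upd; case: eqP.
have face : nz s (fun z => f (upd z i 0) * g (upd z i 0) = 0).
  have [d d0 h] := fu; exists d => // z cz.
  rewrite h; last by apply: cube_upd => //; rewrite normr0 ltW.
  by rewrite alE upd_eq !mul0r.
have divA h : An s h -> nz s (fun z => h (upd z i 0) = 0) ->
    exists2 k, An s k & nz s (fun z => h z = z i * k z).
  move=> [r [M [r0 hM]]] h0; have [k kM hk] := AN_div r0 im hM.
  exists k; first by exists r, (M / r).
  have hk' : nz s (fun z => h z = h (upd z i 0) + z i * k z) by exists r.
  by apply: nzW (nzI h0 hk') => z [-> ->]; rewrite add0r.
have cancel h k : An s h -> An s k -> nz s (fun z => z i * h z = z i * k z) ->
    nz s (fun z => h z = k z).
  move=> hA kA [d d0 hk].
  have [r [M [r0 hM]]] := An_B hA kA.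
  have dr : 0 < Num.min d r by rewrite lt_min d0.
  exists r => // z cz; apply/eqP; rewrite -subr_eq0; apply/eqP.
  apply: (AN_zero dr _ hM) cz; first by rewrite ge_min lexx orbT.
  move=> y hy; have /andP[yi0 _] := hy i im.
  apply: (mulfI (lt0r_neq0 yi0)); rewrite mulrBr mulr0 hk ?subrr// => j jm.
  have /andP[y0 yd] := hy j jm; rewrite gtr0_norm//; apply: le_trans (ltW yd) _.
  by rewrite ge_min lexx.
case: (An_domain (updA _ fA) (updA _ gA) face) => h0.
  have [k kA fk] := divA _ fA h0.
  have : Mono1 s k.
    apply: (IH be k g) => //.
    apply: cancel; [exact: An_M|by apply: An_M => //; exact: An_mono|].
    by apply: nzW (nzI fu fk) => z [e1 e2]; rewrite mulrA -e2 e1 alE mulrA.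
  move=> kM; apply: Mono1_ext (Mono1_M (Mono1_coord im) kM).
  by apply: nzW fk => z ->.
have [k kA gk] := divA _ gA h0.
apply: (IH be f k) => //.
apply: cancel; [exact: An_M|by apply: An_M => //; exact: An_mono|].
apply: nzW (nzI fu gk) => z [e1 e2].
by rewrite mulrCA -e2 e1 alE mulrA.
Qed.

End Mono.

(** * Lifting germs of points through charts *)

Section Lift.
Variables (R : realType) (T : Type) (U : set_system T).
Hypothesis UU : UltraFilter U.
Notation pt := (nat -> R).
Implicit Types (f g : pt -> R) (x z : T -> pt) (al be : nat -> nat) (c e : R).
Implicit Types (S : nat -> bool) (p : pt -> pt) (P : T -> Prop).

Let UP : ProperFilter U. Proof. exact: ultra_proper. Qed.

Definition ae P := \forall t \near U, P t.

Lemma aeW P P' : (forall t, P t -> P' t) -> ae P -> ae P'.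
Proof. by move=> h; apply: filterS. Qed.

Lemma aeI P P' : ae P -> ae P' -> ae (fun t => P t /\ P' t).
Proof. exact: filterI. Qed.

Lemma ae_ex P : ae P -> exists t, P t.
Proof. exact: filter_ex. Qed.

Lemma ae_dec P : ae P \/ ae (fun t => ~ P t).
Proof. exact: in_ultra_setVsetC. Qed.

Lemma ae_all n (P : nat -> T -> Prop) : (forall i, (i < n)%N -> ae (P i)) ->
  ae (fun t => forall i, (i < n)%N -> P i t).
Proof.
move=> h; have : ae (fun t => forall i : 'I_n, P i t).
  by apply: (@filter_forall _ _ (fun (i : 'I_n) t => P i t)) => i; exact: h.
by apply: aeW => t ht i im; exact: (ht (Ordinal im)).
Qed.

Definition tends s z := forall i, (i < s)%N -> (fun t => z t i) @ U --> (0 : R).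

Lemma tends_cube s z e : tends s z -> 0 < e -> ae (fun t => cube s e (z t)).
Proof.
move=> zs e0; apply: ae_all => i im.
have /cvgrPdist_le/(_ _ e0) := zs i im.
by apply: aeW => t; rewrite sub0r normrN.
Qed.

Lemma tends_nz s z (P : pt -> Prop) : tends s z -> nz s P -> ae (fun t => P (z t)).
Proof. by move=> zs [d d0 h]; apply: aeW (tends_cube zs d0) => t /h. Qed.

Definition Dom S s e : set pt :=
  [set w | cube s e w /\ forall i, (i < s)%N -> S i -> 0 < w i].

(** The path [w] is not assumed continuous: it is any choice in [D] of preimages of a differentiable
    path. With [Dom] for [D] this makes velocities computable in a chart that need not be an
    immersion at the origin. *)
Definition derivable_lift s m (D : set pt) p := forall (w : R -> pt) t0,
  (\forall t \near t0, D (w t)) ->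
  (forall i, (i < m)%N -> dv (fun t => p (w t) i) t0) ->
  forall i, (i < s)%N -> dv (fun t => w t i) t0.

Lemma Dom_sub S s e e' : e' <= e -> Dom S s e' `<=` Dom S s e.
Proof. by move=> ee w [cw hw]; split=> //; apply: cubeW cw. Qed.

(* The germ x of points along U is lifted to z through the chart p; S is the set
   of coordinates of the chart known to be positive along z. *)
Record Lift m x s S p z : Prop := {
  lift_An : forall i, (i < m)%N -> An s (fun w => p w i);
  lift_0 : forall i, (i < m)%N -> p pt0 i = 0;
  lift_derivable : exists2 e, 0 < e & derivable_lift s m (Dom S s e) p;
  lift_tends : tends s z;
  lift_pos : forall i, (i < s)%N -> S i -> ae (fun t => 0 < z t i);
  lift_eq : forall i, (i < m)%N -> ae (fun t => p (z t) i = x t i)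
}.

(** The positivity condition says that [p2] maps its own domain into that of [p1], so that the two
    liftings of paths can be applied one after the other. *)
Lemma lift_comp m x s1 S1 p1 z1 s2 S2 p2 z2 :
  Lift m x s1 S1 p1 z1 -> Lift s1 z1 s2 S2 p2 z2 ->
  (forall i, (i < s1)%N -> S1 i -> exists2 e, 0 < e &
     forall w, Dom S2 s2 e w -> 0 < p2 w i) ->
  Lift m x s2 S2 (fun w => p1 (p2 w)) z2.
Proof.
move=> [A1 O1 [e1 e10 L1] T1 P1 E1] [A2 O2 [e2 e20 L2] T2 P2 E2] pos.
split=> //.
- move=> i im; exact: (An_comp (p := fun j w => p2 w j) (A1 i im) A2 O2).
- move=> i im; rewrite -[RHS](O1 i im).
  have [d d0 h] := An_dep (A1 i im); apply/esym/h; first exact: cube0 (ltW d0).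
  by move=> j jm; rewrite O2.
- have [e3 e30 h3] : exists2 e, 0 < e & forall i, (i < s1)%N ->
      S1 i -> forall w, Dom S2 s2 e w -> 0 < p2 w i.
    apply: (@min_rad R s1 (fun i e => S1 i -> forall w, Dom S2 s2 e w -> 0 < p2 w i)).
      move=> i d d' _ dd h Si w Dw; apply: (h Si); exact: Dom_sub Dw.
    move=> i im; have [Si|nSi] := boolP (S1 i); last by exists 1.
    by have [e e0 h] := pos i im Si; exists e.
  have [e4 e40 h4] : nz s2 (fun w => cube s1 e1 (p2 w)).
    apply: nz_all => i im; apply: nzW (An_cts (A2 i im) e10) => w.
    by rewrite O2// subr0.
  exists (Num.min (Num.min e2 e3) e4); first by rewrite !lt_min e20 e30.
  move=> w t0 hw hd; apply: (L2 w t0).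
    by apply: filterS hw => t; apply: Dom_sub; rewrite !ge_min lexx.
  apply: (L1 (fun t => p2 (w t))) => //.
  apply: filterS hw => t hw; split.
    by apply: h4; case: hw => cw _; apply: cubeW cw => //; rewrite !ge_min lexx !orbT.
  move=> i im Si; apply: (h3 i im Si); apply: Dom_sub hw.
  by rewrite !ge_min lexx !orbT.
- move=> i im.
  have h1 := tends_nz T1 (An_dep (A1 i im)).
  have h2 := ae_all E2.
  apply: aeW (aeI (aeI h1 h2) (E1 i im)) => t [[h3 h4] <-].
  by apply/esym/h3 => j jm; rewrite h4.
Qed.

(** A monomial times a unit has constant sign on the open positive orthant near 0, so one point of
    the germ decides it. *)
Lemma MonoZ_pos s g z : MonoZ s g -> tends s z ->
  (forall i, (i < s)%N -> ae (fun t => 0 < z t i)) -> ae (fun t => 0 < g (z t)) ->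
  exists2 e, 0 < e & forall w, Dom xpredT s e w -> 0 < g w.
Proof.
move=> [g0|[al [u [uA u0 gu]]]] zs z0 gz.
  have [t [h1 h2]] := ae_ex (aeI (tends_nz zs g0) gz).
  by rewrite h1 ltxx in h2.
have e0 : 0 < `|u pt0| / 2 by rewrite divr_gt0// normr_gt0.
have uc := An_cts uA e0.
have [t [[[h1 h2] h3] h4]] :=
  ae_ex (aeI (aeI (tends_nz zs (nzI gu uc)) (ae_all z0)) gz) => /=.
have mt : 0 < mono s al (z t) by apply: mono_gt0 => i im _; exact: h3.
have ut : 0 < u (z t) by rewrite h1 pmulr_rgt0 in h4.
have up : 0 < u pt0.
  rewrite lt_neqAle eq_sym u0 /= leNgt; apply/negP => u0'.
  by move: h2 e0; rewrite (ltr0_norm u0') ger0_norm; lra.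
have [d d0 h] := nzI gu uc; exists d => // w [cw hw].
have mw : 0 < mono s al w by apply: mono_gt0 => i im _; exact: hw.
have [-> h5] := h w cw; rewrite (pmulr_rgt0 _ mw).
by move: h5; rewrite (gtr0_norm up) ler_norml => /andP[]; lra.
Qed.

Lemma lift_full_comp m x s1 S1 p1 z1 s2 p2 z2 :
  Lift m x s1 S1 p1 z1 -> Lift s1 z1 s2 xpredT p2 z2 ->
  (forall i, (i < s1)%N -> S1 i -> MonoZ s2 (fun w => p2 w i)) ->
  Lift m x s2 xpredT (fun w => p1 (p2 w)) z2.
Proof.
move=> L1 L2 M2; apply: (lift_comp L1 L2) => i im Si.
apply: (MonoZ_pos (M2 i im Si) (lift_tends L2)).
  by move=> j jm; exact: lift_pos L2 _ jm _.
apply: aeW (aeI (lift_eq L2 im) (lift_pos L1 im Si)) => t [-> //].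
Qed.

Lemma lift_drop m x j : (j <= m)%N -> tends m.+1 x -> ae (fun t => x t j = 0) ->
  Lift m.+1 x m xpred0
    (fun w i => if (i < j)%N then w i else if i == j then 0 else w i.-1)
    (fun t i => if (i < j)%N then x t i else x t i.+1).
Proof.
move=> jm xs xj; split=> //.
- move=> i im; case: (ltnP i j) => ij; first by apply: An_coord; apply: leq_trans jm.
  case: (eqVneq i j) => [_|ne]; first exact: An_cst.
  by apply: An_coord; rewrite -ltnS prednK// (leq_ltn_trans (leq0n j))// ltn_neqAle eq_sym ne.
- by move=> i im; case: ifP => // _; case: eqP.
- exists 1 => // w t0 _ hd i im; case: (ltnP i j) => ij.
    by have := hd i (ltnW im); rewrite ij.
  have := hd i.+1 im; rewrite ltnNge (leqW ij) /= gtn_eqF//.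
- move=> i im; case: (ltnP i j) => _; apply: xs => //; exact: ltnW.
- move=> i im; case: (ltnP i j) => ij; first by apply: nearW.
  case: (eqVneq i j) => [->|ne]; first by apply: aeW xj => t ->.
  have ji : (j < i)%N by rewrite ltn_neqAle eq_sym ne.
  have -> : (i.-1 < j)%N = false.
    by apply/negbTE; rewrite -leqNgt -ltnS prednK// (leq_ltn_trans (leq0n j)).
  by apply: nearW => t; rewrite prednK// (leq_ltn_trans (leq0n j)).
Qed.

Lemma lift_sign m x S (k : nat -> R) : (forall i, k i != 0) -> tends m x ->
  (forall i, (i < m)%N -> ae (fun t => 0 < k i * x t i)) ->
  Lift m x m S (fun w i => (k i)^-1 * w i) (fun t i => k i * x t i).
Proof.
move=> k0 xs kx; split.
- by move=> i im; apply: An_Z; exact: An_coord.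
- by move=> i _; rewrite mulr0.
- exists 1 => // w t0 _ hd i im.
  apply: (dv_ext _ (dvZ (k i) (hd i im))) => t.
  by rewrite mulVKf.
- move=> i im; have : (fun t => k i * x t i) @ U --> k i * 0.
    by apply: cvgM; [exact: cvg_cst|exact: xs].
  by rewrite mulr0.
- by move=> i im _; exact: kx.
- by move=> i im; apply: nearW => t; rewrite mulKf.
Qed.

(* Chart x_j = x^ga * (c + k * w_j) of a blow-up, the ratio x_j / x^ga being recentred at its limit c. *)
Lemma lift_twist m x j (ga : nat -> nat) c k S : (j < m)%N -> ga j = 0%N -> k != 0 ->
  mono m ga pt0 * c = 0 -> tends m x ->
  (forall i, (i < m)%N -> (0 < ga i)%N -> S i) ->
  (forall i, (i < m)%N -> i != j -> S i -> ae (fun t => 0 < x t i)) ->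
  let z := fun t => upd (x t) j (k^-1 * (x t j / mono m ga (x t) - c)) in
  (fun t => k^-1 * (x t j / mono m ga (x t) - c)) @ U --> (0 : R) ->
  (S j -> ae (fun t => 0 < k^-1 * (x t j / mono m ga (x t) - c))) ->
  Lift m x m S (fun w => upd w j (mono m ga w * (c + k * w j))) z.
Proof.
move=> jm gj k0 gc xs gS xS z zj zS.
have mx i v : mono m ga (upd i j v) = mono m ga i.
  apply: mono_ext => // l lm l0; rewrite upd_neq//.
  by apply: contraTneq l0 => ->; rewrite gj.
have gx : ae (fun t => 0 < mono m ga (x t)).
  have h : ae (fun t => forall i, (i < m)%N -> (0 < ga i)%N -> 0 < x t i).
    apply: ae_all => i im; have [g0|g0] := posnP (ga i); first by apply: nearW.
    have ij : i != j by apply: contraTneq g0 => ->; rewrite gj.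
    by apply: aeW (xS i im ij (gS i im g0)) => t ? _.
  by apply: aeW h => t ht; apply: mono_gt0.
split=> //.
- move=> i im; rewrite /upd; case: (eqVneq i j) => [_|_]; last exact: An_coord.
  apply: An_M; first exact: An_mono.
  by apply: An_D; [exact: An_cst|apply: An_Z; exact: An_coord].
- by move=> i im; rewrite /upd; case: eqP => // _; rewrite mulr0 addr0.
- exists 1 => // w t0 hw hd.
  have dw i : (i < m)%N -> i != j -> dv (fun t => w t i) t0.
    by move=> im ij; have := hd i im; under [fun t => _]funext do rewrite upd_neq//.
  have [cw0 w0] := nbhs_singleton hw.
  have gw0 : mono m ga (w t0) != 0.
    by apply: lt0r_neq0; apply: mono_gt0 => i im g0; apply: w0 => //; exact: gS.
  move=> i im; have [->|] := eqVneq i j; last exact: dw.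
  have dm : dv (fun t => mono m ga (w t)) t0.
    apply: (@dv_ext _ (fun t => mono m ga (upd (w t) j 0))) => [t|].
      by rewrite mx.
    apply: (@dv_prod R m (fun i t => upd (w t) j 0 i ^+ ga i)) => l lm.
    apply: dvX; rewrite /upd; case: (eqVneq l j) => [_|lj]; first exact: dv_cst.
    exact: dw.
  have h1 := dvM (hd j jm) (dvV gw0 dm).
  have h2 := dvZ k^-1 (dvB h1 (dv_cst c t0)).
  apply: dv_near h2; apply: filterS hw => t [_ wt].
  have gt0 : mono m ga (w t) != 0.
    by apply: lt0r_neq0; apply: mono_gt0 => l lm g0; apply: wt => //; exact: gS.
  rewrite upd_eq mulrAC divff// mul1r addrAC subrr add0r mulKf//.
- move=> i im; rewrite /z /upd; case: (eqVneq i j) => [_|_] //; exact: xs.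
- move=> i im Si; rewrite /z /upd; case: (eqVneq i j) => [E|ij]; last exact: xS.
  by apply: zS; rewrite -E.
- move=> i im; rewrite /z; have [->|ij] := eqVneq i j.
    apply: aeW gx => t gt; rewrite upd_eq mx upd_eq mulVKf// addrCA subrr addr0.
    by rewrite mulrCA divff ?mulr1// gt_eqF.
  by apply: nearW => t; rewrite !upd_neq.
Qed.

Lemma lift_shift k x phi : An k phi -> phi pt0 = 0 -> tends k.+1 x ->
  Lift k.+1 x k.+1 xpred0 (fun w => upd w k (w k + phi w))
    (fun t => upd (x t) k (x t k - phi (x t))).
Proof.
move=> pA p0 xs.
have xk : tends k x by move=> i im; apply: xs; exact: ltnW.
have [d d0 hd] := An_dep pA.
have pu w v : cube k d w -> phi (upd w k v) = phi w.
  by move=> cw; apply/esym/hd => // i im; rewrite upd_neq// neq_ltn im.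
split=> //.
- move=> i im; rewrite /upd; case: (eqVneq i k) => [_|_]; last exact: An_coord.
  by apply: An_D; [exact: An_coord|apply: An_leq pA].
- by move=> i im; rewrite /upd; case: eqP => // _; rewrite p0 addr0.
- have [D [DA [d' d'0 hD]]] := An_diff pA.
  exists d' => // w t0 hw hdv.
  have dw i : (i < k)%N -> dv (fun t => w t i) t0.
    move=> im; have := hdv i (ltnW im).
    by under [fun t => _]funext do rewrite upd_neq ?neq_ltn ?im//.
  have [cw0 _] := nbhs_singleton hw.
  have /choice[c' hc'] : forall i, exists l, (i < k)%N -> is_derive t0 1 (fun t => w t i) l.
    move=> i; case: (ltnP i k) => im; last by exists 0.
    by have [l hl] := dv_is (dw i im); exists l.
  have dp : dv (fun t => phi (w t)) t0.
    have cw0' : cube k d' (w t0) by apply: cubeW cw0.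
    exact: is_dv (hD _ cw0' w c' t0 (fun i _ => erefl) hc').
  move=> i; rewrite ltnS leq_eqVlt => /orP[/eqP ->|im]; last exact: dw.
  apply: (dv_ext _ (dvB (hdv k (ltnSn k)) dp)) => t.
  by rewrite upd_eq addrK.
- move=> i im; rewrite /upd; case: (eqVneq i k) => [_|_]; last exact: xs.
  have h : (fun t => phi (x t)) @ U --> phi pt0 by apply: An_cvg0 pA xk.
  rewrite p0 in h.
  have : (fun t => x t k - phi (x t)) @ U --> 0 - (0 : R) by apply: cvgB (xs k (ltnSn k)) h.
  by rewrite subr0.
- move=> i im; have [->|ik] := eqVneq i k; last first.
    by apply: nearW => t; rewrite !upd_neq.
  apply: aeW (tends_cube xk d0) => t ct.
  by rewrite upd_eq upd_eq pu// subrK.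
Qed.

Lemma lift_shear k x (c : nat -> R) : tends k.+1 x ->
  Lift k.+1 x k.+1 xpred0
    (fun w i => if (i < k)%N then w i + c i * w k else w i)
    (fun t i => if (i < k)%N then x t i - c i * x t k else x t i).
Proof.
move=> xs; split=> //.
- move=> i im; case: (ltnP i k) => ik; last exact: An_coord.
  by apply: An_D; [exact: An_coord|apply: An_Z; exact: An_coord].
- by move=> i im; case: ifP => // _; rewrite mulr0 addr0.
- exists 1 => // w t0 _ hdv.
  have dk : dv (fun t => w t k) t0.
    by have := hdv k (ltnSn k); rewrite ltnn.
  move=> i im; case: (ltnP i k) => ik; last first.
    by have := hdv i im; rewrite ltnNge ik.
  apply: (dv_ext _ (dvB (hdv i im) (dvZ (c i) dk))) => t.
  by rewrite ik addrK.
- move=> i im; case: (ltnP i k) => ik; last exact: xs.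
  have : (fun t => x t i - c i * x t k) @ U --> 0 - c i * (0 : R).
    by apply: cvgB; [exact: xs|apply: cvgM; [exact: cvg_cst|exact: xs]].
  by rewrite mulr0 subr0.
- move=> i im; apply: nearW => t; case: (ltnP i k) => // ik.
  by rewrite ltnn subrK.
Qed.

Lemma lift_prod k x s p z : Lift k x s xpredT p z ->
  (fun t => x t k) @ U --> (0 : R) ->
  Lift k.+1 x s.+1 (fun i => (i < s)%N) (fun w => upd (p w) k (w s))
    (fun t => upd (z t) s (x t k)).
Proof.
move=> [A1 O1 [e1 e10 L1] T1 P1 E1] xk; split.
- move=> i im; rewrite /upd; case: (eqVneq i k) => [_|ik]; first exact: An_coord.
  by apply: (@An_leq _ s) => //; apply: A1; rewrite ltn_neqAle ik -ltnS.
- move=> i im; rewrite /upd; case: (eqVneq i k) => [//|ik].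
  by apply: O1; rewrite ltn_neqAle ik -ltnS.
- exists e1 => // w t0 hw hdv.
  have ds i : (i < s)%N -> dv (fun t => w t i) t0.
    apply: (L1 w t0).
      apply: filterS hw => t [cw hw]; split; first by apply: cubeW cw.
      by move=> l lm _; apply: hw => //; exact: ltnW.
    move=> l lm; have := hdv l (ltnW lm).
    by under [fun t => _]funext do rewrite upd_neq ?neq_ltn ?lm//.
  move=> i; rewrite ltnS leq_eqVlt => /orP[/eqP ->|im]; last exact: ds.
  by have := hdv k (ltnSn k); under [fun t => _]funext do rewrite upd_eq.
- move=> i im; rewrite /upd; case: (eqVneq i s) => [//|ik].
  by apply: T1; rewrite ltn_neqAle ik -ltnS.
- move=> i _ im; have [E|ne] := eqVneq i s; first by rewrite E ltnn in im.
  by apply: aeW (P1 i im isT) => t; rewrite upd_neq.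
- move=> i im; have [->|ik] := eqVneq i k.
    by apply: nearW => t; rewrite upd_eq upd_eq.
  have im' : (i < k)%N by rewrite ltn_neqAle ik -ltnS.
  have h1 := tends_nz T1 (An_dep (A1 i im')).
  apply: aeW (aeI h1 (E1 i im')) => t [h2 <-]; rewrite upd_neq//.
  apply/esym/h2 => l lm; by rewrite upd_neq// neq_ltn lm.
Qed.

(** Root chart: making the positive coordinates $n$-th powers turns exponents with denominator [n]
    into integers. The last coordinate, whose sign is not known, is left alone. *)
Lemma lift_root k x n : (0 < n)%N -> tends k.+1 x ->
  (forall i, (i < k)%N -> ae (fun t => 0 < x t i)) ->
  Lift k.+1 x k.+1 (fun i => (i < k)%N)
    (fun w i => if (i < k)%N then w i ^+ n else w i)
    (fun t i => if (i < k)%N then rt n (x t i) else x t i).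
Proof.
move=> n0 xs x0; split.
- move=> i im; case: (ltnP i k) => ik; last exact: An_coord.
  by apply: An_X; exact: An_coord.
- by move=> i im; case: ifP => // _; rewrite /pt0 expr0n gtn_eqF.
- exists 1 => // w t0 hw hdv i im; case: (ltnP i k) => ik; last first.
    by have := hdv i im; rewrite ltnNge ik.
  have := hdv i im; rewrite ik => h.
  have w0 : 0 < w t0 i ^+ n.
    by have [_ h2] := nbhs_singleton hw; rewrite exprn_gt0// h2.
  apply: (@dv_near _ (fun t => rt n (w t i ^+ n))); last exact: dv_rt.
  apply: filterS hw => t [_ hw].
  by rewrite Krt// hw.
- move=> i im; case: (ltnP i k) => ik; last exact: xs.
  apply/cvgrPdist_lt => e e0.
  have en : 0 < e ^+ n by rewrite exprn_gt0.
  have /cvgrPdist_lt/(_ _ en) := xs i im.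
  apply: filter_app; apply: aeW (x0 i ik) => t xt.
  rewrite !sub0r !normrN (gtr0_norm xt) gtr0_norm ?rt_gt0// -{1}(rtK n0 xt).
  by rewrite ltr_pXn2r// ?nnegrE ltW// rt_gt0.
- by move=> i im ik; apply: nearW => t; rewrite ik rt_gt0.
- move=> i im; case: (ltnP i k) => ik; last by apply: nearW.
  by apply: aeW (x0 i ik) => t; exact: rtK.
Qed.

End Lift.

(** * Multiplicity of roots of a polynomial without its second leading term *)

Section Poly.
Variable R : realType.

Lemma coef_XDc_exp (a : R) n : (('X + a%:P) ^+ n)`_n = 1 /\
  (('X + a%:P) ^+ n.+1)`_n = n.+1%:R * a.
Proof.
have deg j k : (j < k)%N -> (('X + a%:P) ^+ j)`_k = 0.
  move=> jk; rewrite nth_default// -[a]opprK polyCN size_exp_XsubC.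
  exact: jk.
have lead k : (('X + a%:P) ^+ k)`_k = 1.
  elim: k => [|k IH]; first by rewrite expr0 coef1.
  by rewrite exprSr mulrDr coefD coefMX coefMC /= IH deg// mul0r addr0.
split=> //; elim: n => [|n IH].
  by rewrite expr1 coefD coefX coefC /= add0r mul1r.
by rewrite exprSr mulrDr coefD coefMX coefMC /= IH lead -natr1; ring.
Qed.

(** A root $w_0$ of multiplicity $d+1$ would make the polynomial a multiple of $(X-w_0)^{d+1}$; the
    missing term of degree $d$ forces $w_0=0$, and then [c j0] would vanish. So the order at every
    centre is at most $d$, which is the gain from the Tschirnhausen transformation. *)
Lemma shift_order (c : nat -> R) d (u0 w0 : R) j0 : u0 != 0 -> (j0 < d)%N ->
  c j0 != 0 -> exists d' (q : {poly R}), [/\ (d' <= d)%N, q.[w0] != 0 &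
  forall y, \sum_(j < d) c j * (w0 + y) ^+ j + (w0 + y) ^+ d.+1 * u0 =
     y ^+ d' * q.[w0 + y]].
Proof.
move=> u00 jd cj0.
pose p : {poly R} := (\poly_(j < d) c j) + u0 *: 'X^(d.+1).
have pE v : p.[v] = \sum_(j < d) c j * v ^+ j + v ^+ d.+1 * u0.
  by rewrite /p hornerD horner_poly hornerZ hornerXn [u0 * _]mulrC.
have sp : size p = d.+2.
  rewrite /p addrC size_polyDl ?size_scale ?size_polyXn//.
  by apply: leq_ltn_trans (size_poly _ _) _; rewrite ltnS leqnSn.
have p0 : p != 0 by rewrite -size_poly_eq0 sp.
have [d' [q]] := multiplicity_XsubC p w0; rewrite p0 /= => qw pq.
have q0 : q != 0 by apply: contra qw => /eqP ->; rewrite root0.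
have sq : (size q + d')%N = d.+2.
  have := size_Mmonic q0 (monic_exp d' (monicXsubC w0)).
  by rewrite -pq sp size_exp_XsubC addnS /= => <-.
exists d', q; split=> //; last first.
  move=> y; rewrite -pE pq hornerM horner_exp hornerXsubC mulrC.
  by rewrite addrAC subrr add0r.
have sq0 : (0 < size q)%N by rewrite size_poly_gt0.
have dd : (d' <= d.+1)%N by rewrite -ltnS -sq -[X in (X < _)%N]add0n ltn_add2r.
move: dd; rewrite leq_eqVlt => /orP[/eqP E|//]; exfalso.
have sq1 : size q = 1%N by apply/eqP; rewrite -(eqn_add2r d') sq E add1n.
have /size_poly1P[b b0 qb] : size q == 1%N by rewrite sq1.
have pb : p = b *: ('X + (- w0)%:P) ^+ d.+1.
  by rewrite pq qb E polyCN mul_polyC.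
have [_ h2] := coef_XDc_exp (- w0) d.
have w00 : w0 = 0.
  have := congr1 (fun r : {poly R} => r`_d) pb.
  rewrite coefZ h2 /p coefD coef_poly ltnn coefZ coefXn ltn_eqF// mulr0 addr0.
  move/esym/eqP; rewrite !mulf_eq0 (negbTE b0) /= pnatr_eq0 /= oppr_eq0.
  by move/eqP.
have := congr1 (fun r : {poly R} => r`_j0) pb.
rewrite w00 oppr0 addr0 coefZ coefXn ltn_eqF; last exact: ltn_trans jd _.
rewrite mulr0 /p coefD coef_poly jd coefZ coefXn ltn_eqF; last exact: ltn_trans jd _.
by rewrite mulr0 addr0 => h; rewrite h eqxx in cj0.
Qed.

End Poly.

(** * Local monomialization along an ultrafilter *)

Section Toric.
Variables (R : realType) (T : Type) (U : set_system T).
Hypothesis UU : UltraFilter U.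
Notation pt := (nat -> R).
Implicit Types (f : pt -> R) (x z : T -> pt) (al be : nat -> nat) (c e : R).
Implicit Types (S : nat -> bool) (p : pt -> pt) (P : T -> Prop).

Let UP : ProperFilter U. Proof. exact: ultra_proper. Qed.

Notation ae := (ae U).
Notation tends := (tends U).
Notation Lift := (Lift U).

(** A function bounded along [U] converges to the supremum of the numbers that it exceeds along [U].
    Applied to a ratio of coordinates, the dichotomy tells which chart of a blow-up contains the
    germ. *)
Lemma ultra_lim (g : T -> R) :
  (exists l : R, g @ U --> l) \/ (forall M : R, ae (fun t => M < `|g t|)).
Proof.
have [[M hM]|nM] := pselect (exists M, ae (fun t => `|g t| <= M)); last first.
  right=> M; have [h|h] := ae_dec UU (fun t => M < `|g t|) => //.
  by exfalso; apply: nM; exists M; apply: aeW h => t /negP; rewrite -leNgt.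
left; pose E := [set a | ae (fun t => a < g t)].
have supE : has_sup E.
  split; first by exists (- M - 1); apply: aeW hM => t; rewrite ler_norml => /andP[]; lra.
  exists M => a Ea; have [t [h1 h2]] := ae_ex UU (aeI UU Ea hM).
  by move: h2; rewrite ler_norml => /andP[_]; lra.
exists (sup E); apply/cvgrPdist_le => e e0.
have h1 : ae (fun t => sup E - e < g t).
  have [a Ea ha] := sup_adherent e0 supE.
  by apply: aeW Ea => t; exact: lt_trans ha.
have h2 : ae (fun t => g t <= sup E + e).
  have [h|h] := ae_dec UU (fun t => sup E + e < g t); last first.
    by apply: aeW h => t /negP; rewrite -leNgt.
  have := ub_le_sup (proj2 supE) h; lra.
apply: aeW (aeI UU h1 h2) => t [h3 h4]; rewrite distrC ler_norml; lra.
Qed.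

Lemma lim0_lt (g : T -> R) e : g @ U --> (0 : R) -> 0 < e -> ae (fun t => `|g t| < e).
Proof.
by move=> /cvgrPdist_lt h /h; apply: aeW => t; rewrite sub0r normrN.
Qed.

(* Some lift uses fewer variables, so that induction on their number applies. *)
Definition Drop m x := exists s S p z, (s < m)%N /\ Lift m x s S p z.

Definition Monomializable m := forall x (I : finType) (g : I -> pt -> R), tends m x ->
  (forall i, An m (g i)) -> exists s p z,
  [/\ (s <= m)%N, Lift m x s xpredT p z & forall i, MonoZ s (fun w => g i (p w))].

(** The coordinates of the chart with fewer variables are adjoined to the family [g]: monomialized
    along with it, they meet the condition of [lift_full_comp] for composing charts. *)
Lemma drop_goal m x (I : finType) (g : I -> pt -> R) :
  (forall m', (m' < m)%N -> Monomializable m') -> Drop m x ->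
  (forall i, An m (g i)) -> exists s p z,
  [/\ (s < m)%N, Lift m x s xpredT p z & forall i, MonoZ s (fun w => g i (p w))].
Proof.
move=> H [s [S [p [z [sm L]]]]] gA.
pose g' (i : I + 'I_s) := match i with inl i => fun w => g i (p w) | inr j => fun w => w j end.
have [|s' [p' [z' [ss' L' hM]]]] := H s sm z _ g' (lift_tends L).
  case=> [i|j]; last exact: An_coord.
  by apply: (An_comp (p := fun j w => p w j) (gA i)); [exact: lift_An L|exact: lift_0 L].
exists s', (fun w => p (p' w)), z'; split.
- exact: leq_ltn_trans ss' sm.
- apply: (lift_full_comp UU L L') => i im _; exact: (hM (inr (Ordinal im))).
- by move=> i; exact: (hM (inl i)).
Qed.

Lemma drop_comp m x m1 S1 p1 z1 : (forall m', (m' < m)%N -> Monomializable m') ->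
  (m1 <= m)%N -> Lift m x m1 S1 p1 z1 -> Drop m1 z1 -> Drop m x.
Proof.
move=> H mm L D1.
have H1 m' : (m' < m1)%N -> Monomializable m' by move=> h; apply: H; apply: leq_trans mm.
have [j|s [p [z [sm L' hM]]]] := drop_goal (g := fun (j : 'I_m1) w => w j) H1 D1.
  exact: An_coord.
exists s, xpredT, (fun w => p1 (p w)), z; split; first exact: leq_trans sm mm.
by apply: (lift_full_comp UU L L') => i im _; exact: (hM (Ordinal im)).
Qed.

Lemma coord_dec m x j : tends m x -> (j < m)%N ->
  Drop m x \/ ae (fun t => x t j != 0).
Proof.
case: m => // m xs jm; have [h|h] := ae_dec UU (fun t => x t j = 0).
  have L := @lift_drop R T U UU m x j jm xs h.
  by left; exists m, xpred0; do 2!eexists; split; [exact: ltnSn|exact: L].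
by right; apply: aeW h => t /eqP.
Qed.

Lemma ae_sign (g : T -> R) : ae (fun t => g t != 0) ->
  exists2 k : R, k != 0 /\ k^-1 = k & ae (fun t => 0 < k * g t).
Proof.
move=> g0; have [h|h] := ae_dec UU (fun t => 0 < g t).
  exists 1; first by rewrite oner_neq0 invr1.
  by apply: aeW h => t; rewrite mul1r.
exists (-1); first by rewrite oppr_eq0 oner_neq0 invrN invr1.
apply: aeW (aeI UU g0 h) => t [h1 /negP h2].
by rewrite mulN1r oppr_gt0 lt_neqAle h1 leNgt.
Qed.

(** Blow-ups make $x_k$ divide the monomial [be]. For an $i$ occurring in it, either $x_i/x_k$ has a
    finite limit, so that $x_k$ divides $x_i$ in the chart and the proof ends, or $x_k=x_iw_k$ in
    the chart and one factor $x_i$ is removed from both sides, which lowers the degree of the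
    monomial. *)
Lemma toric k x be : (forall m', (m' < k.+1)%N -> Monomializable m') -> tends k.+1 x ->
  (forall i, (i < k.+1)%N -> ae (fun t => 0 < x t i)) -> be k = 0%N ->
  (fun t => mono k.+1 be (x t) / x t k) @ U --> (0 : R) ->
  Drop k.+1 x \/ exists p z h, [/\ Lift k.+1 x k.+1 xpredT p z,
    forall i, (i < k.+1)%N -> Mono1 k.+1 (fun w => p w i),
    An k.+1 h /\ h pt0 = 0 &
    nz k.+1 (fun w => mono k.+1 be (p w) = p w k * h w)].
Proof.
move=> H; have [n] := ubnP (\sum_(i < k.+1) be i).
elim: n x be => // n IH x be sn xs x0 bk bx.
(* A trivial monomial is impossible: $1/x_k$ would tend to 0 together with $x_k$. *)
have [be0|] := pselect (forall i, (i < k.+1)%N -> be i = 0%N).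
  exfalso; have h1 := lim0_lt bx ltr01; have h2 := lim0_lt (xs k (ltnSn k)) ltr01.
  have [t [[h3 h4] h5]] := ae_ex UU (aeI UU (aeI UU h1 h2) (x0 k (ltnSn k))).
  move: h3 h4; rewrite mono0// div1r normfV (gtr0_norm h5) => h3 h4.
  by rewrite invf_lt1// ltNge (ltW h4) in h3.
move=> /existsNP[i] /not_implyP[im /eqP]; rewrite -lt0n => bi.
have ik : i != k by apply: contraTneq bi => ->; rewrite bk.
pose ind (a j : nat) : nat := j == a.
have indk : ind k i = 0%N by rewrite /ind (negbTE ik).
have indi : ind i k = 0%N by rewrite /ind eq_sym (negbTE ik).
have mk w : mono k.+1 (ind k) w = w k :> R by apply: mono1.
have mi w : mono k.+1 (ind i) w = w i :> R by apply: mono1.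
have bs w : mono k.+1 be w = w i ^+ be i * mono k.+1 be (upd w i 1).
  rewrite /mono (bigD1 (Ordinal im)) //= [in RHS](bigD1 (Ordinal im)) //=.
  rewrite upd_eq expr1n mul1r; congr (_ * _); apply: eq_bigr => j ji.
  by rewrite upd_neq.
have [[l rl]|rinf] := ultra_lim (fun t => x t i / x t k).
  have T1 c : c != 0 -> (fun t => c^-1 * (x t i / mono k.+1 (ind k) (x t) - l)) @ U --> (0 : R).
    move=> c0; have -> : (fun t => c^-1 * (x t i / mono k.+1 (ind k) (x t) - l)) =
       (fun t => c^-1 * (x t i / x t k - l)) by apply/funext => t; rewrite mk.
    have : (fun t => c^-1 * (x t i / x t k - l)) @ U --> c^-1 * (l - l).
      by apply: cvgM; [exact: cvg_cst|apply: cvgB => //; exact: cvg_cst].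
    by rewrite subrr mulr0.
  have mc : mono k.+1 (ind k) pt0 * l = 0 by rewrite mk mul0r.
  (* Here the sign of the new coordinate [i] is left open. If it vanishes along [U], a variable is
     dropped; otherwise its sign [s] is built into the final lift [L2]. *)
  have L1 : Lift k.+1 x k.+1 (fun j => j != i)
      (fun w => upd w i (mono k.+1 (ind k) w * (l + 1 * w i)))
      (fun t => upd (x t) i (1^-1 * (x t i / mono k.+1 (ind k) (x t) - l))).
    apply: (lift_twist UU) => //.
    - by move=> j jm; rewrite /ind; case: (eqVneq j k) => // -> _; rewrite eq_sym.
    - by move=> j jm _ _; exact: x0.
    - exact: T1 _ (oner_neq0 _).
    - by rewrite eqxx.
  have [D1|z0] := coord_dec (lift_tends L1) im.
    by left; apply: drop_comp H _ L1 D1.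
  have z0' : ae (fun t => x t i / x t k - l != 0).
    by apply: aeW z0 => t; rewrite upd_eq mk invr1 mul1r.
  have [s [s0 sV] zs] := ae_sign z0'.
  pose p (w : pt) := upd w i (mono k.+1 (ind k) w * (l + s * w i)).
  pose z t := upd (x t) i (s^-1 * (x t i / mono k.+1 (ind k) (x t) - l)).
  right; have L2 : Lift k.+1 x k.+1 xpredT p z.
    apply: (lift_twist UU) => //.
    - by move=> j jm _ _; exact: x0.
    - exact: T1 _ s0.
    - by move=> _; apply: aeW zs => t; rewrite mk sV.
  pose h (w : pt) := w k ^+ (be i).-1 * (l + s * w i) ^+ be i * mono k.+1 be (upd w i 1).
  have pk w : p w k = w k by rewrite /p upd_neq// eq_sym.
  have hp w : mono k.+1 be (p w) = p w k * h w.
    rewrite bs {1}/p upd_eq mk exprMn pk /h.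
    have -> : mono k.+1 be (upd (p w) i 1) = mono k.+1 be (upd w i 1).
      by congr mono; apply/funext => j; rewrite /p /upd; case: eqP.
    by rewrite -{1}(prednK bi) exprS; ring.
  have hA : An k.+1 h.
    apply: An_M; [apply: An_M|].
    - by apply: An_X; exact: An_coord.
    - apply: An_X; apply: An_D; [exact: An_cst|apply: An_Z; exact: An_coord].
    - apply: An_prod => j _; apply: An_X; rewrite /upd.
      case: (eqVneq (nat_of_ord j) i) => _; [exact: An_cst|exact: An_coord].
  exists p, z, h; split=> //.
  - move=> j jm; rewrite /p; have [->|ji] := eqVneq j i; last first.
      apply: Mono1_ext (Mono1_coord R jm); apply: nzT => w; by rewrite upd_neq.
    apply: (@Mono1_ext _ _ (fun w => w k * (l + s * w i))).
      by apply: nzT => w; rewrite upd_eq mk.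
    apply: Mono1_M; first exact: Mono1_coord.
    have [->|l0] := eqVneq l 0.
      apply: (@Mono1_ext _ _ (fun w => s * w i)); first by apply: nzT => w; rewrite add0r.
      by apply: Mono1_Z => //; exact: Mono1_coord.
    apply: Mono1_unit; last by rewrite mulr0 addr0.
    by apply: An_D; [exact: An_cst|apply: An_Z; exact: An_coord].
  - split=> //.
    (* Along the germ [h] is the quotient whose limit is assumed to be 0. *)
    have c1 : (fun t => h (z t)) @ U --> h pt0 by apply: An_cvg0 hA (lift_tends L2).
    have c2 : (fun t => h (z t)) @ U --> (0 : R).
      apply: cvg_trans bx; apply: near_eq_cvg.
      have e1 := ae_all UU (lift_eq L2).
      apply: aeW (aeI UU e1 (x0 k (ltnSn k))) => t [e2 xk].
      have -> : mono k.+1 be (x t) = mono k.+1 be (p (z t)).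
        by apply: mono_ext => // j jm _; rewrite e2.
      by rewrite hp e2// mulrAC divff ?mul1r// gt_eqF.
    by apply: cvg_unique c1 c2; exact: norm_hausdorff.
  - by apply: nzT.
have inv0 : (fun t => x t k / x t i) @ U --> (0 : R).
  apply/cvgrPdist_lt => e e0; have := rinf e^-1.
  apply: filter_app; apply: aeW (aeI UU (x0 i im) (x0 k (ltnSn k))) => t [xi xk].
  rewrite sub0r normrN !normrM !normfV (gtr0_norm xi) (gtr0_norm xk) => h.
  by rewrite -[e]invrK -[X in X < _]invf_div ltf_pV2// posrE ?divr_gt0 ?invr_gt0.
have T2 : (fun t => 1^-1 * (x t k / mono k.+1 (ind i) (x t) - 0)) @ U --> (0 : R).
  have -> // : (fun t => 1^-1 * (x t k / mono k.+1 (ind i) (x t) - 0)) =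
     (fun t => x t k / x t i).
  by apply/funext => t; rewrite mi invr1 mul1r subr0.
have mc : mono k.+1 (ind i) pt0 * (0 : R) = 0 by rewrite mulr0.
pose p1 (w : pt) := upd w k (mono k.+1 (ind i) w * (0 + 1 * w k)).
pose z1 t := upd (x t) k (1^-1 * (x t k / mono k.+1 (ind i) (x t) - 0)).
have L1 : Lift k.+1 x k.+1 xpredT p1 z1.
  apply: (lift_twist UU) => //.
    by move=> j jm _ _; exact: x0.
  move=> _; apply: aeW (aeI UU (x0 i im) (x0 k (ltnSn k))) => t [xi xk].
  by rewrite mi invr1 mul1r subr0 divr_gt0.
pose be1 j := if j == i then (be i).-1 else be j.
have be1E w : mono k.+1 be w = w i * mono k.+1 be1 w :> R.
  rewrite -[in RHS](mi w) -monoD; apply: mono_ext => // j jm.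
  by rewrite /be1 /ind; case: eqP => // ->; rewrite add1n prednK.
have sbe : (\sum_(j < k.+1) be1 j < n)%N.
  rewrite ltnS in sn; apply: leq_trans sn; rewrite (bigD1 (Ordinal im)) //=.
  rewrite [in leqRHS](bigD1 (Ordinal im)) //=.
  rewrite /be1 eqxx -addSn prednK// leq_add2l leq_eqVlt; apply/orP; left; apply/eqP.
  by apply: eq_bigr => j ji; case: eqP => // jj; case/eqP: ji; apply: val_inj.
have zi t : z1 t i = x t i by rewrite /z1 upd_neq.
have zk t : z1 t k = x t k / x t i.
  by rewrite /z1 upd_eq mi invr1 mul1r subr0.
have [|||D1|[p2 [z2 [h [L2 M2 [hA h0] hh]]]]] := IH z1 be1 sbe (lift_tends L1).
- by move=> j jm; exact: lift_pos L1 _ jm _.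
- by rewrite /be1 eq_sym (negbTE ik).
- apply: cvg_trans bx; apply: near_eq_cvg.
  apply: aeW (aeI UU (x0 i im) (x0 k (ltnSn k))) => t [xi xk].
  rewrite zk; have -> : mono k.+1 be1 (z1 t) = mono k.+1 be1 (x t).
    apply: mono_ext => // j jm; rewrite /be1 /z1; have [->|jk] := eqVneq j k.
      by rewrite eq_sym (negbTE ik) bk.
    by move=> _; rewrite upd_neq.
  by rewrite be1E; field; rewrite !gt_eqF.
- by left; apply: drop_comp H _ L1 D1.
right; exists (fun w => p1 (p2 w)), z2, h.
have pk w : p1 w k = w i * w k by rewrite /p1 upd_eq mi add0r mul1r.
split=> //.
- by apply: (lift_full_comp UU L1 L2) => j jm _; right; exact: M2.
- move=> j jm; rewrite /p1; have [->|jk] := eqVneq j k.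
    apply: (@Mono1_ext _ _ (fun w => p2 w i * p2 w k)).
      by apply: nzT => w; rewrite -pk.
    by apply: Mono1_M; exact: M2.
  by apply: Mono1_ext (M2 j jm); apply: nzT => w; rewrite upd_neq.
- apply: nzW hh => w hw; rewrite pk -mulrA -hw -be1E.
  apply: mono_ext => // j jm; rewrite /p1; have [->|jk] := eqVneq j k.
    by rewrite bk.
  by move=> _; rewrite upd_neq.
Qed.

End Toric.

Import zify.

(** * Lowering the order in the last variable, and the monomialization theorem *)

Section Monomialize.
Variables (R : realType) (T : Type) (U : set_system T).
Hypothesis UU : UltraFilter U.
Notation pt := (nat -> R).
Implicit Types (f g : pt -> R) (x z : T -> pt) (al be : nat -> nat) (c e : R).
Implicit Types (S : nat -> bool) (p : pt -> pt) (P : T -> Prop).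

Let UP : ProperFilter U. Proof. exact: ultra_proper. Qed.

Notation ae := (ae U).
Notation tends := (tends U).
Notation Lift := (Lift U).
Notation Drop := (Drop U).
Notation Monomializable := (@Monomializable R T U).

Lemma An_comp' m s f p : An m f -> (forall i, (i < m)%N -> An s (fun w => p w i)) ->
  (forall i, (i < m)%N -> p pt0 i = 0) -> An s (fun w => f (p w)).
Proof. by move=> fA pA p0; exact: (@An_comp R m f s (fun j w => p w j) fA pA p0). Qed.

Lemma An_comp0 m f p : An m f -> (forall i, (i < m)%N -> p pt0 i = 0) ->
  f (p pt0) = f pt0 :> R.
Proof.
move=> fA p0; have [d d0 h] := An_dep fA; apply/esym/h; first exact: cube0 (ltW d0).
by move=> i im; rewrite p0.
Qed.

Lemma nz_coord m (P : pt -> Prop) k : (m <= k)%N -> nz m P -> @nz R k P.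
Proof. by move=> mk [d d0 h]; exists d => // w cw; apply: h; apply: cubeW cw. Qed.

Lemma mono_recr k be (w : pt) : be k = 0%N -> mono k.+1 be w = mono k be w.
Proof. by move=> bk; rewrite /mono big_ord_recr /= bk expr0 mulr1. Qed.

Lemma cvg_mono_pos k be z : tends k z ->
  (forall i, (i < k)%N -> ae (fun t => 0 < z t i)) -> ae (fun t => 0 < mono k be (z t)).
Proof.
move=> zs z0; apply: aeW (ae_all UU z0) => t h; apply: mono_gt0 => i im _; exact: h.
Qed.

(** Coordinates below [k] must pull back to monomials, because monomials in them are taken out of
    [f] before a recursive call; the coordinate $x_k$ is exempt, as it gets translated. *)
Definition Reducible k x f := Drop k.+1 x \/ exists p z, [/\ Lift k.+1 x k.+1 xpredT p z,
  Mono1 k.+1 (fun w => f (p w)) & forall i, (i < k)%N -> Mono1 k.+1 (fun w => p w i)].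

Lemma Reducible_ext k x f g : nz k.+1 (fun w => f w = g w) -> Reducible k x g -> Reducible k x f.
Proof.
move=> fg [D|[p [z [L M C]]]]; [by left|right; exists p, z; split=> //].
apply: Mono1_ext M; have := nz_comp (lift_An L) (lift_0 L) fg.
by apply: nzW => w ->.
Qed.

Lemma Reducible_comp k x f S p z : (forall m', (m' < k.+1)%N -> Monomializable m') ->
  Lift k.+1 x k.+1 S p z -> (forall i, (i < k.+1)%N -> S i -> (i < k)%N) ->
  (forall i, (i < k)%N -> Mono1 k (fun w => p w i)) ->
  Reducible k z (fun w => f (p w)) -> Reducible k x f.
Proof.
move=> H L Sk pM [D|[p' [z' [L' M C]]]]; first by left; exact: drop_comp H _ L D.
right; exists (fun w => p (p' w)), z'; split=> //.
  by apply: (lift_full_comp UU L L') => i im Si; right; apply: C; exact: Sk.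
move=> i im; apply: (Mono1_comp (f := fun w => p w i) (pM i im)) => j jm; first exact: C.
by apply: (lift_0 L'); exact: ltnW.
Qed.

Lemma Reducible_sign k x f : (forall m', (m' < k.+1)%N -> Monomializable m') -> tends k.+1 x ->
  (forall i, (i < k)%N -> ae (fun t => 0 < x t i)) ->
  (forall s : R, s != 0 -> forall z, tends k.+1 z ->
     (forall i, (i < k.+1)%N -> ae (fun t => 0 < z t i)) ->
     (forall t, z t = upd (x t) k (s * x t k)) ->
     Reducible k z (fun w => f (upd w k (s * w k)))) ->
  Reducible k x f.
Proof.
move=> H xs x0 h; have [|xk] := coord_dec UU xs (ltnSn k); first by left.
have [s [s0 sV] sx] := ae_sign UU xk.
pose c (i : nat) : R := if i == k then s else 1.
have c0 i : c i != 0 by rewrite /c; case: ifP => _; [exact: s0|exact: oner_neq0].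
have cE (w : pt) : (fun i => c i * w i) = upd w k (s * w k).
  by apply/funext => i; rewrite /upd /c; case: eqP => [->|_] //; rewrite mul1r.
have cV i : (c i)^-1 = c i by rewrite /c; case: eqP => // _; exact: invr1.
have cx i : (i < k.+1)%N -> ae (fun t => 0 < c i * x t i).
  move=> im; rewrite /c; have [->//|ik] := eqVneq i k.
  under [fun t => _]funext do rewrite mul1r.
  by apply: x0; rewrite ltn_neqAle ik.
have L := lift_sign UU (fun i => (i < k)%N) c0 xs cx.
have E : (fun w : pt => (fun i => (c i)^-1 * w i)) = (fun w => upd w k (s * w k)).
  by apply/funext => w; rewrite -cE; apply/funext => i; rewrite cV.
rewrite E in L.
apply: (Reducible_comp H L) => // [i ik|].
  apply: (Mono1_ext (f := fun w => w i)); last exact: Mono1_coord.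
  by apply: nzT => w; rewrite upd_neq// neq_ltn ik.
apply: h => //; first exact: lift_tends L.
Qed.

Lemma upd_dep k f : An k f ->
  nz k (fun w => forall v, f (upd w k v) = f w).
Proof.
move=> fA; apply: nzW (An_dep fA) => w h v; apply/esym/h => i im.
by rewrite upd_neq// neq_ltn im.
Qed.

(** Up to the coefficients [C j] and [u], [f] is homogeneous of degree $d+1$ in $x_k$ and the
    monomial $x^{be}$, so these two are compared. Finite ratio: $x_k=x^{be}(w_0+w_k)$, and the
    quotient has order at most $d$ by [shift_order]. Infinite ratio: [toric] gives $x^{be}=x_kh$
    with $h(0)=0$, and $f/x_k^{d+1}$ is a unit. *)
Lemma Reducible_weighted k d x f be (C : nat -> pt -> R) (u : pt -> R) j0 :
  (forall m', (m' < k.+1)%N -> Monomializable m') ->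
  tends k.+1 x -> (forall i, (i < k)%N -> ae (fun t => 0 < x t i)) ->
  be k = 0%N -> (exists2 i, (i < k)%N & (0 < be i)%N) ->
  (forall j, An k (C j)) -> (j0 < d)%N -> C j0 pt0 != 0 ->
  An k.+1 u -> u pt0 != 0 ->
  nz k.+1 (fun w => f w = \sum_(j < d) mono k.+1 be w ^+ (d.+1 - j) * C j w * w k ^+ j
     + w k ^+ d.+1 * u w) ->
  (forall d' z g, (d' <= d)%N -> tends k.+1 z -> An k.+1 g -> ordlast k d' g ->
     Reducible k z g) ->
  Reducible k x f.
Proof.
move=> H xs x0 bk [i0 i0k bi0] CA jd Cj0 uA u0 fE IH.
have i0k' : (i0 < k.+1)%N by exact: ltnW.
have CA' j : An k.+1 (C j) by apply: An_leq (CA j).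
have mu w v : mono k.+1 be (upd w k v) = mono k.+1 be w :> R.
  apply: mono_ext => // i im b0; rewrite upd_neq//.
  by apply: contraTneq b0 => ->; rewrite bk.
have mb0 : mono k.+1 be pt0 = 0 :> R by apply: (mono_eq0 i0k' bi0).
have mx : ae (fun t => 0 < mono k.+1 be (x t)).
  have := cvg_mono_pos be (fun i im => xs i (ltnW im)) x0.
  by apply: aeW => t; rewrite mono_recr.
have Cdep : nz k.+1 (fun w => forall j : nat, (j < d)%N -> forall v, C j (upd w k v) = C j w).
  by apply: nz_all => j _; apply: nz_coord (leqnSn k) (upd_dep (CA j)).
have [[w0 xw]|xinf] := ultra_lim UU (fun t => x t k / mono k.+1 be (x t)).
  pose p (w : pt) := upd w k (mono k.+1 be w * (w0 + 1 * w k)).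
  have T1 : (fun t => 1^-1 * (x t k / mono k.+1 be (x t) - w0)) @ U --> (0 : R).
    have : (fun t => 1^-1 * (x t k / mono k.+1 be (x t) - w0)) @ U --> 1^-1 * (w0 - w0).
      by apply: cvgM; [exact: cvg_cst|apply: cvgB => //; exact: cvg_cst].
    by rewrite subrr mulr0.
  have L : Lift k.+1 x k.+1 (fun i => (i < k)%N) p
      (fun t => upd (x t) k (1^-1 * (x t k / mono k.+1 be (x t) - w0))).
    apply: (lift_twist UU) => //.
    - by rewrite mb0 mul0r.
    - move=> i; rewrite ltnS leq_eqVlt => /orP[/eqP ->|//].
      by rewrite bk.
    - by move=> i _ _ ik; exact: x0.
    - by rewrite ltnn.
  apply: (Reducible_comp H L) => // [i ik|].
    apply: (Mono1_ext (f := fun w => w i)); last exact: Mono1_coord.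
    by apply: nzT => w; rewrite /p upd_neq// neq_ltn ik.
  pose G (w : pt) := \sum_(j < d) C j w * (w0 + w k) ^+ j
                     + (w0 + w k) ^+ d.+1 * u (p w).
  have upA : An k.+1 (fun w => u (p w)).
    by apply: (An_comp' uA); [exact: lift_An L|exact: lift_0 L].
  have wA : An k.+1 (fun w : pt => w0 + w k).
    by apply: An_D; [exact: An_cst|exact: An_coord].
  have GA : An k.+1 G.
    apply: An_D; last by apply: An_M upA; apply: An_X.
    by apply: An_sum => j _; apply: An_M (CA' j) _; exact: An_X.
  have fG : nz k.+1 (fun w => f (p w) = mono k.+1 be w ^+ d.+1 * G w).
    apply: nzW (nzI (nz_comp (lift_An L) (lift_0 L) fE) Cdep) => w [-> Cw].
    rewrite /G mulrDr mulr_sumr {1 2 3 4}/p mu upd_eq mul1r; congr (_ + _).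
      apply: eq_bigr => j _; rewrite Cw//.
      have E : mono k.+1 be w ^+ d.+1 = mono k.+1 be w ^+ (d.+1 - j) * mono k.+1 be w ^+ j.
        by rewrite -exprD subnK// ltnW// ltnS ltnW.
      by rewrite E exprMn; ring.
    by rewrite exprMn; ring.
  (* On the last axis $x^{be}$ vanishes, so [C j] and [u] take their values at 0 and [G] is exactly
     the polynomial of [shift_order]. *)
  have [d' [q [dd q0 hq]]] :=
    @shift_order R (fun j => C j pt0) d (u pt0) w0 j0 u0 jd Cj0.
  have oG : ordlast k d' G.
    have [e e0 he] := Cdep.
    exists (fun y => q.[w0 + y]), q.[w0], e => //; split=> // [y y0 ye|e' e'0].
      rewrite -hq /G upd_eq; congr (_ + _ * _).
        apply: eq_bigr => j _; congr (_ * _); apply: he => //.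
        exact: cube0 (ltW e0).
      congr u; apply/funext => i; rewrite /p /upd; case: eqP => // _.
      have -> : mono k.+1 be (fun j => if j == k then y else pt0 j) = 0 by rewrite (mu pt0 y).
      by rewrite mul0r.
    have qc : {for w0, continuous (fun y => q.[y])} by exact: continuous_horner.
    have c1 : (fun y => w0 + y) @ (0 : R) --> w0 + 0.
      by apply: cvgD; [exact: cvg_cst|exact: cvg_id].
    rewrite addr0 in c1.
    have : (fun y => q.[w0 + y]) @ (0 : R) --> q.[w0] by exact: (cvg_comp _ _ c1 qc).
    move=> /cvgrPdist_le/(_ _ e'0) /nbhs_ballP[d1 /= d10 hd1].
    exists d1 => // y y0 yd; rewrite distrC; apply: hd1.
    by rewrite /ball /= sub0r normrN gtr0_norm.
  have [D|[p' [z' [L' M C']]]] := IH d' _ _ dd (lift_tends L) GA oG; first by left.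
  right; exists p', z'; split=> //.
  apply: (@Mono1_ext _ _ (fun w => mono k be (p' w) ^+ d.+1 * G (p' w))).
    apply: nzW (nz_comp (lift_An L') (lift_0 L') fG) => w ->.
    by rewrite mono_recr.
  apply: Mono1_M M; apply: Mono1_X.
  by apply: (@Mono1_prod R k.+1 k (fun i w => p' w i ^+ be i)) => i ik; apply: Mono1_X; exact: C'.
apply: (Reducible_sign H xs x0) => s s0 z zs z0 zE.
have zk t : z t k = s * x t k by rewrite zE upd_eq.
have T1 : (fun t => mono k.+1 be (z t) / z t k) @ U --> (0 : R).
  apply/cvgrPdist_lt => e e0; have := xinf (e^-1 / `|s|).
  apply: filter_app; apply: aeW (aeI UU mx (z0 k (ltnSn k))) => t [xi zp] h.
  have n0 : 0 < `|s| by rewrite normr_gt0.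
  have xk0 : 0 < `|x t k|.
    by rewrite normr_gt0; apply: contraTneq zp => h0; rewrite zk h0 mulr0 ltxx.
  rewrite sub0r normrN zE mu upd_eq !normrM normfV (gtr0_norm xi) normrM.
  rewrite normrM normfV (gtr0_norm xi) in h.
  rewrite ltr_pdivrMr ?mulr_gt0//.
  move: h; rewrite ltr_pdivrMr// mulrAC ltr_pdivlMr//.
  by rewrite ltr_pdivrMl// [`|x t k| * _]mulrC.
have [D|[p [z' [h [L M [hA h0] hE]]]]] := toric UU H zs z0 bk T1; first by left.
right; exists p, z'; split=> //; last by move=> i ik; apply: M; exact: ltnW.
(* The terms with $j<d$ carry a positive power of [h], which vanishes at 0; what remains there is
   [s ^+ d.+1 * u pt0]. *)
pose V w := \sum_(j < d) h w ^+ (d.+1 - j) * C j (p w) * s ^+ j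
            + s ^+ d.+1 * u (upd (p w) k (s * p w k)).
have pA := lift_An L; have p0 := lift_0 L.
have qA i : (i < k.+1)%N -> An k.+1 (fun w => upd (p w) k (s * p w k) i).
  move=> im; rewrite /upd; case: eqP => _; last exact: pA.
  by apply: An_Z; exact: pA.
have q0 i : (i < k.+1)%N -> upd (p pt0) k (s * p pt0 k) i = 0.
  by move=> im; rewrite /upd; case: eqP => _; rewrite !p0// mulr0.
have VA : An k.+1 V.
  apply: An_D; last by apply: An_Z; exact: (An_comp' uA qA q0).
  apply: An_sum => j _; apply: An_M (An_cst _ _); apply: An_M; first exact: An_X.
  exact: An_comp' (CA' j) pA p0.
apply: (@Mono1_ext _ _ (fun w => p w k ^+ d.+1 * V w)).
  apply: nzW (nzI (nzI (nz_comp pA p0 Cdep) (nz_comp qA q0 fE)) hE) => w [[Cw ->] hw].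
  rewrite /V mulrDr mulr_sumr mu upd_eq hw; congr (_ + _); last by rewrite exprMn; ring.
  apply: eq_bigr => j _; rewrite Cw//.
  have E : p w k ^+ d.+1 = p w k ^+ (d.+1 - j) * p w k ^+ j.
    by rewrite -exprD subnK// ltnW// ltnS ltnW.
  by rewrite E !exprMn; ring.
apply: Mono1_M; first by apply: Mono1_X; exact: M.
apply: Mono1_unit VA _; rewrite /V big1 ?add0r.
  rewrite mulf_neq0 ?expf_neq0// (_ : u _ = u pt0)//.
  exact: (An_comp0 (p := fun w => upd (p w) k (s * p w k)) uA q0).
move=> j _; rewrite h0 expr0n subn_eq0 leqNgt ltnS ltnW//= !mul0r//.
Qed.

Lemma lift_id m x S : tends m x ->
  (forall i, (i < m)%N -> S i -> ae (fun t => 0 < x t i)) -> Lift m x m S id x.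
Proof.
move=> xs xS; split=> //.
- by move=> i im; exact: An_coord.
- by exists 1 => // w t0 _ hd.
- by move=> i im; apply: nearW.
Qed.

(** The witness is 0 on the coordinates in [Z] and a small [d] elsewhere, which kills the first
    monomial but not the second. *)
Lemma mono_vanish s (A B : nat -> nat) (a b : pt -> R) (Z : nat -> bool) (P : pt -> Prop) :
  An s b -> b pt0 != 0 -> nz s P ->
  (exists i, [/\ (i < s)%N, Z i & (0 < A i)%N]) ->
  (forall i, (i < s)%N -> Z i -> B i = 0%N) ->
  exists w, [/\ P w, forall i, Z i -> w i = 0 &
    mono s A w * a w - mono s B w * b w != 0].
Proof.
move=> bA b0 hP [i [im Zi Ai]] ZB.
have [d d0 h] := nzI hP (An_neq0 bA b0).
pose w i := if Z i then 0 else d : R.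
have cw : cube s d w.
  by move=> j _; rewrite /w; case: ifP => _; rewrite ?normr0 ?(ltW d0)// gtr0_norm.
have [Pw bw] := h w cw; exists w; split=> // [j Zj|]; first by rewrite /w Zj.
rewrite (mono_eq0 im Ai); last by rewrite /w Zi.
rewrite mul0r sub0r oppr_eq0 mulf_neq0//.
  apply: lt0r_neq0; apply: mono_gt0 => j jm Bj; rewrite /w; case: ifP => // Zj.
  by rewrite ZB in Bj.
by rewrite -normr_gt0; apply: lt_le_trans bw; rewrite divr_gt0// normr_gt0.
Qed.

(* If neither monomial divides the other, then after division by their gcd the
   difference vanishes at 0 but on no coordinate hyperplane. *)
Lemma mono_comparable s (A B : nat -> nat) (a b : pt -> R) :
  An s a -> An s b -> a pt0 != 0 -> b pt0 != 0 ->
  MonoZ s (fun w => mono s A w * a w - mono s B w * b w) ->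
  (forall i, (i < s)%N -> (A i <= B i)%N) \/ (forall i, (i < s)%N -> (B i <= A i)%N).
Proof.
move=> aA bA a0 b0 hM.
have [|/existsNP[i] /not_implyP[im /negP]] :=
  pselect (forall i, (i < s)%N -> (A i <= B i)%N); first by left.
rewrite -ltnNge => ABi.
have [|/existsNP[j] /not_implyP[jm /negP]] :=
  pselect (forall i, (i < s)%N -> (B i <= A i)%N); first by right.
rewrite -ltnNge => ABj; exfalso.
pose A' l := (A l - B l)%N; pose B' l := (B l - A l)%N; pose M l := minn (A l) (B l).
pose D w := mono s A' w * a w - mono s B' w * b w.
have DA : An s D by apply: An_B; apply: An_M => //; exact: An_mono.
have DE w : mono s A w * a w - mono s B w * b w = D w * mono s M w.
  have -> : mono s A w = mono s A' w * mono s M w.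
    by rewrite -monoD; apply: mono_ext => // l _; rewrite /A' /M; lia.
  have -> : mono s B w = mono s B' w * mono s M w.
    by rewrite -monoD; apply: mono_ext => // l _; rewrite /B' /M; lia.
  by rewrite /D; ring.
have Ai : (0 < A' i)%N by rewrite subn_gt0.
have Bi : B' i = 0%N by apply/eqP; rewrite subn_eq0 ltnW.
have Bj : (0 < B' j)%N by rewrite subn_gt0.
have {}hM : MonoZ s (fun w => D w * mono s M w).
  by case: hM => h; [left; apply: nzW h => w; rewrite DE|
                     right; apply: Mono1_ext h; apply: nzT => w; rewrite DE].
have hD : MonoZ s D.
  case: hM => h; last by right; exact: Mono1_factor DA (@An_mono R s M) h.
  left; case: (An_domain DA (@An_mono R s M) h) => // -[d d0 hM].
  have cd : cube s d (fun=> d) by move=> l _; rewrite gtr0_norm.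
  have : 0 < mono s M (fun=> d) by apply: mono_gt0.
  by rewrite hM// ltxx.
case: hD => [h|[al [u [uA u0 Du]]]].
  have [||w [/= Dw _]] := @mono_vanish s A' B' a b (fun l => l == i) _ bA b0 h.
  - by exists i; split.
  - by move=> l _ /eqP ->.
  by rewrite -/(D w) Dw eqxx.
have D0 : D pt0 = 0.
  by rewrite /D (mono_eq0 im Ai)// (mono_eq0 jm Bj)// !mul0r subrr.
have [l lm al0] : exists2 l, (l < s)%N & (0 < al l)%N.
  apply: contrapT => na; have [d d0 h] := Du.
  have := h pt0 (cube0 (ltW d0)); rewrite D0 mono0 ?mul1r => [E|l lm].
    by rewrite -E eqxx in u0.
  by apply: contrapT => /eqP; rewrite -lt0n => al0; apply: na; exists l.
have bad w : D w = mono s al w * u w -> w l = 0 -> D w = 0.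
  by move=> -> wl; rewrite (mono_eq0 lm al0 wl) mul0r.
(* [D] would vanish on $z_l=0$. The test point depends on whether [l] occurs in the first monomial,
   in the second, or in neither; in the last case coordinate [i] is made zero as well. *)
have [Al|Al] := posnP (A' l); last first.
  have Bl : B' l = 0%N by rewrite /B' /A' in Al *; lia.
  have [||w [/= Dw wl]] := @mono_vanish s A' B' a b (fun i => i == l) _ bA b0 Du.
  - by exists l; split.
  - by move=> i' _ /eqP ->.
  by rewrite -/(D w) bad ?eqxx// wl.
have [Bl|Bl] := posnP (B' l); last first.
  have [||w [/= Dw wl]] := @mono_vanish s B' A' b a (fun i => i == l) _ aA a0 Du.
  - by exists l; split.
  - by move=> i' _ /eqP ->.
  rewrite -opprB -/(D w) bad ?oppr0 ?eqxx// wl//.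
have [||w [/= Dw wl]] := @mono_vanish s A' B' a b (fun l' => (l' == i) || (l' == l)) _ bA b0 Du.
- by exists i; rewrite eqxx.
- by move=> i' _ /orP[] /eqP ->.
by rewrite -/(D w) bad ?eqxx// wl// eqxx orbT.
Qed.

(** After the Tschirnhausen transformation the coefficients $F_j$, $j<d$, are monomialized in [k]
    variables together with differences of suitable powers. These powers become comparable; after
    roots of the coordinates the smallest $F_j^{1/(d+1-j)}$ is a monomial up to a unit, and
    [Reducible_weighted] ends the proof or lowers the order. *)
Lemma Reducible_ordlast k : (forall m', (m' < k.+1)%N -> Monomializable m') ->
  forall d x f, tends k.+1 x -> An k.+1 f -> ordlast k d f -> Reducible k x f.
Proof.
move=> H; elim/ltn_ind => d IH x f xs fA fo.
have [x0|] := pselect (forall i, (i < k.+1)%N -> ae (fun t => x t i != 0)); last first.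
  move=> /existsNP[i] /not_implyP[im xi].
  by have [|] := coord_dec UU xs im; [left|].
case: d IH fo => [|d] IH fo.
  have f0 : f pt0 != 0.
    have [v [v0 [d0 d00 [v00 fv vv]]]] := fo.
    apply/eqP => f0; have e0 : 0 < `|v0| / 4 by rewrite divr_gt0// normr_gt0.
    have [d1 d10 h1] := An_cts fA e0.
    have [d2 d20 h2] := vv _ e0.
    pose y := Num.min d0 (Num.min d1 d2) / 2.
    have ym : 0 < Num.min d0 (Num.min d1 d2) by rewrite !lt_min d00 d10.
    have y0 : 0 < y by rewrite divr_gt0.
    have yl : y < Num.min d0 (Num.min d1 d2) by rewrite ltr_pdivrMr// mulr2n mulrDr mulr1 ltrDl.
    move: yl; rewrite !lt_min => /and3P[yd0 yd1 yd2].
    have := h1 (upd pt0 k y); rewrite f0 subr0 fv// expr0 mul1r.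
    have cu : cube k.+1 d1 (upd pt0 k y).
      by apply: cube_upd; [exact: cube0 (ltW d10)|rewrite gtr0_norm// ltW].
    move=> /(_ cu) h3; have := h2 y y0 yd2.
    have := ler_normD (v0 - v y) (v y); rewrite subrK distrC.
    have : 0 < `|v0| by rewrite normr_gt0.
    by lra.
  have /choice[c hc] : forall i, exists c, c != 0 /\
      ((i < k.+1)%N -> ae (fun t => 0 < c * x t i)).
    move=> i; have [im|im] := ltnP i k.+1; last by exists 1; rewrite oner_neq0.
    by have [s [s0 _] sx] := ae_sign UU (x0 i im); exists s.
  right; have L := lift_sign UU xpredT (fun i => proj1 (hc i)) xs (fun i => proj2 (hc i)).
  have M i : (i < k.+1)%N -> Mono1 k.+1 (fun w : pt => (c i)^-1 * w i).
    by move=> im; apply: Mono1_Z; [rewrite invr_eq0; case: (hc i)|exact: Mono1_coord].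
  do 2!eexists; split; [exact: L| |by move=> i ik; apply: M; exact: ltnW].
  by apply: (Mono1_comp (Mono1_unit fA f0)) => // i _; rewrite mulr0.
have [phi [F [u [[phA ph0] FA [uA u0] F0 fE]]]] := An_tschirnhausen fA fo.
have L1 := lift_shift UU phA ph0 xs.
apply: (Reducible_comp H L1) => // [i ik|].
  apply: (Mono1_ext (f := fun w => w i)); last exact: Mono1_coord.
  by apply: nzT => w; rewrite upd_neq// neq_ltn ik.
pose z1 t := upd (x t) k (x t k - phi (x t)); have zs : tends k.+1 z1 := lift_tends L1.
rewrite -[X in Reducible _ X _]/z1.
have zs' : tends k z1 by move=> i ik; apply: zs; exact: ltnW.
apply: (Reducible_ext fE).
(* $F_j$ has weight $d+1-j$, so its power [e j] has the common weight $(d+1)!$. *)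
pose e j := ((d.+1)`! %/ (d.+1 - j))%N.
have eE j : (j < d)%N -> (e j * (d.+1 - j) = (d.+1)`!)%N.
  by move=> jd; apply: divnK; apply: dvdn_fact; rewrite leq_subr subn_gt0 ltnS ltnW.
(* The differences of the powers serve [mono_comparable]; the coordinates serve the composition of
   charts. *)
pose I : finType := ('I_d + ('I_d * 'I_d) + 'I_k)%type.
pose g (i : I) : pt -> R := match i with
  | inl (inl j) => F j
  | inl (inr (i, j)) => fun w => F i w ^+ e i - F j w ^+ e j
  | inr i => fun w => w i end.
have [|s [p2 [z2 [sk L2 hM]]]] := H k (ltnSn k) z1 I g zs'.
  case=> [[j|[i j]]|i]; [exact: FA|by apply: An_B; apply: An_X|exact: An_coord].
have L3 := lift_prod UU L2 (zs k (ltnSn k)).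
(* If the chart of the first [k] variables has fewer than [k] coordinates, adding $x_k$ still gives
   a drop. *)
move: sk; rewrite leq_eqVlt => /orP[/eqP sk|sk]; last first.
  left; exists s.+1; do 3!eexists; split; [exact: sk|exact: L3].
subst s.
have p2M i : (i < k)%N -> Mono1 k (fun w => p2 w i).
  move=> ik; case: (hM (inr (Ordinal ik))) => //= h; exfalso.
  have [t [h1 [h2 h3]]] := ae_ex UU (aeI UU (tends_nz UU (lift_tends L2) h)
    (aeI UU (lift_eq L2 ik) (x0 i (ltnW ik)))).
  have z1i : z1 t i = x t i by rewrite /z1 upd_neq// neq_ltn ik.
  by rewrite -z1i -h2 h1 eqxx in h3.
apply: (Reducible_comp H L3) => // [i ik|].
  by apply: Mono1_ext (p2M i ik); apply: nzT => w; rewrite upd_neq// neq_ltn ik.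
pose p3 (w : pt) := upd (p2 w) k (w k); pose z3 t := upd (z2 t) k (z1 t k).
rewrite -[X in Reducible _ X _]/z3; have zs3 : tends k.+1 z3 := lift_tends L3.
have {}L3 : Lift k.+1 z1 k.+1 (fun i => (i < k)%N) p3 z3 by [].
pose Ph j (w : pt) := F j (p2 w).
pose u3 w := u (p3 w).
have u3A : An k.+1 u3 by apply: (An_comp' uA); [exact: lift_An L3|exact: lift_0 L3].
have u30 : u3 pt0 != 0 by rewrite /u3 (An_comp0 uA (lift_0 L3)).
have PhA j : An k (Ph j) by apply: An_comp' (FA j) _ _; [exact: lift_An L2|exact: lift_0 L2].
pose g3 (w : pt) := \sum_(j < d) Ph j w * w k ^+ j + w k ^+ d.+1 * u3 w.
have g3E : nz k.+1 (fun w => \sum_(j < d) F j (p3 w) * p3 w k ^+ j + p3 w k ^+ d.+1 * u (p3 w)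
     = g3 w).
  have h1 : nz k.+1 (fun w => forall j, (j < d)%N -> forall v, F j (upd w k v) = F j w).
    by apply: nz_all => j _; apply: nz_coord (leqnSn k) (upd_dep (FA j)).
  have h2 : nz k.+1 (fun w => forall j, (j < d)%N -> forall v, F j (upd (p2 w) k v) = F j (p2 w)).
    have [d1 d10 h] := h1; apply: nzW (nz_comp (lift_An L3) (lift_0 L3) h1) => w hw j jd v.
    have := hw j jd; rewrite /p3 => hw'.
    have E y : upd (upd (p2 w) k (w k)) k y = upd (p2 w) k y.
      by apply/funext => i; rewrite /upd; case: eqP.
    have hv y : F j (upd (p2 w) k y) = F j (upd (p2 w) k (w k)) by rewrite -(hw' y) E.
    rewrite hv -(hv (p2 w k)); congr (F j); apply/funext => i.
    by rewrite /upd; case: eqP => // ->.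
  apply: nzW h2 => w hw; rewrite /g3 /u3 {2 3}/p3 upd_eq; congr (_ + _).
  by apply: eq_bigr => j _; rewrite hw.
apply: (Reducible_ext g3E).
have z3p i : (i < k)%N -> ae (fun t => 0 < z3 t i).
  by move=> ik; apply: (lift_pos L3) => //; exact: ltnW.
(* Without lower coefficients [f] is already $x_k^{d+1}$ times a unit. *)
have [Ph0|] := pselect (forall j, (j < d)%N -> nz k (fun w => Ph j w = 0)).
  apply: (@Reducible_ext _ _ _ (fun w => w k ^+ d.+1 * u3 w)).
    have : nz k.+1 (fun w => forall j, (j < d)%N -> Ph j w = 0).
      by apply: nz_all => j jd; apply: nz_coord (leqnSn k) (Ph0 j jd).
    apply: nzW => w hw; rewrite /g3 big1 ?add0r// => j _.
    by rewrite hw// mul0r.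
  apply: (Reducible_sign H zs3 z3p) => s s0 z zs0 z0 _; right; exists id, z; split.
  - by apply: lift_id => // i im _; exact: z0.
  - have cM i : (i < k.+1)%N -> Mono1 k.+1 (fun w : pt => upd w k (s * w k) i).
      move=> im; have [->|ik] := eqVneq i k.
        apply: (Mono1_ext (f := fun w => s * w k)); last by apply: Mono1_Z => //; exact: Mono1_coord.
        by apply: nzT => w; rewrite upd_eq.
      apply: (Mono1_ext (f := fun w => w i)); last exact: Mono1_coord.
      by apply: nzT => w; rewrite upd_neq.
    apply: (Mono1_comp (f := fun w => w k ^+ d.+1 * u3 w) (m := k.+1) _ cM).
      by apply: Mono1_M; [apply: Mono1_X; exact: Mono1_coord|exact: Mono1_unit].
    by move=> i _; rewrite /upd; case: eqP => // _; rewrite mulr0.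
  - by move=> i ik; apply: Mono1_coord; exact: ltnW.
move=> /existsNP[j1 /not_implyP[j1d nPh1]].
have PhM j : (j < d)%N -> MonoZ k (Ph j) by move=> jd; exact: (hM (inl (inl (Ordinal jd)))).
have /choice[av hav] : forall j, exists av : (nat -> nat) * (pt -> R),
    Mono1 k (Ph j) -> [/\ An k av.2, av.2 pt0 != 0 &
      nz k (fun w => Ph j w = mono k av.1 w * av.2 w)].
  move=> j; have [[al [v h]]|n] := pselect (Mono1 k (Ph j)); first by exists (al, v).
  by exists (fun=> 0%N, fun=> 0).
pose al j := (av j).1; pose v j := (av j).2.
pose J (j : 'I_d) := `[< Mono1 k (Ph j) >].
pose sz (j : 'I_d) := (\sum_(i < k) e j * al j i)%N.
have J1 : J (Ordinal j1d) by apply/asboolP; case: (PhM j1 j1d).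
(* Among comparable exponents the one of least total degree is least in every coordinate. *)
have [j0 Jj0 jmin] : exists2 j0, J j0 & forall j, J j -> (sz j0 <= sz j)%N.
  by case: (arg_minnP sz J1) => j0 *; exists j0.
have cmp (j : 'I_d) : J j -> forall i, (i < k)%N -> (e j0 * al j0 i <= e j * al j i)%N.
  move=> Jj; move: (Jj) (Jj0) => /asboolP/hav[vA v0 vE] /asboolP/hav[wA w0 wE].
  have [|||//|h] := @mono_comparable k (fun i => e j0 * al j0 i)%N (fun i => e j * al j i)%N
      (fun w => v j0 w ^+ e j0) (fun w => v j w ^+ e j) (An_X _ wA) (An_X _ vA).
  - by rewrite expf_neq0.
  - by rewrite expf_neq0.
  - have E : nz k (fun w => Ph j0 w ^+ e j0 - Ph j w ^+ e j =
       mono k (fun i => e j0 * al j0 i)%N w * v j0 w ^+ e j0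
        - mono k (fun i => e j * al j i)%N w * v j w ^+ e j).
      by apply: nzW (nzI wE vE) => w [-> ->]; rewrite !monoX !exprMn.
    case: (hM (inl (inr (j0, j)))) => /= h'.
      by left; apply: nzW (nzI h' E) => w [h1 <-]; rewrite -[RHS]h1.
    by right; apply: Mono1_ext h'; apply: nzW E => w <-.
  move=> i ik; have := jmin j Jj; rewrite /sz (bigD1 (Ordinal ik)) //=.
  rewrite [in X in (_ <= X)%N -> _](bigD1 (Ordinal ik)) //=.
  have le : (\sum_(i0 < k | i0 != Ordinal ik) e j * al j i0 <=
     \sum_(i0 < k | i0 != Ordinal ik) e j0 * al j0 i0)%N by apply: leq_sum => i0 _; exact: h.
  move=> le2; have := leq_trans le2 (leq_add (leqnn _) le).
  by rewrite leq_add2r.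
(* Once the coordinates are [N]-th powers, $F_{j_0}$ has exponent [N * al j0]. This is also the
   exponent of the [d.+1 - j0]-th power of the monomial [be], because [e j0 * (d.+1 - j0) = N]; so
   [C j0] is a unit. *)
pose N := (d.+1)`!; pose be i := if (i < k)%N then (e j0 * al j0 i)%N else 0%N.
have N0 : (0 < N)%N by exact: fact_gt0.
have L5 := lift_root UU N0 zs3 z3p.
pose p5 (w : pt) i := if (i < k)%N then w i ^+ N else w i.
apply: (Reducible_comp H L5) => // [i ik|].
  apply: (Mono1_ext (f := fun w => w i ^+ N)); last by apply: Mono1_X; exact: Mono1_coord.
  by apply: nzT => w; rewrite ik.
have p5k w : p5 w k = w k by rewrite /p5 ltnn.
have p5A i : (i < k)%N -> An k (fun w => p5 w i).
  by move=> ik; rewrite /p5 ik; apply: An_X; exact: An_coord.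
have p50 i : p5 pt0 i = 0 by rewrite /p5; case: ifP => // _; rewrite /pt0 expr0n gtn_eqF.
pose C j (w : pt) := if `[< (j < d)%N /\ Mono1 k (Ph j) >] then
   mono k (fun i => N * al j i - (d.+1 - j) * be i)%N w * v j (p5 w) else 0.
have CA j : An k (C j).
  rewrite /C; case: asboolP => [[_ /hav[vA _ _]]|_]; last exact: An_cst.
  apply: An_M; first exact: An_mono.
  by apply: (An_comp' vA p5A) => i _.
have [v0A v00 v0E] := hav j0 (asboolW Jj0).
have Cj0 : C j0 pt0 != 0.
  rewrite /C asboolT; last by split=> //; exact: asboolW.
  rewrite /v mono0 ?mul1r ?(An_comp0 v0A (fun i _ => p50 i))// => i ik.
  by rewrite /be ik /N -(eE j0)// mulnA [(e j0 * _)%N]mulnC subnn.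
apply: (@Reducible_weighted k d _ _ be C (fun w => u3 (p5 w)) j0 H) => //.
- exact: lift_tends L5.
- by move=> i ik; apply: (lift_pos L5) => //; exact: ltnW.
- by rewrite /be ltnn.
(* The monomial [be] is not constant because $F_{j_0}$ vanishes at the origin. *)
- apply: contrapT => na; have al0 i : (i < k)%N -> al j0 i = 0%N.
    move=> ik; apply: contrapT => /eqP; rewrite -lt0n => a0; apply: na; exists i => //.
    rewrite /be ik muln_gt0 a0 andbT.
    have : (0 < e j0 * (d.+1 - j0))%N by rewrite eE.
    by rewrite muln_gt0 => /andP[].
  have [d1 d10 h1] := v0E; have := h1 pt0 (cube0 (ltW d10)).
  rewrite mono0// mul1r /Ph (An_comp0 (FA j0) (lift_0 L2)) F0; last exact: ltnW.
  by move=> E; rewrite -E eqxx in v00.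
- by apply: (An_comp' u3A); [exact: lift_An L5|exact: lift_0 L5].
- by rewrite (An_comp0 u3A (lift_0 L5)).
- have h : nz k (fun w => forall j, (j < d)%N -> Ph j w =
       if `[< Mono1 k (Ph j) >] then mono k (al j) w * v j w else 0).
    apply: nz_all => j jd; case: asboolP => [/hav[]//|n].
    by case: (PhM j jd).
  have {}h := nz_comp p5A (fun i _ => p50 i) h.
  apply: nzW (nz_coord (leqnSn k) h) => w hw.
  rewrite -[(fun i => _)]/(p5 w) /g3 p5k; congr (_ + _); apply: eq_bigr => j _.
  rewrite hw// /C; congr (_ * _); case: asboolP => [M1|n]; last first.
    by rewrite asboolF ?mulr0// => -[].
  rewrite asboolT// mulrA -monoX mono_recr; last by rewrite /be ltnn muln0.
  rewrite -monoD.
  have -> : mono k (al j) (p5 w) = mono k (fun i => N * al j i)%N w.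
    by apply: eq_bigr => i _; rewrite /p5 ltn_ord -exprM.
  congr (_ * _); apply: mono_ext => // i ik; rewrite subnKC//.
  rewrite /be ik /N -(eE j)// [(e j * (_ - _))%N]mulnC -[in leqRHS]mulnA leq_mul2l.
  by apply/orP; right; apply: cmp => //; apply/asboolP.
- by move=> d' z g' dd; apply: IH.
Qed.

(** By the identity theorem some point [a] of the open orthant has $f(a)\ne0$. The shear turns the
    line through 0 and [a] into the last axis, where [f] is then a nonzero power series in one
    variable. *)
Lemma shear_ordlast k f : An k.+1 f -> ~ nz k.+1 (fun w => f w = 0) ->
  exists (c : nat -> R) d,
    ordlast k d (fun w => f (fun i => if (i < k)%N then w i + c i * w k else w i)).
Proof.
move=> fA nf; have [r [M [r0 fM]]] := fA.
have [a [a0 fa]] : exists a : pt, (forall i, (i < k.+1)%N -> 0 < a i < r) /\ f a != 0.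
  apply: contrapT => na; apply: nf; exists r => // x; apply: (AN_zero r0 (lexx r) fM) => a ha.
  by apply: contrapT => /eqP fa; apply: na; exists a.
have ak : 0 < a k by have /andP[] := a0 k (ltnSn k).
pose c i := a i / a k.
pose sh (w : pt) i := if (i < k)%N then w i + c i * w k else w i.
have shA i : (i < k.+1)%N -> An k.+1 (fun w => sh w i).
  move=> im; rewrite /sh; case: (ltnP i k) => _; last exact: An_coord.
  by apply: An_D; [exact: An_coord|apply: An_Z; exact: An_coord].
have sh0 i : sh pt0 i = 0 by rewrite /sh /pt0; case: ifP => // _; rewrite mulr0 addr0.
have f1A := An_comp' fA shA (fun i _ => sh0 i).
(* The segment from 0 to [a] stays in the polydisc, so the restriction is analytic all the way to
   [a] and cannot vanish near 0 without vanishing at [a]. *)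
have hM : AN 1 1 M (fun z : pt => f (fun i => z 0%N * a i)).
  apply: (@AN_comp R k.+1 r M f 1 1 (fun i (z : pt) => z 0%N * a i)) => // i im.
  have /andP[ai0 air] := a0 i im.
  apply: (AN_ext (f := fun z : pt => a i * z 0%N)); last by move=> z _; rewrite mulrC.
  apply: (@AN_sub R 1 1 (`|a i| * 1)) => //; first by rewrite mulr1 gtr0_norm// ltW.
  by apply: AN_Z => //; apply: AN_coord.
have line y : 0 < y -> y <= a k -> f (sh (upd pt0 k y)) = f (fun i => y / a k * a i).
  move=> y0 ya; have h := AN_dep (ltW r0) fM; apply: h => i im.
    rewrite /sh; have /andP[ai0 air] := a0 i im; case: (ltnP i k) => ik.
      rewrite upd_neq ?neq_ltn ?ik// add0r upd_eq /c gtr0_norm ?mulr_gt0 ?divr_gt0 ?invr_gt0//.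
      apply: le_trans (ltW air); rewrite mulrAC ler_pdivrMr// ler_pM2l//.
    have -> : i = k by apply/eqP; rewrite eqn_leq ik -ltnS im.
    rewrite upd_eq gtr0_norm//; have /andP[_ akr] := a0 k (ltnSn k).
    exact: le_trans ya (ltW akr).
  rewrite /sh; case: (ltnP i k) => ik.
    by rewrite upd_neq ?neq_ltn ?ik// add0r upd_eq /c; ring.
  have -> : i = k by apply/eqP; rewrite eqn_leq ik -ltnS im.
  by rewrite upd_eq divfK// gt_eqF.
exists c; have [r1 [M1 [r10 /AN_SP[F [N [FN NM fx]]]]]] := f1A.
have [d Fd dmin] : exists2 d, F d pt0 != 0 & forall j, (j < d)%N -> F j pt0 = 0.
  have ex : exists d, F d pt0 != 0.
    apply: contrapT => na.
    have z0 y : 0 < y -> y < Num.min r1 (a k) -> f (sh (upd pt0 k y)) = 0.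
      move=> y0; rewrite lt_min => /andP[yr ya].
      have cu : cube k.+1 r1 (upd pt0 k y).
        by apply: cube_upd; [exact: cube0 (ltW r10)|rewrite gtr0_norm// ltW].
      apply: (hsum_uniq (fx _ cu)); refine (hsum_ext _ (@hsum0 R)) => j.
      have -> : F j (upd pt0 k y) = F j pt0.
        apply: (AN_dep (ltW r10) (FN j)); first by apply: cubeW cu.
        by move=> i ik; rewrite upd_neq// neq_ltn ik.
      have -> : F j pt0 = 0 by apply: contrapT => /eqP h; apply: na; exists j.
      by rewrite mul0r.
    have d0 : 0 < Num.min 1 (r1 / a k) by rewrite lt_min ltr01 divr_gt0.
    move/negP: fa; apply.
    have := @AN_zero R 1 1 M _ _ d0 _ hM _ (fun=> 1); rewrite ge_min lexx => h.
    rewrite (_ : a = fun i => 1 * a i); last by apply/funext => i; rewrite mul1r.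
    apply/eqP; apply: h => //; last by move=> i _; rewrite normr1.
    move=> x hx; have /andP[x0] := hx 0%N isT; rewrite lt_min => /andP[x1 xr].
    have xa0 : 0 < x 0%N * a k by rewrite mulr_gt0.
    have xa1 : x 0%N * a k <= a k by rewrite ger_pMl// ltW.
    rewrite -(z0 (x 0%N * a k)) ?line//.
      by congr f; apply/funext => i; rewrite mulfK// gt_eqF.
    rewrite lt_min; rewrite ltr_pdivlMr// in xr; rewrite xr /=.
    by rewrite gtr_pMl.
  have [d Fd dmin] := ex_minnP ex; exists d => // j jd.
  apply: contrapT => /eqP /dmin; by rewrite leqNgt jd.
exists d; have [u [uA uF hu]] := AN_splitX d r10 FN NM fx.
exists (fun y => u (upd pt0 k y)), (F d pt0), r1 => //; split=> // [y y0 yr|e e0].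
  have cu : cube k.+1 r1 (upd pt0 k y).
    by apply: cube_upd; [exact: cube0 (ltW r10)|rewrite gtr0_norm// ltW].
  rewrite -[LHS]/(f (sh (upd pt0 k y))) hu// upd_eq big1 ?add0r// => j _.
  have -> : F j (upd pt0 k y) = F j pt0.
    apply: (AN_dep (ltW r10) (FN j)); first by apply: cubeW cu.
    by move=> i ik; rewrite upd_neq// neq_ltn ik.
  by rewrite dmin// mul0r.
have [d1 d10 h] := An_cts uA e0; exists d1 => // y y0 yd.
have -> : F d pt0 = u pt0 by rewrite uF//; exact: cube0 (ltW r10).
by apply: h; apply: cube_upd; [exact: cube0 (ltW d10)|rewrite gtr0_norm// ltW].
Qed.

Lemma prod_nonzero s (I : Type) (r : seq I) (g : I -> pt -> R) :
  (forall i, An s (g i)) -> (forall i, ~ nz s (fun w => g i w = 0)) ->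
  ~ nz s (fun w => \prod_(i <- r) g i w = 0).
Proof.
move=> gA gn; elim: r => [[d d0 h]|i r IH h].
  by have /eqP := h pt0 (cube0 (ltW d0)); rewrite big_nil oner_eq0.
have : nz s (fun w => g i w * \prod_(i <- r) g i w = 0).
  by apply: nzW h => w; rewrite big_cons.
by case/(An_domain (gA i) (An_prod r (fun i _ => gA i)))=> [/gn|/IH].
Qed.

(** What is reduced is the product of the germs, after a shear gives it finite order in the last
    variable; [Mono1_factor] passes the result on to each factor. Germs that vanish identically are
    replaced by 1 in the product. *)
Theorem local_monomialization m : Monomializable m.
Proof.
elim/ltn_ind: m => -[|k] H x I g xs gA.
  exists 0%N, id, x; split=> //; first exact: lift_id.
  move=> i; have [r [M [_ [c [_ gc]]]]] := gA i.
  have [c0|c0] := eqVneq c 0; first by left; apply: nzT => w; rewrite gc.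
  by right; apply: Mono1_unit (gA i) _; rewrite gc.
pose P i := `[< nz k.+1 (fun w => g i w = 0) >].
pose g' i := if P i then fun=> 1 else g i.
have g'A i : An k.+1 (g' i) by rewrite /g'; case: ifP => _; [exact: An_cst|].
pose G w := \prod_(i <- enum I) g' i w.
have GA : An k.+1 G by apply: An_prod => i _; exact: g'A.
have g'n i : ~ nz k.+1 (fun w => g' i w = 0).
  rewrite /g' /P; case: asboolP => // _ [d d0 h].
  by have /eqP := h pt0 (cube0 (ltW d0)); rewrite oner_eq0.
have Gn : ~ nz k.+1 (fun w => G w = 0) by exact: (prod_nonzero (r := enum I) g'A g'n).
have [c [d ho]] := shear_ordlast GA Gn.
have L1 := lift_shear UU c xs.
have f1A := An_comp' GA (lift_An L1) (lift_0 L1).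
have [D|[p [z [L2 M _]]]] := Reducible_ordlast H (lift_tends L1) f1A ho.
  have D' : Drop k.+1 x by exact: drop_comp H _ L1 D.
  have [s [p [z [sm L hM]]]] := drop_goal UU H D' gA.
  by exists s, p, z; split=> //; exact: ltnW.
have L := lift_full_comp UU L1 L2 (fun _ _ h => False_ind _ (notF h)).
eexists k.+1, _, z; split; [exact: leqnn|exact: L|].
move=> i; have [Pi|nPi] := boolP (P i).
  by left; have /asboolP h := Pi; exact: nz_comp (lift_An L) (lift_0 L) h.
have ii : i \in enum I by rewrite mem_enum.
pose h w := \prod_(j <- rem i (enum I)) g' j w.
have hA : An k.+1 h by apply: An_prod => j _; exact: g'A.
have GE w : G w = g i w * h w.
  by rewrite /G (perm_big _ (perm_to_rem ii)) big_cons /= /g' (negbTE nPi).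
right; apply: (Mono1_factor (An_comp' (gA i) (lift_An L) (lift_0 L))
                            (An_comp' hA (lift_An L) (lift_0 L))).
by apply: Mono1_ext M; apply: nzT => w; rewrite -GE.
Qed.

End Monomialize.

(** * Multi-index expansions *)

Section Bridge.
Variable R : realType.
Notation pt := (nat -> R).
Implicit Types (f g : pt -> R) (r M c e B : R) (w : pt).

Lemma near_rV m (x : 'rV[R]_m) (P : 'rV[R]_m -> Prop) :
  (\forall y \near x, P y) <->
  exists2 e : R, 0 < e & forall y : 'rV[R]_m, (forall i, `|y 0 i - x 0 i| < e) -> P y.
Proof.
split.
  move=> /nbhs_ballP[e /= e0 h]; exists e => // y hy; apply: h.
  split=> // i j; rewrite (ord1 i) /ball /= distrC; exact: hy.
move=> [e e0 h]; apply/nbhs_ballP; exists e => // y [_ hy]; apply: h => i.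
by have := hy 0 i; rewrite /ball /= distrC.
Qed.

Definition vec m w : 'rV[R]_m := \row_i w i.

Lemma AN_prodseq m r (I : Type) (s : seq I) (N : I -> R) (f : I -> pt -> R) :
  0 < r -> (forall i, AN m r (N i) (f i)) ->
  AN m r (\prod_(i <- s) N i) (fun w => \prod_(i <- s) f i w).
Proof.
move=> r0 h; elim: s => [|i s IH].
  rewrite big_nil; apply: AN_ext (AN_cst _ (ltW r0) _) _; last by move=> w _; rewrite big_nil.
  by rewrite normr1.
rewrite big_cons; apply: AN_ext (AN_M r0 (h i) IH) _ => w _.
by rewrite big_cons.
Qed.

Lemma AN_sumseq m r (I : Type) (s : seq I) (N : I -> R) (f : I -> pt -> R) :
  0 < r -> (forall i, AN m r (N i) (f i)) ->
  AN m r (\sum_(i <- s) N i) (fun w => \sum_(i <- s) f i w).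
Proof.
move=> r0 h; elim: s => [|i s IH].
  rewrite big_nil; apply: AN_ext (AN_0 m r) _ => w _; by rewrite big_nil.
rewrite big_cons; apply: AN_ext (AN_D (h i) IH) _ => w _.
by rewrite big_cons.
Qed.

Section Box.
Variables (m : nat).
Notation idx := {ffun 'I_m -> nat}.

Definition box N : seq idx :=
  [seq [ffun i => nat_of_ord (k i)] | k : {ffun 'I_m -> 'I_N} <- enum {: {ffun 'I_m -> 'I_N}}].

Lemma box_uniq N : uniq (box N).
Proof.
rewrite map_inj_uniq ?enum_uniq// => k l /ffunP h; apply/ffunP => i.
by have := h i; rewrite !ffunE => /val_inj.
Qed.

Lemma mem_box N (k : idx) : (k \in box N) = [forall i, (k i < N)%N].
Proof.
apply/mapP/forallP => [[l _ ->] i|h]; first by rewrite ffunE.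
by exists [ffun i => Ordinal (h i)]; rewrite ?mem_enum//; apply/ffunP => i; rewrite !ffunE.
Qed.

Lemma big_box N (F : idx -> R) :
  \sum_(k <- box N) F k = \sum_(k : {ffun 'I_m -> 'I_N}) F [ffun i => nat_of_ord (k i)].
Proof. by rewrite big_map big_enum. Qed.

(** Analyticity is stated through sums over boxes; the shells between consecutive boxes turn them
    into the partial sums of a series. *)
Definition shell N := [seq k <- box N.+1 | k \notin box N].

Lemma big_shell N (F : idx -> R) :
  \sum_(k <- box N.+1) F k = \sum_(k <- box N) F k + \sum_(k <- shell N) F k.
Proof.
rewrite (bigID (fun k => k \in box N)) /= /shell big_filter; congr (_ + _).
rewrite -big_filter; apply: perm_big; apply: uniq_perm; rewrite ?filter_uniq ?box_uniq// => k.
rewrite mem_filter andb_idr// !mem_box => /forallP h.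
by apply/forallP => i; exact: leqW.
Qed.

Lemma sum_shell K (F : idx -> R) :
  \sum_(N < K) \sum_(k <- shell N) F k = \sum_(k <- box K) F k - \sum_(k <- box 0) F k.
Proof.
elim: K => [|K IH]; first by rewrite big_ord0 subrr.
by rewrite big_ord_recr /= IH big_shell addrAC.
Qed.

(** Summability at the corner $(r,\dots,r)$ gives one majorant [b] for the whole cube of radius [r].
    Monomials are then grouped by shells and summed by [AN_hsum]. *)
Lemma analytic_An (f : 'rV[R]_m -> R) (x : 'rV[R]_m) :
  analytic_at f x -> An m (fun w => f (x + vec m w)).
Proof.
move=> [c /near_rV[e e0 h]].
pose r := e / 2; have r0 : 0 < r by rewrite divr_gt0.
have re : r < e by rewrite ltr_pdivrMr// mulr2n mulrDr mulr1 ltrDl.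
pose mon (k : idx) w := \prod_(i < m) w i ^+ k i.
have monE k w : monomial_at x (x + vec m w) k = mon k w.
  by apply: eq_bigr => i _; rewrite !mxE addrAC subrr add0r.
have near w : cube m r w -> forall i, `|(x + vec m w) 0 i - x 0 i| < e.
  by move=> cw i; rewrite !mxE addrAC subrr add0r; apply: le_lt_trans re; exact: cw.
pose b k := `|c k| * \prod_(i < m) r ^+ k i.
have b0 k : 0 <= b k.
  by rewrite mulr_ge0// prodr_ge0// => i _; rewrite exprn_ge0// ltW.
have cr : cube m r (fun=> r) by move=> i _; rewrite gtr0_norm.
have [S _] := h _ (near _ cr).
pose M := fine (\esum_(k in [set: idx]) `|(c k * monomial_at x (x + vec m (fun=> r)) k)%:E|)%E.
have bM (s : seq idx) : uniq s -> \sum_(k <- s) b k <= M.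
  move=> us; rewrite -lee_fin /M fineK; last first.
    by rewrite ge0_fin_numE//; apply: esum_ge0.
  apply: esum_ge; exists [set` s]; first by split=> //; exact: finite_seq.
  rewrite -fsbig_seq//= -sumEFin; apply: lee_sum => k _.
  by rewrite lee_fin monE /b normrM [`|mon _ _|]ger0_norm// prodr_ge0// => i _; rewrite exprn_ge0// ltW.
have monA k : AN m r (b k) (fun w => c k * mon k w).
  rewrite /b; apply: (AN_Z _ r0); apply: AN_prodseq => // i.
  by apply: AN_X => //; apply: AN_coord => //; exact: ltW.
(* The sum over [box 0] is kept as the term of index 0: that box is empty for positive [m], but for
   [m = 0] it contains the empty multi-index. Hence [K.+1] terms make up [box K]. *)
pose q N w := match N with
  | 0 => \sum_(k <- box 0) c k * mon k w
  | N.+1 => \sum_(k <- shell N) c k * mon k w end.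
pose qn N := match N with
  | 0 => \sum_(k <- box 0) b k | N.+1 => \sum_(k <- shell N) b k end.
have qs K (F : idx -> R) : \sum_(N < K.+1) (match nat_of_ord N with
  | 0 => \sum_(k <- box 0) F k | N.+1 => \sum_(k <- shell N) F k end) =
   \sum_(k <- box K) F k.
  by rewrite big_ord_recl /= sum_shell addrCA subrr addr0.
exists r, M; split=> //; apply: (@AN_hsum R m r qn M q) => //.
- by case=> [|N]; apply: AN_sumseq.
- case=> [|K]; first by rewrite big_ord0 (le_trans _ (bM [::] isT))// big_nil.
  by rewrite (qs K b); apply: bM; exact: box_uniq.
- move=> w cw; have [_ hf] := h _ (near w cw).
  have : (fun N => \sum_(k < N.+1) q k w) @ \oo --> f (x + vec m w).
    apply: cvg_eqfun hf => K /=; rewrite /q (qs K (fun k => c k * mon k w)) big_box.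
    by apply: eq_bigr => k _; rewrite monE.
  by move=> h1; rewrite /hsum -cvg_shiftS.
Qed.

End Box.
End Bridge.

(** * Entrywise limits of matrices along a filter *)

Section MatrixLimits.
Variables (R : realType) (T : Type) (U : set_system T).
Hypothesis UF : ProperFilter U.

Definition mlim a b (M : T -> 'M[R]_(a, b)) (M0 : 'M[R]_(a, b)) :=
  forall i j, (fun t => M t i j) @ U --> M0 i j.

Lemma mlim_cst a b (M : 'M[R]_(a, b)) : mlim (fun=> M) M.
Proof. by move=> i j; exact: cvg_cst. Qed.

Lemma mlimD a b (M N : T -> 'M[R]_(a, b)) M0 N0 : mlim M M0 -> mlim N N0 ->
  mlim (fun t => M t + N t) (M0 + N0).
Proof.
move=> h1 h2 i j; rewrite mxE; have : (fun t => M t i j + N t i j) @ U --> M0 i j + N0 i j.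
  exact: cvgD.
by under [fun t => (M t + N t) i j]funext do rewrite mxE.
Qed.

Lemma mlimZ a b (c : T -> R) (M : T -> 'M[R]_(a, b)) (c0 : R) M0 : c @ U --> c0 -> mlim M M0 ->
  mlim (fun t => c t *: M t) (c0 *: M0).
Proof.
move=> h1 h2 i j; rewrite mxE; have : (fun t => c t * M t i j) @ U --> c0 * M0 i j.
  exact: cvgM.
by under [fun t => (c t *: M t) i j]funext do rewrite mxE.
Qed.

Lemma mlimN a b (M : T -> 'M[R]_(a, b)) M0 : mlim M M0 -> mlim (fun t => - M t) (- M0).
Proof.
move=> h1 i j; rewrite mxE; have : (fun t => - M t i j) @ U --> - M0 i j.
  exact: cvgN.
by under [fun t => (- M t) i j]funext do rewrite mxE.
Qed.

Lemma mlimB a b (M N : T -> 'M[R]_(a, b)) M0 N0 : mlim M M0 -> mlim N N0 ->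
  mlim (fun t => M t - N t) (M0 - N0).
Proof. by move=> h1 h2; apply: mlimD h1 _; exact: mlimN. Qed.

Lemma cvg_sum_ord n (u : 'I_n -> T -> R) (v : 'I_n -> R) :
  (forall k, u k @ U --> v k) ->
  (fun t => \sum_(k < n) u k t) @ U --> \sum_(k < n) v k.
Proof. exact: cvgr_sum. Qed.

Lemma mlimM a b c (M : T -> 'M[R]_(a, b)) (N : T -> 'M[R]_(b, c)) M0 N0 :
  mlim M M0 -> mlim N N0 -> mlim (fun t => M t *m N t) (M0 *m N0).
Proof.
move=> h1 h2 i j; rewrite mxE.
have : (fun t => \sum_k M t i k * N t k j) @ U --> \sum_k M0 i k * N0 k j.
  by apply: cvg_sum_ord => k; exact: cvgM.
by under [fun t => (M t *m N t) i j]funext do rewrite mxE.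
Qed.

Lemma mlim_tr a b (M : T -> 'M[R]_(a, b)) M0 : mlim M M0 ->
  mlim (fun t => (M t)^T) M0^T.
Proof.
move=> h i j; rewrite mxE; have := h j i.
by under [fun t => (M t)^T i j]funext do rewrite mxE.
Qed.

Lemma mlim_uniq a b (M : T -> 'M[R]_(a, b)) M0 N0 : mlim M M0 -> mlim M N0 -> M0 = N0.
Proof.
move=> h1 h2; apply/matrixP => i j; apply: cvg_unique (h1 i j) (h2 i j).
exact: norm_hausdorff.
Qed.

Lemma mlim_near a b (M N : T -> 'M[R]_(a, b)) M0 : (\forall t \near U, M t = N t) ->
  mlim M M0 -> mlim N M0.
Proof.
move=> h h1 i j; apply: cvg_trans (h1 i j); apply: near_eq_cvg.
by apply: filterS h => t ->.
Qed.

Lemma mlim_lt a b (M : T -> 'M[R]_(a, b)) M0 e : mlim M M0 -> 0 < e ->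
  \forall t \near U, forall i j, `|M t i j - M0 i j| < e.
Proof.
move=> h e0; apply: (@filter_forall _ _ (fun i t => forall j, `|M t i j - M0 i j| < e)) => i.
apply: (@filter_forall _ _ (fun j t => `|M t i j - M0 i j| < e)) => j.
by have /cvgrPdist_lt/(_ _ e0) := h i j; apply: filterS => t; rewrite distrC.
Qed.

End MatrixLimits.
Arguments mlim_cst {R T U} UF {a b} M.

(** * Orthonormal frames of subspaces *)

Section Orthonormal.
Variables (R : realType).

Lemma orth_bound k n (E : 'M[R]_(k, n)) : E *m E^T = 1%:M -> forall i j, `|E i j| <= 1.
Proof.
move=> EE i j; have := congr1 (fun M : 'M[R]_k => M i i) EE.
rewrite !mxE eqxx (bigD1 j) //= !mxE => h.
rewrite -(ler_pXn2r (n := 2))// ?nnegrE// expr1n -normrX ger0_norm ?sqr_ge0//.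
have S : 0 <= \sum_(l < n | l != j) E i l * E^T l i.
  by apply: sumr_ge0 => l _; rewrite !mxE -expr2 sqr_ge0.
by have {}h : E i j * E i j + \sum_(l < n | l != j) E i l * E^T l i = 1 by []; rewrite expr2; lra.
Qed.

(** Compactness of the set of orthonormal $k$-frames: the entries are bounded by 1, hence converge
    along [U], and $EE^T=1$ passes to the limit. *)
Lemma orth_lim k n T (U : set_system T) (UU : UltraFilter U) (E : T -> 'M[R]_(k, n)) :
  ae U (fun t => E t *m (E t)^T = 1%:M) ->
  exists E0, mlim U E E0 /\ E0 *m E0^T = 1%:M.
Proof.
move=> EE; have UP : ProperFilter U by exact: ultra_proper.
have /choice[l hl] : forall ij : 'I_k * 'I_n, exists l : R, (fun t => E t ij.1 ij.2) @ U --> l.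
  move=> [i j] /=; case: (ultra_lim UU (fun t => E t i j)) => // /(_ 1) h.
  have [t [h1 h2]] := ae_ex UU (aeI UU h EE).
  by have := orth_bound h2 i j; rewrite leNgt h1.
exists (\matrix_(i, j) l (i, j)).
have L : mlim U E (\matrix_(i, j) l (i, j)) by move=> i j; rewrite mxE; exact: (hl (i, j)).
split=> //; have h1 := mlimM UP L (mlim_tr L); apply: (mlim_uniq UP h1).
have h2 : mlim U (fun=> 1%:M : 'M[R]_k) 1%:M by exact: mlim_cst.
by apply: mlim_near h2; apply: aeW EE => t ->.
Qed.

Lemma orth_rank k n (E : 'M[R]_(k, n)) : E *m E^T = 1%:M -> row_free E.
Proof.
by move=> EE; apply/row_freeP; exists E^T.
Qed.

Lemma orth_le k n (E : 'M[R]_(k, n)) : E *m E^T = 1%:M -> (k <= n)%N.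
Proof. by move=> /orth_rank /eqP <-; exact: rank_leq_col. Qed.

Lemma orth_full n (E : 'M[R]_n) (x : 'rV[R]_n) : E *m E^T = 1%:M -> exists u, x = u *m E.
Proof.
move=> EE; exists (x *m E^T); rewrite -mulmxA.
by rewrite (mulmx1C EE) mulmx1.
Qed.

(** One Gram-Schmidt step. The last clause bounds the new span from above, so that a property of it
    can be checked on the vectors [w *m E + t *: x]. *)
Lemma orth_extend k n (E : 'M[R]_(k, n)) (x : 'rV[R]_n) : E *m E^T = 1%:M ->
  ~ (exists u, x = u *m E) ->
  exists E' : 'M[R]_(k.+1, n), [/\ E' *m E'^T = 1%:M,
    exists v, x = v *m E', forall u : 'rV_k, exists v : 'rV_k.+1, u *m E = v *m E' &
    forall v : 'rV_k.+1, exists w t, v *m E' = w *m E + t *: x].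
Proof.
move=> EE nx; pose e0 := x - x *m E^T *m E.
have e00 : e0 != 0.
  by apply/eqP => /eqP; rewrite subr_eq0 => /eqP h; apply: nx; exists (x *m E^T).
pose s := enorm e0.
have sE : s ^+ 2 = \sum_(i < n) e0 0 i ^+ 2.
  by rewrite sqr_sqrtr ?sumr_ge0// => i _; exact: sqr_ge0.
have ss : s ^+ 2 = (e0 *m e0^T) 0 0.
  rewrite sE.
  by rewrite [(e0 *m _) _ _]mxE; apply: eq_bigr => i _; rewrite [e0^T i 0]mxE expr2.
have s0 : s != 0.
  apply: contra_neq e00 => s0; apply/rowP => i; rewrite [RHS]mxE.
  have /eqP : \sum_(i < n) e0 0 i ^+ 2 = 0 by rewrite -sE s0 expr0n.
  rewrite psumr_eq0 => [/allP/(_ i)|j _]; last exact: sqr_ge0.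
  by rewrite mem_index_enum sqrf_eq0 => /(_ isT) /eqP.
pose e := s^-1 *: e0; pose E' : 'M[R]_(1 + k, n) := col_mx e E.
have eE : e *m E^T = 0.
  by rewrite -scalemxAl mulmxBl -!mulmxA EE mulmx1 subrr scaler0.
have ee : e *m e^T = 1%:M.
  apply/matrixP => i j; rewrite !ord1 linearZ /= -scalemxAl -scalemxAr !mxE /=.
  have := ss; rewrite mxE => <-; rewrite expr2; field; exact: s0.
exists E'; split.
(* [col_mx] lives in dimension [1 + k], convertible to [k.+1]; the clauses are first proved in that
   form. *)
- have H : (col_mx e E : 'M[R]_(1 + k, n)) *m (col_mx e E : 'M[R]_(1 + k, n))^T = 1%:M :> 'M[R]_(1 + k).
    rewrite tr_col_mx mul_col_row ee eE EE -[E *m e^T]trmxK trmx_mul trmxK eE trmx0.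
    by rewrite -scalar_mx_block.
  exact: H.
- have H : x = row_mx s%:M (x *m E^T) *m col_mx e E.
    rewrite mul_row_col mul_scalar_mx /e scalerA divff//.
    by rewrite scale1r subrK.
  by exists (row_mx s%:M (x *m E^T)); exact: H.
- move=> u; have H : u *m E = row_mx (0 : 'M[R]_1) u *m col_mx e E by rewrite mul_row_col mul0mx add0r.
  by exists (row_mx (0 : 'M[R]_1) u); exact: H.
- move=> v; pose v' : 'rV[R]_(1 + k) := v; pose t := lsubmx v' 0 0 / s.
  exists (rsubmx v' - t *: (x *m E^T)), t.
  have H : v' *m col_mx e E = lsubmx v' *m e + rsubmx v' *m E.
    by rewrite -{1}[v']hsubmxK mul_row_col.
  have -> : v *m E' = v' *m col_mx e E by [].
  rewrite H [lsubmx v']mx11_scalar mul_scalar_mx /e scalerA mulmxBl -scalemxAl scalerBr.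
  by rewrite -/t addrAC [X in X - _]addrC addrAC.
Qed.

End Orthonormal.

(** * Tangent cones and the cone over GD *)

Section Cones.
Variables (R : realType) (n : nat).
Notation V := 'rV[R]_n.
Implicit Types (A B C : set V) (p q v u a : V) (e : R).

Definition cl e (x v : V) := forall i, `|x 0 i - v 0 i| < e.

(* v belongs to the tangent cone of A at p. *)
Definition TC A p v := forall e, 0 < e -> exists (x : V) (t : R),
  [/\ A x, 0 < t, cl e x p & cl e (t *: (x - p)) v].

(* The nonzero vectors of GC A are those of the cone over GD A. *)
Definition GC A v := forall e, 0 < e -> exists p u,
  [/\ A p, cl e p 0, cl e u v, u != 0 & TC A p u].

Lemma enorm_ge0 (x : V) : 0 <= enorm x. Proof. exact: sqrtr_ge0. Qed.

Lemma enorm0 (x : V) : (enorm x == 0) = (x == 0).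
Proof.
have S : 0 <= \sum_(i < n) x 0 i ^+ 2 by apply: sumr_ge0 => i _; exact: sqr_ge0.
rewrite sqrtr_eq0 le_eqVlt ltNge S orbF; apply/eqP/eqP => [/eqP|->]; last first.
  by rewrite big1// => i _; rewrite mxE expr0n.
rewrite psumr_eq0 => [/allP h|j _]; last exact: sqr_ge0.
apply/rowP => i; rewrite mxE; apply/eqP; rewrite -sqrf_eq0.
by apply: h; rewrite mem_index_enum.
Qed.

Lemma enorm_gt0 (x : V) : (0 < enorm x) = (x != 0).
Proof. by rewrite lt_neqAle enorm_ge0 andbT eq_sym enorm0. Qed.

Lemma enormZ (t : R) (x : V) : enorm (t *: x) = `|t| * enorm x.
Proof.
rewrite /enorm; under eq_bigr do rewrite mxE exprMn.
by rewrite -mulr_sumr sqrtrM ?sqr_ge0// sqrtr_sqr.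
Qed.

Lemma enorm_lim T (U : set_system T) (UF : ProperFilter U) (x : T -> V) (x0 : V) :
  mlim U x x0 -> (fun t => enorm (x t)) @ U --> enorm x0.
Proof.
move=> h; apply: (@cvg_comp _ _ _ (fun t => \sum_(i < n) x t 0 i ^+ 2) Num.sqrt).
  by apply: cvg_sum_ord => i; apply: cvgM; exact: h.
exact: sqrt_continuous.
Qed.

Lemma unit_lim T (U : set_system T) (UF : ProperFilter U) (x : T -> V) (x0 : V) : x0 != 0 ->
  mlim U x x0 -> mlim U (fun t => (enorm (x t))^-1 *: x t) ((enorm x0)^-1 *: x0).
Proof.
move=> x00 h; apply: mlimZ => //; apply: cvgV; last exact: enorm_lim.
by rewrite enorm0.
Qed.

Lemma cvg_rV T (F : set_system T) {FF : Filter F} (x : T -> V) (x0 : V) :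
  x @ F --> x0 <-> forall i, (fun t => x t 0 i) @ F --> x0 0 i.
Proof.
split=> h.
  move=> i; apply/cvgrPdist_lt => e e0.
  have : \forall y \near x0, `|x0 0 i - (y : V) 0 i| < e.
    by apply/near_rV; exists e => // y hy; rewrite distrC.
  exact: h.
move=> P /near_rV[e e0 hP]; rewrite /= nbhs_simpl /=.
have : \forall t \near F, forall i, `|x t 0 i - x0 0 i| < e.
  apply: filter_forall => i; have /cvgrPdist_lt/(_ _ e0) := h i.
  by apply: filterS => t; rewrite distrC.
by apply: filterS => t; exact: hP.
Qed.

Lemma cvg_mlim T (F : set_system T) {FF : Filter F} (x : T -> V) (x0 : V) :
  x @ F --> x0 <-> mlim F x x0.
Proof.
split=> [/cvg_rV h i j|h]; first by rewrite (ord1 i); exact: h.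
by apply/cvg_rV => i; exact: h.
Qed.

Lemma clW e e' (x v : V) : e <= e' -> cl e x v -> cl e' x v.
Proof. by move=> ee h i; apply: lt_le_trans (h i) ee. Qed.

Lemma cl_trans e e' (x v u : V) : cl e x v -> cl e' v u -> cl (e + e') x u.
Proof.
move=> h h' i; have := ltrD (h i) (h' i); apply: le_lt_trans.
by apply: le_trans (ler_normD _ _); rewrite addrA subrK.
Qed.

Lemma inv_nat_lt e : 0 < e -> exists N, forall j, (N <= j)%N -> j.+1%:R^-1 < e :> R.
Proof.
move=> e0; have [N _ hN] := near_infty_natSinv_lt (PosNum e0).
by exists N => j jN; exact: hN.
Qed.

Lemma cl_mlim (x : nat -> V) (x0 : V) : (forall j, cl j.+1%:R^-1 (x j) x0) -> mlim \oo x x0.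
Proof.
move=> h i k; rewrite (ord1 i); apply/cvgrPdist_lt => e e0.
have [N hN] := inv_nat_lt e0; exists N => // j /= Nj; rewrite distrC.
exact: lt_trans (h j k) (hN j Nj).
Qed.

Lemma mlim_cl T (U : set_system T) (UF : ProperFilter U) (x : T -> V) (x0 : V) e : mlim U x x0 -> 0 < e ->
  \forall t \near U, cl e (x t) x0.
Proof. by move=> h e0; apply: filterS (mlim_lt UF h e0) => t ht i. Qed.

Lemma TC_seq A p v : TC A p v -> exists (x : nat -> V) (t : nat -> R),
  [/\ forall j, A (x j), forall j, 0 < t j, mlim \oo x p &
      mlim \oo (fun j => t j *: (x j - p)) v].
Proof.
move=> h; have /choice[xt hxt] : forall j, exists xt : V * R,
    [/\ A xt.1, 0 < xt.2, cl j.+1%:R^-1 xt.1 p & cl j.+1%:R^-1 (xt.2 *: (xt.1 - p)) v].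
  by move=> j; have [//|x [t ht]] := h j.+1%:R^-1; exists (x, t).
exists (fun j => (xt j).1), (fun j => (xt j).2); split.
- by move=> j; case: (hxt j).
- by move=> j; case: (hxt j).
- by apply: cl_mlim => j; case: (hxt j).
- by apply: cl_mlim => j; case: (hxt j).
Qed.

Lemma TC_lim T (U : set_system T) (UF : ProperFilter U) A p v (x : T -> V) (t : T -> R) :
  (\forall j \near U, A (x j)) -> (\forall j \near U, 0 < t j) -> mlim U x p ->
  mlim U (fun j => t j *: (x j - p)) v -> TC A p v.
Proof.
move=> xA t0 xp xv e e0.
have [j [[[h1 h2] h3] h4]] := filter_ex (filterI (filterI (filterI xA t0)
   (mlim_cl UF xp e0)) (mlim_cl UF xv e0)).
by exists (x j), (t j).
Qed.

Lemma TC_Z A p v s : 0 < s -> TC A p v -> TC A p (s *: v).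
Proof.
move=> s0 /TC_seq[x [t [xA t0 xp xv]]].
apply: (@TC_lim _ \oo _ A p _ x (fun j => s * t j)) => //; first exact: nearW.
  by apply: nearW => j; rewrite mulr_gt0.
apply: mlim_near (mlimZ _ (cvg_cst s) xv).
by apply: nearW => j; rewrite scalerA.
Qed.

Lemma dirset_TC A p a : dirset A p a -> a != 0 /\ TC A p a.
Proof.
move=> [/= sa [x [xA xp xa]]]; split.
  by rewrite -enorm_gt0 sa.
apply: (@TC_lim _ \oo _ A p _ x (fun j => (enorm (x j - p))^-1)).
- by apply: nearW => j; case: (xA j).
- apply: nearW => j; rewrite invr_gt0 enorm_gt0 subr_eq0; apply/eqP => h.
  by case: (xA j) => _; apply.
- exact/cvg_mlim.
- exact/cvg_mlim.
Qed.

Lemma sphere_unit v : v != 0 -> sphere R n ((enorm v)^-1 *: v).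
Proof.
move=> v0; rewrite /sphere /= enormZ normfV ger0_norm ?enorm_ge0// mulVf//.
by rewrite enorm0.
Qed.

(** As $v\ne0$, the points of the sequence differ from [p] from some index on, and the earlier ones
    are dropped; normalization removes the factors [t j]. *)
Lemma TC_dirset A p v : v != 0 -> TC A p v -> dirset A p ((enorm v)^-1 *: v).
Proof.
move=> v0 /TC_seq[x [t [xA t0 xp xv]]]; split; first exact: sphere_unit.
have xp0 : \forall j \near \oo, x j != p.
  have e0 : 0 < enorm v by rewrite enorm_gt0.
  have h : (fun j => enorm (t j *: (x j - p))) @ \oo --> enorm v by apply: enorm_lim.
  have /cvgrPdist_lt/(_ _ e0) := h.
  have E0 : enorm (0 : V) = 0 by apply/eqP; rewrite enorm0.
  apply: filterS => j; apply: contraTneq => ->.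
  by rewrite subrr scaler0 E0 subr0 ger0_norm ?enorm_ge0// ltxx.
have [N _ hN] := xp0; exists (fun j => x (j + N)%N); split.
- move=> j; split=> //= h; have := hN (j + N)%N (leq_addl _ _).
  by rewrite h eqxx.
- by apply/cvg_mlim => i j; have := xp i j; rewrite -(cvg_shiftn N).
- apply/cvg_mlim => i k.
  suff : mlim \oo (fun j => (enorm (x j - p))^-1 *: (x j - p)) ((enorm v)^-1 *: v).
    by move=> h; have := h i k; rewrite -(cvg_shiftn N).
  apply: mlim_near (unit_lim _ v0 xv); apply: nearW => j.
  rewrite enormZ gtr0_norm// scalerA invfM mulrAC mulVf ?mul1r// gt_eqF//.
Qed.

Lemma GD_GC A a : GD A a <-> sphere R n a /\ GC A a.
Proof.
split=> -[sa h]; split=> //.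
  move=> e e0; have [[p u] /= [[/= Ap pu] [cp cu]]] : dirbundle A `&`
      [set q : V * V | cl e q.1 0 /\ cl e q.2 a] !=set0.
    apply: h; exists ([set q | cl e q 0], [set q | cl e q a]) => //=.
    by split; apply/near_rV; exists e.
  by have [u0 T] := dirset_TC pu; exists p, u.
move=> B [[B1 B2] /= [/near_rV[e1 e10 h1] /near_rV[e2 e20 h2]] hB].
have a0 : a != 0 by rewrite -enorm_gt0 sa.
have /choice[pu hpu] : forall j, exists pu : V * V, [/\ A pu.1, cl j.+1%:R^-1 pu.1 0,
    cl j.+1%:R^-1 pu.2 a, pu.2 != 0 & TC A pu.1 pu.2].
  by move=> j; have [//|p [u hpu]] := h j.+1%:R^-1; exists (p, u).
have l1 : mlim \oo (fun j => (pu j).2) a by apply: cl_mlim => j; case: (hpu j).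
have l3 : mlim \oo (fun j => (enorm (pu j).2)^-1 *: (pu j).2) ((enorm a)^-1 *: a).
  exact: unit_lim.
rewrite sa invr1 scale1r in l3.
have l2 : mlim \oo (fun j => (pu j).1) 0 by apply: cl_mlim => j; case: (hpu j).
have [j [j1 j2]] := filter_ex (filterI (mlim_cl _ l2 e10) (mlim_cl _ l3 e20)).
have [Ap _ _ u0 T] := hpu j.
exists ((pu j).1, (enorm (pu j).2)^-1 *: (pu j).2); split.
  by split=> //=; exact: TC_dirset.
by apply: hB; split=> /=; [exact: h1|exact: h2].
Qed.

Lemma GC_Z A v (s : R) : 0 < s -> GC A v -> GC A (s *: v).
Proof.
move=> s0 h e e0; have [|p [u [Ap cp cu u0 T]]] := h (Num.min e (e / s)).
  by rewrite lt_min e0 divr_gt0.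
exists p, (s *: u); split=> //.
- by apply: clW cp; rewrite ge_min lexx.
- move=> i; rewrite !mxE -mulrBr normrM gtr0_norm// mulrC -ltr_pdivlMr//.
  by apply: lt_le_trans (cu i) _; rewrite ge_min lexx orbT.
- by rewrite scaler_eq0 negb_or gt_eqF.
- exact: TC_Z.
Qed.

Lemma GC_closed A v : (forall e, 0 < e -> exists u, cl e u v /\ GC A u) -> GC A v.
Proof.
move=> h e e0; have e20 : 0 < e / 2 by rewrite divr_gt0.
have [u [cu /(_ _ e20)[p [w [Ap cp cw w0 T]]]]] := h _ e20.
exists p, w; split=> //; first by apply: clW cp; rewrite ler_pdivrMr// mulr2n mulrDr mulr1 lerDl ltW.
by have := cl_trans cw cu; rewrite -splitr.
Qed.

Definition conic C := forall x (t : R), C x -> 0 <= t -> C (t *: x).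

Lemma cone_conic D : conic (cone D).
Proof.
move=> x t [v [s [Dv s0 ->]]] t0; exists v, (t * s); rewrite scalerA; split=> //.
exact: mulr_ge0.
Qed.

Lemma cone_GC A x : x != 0 -> cone (GD A) x <-> GC A x.
Proof.
move=> x0; split=> [[v [t [/GD_GC[sv G] t0 E]]]|G].
  rewrite E; apply: GC_Z => //; rewrite lt_neqAle t0 andbT eq_sym.
  by apply: contra_neq x0 => t00; rewrite E t00 scale0r.
exists ((enorm x)^-1 *: x), (enorm x); split.
- by apply/GD_GC; split; [exact: sphere_unit|apply: GC_Z => //; rewrite invr_gt0 enorm_gt0].
- exact: enorm_ge0.
- by rewrite scalerA divff ?scale1r// enorm0.
Qed.

(** The cone determines its unit vectors, so stabilization may be proved for cones, where rescaling
    and subspaces are available. *)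
Lemma GDpow_cone m A : GDpow m.+1 A = [set a | sphere R n a /\ cone (GDpow m.+1 A) a].
Proof.
have sub : GDpow m.+1 A `<=` sphere R n by case: m => [|m] a [].
apply/seteqP; split=> a /=.
  by move=> h; split; [exact: sub|exists a, 1; rewrite scale1r].
move=> [sa [v [t [h t0 E]]]]; have sv := sub _ h.
suff t1 : t = 1 by rewrite E t1 scale1r.
by move: sa; rewrite E /sphere /= enormZ (sv : enorm v = 1) mulr1 ger0_norm.
Qed.

End Cones.

(** * Growth of the dimension of the subspaces *)

Section Stabilization.
Variables (R : realType) (n : nat).
Notation V := 'rV[R]_n.
Implicit Types (A B C : set V) (p q v u a : V) (e : R).

(* x lies in a k-dimensional subspace contained in C; E is an orthonormal basis of it. *)
Definition Sub k C (x : V) := exists E : 'M[R]_(k, n),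
  [/\ E *m E^T = 1%:M, exists w, x = w *m E & forall w, C (w *m E)].

Definition seq_closed C := forall x : V,
  (forall e, 0 < e -> exists u, cl e u x /\ C u) -> C x.

Lemma cone_zero D (x : V) : cone D x -> cone D 0.
Proof. by move=> h; rewrite -[0](scale0r x); apply: cone_conic. Qed.

Lemma seq_closed_lim C T (U : set_system T) (UF : ProperFilter U) (x : T -> V) (x0 : V) :
  seq_closed C -> (\forall t \near U, C (x t)) -> mlim U x x0 -> C x0.
Proof.
move=> cC Cx xl; apply: cC => e e0.
have [t [h1 h2]] := filter_ex (filterI Cx (mlim_cl UF xl e0)).
by exists (x t).
Qed.

Lemma cl_neq0 (x : V) : x != 0 -> exists2 e, 0 < e & forall u, cl e u x -> u != 0.
Proof.
move=> x0; have [i xi] : exists i, x 0 i != 0.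
  apply: contrapT => h; move/eqP: x0; apply; apply/rowP => i; rewrite mxE.
  by apply: contrapT => /eqP xi; apply: h; exists i.
exists `|x 0 i|; rewrite ?normr_gt0// => u hu; apply: contraTneq (hu i) => ->.
by rewrite mxE sub0r normrN ltxx.
Qed.

Lemma cone_GD_closed A : seq_closed (cone (GD A)).
Proof.
move=> x h; have [->|x0] := eqVneq x 0.
  by have [u [_ Cu]] := h 1 ltr01; exact: cone_zero Cu.
apply/cone_GC => //; apply: GC_closed => e e0.
have [d d0 hd] := cl_neq0 x0.
have [|u [cu Cu]] := h (Num.min e d); first by rewrite lt_min e0.
exists u; split; first by apply: clW cu; rewrite ge_min lexx.
by apply/cone_GC => //; apply: hd; apply: clW cu; rewrite ge_min lexx orbT.
Qed.

Lemma ultra_oo : exists U : set_system nat, UltraFilter U /\ \oo `<=` U.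
Proof. exact: ultraFilterLemma. Qed.

Lemma mlim_sub (U : set_system nat) k l (M : nat -> 'M[R]_(k, l)) M0 : \oo `<=` U ->
  mlim \oo M M0 -> mlim U M M0.
Proof. by move=> sU h i j; apply: cvg_trans (h i j); move=> P; exact: sU. Qed.

Lemma Sub_lim k C (u : nat -> V) a : seq_closed C -> (forall j, Sub k C (u j)) ->
  mlim \oo u a -> Sub k C a.
Proof.
move=> cC /choice[E hE] ua; have [U [UU sU]] := ultra_oo.
have UP : ProperFilter U by exact: ultra_proper.
have [|E0 [EE0 E0E]] := @orth_lim R k n nat U UU E.
  by apply: nearW => j; case: (hE j).
have ua' := mlim_sub sU ua.
exists E0; split=> //.
  exists (a *m E0^T); apply: (mlim_uniq UP ua').
  have h := mlimM UP (mlimM UP ua' (mlim_tr EE0)) EE0.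
  apply: mlim_near h; apply: nearW => j; have [EE [w ->] _] := hE j.
  by rewrite -(mulmxA w) EE mulmx1.
move=> w; apply: (seq_closed_lim UP cC _ (mlimM UP (mlim_cst UP w) EE0)).
by apply: nearW => j; case: (hE j).
Qed.

(** Rescaling moves [p] as close to 0 as desired, while [v] remains tangent because the set is
    conic. *)
Lemma TC_conic C p v : conic C -> seq_closed C -> v != 0 -> TC C p v -> cone (GD C) v.
Proof.
move=> nC cC v0 T; apply/cone_GC => // e e0.
have [x [t [xC t0 xp xv]]] := TC_seq T.
have Cp : C p by apply: (seq_closed_lim _ cC _ xp); apply: nearW.
pose N := 1 + \sum_i `|p 0 i|.
have N0 : 0 < N by rewrite ltr_pwDl// sumr_ge0.
have s0 : 0 < e / N by rewrite divr_gt0.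
exists (e / N *: p), v; split=> //.
- by apply: nC => //; exact: ltW.
- move=> i; rewrite !mxE subr0 normrM gtr0_norm// mulrAC ltr_pdivrMr// ltr_pM2l//.
  rewrite /N (bigD1 i) //= addrA [1 + _]addrC -addrA ltrDl ltr_pwDl// sumr_ge0//.
- by move=> i; rewrite subrr normr0.
apply: (@TC_lim _ _ _ \oo _ C _ v (fun j => e / N *: x j) (fun j => t j / (e / N))) => //.
- by apply: nearW => j; apply: nC => //; exact: ltW.
- by apply: nearW => j; rewrite divr_gt0.
- exact: mlimZ (cvg_cst _) xp.
- apply: mlim_near xv; apply: nearW => j.
  by rewrite -scalerBr scalerA divfK// gt_eqF.
Qed.

(** A nonzero point of a conic set is tangent to its own ray at points arbitrarily close to 0. Hence
    the cones increase with the degree. *)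
Lemma conic_sub C (x : V) : conic C -> C x -> x != 0 -> cone (GD C) x.
Proof.
move=> nC Cx x0; apply/cone_GC => // e e0.
pose N := 1 + \sum_i `|x 0 i|.
have N0 : 0 < N by rewrite ltr_pwDl// sumr_ge0.
have small i s : 0 < s -> `|s / N * x 0 i| < s.
  move=> s0; rewrite normrM gtr0_norm ?divr_gt0// mulrAC ltr_pdivrMr// ltr_pM2l//.
  rewrite /N (bigD1 i) //= addrA [1 + _]addrC -addrA ltrDl ltr_pwDl// sumr_ge0//.
have s0 : 0 < e / N by rewrite divr_gt0.
exists (e / N *: x), x; split=> //.
- by apply: nC => //; exact: ltW.
- by move=> i; rewrite !mxE subr0; exact: small.
- by move=> i; rewrite subrr normr0.
move=> d d0; exists (e / N *: x + d / N *: x), (N / d).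
have dN : 0 < d / N by rewrite divr_gt0.
split; first by rewrite -scalerDl; apply: nC => //; rewrite addr_ge0// ltW.
- by rewrite divr_gt0.
- by move=> i; rewrite !mxE addrAC subrr add0r; exact: small.
- have -> : N / d *: (e / N *: x + d / N *: x - e / N *: x) = x.
    rewrite addrAC subrr add0r scalerA (_ : N / d * (d / N) = 1) ?scale1r//.
    by field; rewrite !gt_eqF.
  by move=> i; rewrite subrr normr0.
Qed.

Lemma TC_nonzero (U : set_system nat) (UU : UltraFilter U) p u (x : nat -> V) (t : nat -> R) :
  mlim U x p -> mlim U (fun j => t j *: (x j - p)) u -> u != 0 ->
  ae U (fun j => x j != 0).
Proof.
move=> xp xu u0; have UP : ProperFilter U by exact: ultra_proper.
have [h|h] := ae_dec UU (fun j => x j = 0); last by apply: aeW h => j /eqP.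
exfalso; have p0 : p = 0.
  apply: (mlim_uniq UP xp); apply: (mlim_near UP _ (mlim_cst UP 0)).
  by apply: aeW h => j ->.
move/eqP: u0; apply; apply: (mlim_uniq UP xu); apply: (mlim_near UP _ (mlim_cst UP 0)).
by apply: aeW h => j ->; rewrite p0 subrr scaler0.
Qed.

(** In a coordinate where [u] is nonzero, $1/t_j$ is the quotient of a coordinate of $x_j-p$, which
    tends to 0, by one of $t_j(x_j-p)$, which does not. *)
Lemma TC_rate (U : set_system nat) (UU : UltraFilter U) p u (x : nat -> V) (t : nat -> R) :
  mlim U x p -> mlim U (fun j => t j *: (x j - p)) u -> u != 0 ->
  (fun j => (t j)^-1) @ U --> (0 : R).
Proof.
move=> xp xu u0; have UP : ProperFilter U by exact: ultra_proper.
have [i ui] : exists i, u 0 i != 0.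
  apply: contrapT => h; move/eqP: u0; apply; apply/rowP => i; rewrite mxE.
  by apply: contrapT => /eqP xi; apply: h; exists i.
have h1 : (fun j => (x j - p) 0 i) @ U --> (0 : R).
  by have h0 := mlimB UP xp (mlim_cst UP p); have := h0 0 i; rewrite subrr mxE.
have h2 : (fun j => (x j - p) 0 i * ((t j *: (x j - p)) 0 i)^-1) @ U --> 0 * (u 0 i)^-1.
  by apply: cvgM h1 _; apply: cvgV => //; exact: xu.
rewrite mul0r in h2; apply: cvg_trans h2; apply: near_eq_cvg.
have /cvgrPdist_lt/(_ `|u 0 i|) := xu 0 i; rewrite normr_gt0 => /(_ ui).
apply: filterS => j hj.
have nz : (t j *: (x j - p)) 0 i != 0.
  by apply: contraTneq hj => ->; rewrite subr0 ltxx.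
have tE : (t j *: (x j - p)) 0 i = t j * (x j - p) 0 i by rewrite [LHS]mxE.
move: nz; rewrite tE mulf_eq0 negb_or => /andP[tn xn].
by rewrite invfM mulrCA divff ?mulr1.
Qed.

Section Step.
Variables (C B : set V) (k : nat).
Hypotheses (nC : conic C) (cC : seq_closed C).
Hypothesis CB : forall x, C x -> x != 0 -> B x \/ Sub k C x.
Hypothesis BC : forall p v, TC B p v -> v != 0 -> C v.

(* Points q_j -> p in C carry k-planes of C, which converge to a k-plane F at p;
   F + R u consists of limits of tangent directions and has dimension k + 1, as u is not in C. *)
Lemma Sub_tangent p u : u != 0 -> ~ C u -> TC C p u -> Sub k.+1 (cone (GD C)) u.
Proof.
move=> u0 nCu T; have [x [t [xC t0 xp xu]]] := TC_seq T.
have C'u := TC_conic nC cC u0 T.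
have [U [UU sU]] := ultra_oo; have UP : ProperFilter U by exact: ultra_proper.
have xp' := mlim_sub sU xp; have xu' := mlim_sub sU xu.
have x0 := TC_nonzero UU xp' xu' u0; have tV := TC_rate UU xp' xu' u0.
(* Points [x j] in [B] along [U] would put [u] into [C] by [BC]. *)
have xS : ae U (fun j => Sub k C (x j)).
  have [h|h] := ae_dec UU (fun j => B (x j)).
    exfalso; apply: nCu; apply: (@BC p) => //; apply: (TC_lim UP h _ xp' xu').
    exact: nearW.
  by apply: aeW (aeI UU h x0) => j [nB xj]; case: (CB (xC j) xj).
have /choice[E hE] : forall j, exists E : 'M[R]_(k, n), Sub k C (x j) ->
    [/\ E *m E^T = 1%:M, exists w, x j = w *m E & forall w, C (w *m E)].
  move=> j; have [[E h]|nS] := pselect (Sub k C (x j)); first by exists E.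
  by exists 0.
have [|E0 [El EE0]] := @orth_lim R k n nat U UU E.
  by apply: aeW xS => j /hE[].
have CE w : C (w *m E0).
  apply: (seq_closed_lim UP cC _ (mlimM UP (mlim_cst UP w) El)).
  by apply: aeW xS => j /hE[].
have nu : ~ (exists w, u = w *m E0) by move=> [w uw]; apply: nCu; rewrite uw.
have [E' [EE' uE' _ hE']] := orth_extend EE0 nu.
exists E'; split=> // v; have [w [s ->]] := hE' v.
(* The points [sg *: x j + (t j)^-1 *: (w' *m E j)] belong to the [k]-plane of [x j], hence to [C],
   also for negative [sg]. They tend to [sg *: p] by [TC_rate], and their secants have the required
   limit. *)
have key (sg : R) w' : sg != 0 -> cone (GD C) (sg *: u + w' *m E0).
  move=> sg0; apply: (@TC_conic C (sg *: p)) => //.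
    apply/eqP => h; apply: nu; exists (- sg^-1 *: w').
    rewrite -scalemxAl scaleNr -scalerN; move/eqP: h; rewrite addr_eq0 => /eqP <-.
    by rewrite scalerA mulVf// scale1r.
  apply: (@TC_lim _ _ _ U _ C _ _ (fun j => sg *: x j + (t j)^-1 *: (w' *m E j)) t).
  - apply: aeW xS => j /hE[_ [y xy] h]; rewrite xy !scalemxAl -mulmxDl; exact: h.
  - exact: nearW.
  - rewrite -[X in mlim _ _ X]addr0 -[X in _ + X](scale0r (w' *m E0)).
    apply: mlimD => //; first exact: mlimZ (cvg_cst _) xp'.
    by apply: mlimZ => //; exact: mlimM (mlim_cst UP _) El.
  - have h : mlim U (fun j => sg *: (t j *: (x j - p)) + w' *m E j) (sg *: u + w' *m E0).
      by apply: mlimD => //; [exact: mlimZ (cvg_cst _) xu'|exact: mlimM (mlim_cst UP _) El].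
    apply: (mlim_near UP _ h); apply: nearW => j.
    rewrite addrAC -scalerBr [RHS]scalerDr !scalerA.
    by rewrite divff ?gt_eqF// scale1r mulrC.
have [->|sn] := eqVneq s 0.
  rewrite scale0r addr0; have [->|w0] := eqVneq (w *m E0) 0; first exact: cone_zero C'u.
  exact: conic_sub.
by rewrite addrC; exact: key.
Qed.

(** Re-establishes [CB] one dimension higher, with the present cone [C] as the new exceptional set.
    A point outside the closed set [C] is a limit of tangent vectors outside [C], to which
    [Sub_tangent] applies; [Sub_lim] passes to the limit. *)
Lemma Sub_next x : cone (GD C) x -> x != 0 -> C x \/ Sub k.+1 (cone (GD C)) x.
Proof.
move=> C'x x0; have [Cx|nCx] := pselect (C x); [by left|right].
have [e0 e00 he0] : exists2 e, 0 < e & forall u, cl e u x -> ~ C u.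
  apply: contrapT => h; apply: nCx; apply: cC => e ep; apply: contrapT => h'.
  by apply: h; exists e => // u cu Cu; apply: h'; exists u.
have G : GC C x by apply/cone_GC.
have /choice[u hu] : forall j, exists u : V, [/\ cl j.+1%:R^-1 u x & Sub k.+1 (cone (GD C)) u].
  move=> j; have [|p [u [Cp cp cu u0 T]]] := G (Num.min e0 j.+1%:R^-1).
    by rewrite lt_min e00 invr_gt0 ltr0n.
  exists u; split; first by apply: clW cu; rewrite ge_min lexx orbT.
  apply: (Sub_tangent u0 _ T); apply: he0; apply: clW cu; by rewrite ge_min lexx.
apply: (@Sub_lim _ _ u); first exact: cone_GD_closed.
  by move=> j; case: (hu j).
by apply: cl_mlim => j; case: (hu j).
Qed.

(** For $k\ge n$ a [k]-plane in [C] is the whole space. If there is none, all nonzero points of [C]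
    lie in [B], and [BC] returns their tangent vectors to [C]. *)
Lemma Sub_stable x : (n <= k)%N -> cone (GD C) x -> x != 0 -> C x.
Proof.
move=> nk C'x x0.
have [[y [Cy y0 [E [EE _ CE]]]]|nS] := pselect (exists y, [/\ C y, y != 0 & Sub k C y]).
  have kn : k = n by apply/eqP; rewrite eqn_leq nk (orth_le EE).
  by subst k; have [w ->] := orth_full x EE; exact: CE.
have G : GC C x by apply/cone_GC.
apply: cC => e e0; have [p [u [Cp cp cu u0 T]]] := G _ e0; exists u; split=> //.
apply: (@BC p) => //; have [z [t [zC t0 zp zu]]] := TC_seq T.
have [U [UU sU]] := ultra_oo; have UP : ProperFilter U by exact: ultra_proper.
have zp' := mlim_sub sU zp; have zu' := mlim_sub sU zu.
apply: (TC_lim UP _ _ zp' zu'); last exact: nearW.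
apply: aeW (TC_nonzero UU zp' zu' u0) => j zj.
by case: (CB (zC j) zj) => // S; exfalso; apply: nS; exists (z j).
Qed.

End Step.

(** Degree [m.+1] comes with planes of dimension [m.+2], from dimension 2 in degree 1 on.
    [Sub_stable] therefore applies as soon as $n\le m+2$, which is the source of the degree
    $n-1$. *)
Lemma GDpow_stable A B : (1 <= n)%N ->
  (forall x, cone (GD A) x -> x != 0 -> B x \/ Sub 2 (cone (GD A)) x) ->
  (forall p v, TC B p v -> v != 0 -> cone (GD A) v) ->
  forall m m0, (1 <= m0)%N -> (n <= m0.+1)%N -> (m0 <= m)%N -> GDpow m A = GDpow m0 A.
Proof.
move=> n1 AB BA.
have ind m : exists B', (forall x, cone (GDpow m.+1 A) x -> x != 0 ->
     B' x \/ Sub m.+2 (cone (GDpow m.+1 A)) x) /\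
   (forall p v, TC B' p v -> v != 0 -> cone (GDpow m.+1 A) v).
  elim: m => [|m [B' [h1 h2]]]; first by exists B.
  have nC : conic (cone (GDpow m.+1 A)) by exact: cone_conic.
  have cC : seq_closed (cone (GDpow m.+1 A)) by case: m {h1 h2 nC} => [|m]; exact: cone_GD_closed.
  exists (cone (GDpow m.+1 A)); split; first exact: (Sub_next nC cC h1 h2).
  by move=> p v T v0; exact: TC_conic nC cC v0 T.
have stab m : (n <= m.+2)%N -> GDpow m.+2 A = GDpow m.+1 A.
  move=> nm; have [B' [h1 h2]] := ind m.
  have nC : conic (cone (GDpow m.+1 A)) by exact: cone_conic.
  have cC : seq_closed (cone (GDpow m.+1 A)) by case: m {h1 h2 nC nm} => [|m]; exact: cone_GD_closed.
  rewrite [LHS]GDpow_cone [RHS]GDpow_cone; apply/seteqP.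
  have sp (a : V) : sphere R n a -> a != 0 by move=> sa; rewrite -enorm_gt0 sa.
  split=> a /= [sa h]; split=> //; first exact: (Sub_stable cC h1 h2 nm h (sp _ sa)).
  by apply: conic_sub => //; exact: sp.
move=> m [//|m0] _ nm; elim: m => [//|m IH].
rewrite leq_eqVlt => /orP[/eqP <- //|]; rewrite ltnS => m0m.
rewrite -IH//; case: m m0m {IH} => // m m0m; apply: stab.
exact: leq_trans nm _.
Qed.

End Stabilization.

(** * Secants and velocities of arcs *)

Section Paths.
Variables (R : realType).
Notation pt := (nat -> R).

Lemma derive_eps (g : R -> R) (t0 l e : R) : is_derive t0 1 g l -> 0 < e ->
  exists2 d, 0 < d & forall h, h != 0 -> `|h| < d -> `|(g (t0 + h) - g t0) / h - l| < e.
Proof.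
move=> [dg dl] e0; have : (fun h => h^-1 *: (g (h *: 1 + t0) - g t0)) @ 0^' --> l.
  by rewrite -dl.
move=> /cvgrPdist_lt/(_ _ e0); rewrite near_withinE => /nbhs_ballP[d /= d0 h].
exists d => // x x0 xd; have := h x; rewrite /ball /= sub0r normrN => /(_ xd x0).
have -> : x%:A + t0 = t0 + x by rewrite /GRing.scale /= mulr1 addrC.
have -> : (g (t0 + x) - g t0) / x = x^-1 *: (g (t0 + x) - g t0) by rewrite mulrC.
by rewrite distrC.
Qed.

Definition dif m (y0 y : 'rV[R]_m) : pt := fun i =>
  if @insub nat (fun i => (i < m)%N) 'I_m i is Some j then y 0 j - y0 0 j else 0.

Lemma difE m (y0 y : 'rV[R]_m) (i : 'I_m) : dif y0 y i = y 0 i - y0 0 i.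
Proof. by rewrite /dif valK. Qed.

Lemma vec_dif m (y0 y : 'rV[R]_m) : y0 + vec m (dif y0 y) = y.
Proof. by apply/rowP => i; rewrite !mxE difE addrC subrK. Qed.

Lemma dif_tends m T (U : set_system T) (UF : ProperFilter U) (y : T -> 'rV[R]_m) y0 :
  mlim U y y0 -> tends U m (fun t => dif y0 (y t)).
Proof.
move=> h i im; have -> : i = Ordinal im by [].
have h' := mlimB UF h (mlim_cst UF y0); have := h' 0 (Ordinal im).
rewrite subrr [X in _ --> X]mxE; apply: cvg_trans; apply: near_eq_cvg.
by apply: nearW => t; rewrite difE !mxE.
Qed.

Lemma vec_lim m T (U : set_system T) (y0 : 'rV[R]_m) (x : T -> pt) (x0 : pt) (UF : ProperFilter U) :
  (forall i, (i < m)%N -> (fun t => x t i) @ U --> x0 i) ->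
  mlim U (fun t => y0 + vec m (x t)) (y0 + vec m x0).
Proof.
move=> h; apply: (mlimD UF (mlim_cst UF y0)) => i j; rewrite mxE.
apply: cvg_trans (h j (ltn_ord j)); apply: near_eq_cvg.
by apply: nearW => t; rewrite mxE.
Qed.

Lemma analytic_lim m (g : 'rV[R]_m -> R) T (U : set_system T) (UF : ProperFilter U)
    (y : T -> 'rV[R]_m) y0 : analytic_at g y0 -> mlim U y y0 ->
  (fun t => g (y t)) @ U --> g y0.
Proof.
move=> /analytic_An gA h.
have c : (fun t => g (y0 + vec m (dif y0 (y t)))) @ U --> g (y0 + vec m (@pt0 R)).
  by apply: (An_cvg0 gA (dif_tends UF h)).
have E : y0 + vec m (@pt0 R) = y0 by apply/rowP => i; rewrite !mxE addr0.
by rewrite E in c; apply: cvg_trans c; apply: near_eq_cvg; apply: nearW => t; rewrite vec_dif.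
Qed.

(** The path runs on both sides of time 0: positive times give [v], negative ones [- v]. This is
    where the symmetry of the cone originates. *)
Lemma deriv_TC n (A : set 'rV[R]_n) (c : R -> 'rV[R]_n) (v : 'rV[R]_n) :
  (forall l, is_derive (0 : R) 1 (fun t => c t 0 l) (v 0 l)) ->
  (\forall t \near (0 : R), A (c t)) -> TC A (c 0) v /\ TC A (c 0) (- v).
Proof.
move=> dc Ac.
have [d0 d00 hd0] : exists2 d : R, 0 < d & forall t, `|t| < d -> A (c t).
  move/nbhs_ballP : Ac => [d /= d00 h]; exists d => // t td; apply: h.
  by rewrite /ball /= sub0r normrN.
have key e : 0 < e -> exists2 d, 0 < d & forall h, h != 0 -> `|h| < d ->
    A (c h) /\ cl e (c h) (c 0) /\ cl e (h^-1 *: (c h - c 0)) v.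
  (* The tolerance [Num.min e 1] bounds the difference quotients by [N], so that a small [h] also
     brings [c h] close to [c 0]. *)
  move=> e0; pose N := 1 + \sum_l `|v 0 l|.
  have N0 : 0 < N by rewrite ltr_pwDl// sumr_ge0.
  have [d1 d10 h1] : exists2 d : R, 0 < d & forall l, (l < n)%N ->
      forall (lt : (l < n)%N) h, h != 0 -> `|h| < d ->
      `|(c (0 + h) 0 (Ordinal lt) - c 0 0 (Ordinal lt)) / h - v 0 (Ordinal lt)| < Num.min e 1.
    apply: (@min_rad R n (fun l d => forall (lt : (l < n)%N) h, h != 0 -> `|h| < d ->
      `|(c (0 + h) 0 (Ordinal lt) - c 0 0 (Ordinal lt)) / h - v 0 (Ordinal lt)| < Num.min e 1)).
      by move=> i d d' _ dd h lt x x0 xd; apply: h => //; exact: lt_le_trans dd.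
    move=> l ln; have m0 : 0 < Num.min e 1 by rewrite lt_min e0 ltr01.
    have [d dd h] := derive_eps (dc (Ordinal ln)) m0; exists d => // lt x x0 xd.
    by rewrite (bool_irrelevance lt ln); exact: h.
  exists (Num.min d0 (Num.min d1 (e / (N + 1)))).
    by rewrite !lt_min d00 d10 divr_gt0// addr_gt0.
  move=> h h0; rewrite !lt_min => /and3P[hd hd1 he].
  have D l : `|h^-1 * (c h 0 l - c 0 0 l) - v 0 l| < Num.min e 1.
    have := h1 l (ltn_ord l) (ltn_ord l) h h0 hd1; rewrite add0r mulrC.
    by have -> : Ordinal (ltn_ord l) = l by apply: val_inj.
  split; first exact: hd0; split=> l; last first.
    by rewrite !mxE; apply: lt_le_trans (D l) _; rewrite ge_min lexx.
  have -> : c h 0 l - c 0 0 l = h * (h^-1 * (c h 0 l - c 0 0 l)) by rewrite mulVKf.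
  rewrite normrM; have : `|h^-1 * (c h 0 l - c 0 0 l)| <= N.
    have := ler_normD (h^-1 * (c h 0 l - c 0 0 l) - v 0 l) (v 0 l); rewrite subrK.
    have Dl : `|h^-1 * (c h 0 l - c 0 0 l) - v 0 l| <= 1.
      by apply: le_trans (ltW (D l)) _; rewrite ge_min lexx orbT.
    have : `|v 0 l| <= \sum_l `|v 0 l| by rewrite (bigD1 l) //= lerDl sumr_ge0.
    rewrite /N; lra.
  move=> hN; apply: le_lt_trans (ler_wpM2l (normr_ge0 h) hN) _.
  have N1 : 0 < N + 1 by rewrite addr_gt0.
  rewrite ltr_pdivlMr// in he; apply: le_lt_trans he.
  by rewrite ler_wpM2l// lerDl.
split=> e e0; have [d dd h] := key e e0.
  have d20 : 0 < d / 2 by rewrite divr_gt0.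
  have [||h1 [h2 h3]] := h (d / 2); first by rewrite gt_eqF.
    by rewrite gtr0_norm// ltr_pdivrMr// mulr2n mulrDr mulr1 ltrDl.
  by exists (c (d / 2)), (d / 2)^-1; split=> //; rewrite invr_gt0.
have d20 : 0 < d / 2 by rewrite divr_gt0.
have [||h1 [h2 h3]] := h (- (d / 2)); first by rewrite oppr_eq0 gt_eqF.
  by rewrite normrN gtr0_norm// ltr_pdivrMr// mulr2n mulrDr mulr1 ltrDl.
exists (c (- (d / 2))), (d / 2)^-1; split=> //; first by rewrite invr_gt0.
by move=> l; have := h3 l; rewrite !mxE invrN mulNr -opprD normrN opprK.
Qed.

End Paths.

(** * Monomial charts of an analytic set with an analytic map *)

Section Charts.
Variables (R : realType) (m n : nat).
Notation pt := (nat -> R).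
Variables (W Y : set 'rV[R]_m) (f : 'rV[R]_m -> 'rV[R]_n).
Hypotheses (Yan : analytic_subset W Y) (fan : analytic_map_on W f).

Lemma vec_ext (x x' : pt) : (forall i, (i < m)%N -> x i = x' i) -> vec m x = vec m x'.
Proof. by move=> h; apply/rowP => i; rewrite !mxE h. Qed.

Lemma Mono1_neq0 s (g : pt -> R) : Mono1 s g -> exists2 d, 0 < d &
  forall w, Dom xpredT s d w -> g w != 0.
Proof.
move=> [al [u [uA u0 gu]]]; have [d d0 h] := nzI gu (An_neq0 uA u0).
exists d => // w [cw w0]; have [-> ub] := h w cw; rewrite mulf_neq0//.
  by apply: lt0r_neq0; apply: mono_gt0 => i im _; exact: w0.
by rewrite -normr_gt0; apply: lt_le_trans ub; rewrite divr_gt0// normr_gt0.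
Qed.

Lemma min_exponent (I : finType) (J : pred I) (A : I -> nat -> nat) k :
  (exists i, J i) ->
  (forall i j, J i -> J j -> (forall l, (l < k)%N -> (A i l <= A j l)%N) \/
                             (forall l, (l < k)%N -> (A j l <= A i l)%N)) ->
  exists2 i, J i & forall j, J j -> forall l, (l < k)%N -> (A i l <= A j l)%N.
Proof.
move=> [i1 Ji1] cmp; pose sz i := (\sum_(l < k) A i l)%N.
have [i Ji imin] : exists2 i, J i & forall j, J j -> (sz i <= sz j)%N.
  by case: (arg_minnP sz Ji1) => i *; exists i.
exists i => // j Jj; have [//|h] := cmp i j Ji Jj.
move=> l lk; have := imin j Jj; rewrite /sz (bigD1 (Ordinal lk)) //=.
rewrite [in X in (_ <= X)%N -> _](bigD1 (Ordinal lk)) //=.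
have le : (\sum_(l0 < k | l0 != Ordinal lk) A j l0 <=
   \sum_(l0 < k | l0 != Ordinal lk) A i l0)%N by apply: leq_sum => l0 _; exact: h.
move=> le2; have := leq_trans le2 (leq_add (leqnn _) le).
by rewrite leq_add2r.
Qed.

Lemma nz_open s (p : pt -> pt) (y0 : 'rV[R]_m) (V : set 'rV[R]_m) : open V -> V y0 ->
  (forall i, (i < m)%N -> An s (fun w => p w i)) ->
  (forall i, (i < m)%N -> p pt0 i = 0) -> nz s (fun w => V (y0 + vec m (p w))).
Proof.
move=> oV Vy pA p0; have /near_rV[e e0 h] := open_nbhs_nbhs (conj oV Vy).
have e20 : 0 < e / 2 by rewrite divr_gt0.
suff V' : nz m (fun w => V (y0 + vec m w)) by exact: nz_comp pA p0 V'.
exists (e / 2) => // w cw; apply: h => i.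
rewrite !mxE addrAC subrr add0r; apply: le_lt_trans (cw i (ltn_ord i)) _.
by rewrite ltr_pdivrMr// mulr2n mulrDr mulr1 ltrDl.
Qed.

(** The local equations of [Y], the components of $f-f(y_0)$ and the differences of two components
    are monomialized together. An equation vanishes along the germ, where a monomial times a unit
    does not, so it vanishes identically and the chart maps into [Y]. The differences make the
    exponents comparable, and the least monomial divides all components. *)
Lemma monomial_chart T (U : set_system T) (UU : UltraFilter U) (y : T -> 'rV[R]_m) y0 :
  W y0 -> ae U (fun t => Y (y t)) -> mlim U y y0 ->
  exists s p z, [/\ Lift U m (fun t => dif y0 (y t)) s xpredT p z,
    nz s (fun w => Y (y0 + vec m (p w))),
    forall l, An s (fun w => f (y0 + vec m (p w)) 0 l) &
    nz s (fun w => forall l, f (y0 + vec m (p w)) 0 l = f y0 0 l) \/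
    exists al (H : 'I_n -> pt -> R) l0, [/\ forall l, An s (H l), H l0 pt0 != 0 &
      nz s (fun w => forall l, f (y0 + vec m (p w)) 0 l = f y0 0 l + mono s al w * H l w)]].
Proof.
move=> Wy0 Yy yl; have UP : ProperFilter U by exact: ultra_proper.
have [YW /(_ _ Wy0)[V [k [g [oV Vy VW gA YV]]]]] := Yan.
pose F l (w : pt) := f (y0 + vec m w) 0 l - f y0 0 l.
have FA l : An m (F l) by apply: An_B (An_cst _ _); exact: (@analytic_An R m (fun x => f x 0 l) y0 (fan l Wy0)).
pose I : finType := ('I_k + 'I_n + 'I_n * 'I_n)%type.
pose G (i : I) : pt -> R := match i with
  | inl (inl j) => fun w => g j (y0 + vec m w)
  | inl (inr l) => F l
  | inr (l, l') => fun w => F l w - F l' w end.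
have [|s [p [z [_ L hM]]]] :=
  @local_monomialization R T U UU m (fun t => dif y0 (y t)) I G (dif_tends UP yl).
  case=> [[j|l]|[l l']]; last exact: An_B.
    by apply: analytic_An; exact: gA.
  exact: FA.
have yE : ae U (fun t => y t = y0 + vec m (p (z t))).
  apply: aeW (ae_all UU (lift_eq L)) => t h.
  by rewrite -[LHS](vec_dif y0); congr (_ + _); apply: vec_ext => i im; rewrite h.
have pA := lift_An L; have p0 := lift_0 L.
exists s, p, z; split=> //.
- have g0 j : nz s (fun w => g j (y0 + vec m (p w)) = 0).
    case: (hM (inl (inl j))) => //= /Mono1_neq0[d d0 h]; exfalso.
    have zD : ae U (fun t => Dom xpredT s d (z t)).
      apply: aeW (aeI UU (tends_cube UU (lift_tends L) d0)
        (ae_all UU (fun i im => lift_pos L im isT))) => t [h1 h2].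
      by split=> // i im _; exact: h2.
    have yV : ae U (fun t => V (y t)).
      have /near_rV[e e0 hV] := open_nbhs_nbhs (conj oV Vy).
      by apply: aeW (mlim_cl UP yl e0) => t /hV.
    have [t [[h1 h2] [h3 h4]]] := ae_ex UU (aeI UU (aeI UU zD yV) (aeI UU yE Yy)).
    have : (Y `&` V) (y t) by [].
    by rewrite YV => -[_ /(_ j)]; rewrite h3 => /eqP; apply/negP; exact: h.
  have Vn := nz_open oV Vy pA p0.
  have gn : nz s (fun w => forall (j : nat) (jk : (j < k)%N),
      g (Ordinal jk) (y0 + vec m (p w)) = 0).
    have [d d0 h] : nz s (fun w => forall j, (j < k)%N -> forall jk : (j < k)%N,
        g (Ordinal jk) (y0 + vec m (p w)) = 0).
      apply: nz_all => j jk; apply: nzW (g0 (Ordinal jk)) => w h jk'.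
      by rewrite (bool_irrelevance jk' jk).
    by exists d => // w cw j jk; exact: h.
  apply: nzW (nzI Vn gn) => w [Vw gw].
  suff : (Y `&` V) (y0 + vec m (p w)) by case.
  rewrite YV; split=> // i; have := gw i (ltn_ord i).
  by have -> : Ordinal (ltn_ord i) = i by apply: val_inj.
- move=> l; have := An_D (An_comp' (FA l) pA p0) (An_cst s (f y0 0 l)).
  by move=> /An_ext; apply; apply: nzT => w; rewrite /F subrK.
pose Ph l w := F l (p w).
have PhM l : MonoZ s (Ph l) by exact: (hM (inl (inr l))).
have [all0|] := pselect (forall l, nz s (fun w => Ph l w = 0)).
  left; have [d d0 h] : nz s (fun w => forall l, (l < n)%N -> forall ln : (l < n)%N,
      Ph (Ordinal ln) w = 0).
    apply: nz_all => l ln; apply: nzW (all0 (Ordinal ln)) => w h ln'.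
    by rewrite (bool_irrelevance ln' ln).
  exists d => // w cw l; have := h w cw l (ltn_ord l) (ltn_ord l).
  have -> : Ordinal (ltn_ord l) = l by apply: val_inj.
  by rewrite /Ph /F => /eqP; rewrite subr_eq0 => /eqP.
move=> /existsNP[l1 nl1]; right.
have /choice[av hav] : forall l, exists av : (nat -> nat) * (pt -> R),
    Mono1 s (Ph l) -> [/\ An s av.2, av.2 pt0 != 0 &
      nz s (fun w => Ph l w = mono s av.1 w * av.2 w)].
  move=> l; have [[al [v h]]|N] := pselect (Mono1 s (Ph l)); first by exists (al, v).
  by exists (fun=> 0%N, fun=> 0).
pose J (l : 'I_n) := `[< Mono1 s (Ph l) >].
have [||l0 Jl0 lmin] := @min_exponent _ J (fun l => (av l).1) s.
- by exists l1; apply/asboolP; case: (PhM l1).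
- move=> l l' /asboolP/hav[uA u0 uE] /asboolP/hav[vA v0 vE].
  apply: (mono_comparable uA vA u0 v0).
  have E : nz s (fun w => Ph l w - Ph l' w =
      mono s (av l).1 w * (av l).2 w - mono s (av l').1 w * (av l').2 w).
    by apply: nzW (nzI uE vE) => w [-> ->].
  case: (hM (inr (l, l'))) => /= h'.
    by left; apply: nzW (nzI h' E) => w [h1 <-]; rewrite -[RHS]h1.
  by right; apply: Mono1_ext h'; apply: nzW E => w <-.
have [v0A v00 v0E] := hav l0 (asboolW Jl0).
pose al := (av l0).1.
pose H l (w : pt) := if J l then mono s (fun i => (av l).1 i - al i)%N w * (av l).2 w else 0.
exists al, H, l0; split.
- move=> l; rewrite /H /J; case: asboolP => [/hav[uA _ _]|_]; last exact: An_cst.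
  by apply: An_M uA; exact: An_mono.
- by rewrite /H Jl0 mono0 ?mul1r// => i _; rewrite subnn.
have [d d0 h] : nz s (fun w => forall l, (l < n)%N -> forall ln : (l < n)%N,
    Ph (Ordinal ln) w = mono s al w * H (Ordinal ln) w).
  apply: nz_all => l ln.
  have : nz s (fun w => Ph (Ordinal ln) w = mono s al w * H (Ordinal ln) w).
    rewrite /H /J; case: asboolP => [M|nM]; last first.
      by case: (PhM (Ordinal ln)) => // h; apply: nzW h => w ->; rewrite mulr0.
    have [uA u0 uE] := hav _ M; apply: nzW uE => w ->.
    rewrite mulrA -monoD; congr (_ * _); apply: mono_ext => // i im; rewrite subnKC//.
    by apply: lmin => //; apply/asboolP.
  by apply: nzW => w h ln'; rewrite (bool_irrelevance ln' ln).
exists d => // w cw l; have := h w cw l (ltn_ord l) (ltn_ord l).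
have -> : Ordinal (ltn_ord l) = l by apply: val_inj.
by move=> <-; rewrite /Ph /F addrCA subrr addr0.
Qed.

End Charts.

(** * Derivatives along paths that scale one coordinate *)

Section PathDerivatives.
Variable R : realType.
Notation pt := (nat -> R).
Implicit Types (f g : R -> R) (t l k : R).

Lemma is_derD f g t l k : is_derive t 1 f l -> is_derive t 1 g k ->
  is_derive t 1 (fun s => f s + g s) (l + k).
Proof. by move=> h1 h2; exact: is_deriveD. Qed.

Lemma is_derM f g t l k : is_derive t 1 f l -> is_derive t 1 g k ->
  is_derive t 1 (fun s => f s * g s) (l * g t + f t * k).
Proof.
move=> h1 h2; have h := is_deriveM h1 h2; apply: (is_derive_eq h).
by rewrite addrC /GRing.scale /= mulrC.
Qed.

Lemma is_derZ c f t l : is_derive t 1 f l -> is_derive t 1 (fun s => c * f s) (c * l).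
Proof.
move=> h; apply: is_derive_eq (is_derM (is_derive_cst c t 1) h) _.
by rewrite mul0r add0r.
Qed.

Lemma is_derX f n t l : is_derive t 1 f l ->
  is_derive t 1 (fun s => f s ^+ n) (n%:R * f t ^+ n.-1 * l).
Proof.
move=> h; elim: n => [|n IH].
  by apply: is_derive_eq (is_derive_cst (1 : R) t (1 : R)) _; rewrite !mul0r.
rewrite (_ : (fun s => f s ^+ n.+1) = (fun s => f s * f s ^+ n)); last first.
  by apply/funext => s; rewrite exprS.
apply: is_derive_eq (is_derM h IH) _; case: n {IH} => [|n]; first by rewrite !mul0r expr0; ring.
by rewrite /= exprS -[in RHS]natr1; ring.
Qed.

Lemma is_der_scale c t : is_derive t 1 (fun s => c * (1 + s)) c.
Proof.
have h1 : is_derive t 1 (fun=> 1 : R) 0 by exact: is_derive_cst.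
have h2 : is_derive t 1 (fun s : R => s) 1 by exact: is_derive_id.
by apply: is_derive_eq (is_derZ c (is_derD h1 h2)) _; rewrite add0r mulr1.
Qed.

Lemma is_der_uniq f t l k : is_derive t 1 f l -> is_derive t 1 f k -> l = k.
Proof. by move=> [_ <-] [_ <-]. Qed.

Lemma is_der_near f g t l : (\forall s \near t, f s = g s) -> is_derive t 1 f l ->
  is_derive t 1 g l.
Proof. exact: near_eq_is_derive. Qed.

Lemma path_scale (z : pt) i t j :
  is_derive t 1 (fun s => upd z i (z i * (1 + s)) j) (upd (@pt0 R) i (z i) j).
Proof.
rewrite /upd; case: (eqVneq j i) => _; first exact: is_der_scale.
exact: is_derive_cst.
Qed.

Lemma sum_scale s (D : nat -> R) i v : (i < s)%N ->
  \sum_(j < s) D j * upd (@pt0 R) i v j = D i * v.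
Proof.
move=> im; rewrite (bigD1 (Ordinal im)) //= upd_eq big1 ?addr0// => j ji.
by rewrite upd_neq ?mulr0.
Qed.

Lemma mono_scale s al (z : pt) i v : (i < s)%N ->
  mono s al (upd z i (z i * v)) = mono s al z * v ^+ al i.
Proof.
move=> im; rewrite /mono (bigD1 (Ordinal im)) //= upd_eq [in RHS](bigD1 (Ordinal im)) //=.
rewrite exprMn -!mulrA; congr (_ * _); rewrite mulrC; congr (_ * _).
by apply: eq_bigr => j ji; rewrite upd_neq.
Qed.

(* Along t |-> z with z_i multiplied by 1 + t, the monomial scales by a power of 1 + t. *)
Lemma der_mono_scale s al (H : pt -> R) (D : nat -> R) (z : pt) i t : (i < s)%N ->
  (0 < al i)%N ->
  is_derive t 1 (fun s => H (upd z i (z i * (1 + s))))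
     (\sum_(j < s) D j * upd (@pt0 R) i (z i) j) ->
  is_derive t 1 (fun s0 => mono s al (upd z i (z i * (1 + s0))) * H (upd z i (z i * (1 + s0))))
    (mono s al z * (1 + t) ^+ (al i).-1 *
      ((al i)%:R * H (upd z i (z i * (1 + t))) + z i * (1 + t) * D i)).
Proof.
move=> im a0; rewrite sum_scale// => hH.
have h1 : is_derive t 1 (fun s => 1 + s) (1 : R).
  have := is_der_scale 1 t.
  rewrite (_ : (fun s => 1 * (1 + s)) = (fun s => 1 + s))//.
  by apply/funext => s'; rewrite mul1r.
have h2 := is_derM (is_derZ (mono s al z) (is_derX (al i) h1)) hH.
under eq_fun do rewrite mono_scale//.
apply: (is_derive_eq h2).
have E : (1 + t) ^+ al i = (1 + t) ^+ (al i).-1 * (1 + t) by rewrite -exprSr prednK.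
by rewrite E; ring.
Qed.

End PathDerivatives.

(** * From secants to velocities of arcs *)

Section Arcs.
Variables (R : realType) (m n : nat).
Notation pt := (nat -> R).
Variables (W Y : set 'rV[R]_m) (f : 'rV[R]_m -> 'rV[R]_n) (Gd : set 'rV[R]_m).
Hypotheses (Yan : analytic_subset W Y) (fan : analytic_map_on W f).
Hypothesis Gopen : forall y, Gd y -> exists2 e : R, 0 < e & forall y', Y y' -> cl e y' y -> Gd y'.

(* f (c t) moves with velocity approximately positively proportional to a. *)
Definition arc (e : R) (a : 'rV[R]_n) (c : R -> 'rV[R]_m) := \forall t \near (0 : R),
  [/\ Gd (c t), forall i, dv (fun s => c s 0 i) t, cl e (f (c t)) 0 &
    exists (v : 'rV[R]_n) (b : R), [/\ forall l, is_derive t 1 (fun s => f (c s) 0 l) (v 0 l),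
      0 < b & cl e (b *: v) a]].

Lemma path_near (c : R -> 'rV[R]_m) t0 d : (forall j, dv (fun r => c r 0 j) t0) -> 0 < d ->
  \forall r \near t0, cl d (c r) (c t0).
Proof.
move=> dc d0; have h : mlim (nbhs t0) c (c t0) by move=> i j; rewrite (ord1 i); exact: dv_cts.
exact: mlim_cl h d0.
Qed.

Lemma nz_allI s k (P : 'I_k -> pt -> Prop) : (forall i, nz s (P i)) ->
  nz s (fun w => forall i, P i w).
Proof.
move=> h; have [d d0 hd] : nz s (fun w => forall i, (i < k)%N -> forall ik : (i < k)%N, P (Ordinal ik) w).
  by apply: nz_all => i ik; apply: nzW (h (Ordinal ik)) => w hw ik'; rewrite (bool_irrelevance ik' ik).
exists d => // w cw i; have := hd w cw i (ltn_ord i) (ltn_ord i).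
by have -> : Ordinal (ltn_ord i) = i by apply: val_inj.
Qed.

(** In the chart $f-f(y_0)=z^\alpha H$, so [a] is a positive multiple of $H(0)$. Scaling a
    coordinate $z_i$ with $\alpha_i>0$ moves [f] with velocity a positive multiple of
    $\alpha_iH+z_iD_iH$, nearly proportional to $H(0)$ when [z] is small. The arc passes through a
    point of the germ, so near that point it stays in the relatively open set [Gd]. *)
Lemma arc_exists T (U : set_system T) (UU : UltraFilter U) (y : T -> 'rV[R]_m) y0
    (b : T -> R) (a : 'rV[R]_n) e :
  W y0 -> ae U (fun t => Y (y t)) -> ae U (fun t => Gd (y t)) -> mlim U y y0 ->
  ae U (fun t => 0 < b t) -> a != 0 -> mlim U (fun t => b t *: (f (y t) - f y0)) a ->
  0 < e -> cl e (f y0) 0 -> exists c, arc e a c.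
Proof.
move=> Wy Yy Gy yl b0 a0 fl e0 fe; have UP : ProperFilter U by exact: ultra_proper.
have [s [p [z [L YE fA hM]]]] := monomial_chart Yan fan UU Wy Yy yl.
have pA := lift_An L; have p0 := lift_0 L; have zl := lift_tends L.
have yE : ae U (fun t => y t = y0 + vec m (p (z t))).
  apply: aeW (ae_all UU (lift_eq L)) => t h.
  by rewrite -[LHS](vec_dif y0); congr (_ + _); apply: vec_ext => i im; rewrite h.
have zp : ae U (fun t => forall i, (i < s)%N -> 0 < z t i).
  by apply: ae_all => // i im; exact: lift_pos L _ im _.
case: hM => [h|[al [H [l0 [HA H0 HE]]]]].
  exfalso; move/eqP: a0; apply; apply: (mlim_uniq UP fl); apply: (mlim_near UP _ (mlim_cst UP 0)).
  apply: aeW (aeI UU (tends_nz UU zl h) yE) => t [h1 ->].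
  by apply/rowP => l; rewrite !mxE h1 subrr mulr0.
have fE : ae U (fun t => forall l, f (y t) 0 l = f y0 0 l + mono s al (z t) * H l (z t)).
  by apply: aeW (aeI UU (tends_nz UU zl HE) yE) => t [h1 ->].
have Hl l : (fun t => H l (z t)) @ U --> H l pt0 by apply: An_cvg0 (HA l) zl.
pose mu := a 0 l0 / H l0 pt0.
have bm : (fun t => b t * mono s al (z t)) @ U --> mu.
  have h : (fun t => (b t *: (f (y t) - f y0)) 0 l0 * (H l0 (z t))^-1) @ U --> mu.
    by apply: cvgM; [exact: fl|apply: cvgV => //; exact: Hl].
  apply: cvg_trans h; apply: near_eq_cvg.
  have := Hl l0 => /cvgrPdist_lt/(_ `|H l0 pt0|); rewrite normr_gt0 => /(_ H0) h.
  apply: aeW (aeI UU h fE) => t [h1 h2]; rewrite !mxE h2.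
  have Hn : H l0 (z t) != 0 by apply: contraTneq h1 => ->; rewrite subr0 ltxx.
  by rewrite [f y0 0 l0 + _]addrC addrK mulrA mulfK.
have aE l : a 0 l = mu * H l pt0.
  have h1 : (fun t => b t * mono s al (z t) * H l (z t)) @ U --> mu * H l pt0 by apply: cvgM.
  have h2 : (fun t => b t * mono s al (z t) * H l (z t)) @ U --> a 0 l.
    apply: cvg_trans (fl 0 l); apply: near_eq_cvg; apply: aeW fE => t h.
    by rewrite !mxE h [f y0 0 l + _]addrC addrK mulrA.
  by apply: cvg_unique h2 h1; exact: norm_hausdorff.
(* [mu] is the limit of the positive numbers [b t * mono s al (z t)], and it is nonzero because [a]
   is. *)
have mu0 : 0 < mu.
  rewrite lt_neqAle; apply/andP; split.
    apply: contra_neq a0 => h; apply/rowP => l; by rewrite aE -h mul0r mxE.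
  rewrite leNgt; apply/negP => mu0; rewrite -oppr_gt0 in mu0.
  have /cvgrPdist_lt/(_ _ mu0) := bm => hb.
  have [t [[h1 h2] h3]] := ae_ex UU (aeI UU (aeI UU b0 zp) hb).
  have : 0 < b t * mono s al (z t) by rewrite mulr_gt0// mono_gt0// => i im _; exact: h2.
  by move: h3; rewrite ltr_norml => /andP[]; lra.
have vp0 : y0 + vec m (p pt0) = y0 by apply/rowP => i; rewrite !mxE p0 ?addr0.
have [i im ai] : exists2 i, (i < s)%N & (0 < al i)%N.
  apply: contrapT => na; have [d d0 h] := HE.
  have := h pt0 (cube0 (ltW d0)) l0; rewrite vp0 mono0 => [/eqP|i im].
    by rewrite mul1r -subr_eq0 opprD addrA subrr sub0r oppr_eq0; apply/negP.
  by apply: contrapT => /eqP; rewrite -lt0n => h'; apply: na; exists i.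
have /choice[D hD] : forall l, exists D : nat -> pt -> R,
    (forall i, (i < s)%N -> An s (D i)) /\
    nz s (fun x => forall (c : R -> pt) (c' : pt) t0,
      (forall i, (i < s)%N -> c t0 i = x i) ->
      (forall i, (i < s)%N -> is_derive t0 1 (fun t => c t i) (c' i)) ->
      is_derive t0 1 (fun t => H l (c t)) (\sum_(i < s) D i x * c' i)).
  by move=> l; exact: An_diff (HA l).
have c3 : nz s (fun w => forall l, `|mono s al w * H l w| < e - `|f y0 0 l|).
  apply: nz_allI => l; have El : 0 < e - `|f y0 0 l|.
    by rewrite subr_gt0; have := fe l; rewrite mxE subr0.
  have MA : An s (fun w => mono s al w * H l w) by apply: An_M; [exact: An_mono|].
  have El2 : 0 < (e - `|f y0 0 l|) / 2 by rewrite divr_gt0.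
  have m0 : mono s al pt0 = 0 :> R by apply: (mono_eq0 im ai).
  apply: nzW (An_cts MA El2) => w; rewrite m0 mul0r subr0 => h.
  by apply: le_lt_trans h _; rewrite ltr_pdivrMr// mulr2n mulrDr mulr1 ltrDl.
(* This is the velocity up to its positive factor: a continuous function, equal to [a] at the
   origin. *)
have c4 : nz s (fun w => forall l, `|mu * (H l w + w i * D l i w / (al i)%:R) - a 0 l| < e).
  apply: nz_allI => l; have e20 : 0 < e / 2 by rewrite divr_gt0.
  have MA : An s (fun w => mu * (H l w + w i * D l i w / (al i)%:R)).
    apply: An_Z; apply: An_D => //; apply: An_M (An_cst _ _); apply: An_M; first exact: An_coord.
    by case: (hD l) => h _; exact: h.
  apply: nzW (An_cts MA e20) => w; rewrite {2}/pt0 !mul0r addr0 -aE => h.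
  by apply: le_lt_trans h _; rewrite ltr_pdivrMr// mulr2n mulrDr mulr1 ltrDl.
have c5 := nz_allI (fun l => proj2 (hD l)).
have c6 : nz s (fun x => forall j : 'I_m, forall (c : R -> pt) (c' : pt) t0,
      (forall i, (i < s)%N -> c t0 i = x i) ->
      (forall i, (i < s)%N -> is_derive t0 1 (fun t => c t i) (c' i)) ->
      dv (fun t => p (c t) j) t0).
  apply: nz_allI => j; have [D' [_ h]] := An_diff (pA j (ltn_ord j)).
  by apply: nzW h => w h c c' t0 h1 h2; exact: is_dv (h c c' t0 h1 h2).
have [rho rho0 hr] := nzI (nzI YE HE) (nzI (nzI c3 c4) (nzI c5 c6)).
(* Half of the radius leaves room for the factor $1+r$ with $|r|<1/2$. *)
have rho20 : 0 < rho / 2 by rewrite divr_gt0.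
have [t [[zc zp'] [Gyt yt]]] := ae_ex UU (aeI UU (aeI UU (tends_cube UU zl rho20) zp) (aeI UU Gy yE)).
pose w (r : R) := upd (z t) i (z t i * (1 + r)).
have w0 : w 0 = z t.
  by apply/funext => j; rewrite /w /upd addr0 mulr1; case: eqP => // ->.
have wc r : `|r| < 1 / 2 -> cube s rho (w r) /\ 0 < 1 + r.
  rewrite ltr_norml => /andP[r1 r2]; have rp : 0 < 1 + r by lra.
  split=> // j jm; rewrite /w /upd; case: (eqVneq j i) => _; last first.
    by apply: le_trans (zc j jm) _; lra.
  rewrite normrM [`|1 + r|]gtr0_norm//; apply: le_trans (ler_wpM2r (ltW rp) (zc i im)) _.
  by nra.
have hw r : `|r| < 1 / 2 -> _ := fun h => hr _ (proj1 (wc r h)).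
have pw (r : R) j : is_derive r 1 (fun r' : R => w r' j) (upd (@pt0 R) i (z t i) j).
  exact: path_scale.
pose c r := y0 + vec m (p (w r)).
have cd r : `|r| < 1 / 2 -> forall j, dv (fun r => c r 0 j) r.
  move=> rs j; have [_ [_ [_ h]]] := hw r rs.
  have h1 := h j w (upd (@pt0 R) i (z t i)) r (fun _ _ => erefl _) (fun j _ => pw r j).
  apply: (dv_ext _ (dvD (dv_cst (y0 0 j) r) h1)) => r'.
  by rewrite /c !mxE.
have near0 : \forall r \near (0 : R), `|r| < 1 / 2.
  apply/nbhs_ballP; exists (1 / 2) => //= r; by rewrite /ball /= sub0r normrN.
have Gn : \forall r \near (0 : R), Gd (c r).
  have G0 : Gd (c 0) by rewrite /c w0 -yt.
  have [d d0 hd] := Gopen G0.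
  have cn : \forall r \near (0 : R), cl d (c r) (c 0).
    by apply: path_near d0 => j; apply: cd; rewrite normr0.
  apply: filterS (filterI near0 cn) => r [rs h]; apply: hd => //.
  by have [[h1 _] _] := hw r rs.
exists c; rewrite /arc; near=> r.
have rs : `|r| < 1 / 2 by near: r.
have [[Yw fw] [[cw3 cw4] [cw5 _]]] := hw r rs.
have [_ rp] := wc r rs.
have mz : 0 < mono s al (z t) by apply: mono_gt0 => j jm _; exact: zp'.
have ai' : 0 < (al i)%:R :> R by rewrite ltr0n.
pose K := mono s al (z t) * (1 + r) ^+ (al i).-1.
have K0 : 0 < K by rewrite mulr_gt0// exprn_gt0.
pose v : 'rV[R]_n := \row_l (K * ((al i)%:R * H l (w r) + w r i * D l i (w r))).
split.
- by near: r.
- exact: cd.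
- move=> l; rewrite mxE subr0 fw; apply: le_lt_trans (ler_normD _ _) _.
  by rewrite -ltrBrDl; exact: cw3.
exists v, (mu / (K * (al i)%:R)); split.
- move=> l; rewrite mxE.
  have dH := cw5 l w (upd (@pt0 R) i (z t i)) r (fun _ _ => erefl _) (fun j _ => pw r j).
  have h1 := @der_mono_scale R s al (H l) (fun j => D l j (w r)) (z t) i r im ai dH.
  have h2 := is_derD (is_derive_cst (f y0 0 l) r 1) h1.
  have E : 0 + mono s al (z t) * (1 + r) ^+ (al i).-1 *
      ((al i)%:R * H l (upd (z t) i (z t i * (1 + r))) + z t i * (1 + r) * D l i (w r)) =
     K * ((al i)%:R * H l (w r) + w r i * D l i (w r)).
    by rewrite add0r /K /w upd_eq.
  rewrite -E; apply: is_der_near h2.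
  have : \forall r' \near r, `|r'| < 1 / 2.
    have d0 : 0 < 1 / 2 - `|r| by rewrite subr_gt0.
    apply/nbhs_ballP; exists (1 / 2 - `|r|) => //= r'; rewrite /ball /= => h.
    have := ler_normD (r' - r) r; rewrite subrK distrC; lra.
  apply: filterS => r' rs'; have [[_ h] _] := hw r' rs'.
  by rewrite h.
- by rewrite divr_gt0// mulr_gt0.
- move=> l; rewrite !mxE; have := cw4 l; congr (`|_ - _| < _).
  by field; rewrite !gt_eqF.
Unshelve. all: by end_near. Qed.

End Arcs.

(** * Rank of a linear map through its two by two minors *)

Section Minors.
Variables (R : realType) (n s : nat).
Notation pt := (nat -> R).
Variable D : 'I_n -> nat -> R.

Definition lin (c : pt) : 'rV[R]_n := \row_a \sum_(j < s) D a j * c j.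

Lemma lin_parallel : (forall j j', (j < s)%N -> (j' < s)%N -> forall a b,
    D a j * D b j' = D a j' * D b j) ->
  forall c c' a b, lin c 0 a * lin c' 0 b = lin c 0 b * lin c' 0 a.
Proof.
move=> h c c' a b; rewrite !mxE !mulr_suml; apply: eq_bigr => j _.
rewrite !mulr_sumr; apply: eq_bigr => j' _.
by rewrite -!mulrA ![c j * (_ * _)]mulrCA !mulrA h//; ring.
Qed.

Lemma lin_comb (x y : R) c c' : x *: lin c + y *: lin c' = lin (fun j => x * c j + y * c' j).
Proof.
apply/rowP => a; rewrite !mxE !mulr_sumr -big_split; apply: eq_bigr => j _ /=; ring.
Qed.

(** If all columns lay on the line of [lin c], every minor would vanish. So some column is outside
    this line, and [orth_extend] adds it. *)
Lemma lin_plane c j j' a b : (j < s)%N -> (j' < s)%N -> D a j * D b j' != D a j' * D b j ->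
  lin c != 0 -> exists E : 'M[R]_(2, n), [/\ E *m E^T = 1%:M, exists w, lin c = w *m E &
    forall w, exists c', w *m E = lin c'].
Proof.
move=> js js' nz v0; set v := lin c in v0 *.
pose E1 : 'M[R]_(1, n) := (enorm v)^-1 *: v.
have nv : enorm v != 0 by rewrite enorm0.
have EE : E1 *m E1^T = 1%:M.
  apply/matrixP => k l; rewrite !ord1 /E1 linearZ /= -scalemxAl -scalemxAr !mxE /=.
  have <- : enorm v ^+ 2 = \sum_j0 v 0 j0 * v^T j0 0.
    rewrite sqr_sqrtr ?sumr_ge0// => [|i _]; last exact: sqr_ge0.
    by apply: eq_bigr => i _; rewrite [v^T _ _]mxE expr2.
  by rewrite expr2; field.
pose dl i : pt := fun k => (k == i)%:R.
have linE i a' : (i < s)%N -> lin (dl i) 0 a' = D a' i.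
  move=> im; rewrite mxE (bigD1 (Ordinal im)) //= /dl eqxx mulr1 big1 ?addr0// => k ki.
  by rewrite (_ : (nat_of_ord k == i) = false) ?mulr0//; apply/negbTE.
have [i im ni] : exists2 i, (i < s)%N & ~ exists u, lin (dl i) = u *m E1.
  apply: contrapT => na; move/eqP: nz; apply.
  have al i : (i < s)%N -> exists u : R, forall a', D a' i = u * v 0 a'.
    move=> im; have [u hu] : exists u, lin (dl i) = u *m E1.
      by apply: contrapT => nu; apply: na; exists i.
    exists (u 0 0 / enorm v) => a'; rewrite -linE// hu mxE big_ord1 !mxE.
    by rewrite mulrA.
  by have [u hu] := al j js; have [u' hu'] := al j' js'; rewrite !hu !hu'; ring.
have [E [EEt _ E1E EL]] := orth_extend EE ni.
exists E; split=> //.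
  have [w hw] := E1E (enorm v)%:M; exists w; rewrite -hw mul_scalar_mx /E1 scalerA.
  by rewrite divff// scale1r.
move=> w; have [w1 [t ->]] := EL w.
have -> : w1 *m E1 = (w1 0 0 / enorm v) *: v.
  by rewrite [w1]mx11_scalar mul_scalar_mx /E1 scalerA mxE eqxx mulr1n.
by rewrite /v lin_comb; eexists.
Qed.

End Minors.

(** * Continuity, lines and proportionality for analytic germs *)

Section AnLemmas.
Variable R : realType.
Notation pt := (nat -> R).

Lemma An_cont m (f : pt -> R) : An m f -> nz m (fun x0 => forall (U : set_system nat)
  (z : nat -> pt), ProperFilter U -> (forall i, (i < m)%N -> (fun t => z t i) @ U --> x0 i) ->
  (fun t => f (z t)) @ U --> f x0).
Proof.
move=> [r [M [r0 fM]]]; have r20 : 0 < r / 2 by rewrite divr_gt0.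
exists (r / 2) => // x cx U z UF zx; apply: (An_cvg fM _ zx r0) => i im.
by apply: le_lt_trans (cx i im) _; rewrite ltr_pdivrMr// mulr2n mulrDr mulr1 ltrDl.
Qed.

Lemma An_zero m (f : pt -> R) d : An m f -> 0 < d -> (forall x, Dom xpredT m d x -> f x = 0) ->
  nz m (fun x => f x = 0).
Proof.
move=> [r [M [r0 fM]]] d0 h; exists r => // x.
have dr : 0 < Num.min d r by rewrite lt_min d0.
apply: (AN_zero dr _ fM); first by rewrite ge_min lexx orbT.
move=> y hy; apply: h; split=> i im; have /andP[y0 yd] := hy i im.
  by rewrite gtr0_norm// ltW// (lt_le_trans yd)// ge_min lexx.
by [].
Qed.

Lemma nz_line m (P : pt -> Prop) : nz m P -> nz m (fun x => forall c : pt,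
  \forall r \near (0 : R), P (fun i => x i + r * c i)).
Proof.
move=> [d d0 h]; have d20 : 0 < d / 2 by rewrite divr_gt0.
exists (d / 2) => // x cx c; pose N := 1 + \sum_(i < m) `|c i|.
have N0 : 0 < N by rewrite ltr_pwDl// sumr_ge0.
apply/nbhs_ballP; exists (d / 2 / N); rewrite /= ?divr_gt0// => r.
rewrite /ball /= sub0r normrN => rs; apply: h => i im.
apply: le_trans (ler_normD _ _) _; rewrite [leRHS]splitr lerD//; first exact: cx.
rewrite normrM; have cN : `|c i| <= N.
  by rewrite /N (bigD1 (Ordinal im)) //= addrCA lerDl addr_ge0// sumr_ge0.
apply: le_trans (ler_wpM2l (normr_ge0 r) cN) _.
by rewrite -ler_pdivlMr// ltW.
Qed.

Lemma line_der (x c : pt) (t : R) i : is_derive t 1 (fun r => x i + r * c i) (c i).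
Proof.
have h1 : is_derive t 1 (fun=> x i) 0 by exact: is_derive_cst.
have h2 : is_derive t 1 (fun s : R => s) 1 by exact: is_derive_id.
have h3 : is_derive t 1 (fun=> c i) 0 by exact: is_derive_cst.
by apply: is_derive_eq (is_derD h1 (is_derM h2 h3)) _; ring.
Qed.

Lemma der_mono_scale0 s al (H : pt -> R) (D : nat -> R) (z : pt) i : (i < s)%N ->
  is_derive (0 : R) 1 (fun s => H (upd z i (z i * (1 + s))))
     (\sum_(j < s) D j * upd (@pt0 R) i (z i) j) ->
  is_derive (0 : R) 1 (fun s0 => mono s al (upd z i (z i * (1 + s0))) * H (upd z i (z i * (1 + s0))))
    (mono s al z * ((al i)%:R * H z + z i * D i)).
Proof.
move=> im; rewrite sum_scale// => hH.
have h1 : is_derive (0 : R) 1 (fun s : R => 1 + s) (1 : R).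
  have := is_der_scale 1 (0 : R).
  rewrite (_ : (fun s : R => 1 * (1 + s)) = (fun s => 1 + s))//.
  by apply/funext => s'; rewrite mul1r.
have h2 := is_derM (is_derZ (mono s al z) (is_derX (al i) h1)) hH.
under eq_fun do rewrite mono_scale//.
apply: (is_derive_eq h2).
have -> : upd z i (z i * (1 + 0)) = z.
  by apply/funext => j; rewrite /upd addr0 mulr1; case: eqP => // ->.
by rewrite addr0 !expr1n; ring.
Qed.

(* Two solutions of the same linear relation h' || h stay proportional. *)
Lemma parallel_ratio (h g : R -> R) (h' g' : R -> R) :
  (forall t : R, 0 <= t <= 1 -> is_derive t 1 h (h' t)) ->
  (forall t : R, 0 <= t <= 1 -> is_derive t 1 g (g' t)) ->
  (forall t : R, 0 <= t <= 1 -> g t != 0) ->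
  (forall t : R, 0 < t < 1 -> h t * g' t = g t * h' t) -> h 1 * g 0 = h 0 * g 1.
Proof.
move=> hd gd g0 rel.
pose q t := h t * (g t)^-1.
have qd (t : R) : 0 <= t <= 1 -> is_derive t 1 q (h' t * (g t)^-1 + h t * (- (g t) ^- 2 * g' t)).
  move=> t01; have gV := is_deriveV (g0 t t01) (gd t t01).
  exact: (is_derM (hd t t01) gV).
have [||c _] := @MVT_segment R q (fun=> 0) 0 1 ler01.
- move=> t; rewrite in_itv /= => /andP[t0 t1].
  have t01 : 0 <= t <= 1 by rewrite !ltW.
  apply: is_derive_eq (qd t t01) _.
  have gt0 := g0 t t01; have := rel t; rewrite t0 t1 => /(_ isT) hr.
  apply: (mulIf gt0); rewrite mul0r mulrDl mulfVK//.
  rewrite mulrA mulrN mulNr -!mulrA [(g t) ^- 2 * _]mulrC !mulrA hr.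
  by field.
- apply: derivable_within_continuous => t; rewrite in_itv /= => t01.
  by have [] := qd t t01.
rewrite mul0r /q => /eqP; rewrite subr_eq0 => /eqP E.
have g10 : g 1 != 0 by apply: g0; rewrite lexx ler01.
have g00 : g 0 != 0 by apply: g0; rewrite lexx ler01.
apply: (mulIf (x := (g 1)^-1)); first by rewrite invr_eq0.
by rewrite mulrAC E mulfVK// mulfK.
Qed.

End AnLemmas.

(** * Limits of points of a cube along an ultrafilter *)

Section UltraPoints.
Variables (R : realType) (V : set_system nat).
Hypothesis UV : UltraFilter V.
Notation pt := (nat -> R).

Lemma ultra_ge (g : nat -> R) (l e : R) : g @ V --> l -> ae V (fun t => e <= g t) -> e <= l.
Proof.
move=> gl ge; rewrite leNgt; apply/negP => le; rewrite -subr_gt0 in le.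
have /cvgrPdist_lt/(_ _ le) h := gl.
have [t [h1 h2]] := ae_ex UV (aeI UV ge h).
by move: h2; rewrite ltr_norml => /andP[]; lra.
Qed.

Lemma ultra_le (g : nat -> R) (l e : R) : g @ V --> l -> ae V (fun t => g t <= e) -> l <= e.
Proof.
move=> gl ge; rewrite -lerN2; apply: (ultra_ge (g := fun t => - g t)).
  have VP : ProperFilter V by exact: ultra_proper.
  exact: cvgN.
by apply: aeW ge => t; rewrite lerN2.
Qed.

Lemma ultra_pts s d (w : nat -> pt) : (forall j, cube s d (w j)) -> exists w0 : pt,
  (forall i, (i < s)%N -> (fun t => w t i) @ V --> w0 i) /\ cube s d w0.
Proof.
move=> cw; have /choice[w0 hw] : forall i, exists l : R, (i < s)%N -> (fun t => w t i) @ V --> l.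
  move=> i; have [im|_] := ltnP i s; last by exists 0.
  have [[l h]|/(_ d) h] := ultra_lim UV (fun t => w t i); first by exists l.
  by have [t h1] := ae_ex UV h; have := cw t i im; rewrite leNgt h1.
exists w0; split=> // i im; rewrite ler_norml; apply/andP; split.
  apply: ultra_ge (hw i im) _; apply: nearW => t; have := cw t i im.
  by rewrite ler_norml => /andP[].
apply: ultra_le (hw i im) _; apply: nearW => t; have := cw t i im.
by rewrite ler_norml => /andP[].
Qed.

End UltraPoints.

(** * Directions of arcs inside a chart *)

Section ChartDirections.
Variables (R : realType) (m n : nat).
Notation pt := (nat -> R).
Variables (W Y : set 'rV[R]_m) (f : 'rV[R]_m -> 'rV[R]_n) (Gd : set 'rV[R]_m) (A : set 'rV[R]_n).
Hypotheses (Yan : analytic_subset W Y) (fan : analytic_map_on W f).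
Hypothesis Gopen : forall y, Gd y -> exists2 e : R, 0 < e & forall y', Y y' -> cl e y' y -> Gd y'.
Hypothesis GA : forall y, Gd y -> A (f y).

Definition plane_at (e : R) (a : 'rV[R]_n) := exists p, [/\ A p, cl e p 0 &
  exists E : 'M[R]_(2, n), [/\ E *m E^T = 1%:M,
    forall w, w *m E != 0 -> TC A p (w *m E) & exists w, cl e (w *m E) a]].

(** The pieces [E k] are closed and countable in number for the sake of Baire's theorem. The vector
    [b] is fixed before [a]: limit velocities of arcs in the pieces lie on one line unless they are
    approximated by planes. The piece may change with [e]. *)
Definition arc_family (E : nat -> set 'rV[R]_m) := (forall k, seq_closed (E k)) /\
  exists b : 'rV[R]_n, forall a, a != 0 ->
   (forall e, 0 < e -> exists k c, arc f Gd e a c /\ \forall t \near (0 : R), E k (c t)) ->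
   (exists l : R, a = l *: b) \/ (forall e, 0 < e -> plane_at e a).

(* Closed pieces exhausting the image of the open positive orthant, as needed for Baire's theorem. *)
Definition boxes (y0 : 'rV[R]_m) (P : pt -> pt) s d k : set 'rV[R]_m :=
  [set y | exists w, [/\ cube s d w, forall i, (i < s)%N -> d / k.+1%:R <= w i &
                         y = y0 + vec m (P w)]].

Lemma boxes_Dom s d k (w : pt) : 0 < d -> cube s d w ->
  (forall i, (i < s)%N -> d / k.+1%:R <= w i) -> Dom xpredT s d w.
Proof.
move=> d0 cw h; split=> // i im _; apply: lt_le_trans (h i im).
by rewrite divr_gt0// ltr0n.
Qed.

Lemma boxes_closed y0 (P : pt -> pt) s d k :
  (forall i, (i < m)%N -> forall x0, cube s d x0 -> forall (U : set_system nat)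
     (z : nat -> pt), ProperFilter U -> (forall j, (j < s)%N -> (fun t => z t j) @ U --> x0 j) ->
     (fun t => P (z t) i) @ U --> P x0 i) ->
  seq_closed (boxes y0 P s d k).
Proof.
move=> Pc x h; have /choice[w hw] : forall j, exists w, [/\ cube s d w,
    forall i, (i < s)%N -> d / k.+1%:R <= w i & cl j.+1%:R^-1 (y0 + vec m (P w)) x].
  by move=> j; have [//|u [cu [w [cw dw E]]]] := h j.+1%:R^-1; exists w; rewrite -E.
have [V [UV sV]] := ultra_oo; have VP : ProperFilter V by exact: ultra_proper.
have [|w0 [wl cw0]] := @ultra_pts R V UV s d w; first by move=> j; case: (hw j).
exists w0; split=> //.
  move=> i im; apply: (ultra_ge UV (wl i im)); apply: nearW => j.
  by case: (hw j) => _ h' _; exact: h'.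
have l1 : mlim V (fun j => y0 + vec m (P (w j))) x.
  by apply: mlim_sub => //; apply: cl_mlim => j; case: (hw j).
apply: (mlim_uniq VP l1); apply: vec_lim => i im.
by apply: Pc.
Qed.

Lemma boxes_cover y0 (P : pt -> pt) s d (w : pt) : 0 < d -> Dom xpredT s d w ->
  exists k, boxes y0 P s d k (y0 + vec m (P w)).
Proof.
move=> d0 [cw w0].
have [e e0 he] : exists2 e : R, 0 < e & forall i, (i < s)%N -> e <= w i.
  apply: (@min_rad R s (fun i e => e <= w i)) => [i e e' _ ee h|i im].
    exact: le_trans ee h.
  by exists (w i) => //; exact: w0.
have de0 : 0 < e / d by rewrite divr_gt0.
have [k hk] := inv_nat_lt de0; exists k, w; split=> // i im.
apply: le_trans (he i im); rewrite mulrC -ler_pdivlMr//.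
exact: ltW (hk k (leqnn k)).
Qed.

Section Chart.
Variables (T : Type) (U : set_system T) (y : T -> 'rV[R]_m) (y0 : 'rV[R]_m).
Hypotheses (UU : UltraFilter U) (Wy : W y0) (fy : f y0 = 0).
Hypotheses (Yy : ae U (fun t => Y (y t))) (yl : mlim U y y0).
Variables (s s2 : nat) (p q : pt -> pt) (z : T -> pt) (x2 : T -> pt).
Hypothesis L : Lift U m (fun t => dif y0 (y t)) s xpredT p z.
Hypothesis L2 : Lift U s z s2 xpredT q x2.
Hypothesis YE : nz s (fun w => Y (y0 + vec m (p w))).
Variable D : 'I_n -> nat -> pt -> R.
Hypothesis DA : forall l j, (j < s)%N -> An s (D l j).
Hypothesis Dd : forall l, nz s (fun x => forall (c : R -> pt) (c' : pt) t0,
    (forall i, (i < s)%N -> c t0 i = x i) ->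
    (forall i, (i < s)%N -> is_derive t0 1 (fun t => c t i) (c' i)) ->
    is_derive t0 1 (fun t => f (y0 + vec m (p (c t))) 0 l) (\sum_(i < s) D l i x * c' i)).
Hypothesis qM : forall j, (j < s)%N -> Mono1 s2 (fun w => q w j).

Let P w := p (q w).
Let UP : ProperFilter U. Proof. exact: ultra_proper. Qed.

Lemma chart_lift : Lift U m (fun t => dif y0 (y t)) s2 xpredT P x2.
Proof. by apply: (lift_full_comp UU L L2) => j js _; right; exact: qM. Qed.

(** The position [x] is in the second chart, where the minors of the differential are monomialized;
    the velocity [c] is in the coordinates of the first chart, where [f] is differentiated. *)
Definition tangent e a (x : pt) := exists (c : pt) (b : R),
  [/\ 0 < b, cl e (b *: lin s (fun l j => D l j (q x)) c) a, Gd (y0 + vec m (P x)) &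
      cl e (f (y0 + vec m (P x))) 0].

(** An arc inside one box has preimages in the open orthant. The lifting property of the chart makes
    any choice of them differentiable at time 0, and [q] carries that path to the first chart. *)
Lemma chart_boxes : exists2 d0, 0 < d0 & forall d, 0 < d -> d <= d0 ->
  [/\ forall k, seq_closed (boxes y0 P s2 d k), ae U (fun t => exists k, boxes y0 P s2 d k (y t)) &
   forall e a c k, arc f Gd e a c -> (\forall t \near (0 : R), boxes y0 P s2 d k (c t)) ->
     exists2 x, Dom xpredT s2 d x & tangent e a x].
Proof.
have L12 := chart_lift.
have [e1 e10 LPe] := lift_derivable L12.
have Pc : nz s2 (fun x0 => forall i, (i < m)%N -> forall (U : set_system nat)
     (z : nat -> pt), ProperFilter U -> (forall j, (j < s2)%N -> (fun t => z t j) @ U --> x0 j) ->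
     (fun t => P (z t) i) @ U --> P x0 i).
  by apply: nz_all => i im; exact: An_cont (lift_An L12 im).
have /choice[Q hQ] : forall j, exists Q : nat -> pt -> R, (j < s)%N ->
    nz s2 (fun x => forall (c : R -> pt) (c' : pt) t0,
    (forall i, (i < s2)%N -> c t0 i = x i) ->
    (forall i, (i < s2)%N -> is_derive t0 1 (fun t => c t i) (c' i)) ->
    is_derive t0 1 (fun t => q (c t) j) (\sum_(i < s2) Q i x * c' i)).
  move=> j; have [js|_] := ltnP j s; last by exists (fun _ _ => 0).
  by have [Q [_ hQ]] := An_diff (lift_An L2 js); exists Q.
have Dn := nz_comp (lift_An L2) (lift_0 L2) (nz_allI Dd).
have [d0 d00 h] := nzI (nzI Pc (nz_all hQ)) Dn.
exists (Num.min d0 e1); first by rewrite lt_min d00.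
move=> d dp; rewrite le_min => /andP[dd0 dde]; split.
- move=> k; apply: boxes_closed => i im x0 cx V zz VP zl.
  have [[hP _] _] := h x0 (cubeW (leqnn _) dd0 cx).
  exact: hP.
- have yE : ae U (fun t => y t = y0 + vec m (P (x2 t))).
    apply: aeW (ae_all UU (lift_eq L12)) => t ht.
    by rewrite -[LHS](vec_dif y0); congr (_ + _); apply: vec_ext => i im; rewrite ht.
  apply: aeW (aeI UU yE (aeI UU (tends_cube UU (lift_tends L12) dp)
     (ae_all UU (fun i im => lift_pos L12 im isT)))) => t [-> [h1 h2]].
  apply: boxes_cover => //; split=> // i im _; exact: h2.
move=> e a c k arcc near_box.
have /choice[zt hz] : forall r, exists w : pt, boxes y0 P s2 d k (c r) ->
    Dom xpredT s2 d w /\ c r = y0 + vec m (P w).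
  move=> r; have [[w [cw dw E]]|nb] := pselect (boxes y0 P s2 d k (c r)); last by exists pt0.
  by exists w => _; split=> //; exact: boxes_Dom dp cw dw.
have [G0 dc0 fc0 [v [b [dv0 b0 bv]]]] := nbhs_singleton arcc.
have [D0 c0E] := hz 0 (nbhs_singleton near_box).
have zD : \forall r \near (0 : R), Dom xpredT s2 e1 (zt r).
  by apply: filterS near_box => r hr; apply: (Dom_sub dde); case: (hz r hr).
have zd i : (i < s2)%N -> dv (fun r => zt r i) 0.
  apply: (LPe zt 0 zD) => j jm.
  have h1 := dvB (dc0 (Ordinal jm)) (dv_cst (y0 0 (Ordinal jm)) 0).
  apply: dv_near h1; apply: filterS near_box => r hr.
  by have [_ ->] := hz r hr; rewrite !mxE addrAC subrr add0r.
have /choice[z' hz'] : forall i, exists l, (i < s2)%N -> is_derive (0 : R) 1 (fun r => zt r i) l.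
  move=> i; case: (ltnP i s2) => im; last by exists 0.
  by have [l hl] := dv_is (zd i im); exists l.
have [[_ hq] hD] := h (zt 0) (cubeW (leqnn _) dd0 (proj1 D0)).
pose om j := \sum_(i < s2) Q j i (zt 0) * z' i.
have qd j : (j < s)%N -> is_derive (0 : R) 1 (fun r => q (zt r) j) (om j).
  by move=> js; exact: (hq j js zt z' 0 (fun _ _ => erefl _) hz').
exists (zt 0) => //; exists om, b; split=> //; last 2 first.
- by rewrite -c0E.
- by rewrite -c0E.
have vE : v = lin s (fun l j => D l j (q (zt 0))) om.
  apply/rowP => l; rewrite mxE.
  have h1 := hD l (fun r => q (zt r)) om 0 (fun _ _ => erefl _) qd.
  apply: is_der_uniq (dv0 l) _; apply: is_der_near h1.
  by apply: filterS near_box => r hr; have [_ ->] := hz r hr.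
by rewrite -vE.
Qed.

(** A minor that is a monomial times a unit vanishes nowhere on the open orthant, so the
    differential has rank at least 2 at all points met by the arcs. Its image contains a plane
    through the velocity, and every vector of this plane is the velocity of the image of a straight
    line of the first chart. *)
Lemma chart_plane a0 b0 j0 j1 : (j0 < s)%N -> (j1 < s)%N ->
  Mono1 s2 (fun w => D a0 j0 (q w) * D b0 j1 (q w) - D a0 j1 (q w) * D b0 j0 (q w)) ->
  exists E, arc_family E /\ ae U (fun t => exists k, E k (y t)).
Proof.
move=> js0 js1 /Mono1_neq0[d1 d10 hd1]; have [d0 d00 hb] := chart_boxes.
have N3 : nz s (fun x => forall i : 'I_m, forall (c : R -> pt) (c' : pt) t0,
    (forall i, (i < s)%N -> c t0 i = x i) ->
    (forall i, (i < s)%N -> is_derive t0 1 (fun t => c t i) (c' i)) ->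
    dv (fun t => p (c t) i) t0).
  apply: nz_allI => i; have [Q [_ hQ]] := An_diff (lift_An L (ltn_ord i)).
  by apply: nzW hQ => x hx c c' t0 h1 h2; exact: is_dv (hx c c' t0 h1 h2).
have [d2 d20 hd2] := nz_comp (lift_An L2) (lift_0 L2) (nzI (nzI (nz_line YE) (nz_allI Dd)) N3).
pose d := Num.min d0 (Num.min d1 d2).
have dp : 0 < d by rewrite !lt_min d00 d10.
have dd0 : d <= d0 by rewrite ge_min lexx.
have dd1 : d <= d1 by rewrite !ge_min lexx orbT.
have dd2 : d <= d2 by rewrite !ge_min lexx !orbT.
have [bc yb ba] := hb d dp dd0.
(* The line is given by the dummy vector 0, as the planar alternative always holds. *)
exists (boxes y0 P s2 d); split=> //; split=> //; exists 0 => a an0 ha; right => e e0.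
have [e1 e10 he1] := cl_neq0 an0.
have [|k [c [arcc bk]]] := ha (Num.min e e1); first by rewrite lt_min e0.
have [x Dx [c' [b [bp bv Gx fx]]]] := ba _ _ _ _ arcc bk.
set v := lin _ _ c' in bv.
have v0 : v != 0.
  have : b *: v != 0 by apply: he1; apply: clW bv; rewrite ge_min lexx orbT.
  by rewrite scaler_eq0 negb_or => /andP[].
have minor0 := hd1 x (Dom_sub dd1 Dx); rewrite subr_eq0 in minor0.
have [E [EE [w vE] EL]] := @lin_plane R n s (fun l j => D l j (q x)) c' j0 j1 a0 b0 js0 js1 minor0 v0.
have [[hY hD] hp] := hd2 x (cubeW (leqnn _) dd2 (proj1 Dx)).
exists (f (y0 + vec m (P x))); split; first exact: GA.
  by apply: clW fx; rewrite ge_min lexx.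
exists E; split=> //; last first.
  exists (b *: w); rewrite -scalemxAl -vE; apply: clW bv; by rewrite ge_min lexx.
move=> w' w'0; have [c1 E1] := EL w'; rewrite E1.
(* The line may leave the positive orthant, but [YE] holds in a full neighbourhood of 0, so its
   image stays in [Y] and, by [Gopen], in [Gd]. *)
pose ga (r : R) := y0 + vec m (p (fun i => q x i + r * c1 i)).
have ga0 : ga 0 = y0 + vec m (P x).
  rewrite /ga (_ : (fun i => q x i + 0 * c1 i) = q x)//.
  by apply/funext => i; rewrite mul0r addr0.
have x0E i : (i < s)%N -> q x i + 0 * c1 i = q x i by rewrite mul0r addr0.
have dga i : dv (fun r => ga r 0 i) 0.
  have h1 := hp i (fun r i => q x i + r * c1 i) c1 0 x0E (fun i _ => line_der _ _ _ _).
  apply: (dv_ext _ (dvD (dv_cst (y0 0 i) 0) h1)) => r.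
  by rewrite !mxE.
have Gga : \forall r \near (0 : R), Gd (ga r).
  rewrite -ga0 in Gx; have [e2 e20 he2] := Gopen Gx.
  by apply: filterS (filterI (hY c1) (path_near dga e20)) => r [h1 h2]; exact: he2.
have [] := @deriv_TC R n A (fun r => f (ga r)) (lin s (fun l j => D l j (q x)) c1).
- move=> l; rewrite mxE.
  exact: (hD l (fun r i => q x i + r * c1 i) c1 0 x0E (fun i _ => line_der _ _ _ _)).
- by apply: filterS Gga => r; exact: GA.
- by rewrite ga0.
Qed.

(** With all minors zero and $f=w^\beta H$, velocities are parallel to each
    $K_i=\beta_iH+w_i\partial_iH$, which up to a monomial is a value of the differential. At a limit
    point with $f=0$ some $w_i=0$ with $\beta_i>0$, so $K_i=\beta_iH$ and the limit velocity is
    parallel to [H] there. On the segment from 0 to this point $K_i=\beta_iH$ persists, so [H] keeps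
    its line, and $H(0)$ spans it. *)
Lemma chart_rank1 : (forall a b j j', (j < s)%N -> (j' < s)%N ->
    nz s2 (fun w => D a j (q w) * D b j' (q w) - D a j' (q w) * D b j (q w) = 0)) ->
  (nz s (fun w => forall l, f (y0 + vec m (p w)) 0 l = f y0 0 l) \/
    exists al (H : 'I_n -> pt -> R) l0, [/\ forall l, An s (H l), H l0 pt0 != 0 &
      nz s (fun w => forall l, f (y0 + vec m (p w)) 0 l = f y0 0 l + mono s al w * H l w)]) ->
  exists E, arc_family E /\ ae U (fun t => exists k, E k (y t)).
Proof.
move=> mi0 hM; have [d0 d00 hb] := chart_boxes.
have f0 l : f y0 0 l = 0 by rewrite fy mxE.
(* If [f] is constant in the chart its differential vanishes, and no arc has velocity close to a
   nonzero [a]. *)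
case: hM => [Fc|[al [H [l0 [HA H0 HE]]]]].
  have [d2 d20 hd2] := nz_comp (lift_An L2) (lift_0 L2) (nzI (nz_line Fc) (nz_allI Dd)).
  pose d := Num.min d0 d2.
  have dp : 0 < d by rewrite !lt_min d00 d20.
  have dd0 : d <= d0 by rewrite ge_min lexx.
  have dd2 : d <= d2 by rewrite ge_min lexx orbT.
  have [bc yb ba] := hb d dp dd0.
  exists (boxes y0 P s2 d); split=> //; split=> //; exists 0 => a an0 ha; exfalso.
  have [e1 e10 he1] := cl_neq0 an0.
  have [k [c [arcc bk]]] := ha e1 e10.
  have [x Dx [c' [b [bp bv Gx fx]]]] := ba _ _ _ _ arcc bk.
  have [hF hD] := hd2 x (cubeW (leqnn _) dd2 (proj1 Dx)).
  have x0E i : (i < s)%N -> q x i + 0 * c' i = q x i by rewrite mul0r addr0.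
  suff E : lin s (fun l j => D l j (q x)) c' = 0.
    by have := he1 _ bv; rewrite E scaler0 eqxx.
  apply/rowP => l; rewrite !mxE.
  have h1 := hD l (fun r i => q x i + r * c' i) c' 0 x0E (fun i _ => line_der _ _ _ _).
  apply: is_der_uniq h1 _; apply: is_der_near (is_derive_cst (f y0 0 l) (0 : R) (1 : R)).
  by apply: filterS (hF c') => r h; rewrite h.
have [be [u [uA u0 uE]]] : Mono1 s2 (fun w => mono s al (q w)).
  by apply: (Mono1_comp (Mono1_mono R s al) qM); exact: lift_0 L2.
pose H2 l w := u w * H l (q w).
have H2A l : An s2 (H2 l) by apply: An_M uA (An_comp' (HA l) (lift_An L2) (lift_0 L2)).
have H20 : H2 l0 pt0 != 0 by rewrite mulf_neq0// (An_comp0 (HA l0) (lift_0 L2)).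
have /choice[D2 hD2] : forall l, exists D2 : nat -> pt -> R,
    (forall i, (i < s2)%N -> An s2 (D2 i)) /\
    nz s2 (fun x => forall (c : R -> pt) (c' : pt) t0,
      (forall i, (i < s2)%N -> c t0 i = x i) ->
      (forall i, (i < s2)%N -> is_derive t0 1 (fun t => c t i) (c' i)) ->
      is_derive t0 1 (fun t => H2 l (c t)) (\sum_(i < s2) D2 i x * c' i)).
  by move=> l; exact: An_diff (H2A l).
have F2E : nz s2 (fun w => forall l, f (y0 + vec m (P w)) 0 l = mono s2 be w * H2 l w).
  apply: nzW (nzI (nz_comp (lift_An L2) (lift_0 L2) HE) uE) => w [h1 h2] l.
  by rewrite h1 f0 add0r h2 /H2 mulrA.
pose K l i (w : pt) := (be i)%:R * H2 l w + w i * D2 l i w.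
have KA l i : (i < s2)%N -> An s2 (K l i).
  move=> im; apply: An_D; first exact: An_Z.
  by apply: An_M; [exact: An_coord|case: (hD2 l) => h _; exact: h].
have /choice[Q hQ] : forall j, exists Q : nat -> pt -> R, (j < s)%N ->
    nz s2 (fun x => forall (c : R -> pt) (c' : pt) t0,
    (forall i, (i < s2)%N -> c t0 i = x i) ->
    (forall i, (i < s2)%N -> is_derive t0 1 (fun t => c t i) (c' i)) ->
    is_derive t0 1 (fun t => q (c t) j) (\sum_(i < s2) Q i x * c' i)).
  move=> j; have [js|_] := ltnP j s; last by exists (fun _ _ => 0).
  by have [Q [_ hQ]] := An_diff (lift_An L2 js); exists Q.
have minors : nz s2 (fun w => forall a b, forall j, (j < s)%N -> forall j', (j' < s)%N ->
    D a j (q w) * D b j' (q w) = D a j' (q w) * D b j (q w)).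
  apply: nz_allI => a; apply: nz_allI => b; apply: nz_all => j js; apply: nz_all => j' js'.
  by apply: nzW (mi0 a b j j' js js') => w /eqP; rewrite subr_eq0 => /eqP.
have [d1 d10 hd1] := nzI (nzI (nzI (nz_line F2E) minors) (nz_allI (fun l => proj2 (hD2 l))))
  (nzI (nz_all hQ) (nz_comp (lift_An L2) (lift_0 L2) (nz_allI Dd))).
have mpos w : Dom xpredT s2 d1 w -> mono s2 be w != 0.
  by move=> [_ w0]; apply: lt0r_neq0; apply: mono_gt0 => i im _; exact: w0.
have KL w i : Dom xpredT s2 d1 w -> (i < s2)%N -> exists c', forall l,
    lin s (fun l j => D l j (q w)) c' 0 l = mono s2 be w * K l i w.
  move=> [cw w0] im; have [[[hF _] hH] [hq hD]] := hd1 w cw.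
  pose c (r : R) := upd w i (w i * (1 + r)).
  have c0 : c 0 = w by apply/funext => j; rewrite /c /upd addr0 mulr1; case: eqP => // ->.
  have c0E j : (j < s2)%N -> c 0 j = w j by rewrite c0.
  have cd j : (j < s2)%N -> is_derive (0 : R) 1 (fun r => c r j) (upd (@pt0 R) i (w i) j).
    by move=> _; exact: path_scale.
  pose om j := \sum_(i0 < s2) Q j i0 w * upd (@pt0 R) i (w i) i0.
  exists om => l; rewrite mxE.
  have h1 := hD l (fun r => q (c r)) om 0 (fun j _ => congr1 (fun x => q x j) c0)
     (fun j js => hq j js c _ 0 c0E cd).
  have h2 := @der_mono_scale0 R s2 be (H2 l) (fun j => D2 l j w) w i im (hH l c _ 0 c0E cd).
  apply: is_der_uniq h1 _; apply: is_der_near h2.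
  apply: filterS (hF (upd (@pt0 R) i (w i))) => r h.
  have E : (fun i0 => w i0 + r * upd pt0 i (w i) i0) = c r.
    apply/funext => j; rewrite /c /upd; case: eqP => [->|_]; last by rewrite mulr0 addr0.
    by rewrite mulrDr mulr1 mulrC.
  by have := h l; rewrite E.
have vpar w c' i l l' : Dom xpredT s2 d1 w -> (i < s2)%N ->
    lin s (fun l j => D l j (q w)) c' 0 l * K l' i w =
    lin s (fun l j => D l j (q w)) c' 0 l' * K l i w.
  move=> Dw im; have [c1 hc1] := KL w i Dw im.
  have [[[_ hm] _] _] := hd1 w (proj1 Dw).
  have E := @lin_parallel R n s (fun l j => D l j (q w)) (fun j j' js js' a b => hm a b j js j' js')
     c' c1 l l'.
  by apply: (mulfI (mpos w Dw)); rewrite mulrCA -hc1 E hc1; ring.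
(* Parallelism is known on the open orthant; the identity theorem extends it to the faces, where the
   limit points lie. *)
have Kpar : nz s2 (fun w => forall l l', forall i, (i < s2)%N -> forall i', (i' < s2)%N ->
    K l i w * K l' i' w = K l' i w * K l i' w).
  apply: nz_allI => l; apply: nz_allI => l'; apply: nz_all => i im; apply: nz_all => i' im'.
  have QA : An s2 (fun w => K l i w * K l' i' w - K l' i w * K l i' w).
    by apply: An_B; apply: An_M; exact: KA.
  suff h : nz s2 (fun w => K l i w * K l' i' w - K l' i w * K l i' w = 0).
    by apply: nzW h => w /eqP; rewrite subr_eq0 => /eqP.
  apply: (An_zero QA d10) => w Dw; apply/eqP; rewrite subr_eq0; apply/eqP.
  have [c' hc'] := KL w i Dw im; apply: (mulfI (mpos w Dw)).
  by have := vpar w c' i' l l' Dw im'; rewrite !hc' !mulrA.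
have MHA : An s2 (fun w => mono s2 be w * H2 l0 w) by exact: An_M (@An_mono R s2 be) (H2A l0).
have Kc : nz s2 (fun x0 => forall l, forall i, (i < s2)%N -> forall (U : set_system nat)
  (z : nat -> pt), ProperFilter U -> (forall i, (i < s2)%N -> (fun t => z t i) @ U --> x0 i) ->
  (fun t => K l i (z t)) @ U --> K l i x0).
  by apply: nz_allI => l; apply: nz_all => i im; exact: An_cont (KA l i im).
have H2n : nz s2 (fun w => H2 l0 w != 0).
  apply: nzW (An_neq0 (H2A l0) H20) => w h; rewrite -normr_gt0.
  by apply: lt_le_trans h; rewrite divr_gt0// normr_gt0.
have [d2 d20 hd2] := nzI (nzI Kpar F2E) (nzI H2n (nzI (An_cont MHA) Kc)).
pose d := Num.min d0 (Num.min d1 d2).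
have dp : 0 < d by rewrite !lt_min d00 d10.
have dd0 : d <= d0 by rewrite ge_min lexx.
have dd1 : d <= d1 by rewrite !ge_min lexx orbT.
have dd2 : d <= d2 by rewrite !ge_min lexx !orbT.
have [bc yb ba] := hb d dp dd0.
exists (boxes y0 P s2 d); split=> //; split=> //; exists (\row_l H2 l pt0) => a an0 ha; left.
(* For each tolerance a point and a velocity near [a] are kept with their parallelism relations; the
   last entry records that component [l0] of [f] tends to 0. *)
have /choice[xv hxv] : forall j, exists xv : pt * 'rV[R]_n, [/\ cube s2 d xv.1,
    cl j.+1%:R^-1 xv.2 a,
    forall i, (i < s2)%N -> forall l l', xv.2 0 l * K l' i xv.1 = xv.2 0 l' * K l i xv.1 &
    `|mono s2 be xv.1 * H2 l0 xv.1| < j.+1%:R^-1].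
  move=> j; have [//|k [c [arcc bk]]] := ha j.+1%:R^-1.
  have [x Dx [c' [b [bp bv Gx fx]]]] := ba _ _ _ _ arcc bk.
  exists (x, b *: lin s (fun l j => D l j (q x)) c'); split=> //=.
  - exact: (proj1 Dx).
  - move=> i im l l'; rewrite mxE [X in _ = X * _]mxE -!mulrA; congr (_ * _).
    by apply: vpar => //; exact: (Dom_sub dd1 Dx).
  - have [[_ hF] _] := hd2 x (cubeW (leqnn _) dd2 (proj1 Dx)).
    by rewrite -hF; have := fx l0; rewrite mxE subr0.
have [V [UV sV]] := ultra_oo; have VP : ProperFilter V by exact: ultra_proper.
have [|w0 [wl cw0]] := @ultra_pts R V UV s2 d (fun j => (xv j).1); first by move=> j; case: (hxv j).
have [[Kp _] [Hn [Mc Kcw]]] := hd2 w0 (cubeW (leqnn _) dd2 cw0).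
have al' l : (fun j => (xv j).2 0 l) @ V --> a 0 l.
  have h : mlim V (fun j => (xv j).2) a by apply: mlim_sub => //; apply: cl_mlim => j; case: (hxv j).
  exact: h.
have M0 : mono s2 be w0 * H2 l0 w0 = 0.
  have h1 : (fun j => mono s2 be (xv j).1 * H2 l0 (xv j).1) @ V --> mono s2 be w0 * H2 l0 w0 by apply: Mc.
  have h2 : (fun j => mono s2 be (xv j).1 * H2 l0 (xv j).1) @ V --> (0 : R).
    apply/cvgrPdist_lt => e e0; have [N hN] := inv_nat_lt e0; apply: sV.
    exists N => // j /= Nj; rewrite sub0r normrN; apply: lt_trans (hN j Nj).
    by case: (hxv j).
  by apply: cvg_unique h1 h2; exact: norm_hausdorff.
have [i0 i0s [bi0 wi0]] : exists2 i, (i < s2)%N & (0 < be i)%N /\ w0 i = 0.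
  apply: contrapT => na; move/eqP: M0; rewrite mulf_eq0 (negbTE Hn) orbF; apply/negP.
  apply/prodf_neq0 => i _; rewrite expf_eq0 negb_and -leqNgt.
  have [be0|bi] := posnP (be i); first by rewrite be0.
  by apply/orP; right; apply/eqP => w0i; apply: na; exists i.
have bn : (be i0)%:R != 0 :> R by rewrite pnatr_eq0 -lt0n.
have Ki0 l : K l i0 w0 = (be i0)%:R * H2 l w0 by rewrite /K wi0 mul0r addr0.
have aH l : a 0 l * H2 l0 w0 = a 0 l0 * H2 l w0.
  have h1 : (fun j => (xv j).2 0 l * K l0 i0 (xv j).1) @ V --> a 0 l * K l0 i0 w0.
    by apply: cvgM => //; exact: Kcw.
  have h2 : (fun j => (xv j).2 0 l * K l0 i0 (xv j).1) @ V --> a 0 l0 * K l i0 w0.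
    have h3 : (fun j => (xv j).2 0 l0 * K l i0 (xv j).1) @ V --> a 0 l0 * K l i0 w0.
      by apply: cvgM => //; exact: Kcw.
    apply: cvg_trans h3; apply: near_eq_cvg; apply: nearW => j.
    by have [_ _ h _] := hxv j; exact: h.
  have := cvg_unique (@norm_hausdorff _ _) h1 h2; rewrite !Ki0 => E.
  by apply: (mulfI bn); rewrite mulrCA E mulrCA.
have scale0 : (fun i => 0 * w0 i) = pt0 by apply/funext => i; rewrite mul0r.
have scale1 : (fun i => 1 * w0 i) = w0 by apply/funext => i; rewrite mul1r.
have cs (t : R) : 0 <= t <= 1 -> cube s2 d (fun i => t * w0 i).
  move=> /andP[t0 t1] i im; rewrite normrM ger0_norm//.
  by apply: le_trans (cw0 i im); rewrite ler_piMl.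
have sd (t : R) i : is_derive t 1 (fun r => r * w0 i) (w0 i).
  have h2 : is_derive t 1 (fun s : R => s) 1 by exact: is_derive_id.
  have h3 : is_derive t 1 (fun=> w0 i) 0 by exact: is_derive_cst.
  by apply: is_derive_eq (is_derM h2 h3) _; ring.
have hder l (t : R) : 0 <= t <= 1 -> is_derive t 1 (fun r => H2 l (fun i => r * w0 i))
    (\sum_(i < s2) D2 l i (fun i => t * w0 i) * w0 i).
  move=> t01; have [[_ hH] _] := hd1 _ (cubeW (leqnn _) dd1 (cs t t01)).
  exact: (hH l (fun r i => r * w0 i) w0 t (fun _ _ => erefl _) (fun i _ => sd t i)).
(* On the segment coordinate [i0] stays 0, so [K l i0] is a multiple of [H2 l]; compared with the
   other indices this makes the derivative of [H2] parallel to [H2]. *)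
have ratio l : H2 l w0 * H2 l0 pt0 = H2 l pt0 * H2 l0 w0.
  have := parallel_ratio (hder l) (hder l0); rewrite scale1 scale0; apply.
    by move=> t t01; have [_ [h _]] := hd2 _ (cubeW (leqnn _) dd2 (cs t t01)).
  move=> t /andP[t0 t1]; have t01 : 0 <= t <= 1 by rewrite !ltW.
  have [[hK _] _] := hd2 _ (cubeW (leqnn _) dd2 (cs t t01)).
  rewrite !mulr_sumr; apply: eq_bigr => i _.
  have := hK l l0 i0 i0s i (ltn_ord i); rewrite /K wi0 mulr0 !mul0r !addr0 => E.
  have bt : (be i0)%:R * t != 0 by rewrite mulf_neq0// gt_eqF.
  apply: (mulfI bt); set h := H2 l _ in E *; set g := H2 l0 _ in E *.
  set D' := D2 l0 _ _ in E *; set D'' := D2 l _ _ in E *.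
  have -> : (be i0)%:R * t * (h * (D' * w0 i)) =
     (be i0)%:R * h * ((be i)%:R * g + t * w0 i * D') - (be i0)%:R * h * ((be i)%:R * g) by ring.
  by rewrite E; ring.
exists (a 0 l0 / H2 l0 pt0); apply/rowP => l; rewrite !mxE.
apply: (mulIf Hn); rewrite aH; apply: (mulIf H20); rewrite -[LHS]mulrA ratio.
by field; exact: H20.
Qed.

End Chart.

(** Two monomializations in succession: the minors of the differential only make sense in the first
    chart and are monomialized in a second one, together with the coordinates of the first so that
    the charts compose. *)
Lemma arc_family_chart T (U : set_system T) (UU : UltraFilter U) (y : T -> 'rV[R]_m) y0 :
  W y0 -> f y0 = 0 -> ae U (fun t => Y (y t)) -> mlim U y y0 ->
  exists E, arc_family E /\ ae U (fun t => exists k, E k (y t)).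
Proof.
move=> Wy fy Yy yl; have [s [p [z [L YE fA hM]]]] := monomial_chart Yan fan UU Wy Yy yl.
have /choice[D hD] : forall l, exists D : nat -> pt -> R,
    (forall j, (j < s)%N -> An s (D j)) /\
    nz s (fun x => forall (c : R -> pt) (c' : pt) t0,
      (forall i, (i < s)%N -> c t0 i = x i) ->
      (forall i, (i < s)%N -> is_derive t0 1 (fun t => c t i) (c' i)) ->
      is_derive t0 1 (fun t => f (y0 + vec m (p (c t))) 0 l) (\sum_(i < s) D i x * c' i)).
  by move=> l; exact: An_diff (fA l).
pose I : finType := ('I_n * 'I_n * ('I_s * 'I_s) + 'I_s)%type.
pose G (i : I) : pt -> R := match i with
  | inl (a, b, (j, j')) => fun w => D a j w * D b j' w - D a j' w * D b j w
  | inr j => fun w => w j end.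
have GA' i : An s (G i).
  case: i => [[[a b] [j j']]|j] /=; last exact: An_coord.
  by apply: An_B; apply: An_M; case: (hD a) (hD b) => ha _ [hb _]; by [exact: ha|exact: hb].
have [s2 [q [x2 [_ L2 M2]]]] := @local_monomialization R T U UU s z I G (lift_tends L) GA'.
have qM j : (j < s)%N -> Mono1 s2 (fun w => q w j).
  move=> js; case: (M2 (inr (Ordinal js))) => //= h; exfalso.
  have [t [h1 [h2 h3]]] := ae_ex UU (aeI UU (tends_nz UU (lift_tends L2) h)
    (aeI UU (lift_eq L2 js) (lift_pos L js isT))).
  by rewrite -h2 h1 ltxx in h3.
have DA l j : (j < s)%N -> An s (D l j) by move=> js; case: (hD l) => h _; exact: h.
have Dd l := proj2 (hD l).
have [[i Mi]|nM] := pselect (exists i : 'I_n * 'I_n * ('I_s * 'I_s),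
    Mono1 s2 (fun w => G (inl i) (q w))).
  case: i Mi => [[a b] [j j']] Mi.
  exact: (chart_plane UU L L2 YE Dd qM (ltn_ord j) (ltn_ord j') Mi).
apply: (chart_rank1 UU fy L L2 Dd qM _ hM) => a b j j' js js'.
case: (M2 (inl (a, b, (Ordinal js, Ordinal js')))) => // Mi.
by exfalso; apply: nM; exists (a, b, (Ordinal js, Ordinal js')).
Qed.

End ChartDirections.

(** * Finitely many charts *)

Section Cover.
Variables (R : realType) (m n : nat).
Variables (W Y : set 'rV[R]_m) (f : 'rV[R]_m -> 'rV[R]_n) (Gd : set 'rV[R]_m) (A : set 'rV[R]_n).
Variable (O : set 'rV[R]_n).
Hypotheses (Yan : analytic_subset W Y) (fan : analytic_map_on W f).
Hypothesis Gopen : forall y, Gd y -> exists2 e : R, 0 < e & forall y', Y y' -> cl e y' y -> Gd y'.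
Hypothesis GA : forall y, Gd y -> A (f y).
Hypothesis proper : forall K, compact K -> K `<=` O -> compact (Y `&` f @^-1` K).

Lemma map_lim T (U : set_system T) (UF : ProperFilter U) (y : T -> 'rV[R]_m) y0 : W y0 ->
  mlim U y y0 -> mlim U (fun t => f (y t)) (f y0).
Proof.
by move=> Wy yl i j; rewrite (ord1 i); exact: (analytic_lim UF (fan j Wy) yl).
Qed.

Lemma box_compact (p : 'rV[R]_n) (r : R) :
  compact [set v : 'rV[R]_n | forall i, v 0 i \in `[p 0 i - r, p 0 i + r]].
Proof.
by apply: (@rV_compact R n (fun i => [set` `[p 0 i - r, p 0 i + r]])) => i; exact: segment_compact.
Qed.

(** The points lie over a compact box around [p], so by properness they remain in a compact subset
    of [Y], where their ultrafilter converges. *)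
Lemma proper_lim T (U : set_system T) (UU : UltraFilter U) (y : T -> 'rV[R]_m) (p : 'rV[R]_n) :
  open O -> O p -> ae U (fun t => Y (y t)) -> mlim U (fun t => f (y t)) p ->
  exists y0, [/\ Y y0, mlim U y y0 & f y0 = p].
Proof.
move=> oO Op Yy fl; have UP : ProperFilter U by exact: ultra_proper.
have /near_rV[r r0 hr] := open_nbhs_nbhs (conj oO Op).
have r20 : 0 < r / 2 by rewrite divr_gt0.
pose K := [set v : 'rV[R]_n | forall i, v 0 i \in `[p 0 i - r / 2, p 0 i + r / 2]].
have KO : K `<=` O.
  move=> v hv; apply: hr => i; have := hv i; rewrite in_itv /= => /andP[h1 h2].
  by rewrite ltr_norml; apply/andP; split; lra.
have := proper (@box_compact p (r / 2)) KO; rewrite compact_ultra.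
move=> /(_ (y @ U)) [||y0 [[Yy0 _] yl]].
- split; [exact: fmap_proper_filter|move=> G GF sG].
  apply/seteqP; split=> // B GB; have [|h] := in_ultra_setVsetC (y @^-1` B) UU; first by [].
  exfalso; have GB' : G (~` B) by apply: sG; exact: h.
  by have [x []] := filter_ex (filterI GB GB').
- change (ae U (fun t => (Y `&` f @^-1` K) (y t))).
  apply: aeW (aeI UU Yy (mlim_cl UP fl r20)) => t [h1 h2]; split=> // i.
  by have := h2 i; rewrite ltr_norml in_itv /= => /andP[h3 h4]; apply/andP; split; lra.
have yl' : mlim U y y0 by apply/cvg_mlim.
exists y0; split=> //; have Wy0 : W y0 by apply: (proj1 Yan).
have fl0 := map_lim UP Wy0 yl'; exact: (mlim_uniq UP fl0 fl).
Qed.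

(** Compactness by contradiction: if no finite family of charts covers the points with values near
    0, the sets of uncovered points generate a proper filter. A finer ultrafilter converges to a
    point of the fibre over 0, whose chart from [arc_family_chart] it would have both to meet and to
    avoid. *)
Lemma arc_family_cover : open O -> O 0 -> exists (eta : R) (N : nat) (E : nat -> nat -> set 'rV[R]_m),
  [/\ 0 < eta, forall c, (c < N)%N -> arc_family f Gd A (E c) &
      forall y, Y y -> cl eta (f y) 0 -> exists2 c, (c < N)%N & exists k, E c k y].
Proof.
move=> oO O0; apply: contrapT => no.
pose F : set_system 'rV[R]_m := [set B | exists (eta : R) (N : nat) (E : nat -> nat -> set 'rV[R]_m),
  [/\ 0 < eta, forall c, (c < N)%N -> arc_family f Gd A (E c) &
    forall y, Y y -> cl eta (f y) 0 -> ~ (exists2 c, (c < N)%N & exists k, E c k y) -> B y]].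
have FP : ProperFilter F.
  split; last first.
    split.
    - by exists 1, 0%N, (fun _ _ => set0); split.
    - move=> P Q [e1 [N1 [E1 [e10 g1 h1]]]] [e2 [N2 [E2 [e20 g2 h2]]]].
      exists (Num.min e1 e2), (N1 + N2)%N, (fun c => if (c < N1)%N then E1 c else E2 (c - N1)%N).
      split; first by rewrite lt_min e10.
        move=> c cN; case: (ltnP c N1) => c1; first exact: g1.
        by apply: g2; rewrite ltn_subLR.
      move=> y Yy cy nE; split.
        apply: h1 => //; first by apply: clW cy; rewrite ge_min lexx.
        move=> [c c1 [k Ek]]; apply: nE; exists c; first exact: ltn_addr.
        by exists k; rewrite c1.
      apply: h2 => //; first by apply: clW cy; rewrite ge_min lexx orbT.
      move=> [c c2 [k Ek]]; apply: nE; exists (N1 + c)%N; first by rewrite ltn_add2l.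
      by exists k; rewrite ltnNge leq_addr /= addKn.
    - move=> P Q PQ [e1 [N1 [E1 [e10 g1 h1]]]]; exists e1, N1, E1; split=> // y Yy cy nE.
      by apply: PQ; exact: h1.
  move=> [e1 [N1 [E1 [e10 g1 h1]]]]; apply: no; exists e1, N1, E1; split=> // y Yy cy.
  by apply: contrapT => nE; exact: (h1 y Yy cy nE).
have [U [UU sU]] := ultraFilterLemma FP.
have UP : ProperFilter U by exact: ultra_proper.
have YU : ae U (fun y => Y y).
  by apply: sU; exists 1, 0%N, (fun _ _ => set0); split.
have fl : mlim U (fun y => f y) 0.
  move=> i j; rewrite (ord1 i) mxE; apply/cvgrPdist_lt => e e0; apply: sU.
  exists e, 0%N, (fun _ _ => set0); split=> // y Yy cy _.
  by rewrite distrC; have := cy j; rewrite mxE.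
have [y0 [Yy0 yl fy0]] := proper_lim UU oO O0 YU fl.
have Wy0 : W y0 by apply: (proj1 Yan).
have [E [gE hE]] := arc_family_chart Yan fan Gopen GA UU Wy0 fy0 YU yl.
have nE : ae U (fun y => ~ exists k, E k y).
  apply: sU; exists 1, 1%N, (fun _ => E); split=> // y Yy cy nE [k Ek].
  by apply: nE; exists 0%N => //; exists k.
by have [y [h1 h2]] := ae_ex UU (aeI UU hE nE).
Qed.

Lemma arc_shift e a c t0 d : 0 < d ->
  (forall t, `|t - t0| < d -> [/\ Gd (c t), forall i, dv (fun s => c s 0 i) t, cl e (f (c t)) 0 &
    exists (v : 'rV[R]_n) (b : R), [/\ forall l, is_derive t 1 (fun s => f (c s) 0 l) (v 0 l),
      0 < b & cl e (b *: v) a]]) -> arc f Gd e a (fun t => c (t0 + t)).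
Proof.
move=> d0 h; apply/nbhs_ballP; exists d => // t; rewrite /ball /= sub0r normrN => td.
have [|Gc dc fc [v [b [dv' b0 bv]]]] := h (t0 + t); first by rewrite addrC addKr.
have sh (g : R -> R) (l : R) : is_derive (t0 + t) 1 g l -> is_derive t 1 (fun s => g (t0 + s)) l.
  move=> hg; have h1 : is_derive t 1 (fun s : R => t0 + s) (1 : R).
    have h2 : is_derive t 1 (fun=> t0) 0 by exact: is_derive_cst.
    have h3 : is_derive t 1 (fun s : R => s) 1 by exact: is_derive_id.
    by apply: is_derive_eq (is_derD h2 h3) _; rewrite add0r.
  have := @is_derive1_comp R g (fun s => t0 + s) t _ _ hg h1.
  by move=> h4; apply: is_derive_eq h4 _; rewrite mulr1.
split=> //.
  by move=> i; have [l hl] := dv_is (dc i); exact: (is_dv (sh (fun s => c s 0 i) l hl)).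
by exists v, b; split=> // l; exact: (sh (fun s => f (c s) 0 l)).
Qed.

(** Baire's theorem on the line: countably many closed sets of times cover an interval, so one of
    them contains a ball, and the arc is restarted at its centre. *)
Lemma arc_in_cover e a c (N : nat) (E : nat -> nat -> set 'rV[R]_m) :
  (forall c, (c < N)%N -> forall k, seq_closed (E c k)) ->
  (forall y, Gd y -> cl e (f y) 0 -> exists2 c, (c < N)%N & exists k, E c k y) ->
  arc f Gd e a c -> exists2 j, (j < N)%N & exists k c', arc f Gd e a c' /\
    \forall t \near (0 : R), E j k (c' t).
Proof.
move=> Ecl cov /nbhs_ballP[d /= d0 hc].
have {}hc t : `|t| < d -> _ := fun h => hc t (etrans (f_equal (fun x => x < d) (etrans (f_equal _ (sub0r t)) (normrN t))) h).
pose h := d / 2; have h0 : 0 < h by rewrite divr_gt0.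
have hd : h < d by rewrite ltr_pdivrMr// mulr2n mulrDr mulr1 ltrDl.
have N0 : (0 < N)%N.
  have [|G0 _ f0 _] := hc 0; first by rewrite normr0.
  by have [j jN _] := cov _ G0 f0; exact: leq_trans jN.
(* One number codes a chart, [j %% N], and a piece of it, [j %/ N]. *)
pose C j := [set t : R | `|t| <= h /\ E (j %% N)%N (j %/ N)%N (c t)].
have [[j [t0 [r [r0 hr]]]]|no] := pselect (exists j t0 r, 0 < r /\ ball t0 r `<=` C j).
  exists (j %% N)%N; first by rewrite ltn_mod.
  exists (j %/ N)%N, (fun t => c (t0 + t)); split.
    apply: (arc_shift r0) => t tr; have [|th _] := hr t; first by rewrite /ball /= distrC.
    by apply: hc; exact: le_lt_trans th hd.
  apply/nbhs_ballP; exists r => // t; rewrite /ball /= sub0r normrN => tr.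
  by have [|] := hr (t0 + t); rewrite /ball /= ?opprD ?addrA ?subrr ?sub0r ?normrN.
exfalso; pose F j := ~` C j.
have oF j : open (F j).
  rewrite openE => t nC; rewrite /interior.
  have [th|ht] := leP `|t| h; last first.
    apply/nbhs_ballP; exists (`|t| - h); rewrite /= ?subr_gt0// => s; rewrite /ball /= => ts [sh _].
    have := ler_normD (t - s) s; rewrite subrK; lra.
  have nE : ~ E (j %% N)%N (j %/ N)%N (c t) by move=> Et; apply: nC.
  have [e' e'0 he] : exists2 e', 0 < e' & forall u, cl e' u (c t) -> ~ E (j %% N)%N (j %/ N)%N u.
    apply: contrapT => na; apply: nE; apply: (Ecl (j %% N)%N); first by rewrite ltn_mod.
    move=> e' e'0; apply: contrapT => nb; apply: na; exists e' => // u cu Eu.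
    by apply: nb; exists u.
  have [_ dc _ _] := hc t (le_lt_trans th hd).
  by apply: filterS (path_near dc e'0) => s cs [_]; exact: he.
have dF j : dense (F j).
  move=> D [t Dt] oD; apply: contrapT => nD; apply: no; exists j, t.
  have /nbhs_ballP[r /= r0 hr] := open_nbhs_nbhs (conj oD Dt).
  exists r; split=> // s ts; apply: contrapT => nC; apply: nD; exists s; split=> //.
  exact: hr.
have [|||t [th tF]] := @Baire R R F _ (ball 0 h).
- by move=> j; split.
- by exists 0; rewrite /ball /= subrr normr0.
- exact: ball_open.
have th' : `|t| < h by move: th; rewrite /ball /= sub0r normrN.
have [Gt _ ft _] := hc t (lt_trans th' hd).
have [j jN [k Ek]] := cov _ Gt ft.
apply: (tF (k * N + j)%N) => //; split; first exact: ltW.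
by rewrite modnMDl modn_small// divnMDl// divn_small// addn0.
Qed.

End Cover.

(** * Subanalytic sets *)

Section Key.
Variables (R : realType) (n : nat).
Notation V := 'rV[R]_n.
Implicit Types (A X : set V) (p u a : V) (e : R).

Definition Approach X p u := exists (U : set_system nat) (x : nat -> V) (t : nat -> R),
  [/\ UltraFilter U, ae U (fun j => X (x j)), ae U (fun j => 0 < t j), mlim U x p &
      mlim U (fun j => t j *: (x j - p)) u].

(** Preimages of approaching points have a limit by [proper_lim]. Closedness in [O] makes avoiding
    [X2] an open condition. *)
Lemma image_closed (O X : set V) p : open O -> O p -> proper_analytic_image O X ->
  (forall e, 0 < e -> exists u, cl e u p /\ X u) -> X p.
Proof.
move=> oO Op [m [W [Y [f [[_ Yan] fan fO prop ->]]]]] h.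
have /choice[y hy] : forall j, exists y : 'rV[R]_m, Y y /\ cl j.+1%:R^-1 (f y) p.
  by move=> j; have [//|u [cu [y Yy fy]]] := h j.+1%:R^-1; exists y; rewrite fy.
have [U [UU sU]] := ultra_oo; have UP : ProperFilter U by exact: ultra_proper.
have fl : mlim U (fun j => f (y j)) p.
  by apply: mlim_sub => //; apply: cl_mlim => j; case: (hy j).
have Yy : ae U (fun j => Y (y j)) by apply: nearW => j; case: (hy j).
have [y0 [Yy0 _ fy0]] := proper_lim Yan fan prop UU oO Op Yy fl.
by exists y0.
Qed.

Lemma arcW m (f : 'rV[R]_m -> V) Gd e e1 u a c : cl e1 u a -> arc f Gd e u c -> 0 < e1 ->
  arc f Gd (e + e1) a c.
Proof.
move=> ua arcc e10; apply: filterS arcc => t [h1 h2 h3 [v [b [h4 h5 h6]]]]; split=> //.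
  by apply: clW h3; rewrite lerDl ltW.
by exists v, b; split=> //; exact: cl_trans h6 ua.
Qed.

(* The source space of the parametrization is hidden in the predicate Reach. *)
Lemma proper_image_pieces A (O X1 X2 : set V) : open O -> O 0 -> proper_analytic_image O X1 ->
  proper_analytic_image O X2 -> (forall x, X1 x -> ~ X2 x -> A x) ->
  exists (eta : R) (N : nat) (Reach : nat -> R -> V -> Prop) (bs : nat -> V),
  [/\ 0 < eta,
    forall p u e, O p -> u != 0 -> 0 < e -> cl e p 0 -> Approach (X1 `\` X2) p u ->
      exists p' v, [/\ A p', cl e p' 0, cl e v u, TC A p' v & TC A p' (- v)],
    forall p u e, O p -> u != 0 -> 0 < e -> e <= eta -> cl e p 0 -> Approach (X1 `\` X2) p u ->
      exists2 c, (c < N)%N & Reach c e u,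
    forall c a, (c < N)%N -> a != 0 -> (forall e, 0 < e -> Reach c e a) ->
      (exists l : R, a = l *: bs c) \/ (forall e, 0 < e -> plane_at A e a) &
    forall c e e1 u a, cl e1 u a -> 0 < e1 -> Reach c e u -> Reach c (e + e1) a].
Proof.
move=> oO O0 [m [W [Y [f [[_ Yan] fan fO prop X1E]]]]] pX2 difference_sub.
(* Relatively open in [Y] since [X2] is closed in [O]: an arc in [Y] through a point of [Gd] stays
   there for a while. *)
pose Gd := [set y | Y y /\ ~ X2 (f y)].
have YW : Y `<=` W by case: Yan.
have Gopen y : Gd y -> exists2 e : R, 0 < e & forall y', Y y' -> cl e y' y -> Gd y'.
  move=> [Yy nX2]; have Of : O (f y) by apply: fO; exists y.
  have [e e0 he] : exists2 e, 0 < e & forall u, cl e u (f y) -> ~ X2 u.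
    apply: contrapT => na; apply: nX2; apply: (image_closed oO Of pX2) => e e0.
    apply: contrapT => nb; apply: na; exists e => // u cu Xu.
    by apply: nb; exists u.
  have idl : mlim (nbhs y) (fun y' : 'rV[R]_m => y') y by apply/cvg_mlim; exact: cvg_id.
  have fl0 : mlim (nbhs y) (fun y' => f y') (f y) by apply: (map_lim fan _ (YW _ Yy) idl).
  have /near_rV[d d0 hd] : \forall y' \near y, cl e (f y') (f y) by exact: mlim_cl fl0 e0.
  by exists d => // y' Yy' cy'; split=> //; apply: he; exact: hd.
have GA y : Gd y -> A (f y).
  by move=> [Yy nX2]; apply: difference_sub => //; rewrite X1E; exists y.
have [eta [N [E [eta0 gE cov]]]] := arc_family_cover Yan fan Gopen GA prop oO O0.
have mkarc p u e : O p -> u != 0 -> 0 < e -> cl e p 0 -> Approach (X1 `\` X2) p u ->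
    exists c, arc f Gd e u c.
  move=> Op u0 e0 pe [U [x [t [UU xX t0 xp xu]]]].
  have UP : ProperFilter U by exact: ultra_proper.
  have /choice[y hy] : forall j, exists y : 'rV[R]_m, (X1 `\` X2) (x j) -> Gd y /\ f y = x j.
    move=> j; have [[X1x nX2]|nX] := pselect ((X1 `\` X2) (x j)); last by exists 0.
    by move: X1x; rewrite X1E => -[y Yy fy]; exists y => _; split=> //; split=> //; rewrite fy.
  have Gy : ae U (fun j => Gd (y j)) by apply: aeW xX => j /hy[].
  have fE : ae U (fun j => f (y j) = x j) by apply: aeW xX => j /hy[].
  have Yy : ae U (fun j => Y (y j)) by apply: aeW Gy => j [].
  have fl : mlim U (fun j => f (y j)) p.
    by apply: (mlim_near UP _ xp); apply: aeW fE => j ->.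
  have [y0 [Yy0 yl fy0]] := proper_lim Yan fan prop UU oO Op Yy fl.
  apply: (arc_exists Yan fan Gopen UU (YW _ Yy0) Yy Gy yl t0 u0 _ e0); last by rewrite fy0.
  by rewrite fy0; apply: (mlim_near UP _ xu); apply: aeW fE => j ->.
pose Reach c e a := exists k k', arc f Gd e a k' /\ \forall t \near (0 : R), E c k (k' t).
have /choice[bs hbs] : forall c, exists b : V, (c < N)%N -> forall a, a != 0 ->
   (forall e, 0 < e -> Reach c e a) ->
   (exists l : R, a = l *: b) \/ (forall e, 0 < e -> plane_at A e a).
  move=> c; have [cN|_] := ltnP c N; last by exists 0.
  by have [_ [b hb]] := gE c cN; exists b => _ a a0 h; exact: hb.
exists eta, N, Reach, bs; split=> //.
- move=> p u e Op u0 e0 pe Ap; have [c arcc] := mkarc p u e Op u0 e0 pe Ap.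
  have [Gc _ fc [v [b [dv0 b0 bv]]]] := nbhs_singleton arcc.
  have Ac : \forall t \near (0 : R), A (f (c t)).
    by apply: filterS arcc => t [h _ _ _]; exact: GA.
  have [T1 T2] := @deriv_TC R n A (fun t => f (c t)) v dv0 Ac.
  exists (f (c 0)), (b *: v); split=> //; first exact: GA.
    exact: TC_Z.
  by rewrite -scalerN; exact: TC_Z.
- move=> p u e Op u0 e0 ee pe Ap; have [c arcc] := mkarc p u e Op u0 e0 pe Ap.
  have [||j jN [k [c' [h1 h2]]]] := @arc_in_cover R m n f Gd e u c N E _ _ arcc.
  - by move=> j jN; case: (gE j jN).
  - by move=> y [Yy _] cy; apply: cov => //; exact: clW ee cy.
  - by exists j => //; exists k, c'.
- by move=> c a cN; exact: hbs.
- move=> c e e1 u a ua e10 [k [c' [h1 h2]]]; exists k, c'; split=> //.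
  exact: arcW ua h1 e10.
Qed.

Lemma plane_lim A a : a != 0 -> (forall e, 0 < e -> plane_at A e a) -> Sub 2 (cone (GD A)) a.
Proof.
move=> a0 h; have /choice[pE hpE] : forall j, exists pE : V * 'M[R]_(2, n),
    [/\ A pE.1, cl j.+1%:R^-1 pE.1 0, pE.2 *m pE.2^T = 1%:M,
     forall w, w *m pE.2 != 0 -> TC A pE.1 (w *m pE.2) &
     exists w, cl j.+1%:R^-1 (w *m pE.2) a].
  by move=> j; have [//|p [Ap cp [E [EE TE cE]]]] := h j.+1%:R^-1; exists (p, E).
have /choice[w hw] : forall j, exists w, cl j.+1%:R^-1 (w *m (pE j).2) a.
  by move=> j; case: (hpE j).
have [U [UU sU]] := ultra_oo; have UP : ProperFilter U by exact: ultra_proper.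
have [|E0 [El EE0]] := @orth_lim R 2 n nat U UU (fun j => (pE j).2).
  by apply: nearW => j; case: (hpE j).
have wl : mlim U (fun j => w j *m (pE j).2) a by apply: mlim_sub => //; exact: cl_mlim.
have pl : mlim U (fun j => (pE j).1) 0.
  by apply: mlim_sub => //; apply: cl_mlim => j; case: (hpE j).
have aE : a = (a *m E0^T) *m E0.
  apply: (mlim_uniq UP wl).
  have h1 := mlimM UP (mlimM UP wl (mlim_tr El)) El.
  apply: (mlim_near UP _ h1); apply: nearW => j; have [_ _ EE _ _] := hpE j.
  by rewrite -(mulmxA (w j)) EE mulmx1.
have key v : v *m E0 != 0 -> cone (GD A) (v *m E0).
  move=> v0; apply/cone_GC => // e e0; have [d d0 hd] := cl_neq0 v0.
  have vl := mlimM UP (mlim_cst UP v) El.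
  have [j [[h1 h2] h3]] := ae_ex UU (aeI UU (aeI UU (mlim_cl UP vl e0) (mlim_cl UP vl d0))
    (mlim_cl UP pl e0)).
  have [Ap _ _ TE _] := hpE j; exists (pE j).1, (v *m (pE j).2); split=> //.
    exact: hd.
  by apply: TE; exact: hd.
exists E0; split=> //; first by exists (a *m E0^T).
move=> v; have [->|v0] := eqVneq (v *m E0) 0; last exact: key.
by apply: (@cone_zero _ _ _ a); rewrite aE; apply: key; rewrite -aE.
Qed.

Lemma ae_pigeon (U : set_system nat) (UU : UltraFilter U) N (P : nat -> nat -> Prop) :
  ae U (fun j => exists2 c, (c < N)%N & P c j) -> exists2 c, (c < N)%N & ae U (P c).
Proof.
move=> h; apply: contrapT => na.
have : ae U (fun j => forall c, (c < N)%N -> ~ P c j).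
  apply: ae_all => // c cN; have [h'|//] := ae_dec UU (P c).
  by exfalso; apply: na; exists c.
by move=> h'; have [j [[c cN Pc] nP]] := ae_ex UU (aeI UU h h'); exact: (nP c cN Pc).
Qed.

Lemma ae_pigeon_ord (U : set_system nat) (UU : UltraFilter U) N (P : 'I_N -> nat -> Prop) :
  ae U (fun j => exists c, P c j) -> exists c, ae U (P c).
Proof.
move=> h; have [|c cN hc] := @ae_pigeon U UU N (fun c j => exists cN : (c < N)%N, P (Ordinal cN) j).
  apply: aeW h => j [c Pc]; exists c => //; exists (ltn_ord c).
  by have -> : Ordinal (ltn_ord c) = c by apply: val_inj.
exists (Ordinal cN); apply: aeW hc => j [cN' Pj].
by rewrite (bool_irrelevance cN cN').
Qed.

Section Subanalytic.
Variables (A O : set V) (k : nat) (X1 X2 : 'I_k -> set V).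
Hypotheses (oO : open O) (O0 : O 0).
Hypotheses (pX1 : forall i, proper_analytic_image O (X1 i))
           (pX2 : forall i, proper_analytic_image O (X2 i)).
Hypothesis AE : A `&` O = \bigcup_(i in [set: 'I_k]) (X1 i `\` X2 i).

Lemma difference_sub i x : X1 i x -> ~ X2 i x -> A x.
Proof.
move=> h1 h2; suff : (A `&` O) x by case.
by rewrite AE; exists i.
Qed.

(** Near a point of [O] the set is a finite union of differences; the ultrafilter on the
    approximating sequence selects one of them. *)
Lemma GC_approach a e : a != 0 -> GC A a -> 0 < e -> exists i p u,
  [/\ O p, cl e p 0, cl e u a, u != 0 & Approach (X1 i `\` X2 i) p u].
Proof.
move=> a0 G e0; have /near_rV[r r0 hr] := open_nbhs_nbhs (conj oO O0).
have [|p [u [Ap cp cu u0 T]]] := G (Num.min e r); first by rewrite lt_min e0.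
have [x [t [xA t0 xp xu]]] := TC_seq T.
have Op : O p by apply: hr; apply: clW cp; rewrite ge_min lexx orbT.
have [U [UU sU]] := ultra_oo; have UP : ProperFilter U by exact: ultra_proper.
have xp' := mlim_sub sU xp; have xu' := mlim_sub sU xu.
have /near_rV[r1 r10 hr1] := open_nbhs_nbhs (conj oO Op).
have [i hi] : exists i, ae U (fun j => (X1 i `\` X2 i) (x j)).
  apply: ae_pigeon_ord; apply: aeW (mlim_cl UP xp' r10) => j cj.
  have : (A `&` O) (x j) by split=> //; exact: hr1.
  by rewrite AE => -[i _ Xi]; exists i.
exists i, p, u; split=> //; try by [apply: clW cp; rewrite ge_min lexx|apply: clW cu; rewrite ge_min lexx].
by exists U, x, t; split=> //; exact: nearW.
Qed.

(** Starts the induction of [GDpow_stable]. A sequence in [B] lies, along an ultrafilter, on one of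
    finitely many lines, so its tangent vectors lie on that line too, and the symmetry of the cone
    covers both of its rays. *)
Lemma subanalytic_cone : exists B : set V,
  (forall x, cone (GD A) x -> x != 0 -> B x \/ Sub 2 (cone (GD A)) x) /\
  (forall p v, TC B p v -> v != 0 -> cone (GD A) v).
Proof.
have /choice[eta /choice[N /choice[Reach /choice[bs hp]]]] :=
  fun i => proper_image_pieces oO O0 (pX1 i) (pX2 i) (@difference_sub i).
have half e : 0 < e -> 0 < e / 2 by move=> e0; rewrite divr_gt0.
(* Secants are replaced by velocities of two-sided arcs, whose opposites are tangent as well; [d]
   keeps the approximating vectors nonzero. *)
have symm v : cone (GD A) v -> v != 0 -> cone (GD A) (- v).
  move=> Cv v0; have G : GC A v by apply/cone_GC.
  apply/cone_GC; first by rewrite oppr_eq0.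
  move=> e e0; have [d d0 hd] := cl_neq0 v0.
  have m0 : 0 < Num.min e d / 2 by apply: half; rewrite lt_min e0.
  have [i [p [u [Op cp cu u0 Ap]]]] := GC_approach v0 G m0.
  have [_ h _ _ _] := hp i; have [p' [w [Ap' cp' cw T1 T2]]] := h p u _ Op u0 m0 cp Ap.
  have wv := cl_trans cw cu; rewrite -splitr in wv.
  exists p', (- w); split=> //.
  - apply: clW cp'; apply: le_trans (_ : Num.min e d <= _); last by rewrite ge_min lexx.
    by rewrite ler_pdivrMr// mulr2n mulrDr mulr1 lerDl ltW// lt_min e0.
  - by move=> l; have := wv l; rewrite !mxE -opprD normrN => /lt_le_trans; apply; rewrite ge_min lexx.
  - by rewrite oppr_eq0; apply: hd; apply: clW wv; rewrite ge_min lexx orbT.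
pose B := [set x | cone (GD A) x /\ exists i c, (c < N i)%N /\ exists l : R, x = l *: bs i c].
exists B; split.
  move=> a Ca a0; have G : GC A a by apply/cone_GC.
  have [eta0 eta00 heta] : exists2 e : R, 0 < e & forall i, e <= eta i.
    have [e e0 he] : exists2 e : R, 0 < e & forall i, (i < k)%N -> forall ik : (i < k)%N, e <= eta (Ordinal ik).
      apply: (@min_rad R k (fun i e => forall ik : (i < k)%N, e <= eta (Ordinal ik))).
        by move=> i d d' _ dd h ik; exact: le_trans dd (h ik).
      move=> i ik; have [e0 _ _ _ _] := hp (Ordinal ik); exists (eta (Ordinal ik)) => // ik'.
      by rewrite (bool_irrelevance ik ik').
    exists e => // i; have := he i (ltn_ord i) (ltn_ord i).
    by have -> : Ordinal (ltn_ord i) = i by apply: val_inj.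
  have reach e : 0 < e -> exists i, exists2 c, (c < N i)%N & Reach i c e a.
    move=> e0; have m0 : 0 < Num.min (e / 2) eta0 by rewrite lt_min half.
    have [i [p [u [Op cp cu u0 Ap]]]] := GC_approach a0 G m0.
    have [_ _ h _ hW] := hp i.
    have [|c cN Rc] := h p u _ Op u0 m0 _ cp Ap.
      by apply: le_trans (heta i); rewrite ge_min lexx orbT.
    exists i, c => //; have d0 : 0 < e - Num.min (e / 2) eta0.
      rewrite subr_gt0; apply: le_lt_trans (_ : e / 2 < e); first by rewrite ge_min lexx.
      by rewrite ltr_pdivrMr// mulr2n mulrDr mulr1 ltrDl.
    have ca : cl (e - Num.min (e / 2) eta0) u a.
      apply: clW cu; rewrite lerBrDr; apply: le_trans (_ : e / 2 + e / 2 <= e).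
        by rewrite lerD// ge_min lexx.
      by rewrite -splitr.
    by have := hW _ _ _ _ _ ca d0 Rc; rewrite addrC subrK.
  have [U [UU sU]] := ultra_oo; have UP : ProperFilter U by exact: ultra_proper.
  (* Pigeonhole along an ultrafilter: one chart serves arbitrarily small tolerances, and [hW]
     enlarges these to any given [e]. *)
  have [i hi] : exists i, ae U (fun j => exists2 c, (c < N i)%N & Reach i c j.+1%:R^-1 a).
    by apply: ae_pigeon_ord; apply: nearW => j; apply: reach; rewrite invr_gt0.
  have [c cN hc] := ae_pigeon UU hi.
  have [_ _ _ hg hW] := hp i.
  have Rall e : 0 < e -> Reach i c e a.
    move=> e0; have [M hM] := inv_nat_lt e0.
    have late : ae U (fun j => (M <= j)%N) by apply: sU; exists M.
    have [j [Rj Mj]] := ae_ex UU (aeI UU hc late).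
    have d0 : 0 < e - j.+1%:R^-1 by rewrite subr_gt0; exact: hM.
    have aa : cl (e - j.+1%:R^-1) a a by move=> l; rewrite subrr normr0.
    by have := hW _ _ _ _ _ aa d0 Rj; rewrite addrC subrK.
  have [[l E]|pl] := hg c a cN a0 Rall; last by right; exact: plane_lim.
  by left; split=> //; exists i, c; split=> //; exists l.
move=> p v T v0; have [x [t [xB t0 xp xv]]] := TC_seq T.
have [U [UU sU]] := ultra_oo; have UP : ProperFilter U by exact: ultra_proper.
have xp' := mlim_sub sU xp; have xv' := mlim_sub sU xv.
have x0 := TC_nonzero UU xp' xv' v0.
have [i hi] : exists i, ae U (fun j => exists2 c, (c < N i)%N & exists l : R, x j = l *: bs i c).
  apply: ae_pigeon_ord; apply: nearW => j; have [_ [i [c [cN h]]]] := xB j.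
  by exists i, c.
have [c cN hc] := ae_pigeon UU hi.
set b := bs i c in hc.
have [j1 [[l1 xb1] xn1]] := ae_ex UU (aeI UU hc x0).
have b0 : b != 0 by apply: contraNneq xn1 => b00; rewrite xb1 b00 scaler0.
have [l bl] : exists l, b 0 l != 0.
  apply: contrapT => na; move/eqP: b0; apply; apply/rowP => l; rewrite mxE.
  by apply: contrapT => /eqP bl; apply: na; exists l.
have par (y : nat -> V) y0 : mlim U y y0 -> ae U (fun j => exists l : R, y j = l *: b) ->
    y0 = (y0 0 l / b 0 l) *: b.
  move=> yl yb; apply: (mlim_uniq UP yl).
  have h : (fun j => y j 0 l / b 0 l) @ U --> y0 0 l / b 0 l by apply: cvgM (yl 0 l) (cvg_cst _).
  apply: (mlim_near UP _ (mlimZ UP h (mlim_cst UP b))); apply: aeW yb => j [s ->].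
  by rewrite !mxE mulfK.
have pb := par x p xp' hc.
have vb : v = (v 0 l / b 0 l) *: b.
  apply: (par _ v xv'); apply: aeW hc => j [s ->].
  by exists (t j * (s - p 0 l / b 0 l)); rewrite pb -scalerBl scalerA -pb.
have [Cx _] := xB j1.
have l10 : l1 != 0 by apply: contraNneq xn1 => h; rewrite xb1 h scale0r.
have vx : v = (v 0 l / b 0 l / l1) *: x j1 by rewrite xb1 scalerA divfK.
have [s0|s0] := leP 0 (v 0 l / b 0 l / l1).
  by rewrite vx; exact: cone_conic.
rewrite vx -[X in X *: _]opprK scaleNr -scalerN; apply: cone_conic; last by rewrite oppr_ge0 ltW.
exact: symm.
Qed.

End Subanalytic.
End Key.

Theorem theorem1p2 (R : realType) (n : nat) (n_ge1 : (1 <= n)%N)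
    (A : set 'rV[R]_n) (subA : subanalytic A) (A0 : closure A 0) :
  ((2 <= n)%N -> forall m : nat, (n - 1 <= m)%N ->
     GDpow m A = GDpow (n - 1) A) /\
  (n = 1%N -> forall m : nat, (1 <= m)%N -> GDpow m A = GDpow 1 A).
Proof.
have [W [k [X1 [X2 [oW W0 pX1 pX2 AE]]]]] := subA 0.
have [B [AB BA]] := subanalytic_cone oW W0 pX1 pX2 AE.
have stable := GDpow_stable n_ge1 AB BA.
(* Degree $n-1$ meets the bound [n <= m0.+1] with equality; for $n=1$ this would be degree 0, and
   degree 1 takes its place. *)
split=> [n2 m nm|n1 m m1].
  by apply: stable; rewrite ?subn_gt0// subn1 prednK.
by apply: stable => //; rewrite n1.
Qed.
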